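(* Assume that $P/(N+1)\to c$ and $Q/(N+1)\to d$ as $N\to\infty$ with $c=d=0$. Then, for a suitable choice of the probability space $(\Omega,\mathcal A,\mathbb P)$, there exist two sequences $\{\mathcal B_N^{+}(v):0\le v\le 1\}$ and $\{\mathcal B_N^{-}(v):0\le v\le 1\}$, $N=1,2,\ldots$, of Brownian bridges satisfying the distributional identities (as processes in $0\le v\le 1$, for each choice of sign $\pm$) $$\mathcal B_N^{\pm}(H_m(v))\stackrel{d}{=}\mathcal B_N^{\pm}(H_m(v))-8(2m+1)\frac{(2m-1)!}{2m((m-1)!)^2}(v(1-v))^m\int_0^1\mathcal B_N^{\pm}(H_m(s))\,ds,$$ and such that, as $N\to\infty$, $$\sup_{0\le v\le 1}\Big|\gamma_{N;n_1,n_2}(v)-\Big\{\mathcal B_N^{+}(H_m(v))-4(2m+1)\frac{(2m-1)!}{2m((m-1)!)^2}\Big(1+\frac1{\sqrt{2m+1}}\Big)(v(1-v))^m\int_0^1\mathcal B_N^{+}(H_m(s))\,ds\Big\}\Big|=o_{\mathbb P}(1)$$ and $$\sup_{0\le v\le 1}\Big|\gamma_{N;n_1,n_2}(v)-\Big\{\mathcal B_N^{-}(H_m(v))-4(2m+1)\frac{(2m-1)!}{2m((m-1)!)^2}\Big(1-\frac1{\sqrt{2m+1}}\Big)(v(1-v))^m\int_0^1\mathcal B_N^{-}(H_m(s))\,ds\Big\}\Big|=o_{\mathbb P}(1).$$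
   Context: Fix an integer $m\ge1$. Let $\{X_n:n\ge1\}$ and $\{Y_n:n\ge1\}$ be two independent sequences of i.i.d. random variables, uniform on $(0,1)$. Let $X_{1,n_1}<\dots<X_{n_1,n_1}$ and $Y_{1,n_2}<\dots<Y_{n_2,n_2}$ be the order statistics of $X_1,\dots,X_{n_1}$ and $Y_1,\dots,Y_{n_2}$, and put $X_{0,n_1}=Y_{0,n_2}=0$, $X_{n_1+1,n_1}=Y_{n_2+1,n_2}=1$. Put $N_1=\lfloor (n_1+1)/m\rfloor-1$ and $N_2=\lfloor (n_2+1)/m\rfloor-1$. For each integer $N\ge1$, the sample sizes $n_1=n_1(N)$, $n_2=n_2(N)$ are such that $N\le N_1\wedge N_2$; set $P=P(N)=N_1-N\ge0$ and $Q=Q(N)=N_2-N\ge0$. Choose indices $0\le i_0<\dots<i_N\le n_1-m+1$ and $0\le j_0<\dots<j_N\le n_2-m+1$ with $i_{k+1}-i_k\ge m$ and $j_{k+1}-j_k\ge m$ for $0\le k\le N-1$ (the indices may depend on $N,n_1,n_2$). The disjoint $m$-spacings are $S^{(m)}_{k,N;X}=X_{i_k+m,n_1}-X_{i_k,n_1}$ and $S^{(m)}_{k,N;Y}=Y_{j_k+m,n_2}-Y_{j_k,n_2}$, $0\le k\le N$, and their ratios are $$R_{k;n_1,n_2}=\frac{(N_1+1)S^{(m)}_{k,N;X}}{(N_1+1)S^{(m)}_{k,N;X}+(N_2+1)S^{(m)}_{k,N;Y}}.$$ Let $H_{N;n_1,n_2}(x)=\frac1{N+1}\sum_{k=0}^N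 1_{\{R_{k;n_1,n_2}\le x\}}$, let $H_m(x)=\frac{(2m-1)!}{((m-1)!)^2}\int_0^x t^{m-1}(1-t)^{m-1}dt$ ($0\le x\le1$) be the distribution function of the Beta$(m,m)$ law, and set $$\gamma_{N;n_1,n_2}(x)=(N+1)^{1/2}\big(H_{N;n_1,n_2}(x)-H_m(x)\big),\quad 0\le x\le1.$$ ''For a suitable choice of the probability space'' means that the $X_n,Y_n$ may be realized on a (possibly different or enlarged) probability space which also carries the asserted objects. A Brownian bridge is a centered Gaussian process $B$ on $[0,1]$ with continuous paths and $\mathbb E(B(u)B(v))=u\wedge v-uv$. $o_{\mathbb P}(1)$ denotes convergence to $0$ in probability. *)

(* Defs.v *)
From HB Require Import structures.
From mathcomp Require Import all_boot all_order all_algebra.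
From mathcomp Require Import all_classical all_reals all_analysis.
From mathcomp Require Import measurable_realfun.
Set Implicit Arguments.
Unset Strict Implicit.
Unset Printing Implicit Defensive.
Import Order.TTheory GRing.Theory Num.Theory.
Import numFieldNormedType.Exports.

Local Open Scope classical_set_scope.
Local Open Scope ring_scope.

Section Samples.
Context {R : realType}.

(* [x 0, ..., x (n-1)] is the sample of size [n]; index [0] of the result is
   [0], indices [1 .. n] are the sorted sample, index [n + 1] is [1]. *)
Definition order_stat (n : nat) (x : nat -> R) (k : nat) : R :=
  nth 1 (0 :: sort <=%R (mkseq x n)) k.

Definition spacing (m n : nat) (x : nat -> R) (k : nat) : R :=
  order_stat n x (k + m) - order_stat n x k.

(* The predecessor is truncated: for [n + 1 < m] this is [0], not [-1]. *)
Definition last_spacing (m n : nat) : nat := (n.+1 %/ m).-1.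

(* The last clause is [i N <= n - m + 1] without truncated subtraction. *)
Definition disjoint_spacings (m N n : nat) (i : nat -> nat) : Prop :=
  (forall k, (k < N)%N -> (i k < i k.+1)%N /\ (i k + m <= i k.+1)%N) /\
  (i N + m <= n.+1)%N.

(* Only meaningful when the denominator is nonzero, which is the case almost
   surely for independent uniform samples. *)
Definition spacing_ratio (m n1 n2 : nat) (i j : nat -> nat) (x y : nat -> R)
    (k : nat) : R :=
  let sx := (last_spacing m n1).+1%:R * spacing m n1 x (i k) in
  let sy := (last_spacing m n2).+1%:R * spacing m n2 y (j k) in
  sx / (sx + sy).

Definition ratio_edf (m N n1 n2 : nat) (i j : nat -> nat) (x y : nat -> R)
    (v : R) : R :=
  N.+1%:R^-1 *
  \sum_(k < N.+1) (spacing_ratio m n1 n2 i j x y k <= v)%R%:R.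

Definition beta_cdf (m : nat) (v : R) : R :=
  ((2 * m).-1)`!%:R / (m.-1)`!%:R ^+ 2 *
  (\int[lebesgue_measure]_(t in `[0, v]) (t ^+ m.-1 * (1 - t) ^+ m.-1)).

Definition ratio_process (m N n1 n2 : nat) (i j : nat -> nat)
    (x y : nat -> R) (v : R) : R :=
  Num.sqrt N.+1%:R * (ratio_edf m N n1 n2 i j x y v - beta_cdf m v).

(* [b] is one path of a bridge; [a] is the whole factor in front of
   (2m-1)! / (2m ((m-1)!)^2). *)
Definition corrected_path (m : nat) (a : R) (b : R -> R) (v : R) : R :=
  b (beta_cdf m v) -
  a * (((2 * m).-1)`!%:R / ((2 * m)%:R * (m.-1)`!%:R ^+ 2)) *
  (v * (1 - v)) ^+ m *
  (\int[lebesgue_measure]_(s in `[0, 1]) b (beta_cdf m s)).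

Definition sup01 (f : R -> R) : \bar R :=
  ereal_sup [set `|f v|%:E | v in `[0, 1]].

End Samples.

(* Product sigma-algebra of [D -> R], as a sigma-algebra on [I -> R]. *)
Definition cylinder {R : realType} {I : Type} (D : set I)
    : set (set (I -> R)) :=
  <<s \bigcup_(t in D) preimage_set_system setT
        (fun f : I -> R => f t) measurable >>.

Section Processes.
Context {d : measure_display} {T : measurableType d} {R : realType}.
Variable P : probability T R.

Definition uniform01 (X : {RV P >-> R}) : Prop :=
  forall A : set R, measurable A -> distribution P X A = uniform_prob (@ltr01 R) A.

Definition mutually_independent (X : nat -> {RV P >-> R}) : Prop :=
  forall (J : seq nat) (A : nat -> set R),
    uniq J -> (forall k, measurable (A k)) ->
    P (\bigcap_(k in [set` J]) (X k @^-1` A k)) =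
    (\prod_(k <- J) P (X k @^-1` A k))%E.

Definition iid_uniform01 (X : nat -> {RV P >-> R}) : Prop :=
  mutually_independent X /\ forall k, uniform01 (X k).

Definition independent_sequences (X Y : nat -> {RV P >-> R}) : Prop :=
  forall A B : set (nat -> R), cylinder setT A -> cylinder setT B ->
    P ([set w | A (fun k => X k w)] `&` [set w | B (fun k => Y k w)]) =
    (P [set w | A (fun k => X k w)] * P [set w | B (fun k => Y k w)])%E.

(* Equality of the laws, on the product sigma-algebra of [R]^[D], of two
   processes indexed by [D]. *)
Definition same_law (I : Type) (D : set I) (Z Z' : I -> T -> R) : Prop :=
  forall A : set (I -> R), cylinder D A ->
    P [set w | A (fun t => Z t w)] = P [set w | A (fun t => Z' t w)].

(* [normal_prob m 0] is not a Dirac mass (it is uniform on [0, 1] by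
   convention), hence the case distinction. *)
Definition gaussian (Z : T -> R) : Prop :=
  measurable_fun setT Z /\
  exists m s : R, forall A : set R, measurable A ->
    P (Z @^-1` A) = if s == 0 then \d_m A else normal_prob m s A.

Definition gaussian_process (D : set R) (B : R -> T -> R) : Prop :=
  forall (n : nat) (t a : 'I_n -> R), (forall l, D (t l)) ->
    gaussian (fun w => \sum_(l < n) a l * B (t l) w).

Definition brownian_bridge (B : R -> T -> R) : Prop :=
  [/\ gaussian_process `[0, 1] B,
      forall t, t \in `[0, 1] -> ('E_P[B t] = 0)%E,
      forall u v, u \in `[0, 1] -> v \in `[0, 1] ->
        ('E_P[fun w => (B u w * B v w)%R] = (Num.min u v - u * v)%:E)%E &
      forall w, {within `[0, 1], continuous (fun t => B t w)}].

(* Convergence to 0 in probability; measurability makes the probabilities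
   below meaningful. *)
Definition cvg0_in_probability (Z : nat -> T -> \bar R) : Prop :=
  (\forall N \near \oo, measurable_fun setT (Z N)) /\
  forall e : R, 0 < e -> P [set w | (e%:E < `|Z N w|)%E] @[N --> \oo] --> 0%E.

End Processes.

(* Main.v *)
(** All random objects live on the real line with the uniform law on [0, 1], one
    seed being split into independent seeds along its binary digits.

    The uniform spacings are normalised exponential variables, so that up to the
    two total sums the ratios are i.i.d. variables U / (U + V), with U and V
    Gamma(m). Normalising by the total sums only changes the level v at which the
    empirical process of U / (U + V) is read, and to first order
    gamma(v) is the normalised sum of the i.i.d. variables
      1{U / (U + V) <= v} - H_m(v) + phi(v) (U - V) / m,
    where phi(v) = (2m-1)! / (m-1)!^2 (v(1-v))^m. Here P/N -> 0 and Q/N -> 0 make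
    the discarded spacings negligible. The covariance of these variables is
    that of
      L(v) = B(H_m(v)) - 4 (2m+1) c(v) I + 2 c(v) g,    c(v) = phi(v) / (2m),
    with B a Brownian bridge, I the integral of B o H_m and g an independent
    standard normal variable. Replacing the coefficient 2 by -2 sqrt(2m+1) or
    by 2 sqrt(2m+1) turns L into a Brownian bridge, and both corrections of the
    theorem bring these bridges back to L; the correction 8(2m+1) only changes
    the sign of g.

    Finite-dimensional convergence (Lindeberg exchange) and a fourth moment
    chaining bound for the oscillations give, through the conditional law of a
    density close to 1, a realization of L close to gamma on a fine grid, hence
    uniformly. *)

Require Import Defs.
From HB Require Import structures.
From mathcomp Require Import all_boot all_order all_algebra.
From mathcomp Require Import all_classical all_reals all_analysis.
From mathcomp Require Import measurable_realfun.
From mathcomp Require Import zify ring lra.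
Set Implicit Arguments.
Unset Strict Implicit.
Unset Printing Implicit Defensive.
Import Order.TTheory GRing.Theory Num.Theory.
Import numFieldNormedType.Exports.
Local Open Scope classical_set_scope.
Local Open Scope ring_scope.

(** * Splitting a uniform seed *)

Section Seeds.
Context {R : realType}.
Local Notation mR := (measurableTypeR R).

(** Convergence in law alone gives no statement in probability: for each N a bridge must be built on
    the space that carries the data. It is [Z \o psi N] with [psi N] measure preserving, a function
    of the data seed and of one further independent seed; hence everything is a functional of seeds
    composed with measure-preserving maps. The constants come from linear regression. With c and I
    as in the overview, c(v) is the covariance of B(H_m(v)) with I and 4 (2m+1) is the inverse
    variance of I, so B - 4 (2m+1) c I is the residual of B on I, and its integral is 0. Adding al
    c(v) g gives the covariance of a bridge when al^2 = 4 (2m+1), and that of the linearized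
    summands when al^2 = 4, since 4 - 4 (2m+1) = -8m. A correction with coefficient a leaves the
    residual alone and multiplies al by 1 - a / (4 (2m+1)). Gaussian laws enter through stability: a
    Gaussian family has the law of its own normalised n-fold sums. One exchange argument on n-fold
    sums then serves both the limit theorem and the identification of the law of linear
    functionals. *)

Definition lam : probability mR R := uniform_prob (@ltr01 R).

(** The distribution function of the uniform law, and also the retraction onto [0, 1] used later to
    truncate functions. *)
Definition clip (a : R) : R := Num.max 0 (Num.min a 1).

Lemma clipE (a : R) : clip a = if a <= 0 then 0 else if a <= 1 then a else 1.
Proof.
rewrite /clip /Num.max /Num.min.
by case: (lerP a 0) => h0; case: (ltrP a 1) => h1; case: ltrP => h2;
  case: (lerP a 1) => h3; lra.
Qed.

Lemma clip_lt0 (a : R) : a < 0 -> clip a = 0.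
Proof. by move=> h; rewrite clipE ltW. Qed.

Lemma clip_ge1 (a : R) : 1 <= a -> clip a = 1.
Proof. by move=> h; rewrite clipE; case: lerP => // ?; [lra | case: lerP => ? //; lra]. Qed.

Lemma clip01 a : 0 <= clip a <= 1.
Proof.
by rewrite clipE; case: (lerP a 0) => ?; [|case: (lerP a 1) => ?]; apply/andP; split; lra.
Qed.

(** The recursion that halving imposes on the uniform distribution function; it drives both
    [lam_halves] and the contraction in [F_1r]. *)
Lemma clip_double a : clip a = (clip (2 * a) + clip (2 * a - 1)) / 2.
Proof. by rewrite !clipE; do ![case: lerP => ?]; lra. Qed.

(** Rays form a pi-system generating the Borel sets. Finiteness on rays replaces total mass 1, so
    that the lemma also covers restricted and rescaled measures as in [split_rect]. *)
Lemma finite_measure_eq_ray (m1 m2 : {measure set mR -> \bar R}) :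
  (forall a, m1 `]-oo, a]%classic = m2 `]-oo, a]%classic) -> (forall a, (m1 `]-oo, a]%classic < +oo)%E) ->
  forall A : set R, measurable A -> m1 A = m2 A.
Proof.
move=> m12 fin A mA.
pose G : set (set mR) := [set B | exists x, B = `]-oo, x]%classic].
apply: (measure_unique G (fun n : nat => `]-oo, n%:R]%classic)) => //.
- apply/seteqP; split=> B.
    have -> : @measurable _ mR = (@RGenOInfty.G R).-sigma.-measurable := RGenOInfty.measurableE R.
    apply: smallest_sub => // C [x ->].
    rewrite -setCitvl; apply: (@sigma_algebraC).
    by apply: sub_sigma_algebra; exists x.
  apply: smallest_sub; first exact: sigma_algebra_measurable.
  by move=> C [x ->]; exact: measurable_itv.
- move=> B C [x ->] [y ->]; exists (Num.min x y).
  apply/seteqP; split=> z /=; rewrite !in_itv/= le_min; first by case=> -> ->.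
  by move=> /andP[].
- by move=> i; exists i%:R.
- apply/seteqP; split=> x // _; exists (Num.bound `|x : R|) => //=.
  by rewrite in_itv/= ltW// (le_lt_trans (ler_norm (x : R)))// archi_boundP.
- by move=> B [x ->].
Qed.

Lemma lam_lebesgue (A : set R) : measurable A ->
  lam A = lebesgue_measure (A `&` `[0, 1]).
Proof.
move=> mA; rewrite /lam /= /uniform_prob integral_uniform_pdf.
under eq_integral => x.
  rewrite inE => -[_]/=; rewrite in_itv/= => x01.
  rewrite /uniform_pdf x01 subr0 invr1; over.
by rewrite integral_cst ?mul1e//; exact: measurableI.
Qed.

Lemma lam_ray a : lam `]-oo, a]%classic = (clip a)%:E.
Proof.
rewrite lam_lebesgue//; have [a0|a0] := ltP a 0.
  rewrite (_ : _ `&` _ = set0) ?measure0 ?clip_lt0//.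
  by apply/seteqP; split=> x //=; rewrite !in_itv/=; lra.
have [a1|a1] := leP a 1.
  rewrite (_ : _ `&` _ = `[0, a]%classic); last first.
    by apply/seteqP; split=> x /=; rewrite !in_itv/=; [case=> ? /andP[? ?]|move=> /andP[? ?]; split]; lra.
  rewrite lebesgue_measure_itv/= lte_fin clipE; move: a0 a1.
  by rewrite le_eqVlt => /predU1P[<-|a0]; rewrite ?ltxx ?lexx// a0 => a1; rewrite a1 leNgt a0/= oppr0 adde0.
rewrite (_ : _ `&` _ = `[0, 1]%classic); last first.
  by apply/seteqP; split=> x /=; rewrite !in_itv/=; [case=> ? /andP[? ?]|move=> /andP[? ?]; split]; lra.
by rewrite lebesgue_measure_itv/= lte_fin ltr01 clip_ge1 ?ltW// oppr0 adde0.
Qed.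

Lemma lam01 : lam `[0, 1[%classic = 1%E.
Proof.
rewrite lam_lebesgue// (_ : _ `&` _ = `[0, 1[%classic).
  by rewrite lebesgue_measure_itv/= lte_fin ltr01 oppr0 adde0.
by apply/seteqP; split=> x /=; rewrite !in_itv/=; [case=> // |move=> /andP[? ?]; split=> //]; lra.
Qed.

Lemma lam_setI01 (A : set R) : measurable A -> lam A = lam (A `&` `[0, 1[).
Proof.
move=> mA; rewrite -[in LHS](setIT A) -(setUv `[0, 1[%classic) setIUr measureU//.
- rewrite [X in _ + X](_ : _ = 0)%E ?adde0//; apply/eqP; rewrite eq_le measure_ge0 andbT.
  rewrite (@le_trans _ _ (lam (~` `[0, 1[%classic)))//.
    by apply: le_measure; rewrite ?inE//; [apply: measurableI => //; exact: measurableC|exact: measurableC].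
  by rewrite [leLHS]probability_setC// lam01 subee.
- exact: measurableI.
- by apply: measurableI => //; exact: measurableC.
- by rewrite setIACA setICr setI0.
Qed.

(** Half-open on the right because [th0_h0] fails at 1: the leading digit of [h0 1] is already 1. *)
Lemma lam_eq01 (A B : set R) : measurable A -> measurable B ->
  (forall x, 0 <= x < 1 -> A x <-> B x) -> lam A = lam B.
Proof.
move=> mA mB AB; rewrite lam_setI01// [RHS]lam_setI01//; congr (lam _).
by apply/seteqP; split=> x /= []; rewrite in_itv/= => + x01; [rewrite AB|rewrite -AB].
Qed.

Definition mkmfun d1 d2 (T1 : measurableType d1) (T2 : measurableType d2)
  (f : T1 -> T2) (mf : measurable_fun setT f) : {mfun T1 >-> T2} :=
  HB.pack f (isMeasurableFun.Build _ _ _ _ _ mf).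

Lemma preimage_measurable d1 d2 (T1 : measurableType d1) (T2 : measurableType d2)
  (f : T1 -> T2) (A : set T2) : measurable_fun setT f -> measurable A ->
  measurable (f @^-1` A).
Proof. by move=> mf mA; rewrite -(setTI (_ @^-1` _)); exact: mf. Qed.

Definition h0 (x : R) : R := x / 2.
Definition h1 (x : R) : R := (x + 1) / 2.
Lemma mh0 : measurable_fun setT (h0 : mR -> mR).
Proof. exact: measurable_funM. Qed.
Lemma mh1 : measurable_fun setT (h1 : mR -> mR).
Proof. by apply: measurable_funM => //; exact: measurable_funD. Qed.

Lemma lam_halves (A : set R) : measurable A ->
  lam A = (2^-1%:E * (lam (h0 @^-1` A) + lam (h1 @^-1` A)))%E.
Proof.
move=> mA; have h2 : 0 <= (2^-1 : R) by lra.
pose m2 := mscale (NngNum h2) (measure_add (distribution lam (mkmfun mh0)) (distribution lam (mkmfun mh1))).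
have m2E B : m2 B = (2^-1%:E * (lam (h0 @^-1` B) + lam (h1 @^-1` B)))%E.
  by rewrite /m2 /mscale/= /measure_add/= /msum big_ord_recl big_ord1.
rewrite -m2E; apply: (@finite_measure_eq_ray lam m2) => //.
- move=> a; apply: (etrans _ (esym (m2E _))).
  rewrite (_ : h0 @^-1` _ = `]-oo, (2 * a)]%classic); last first.
    by apply/seteqP; split=> x /=; rewrite !in_itv/= /h0; lra.
  rewrite (_ : h1 @^-1` _ = `]-oo, (2 * a - 1)]%classic); last first.
    by apply/seteqP; split=> x /=; rewrite !in_itv/= /h1; lra.
  apply: (etrans (lam_ray a)).
  by rewrite !lam_ray -EFinD -EFinM; congr EFin; have := clip_double a; lra.
- by move=> a; rewrite [ltLHS](lam_ray a) ltry.
Qed.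

Definition bit (x : R) : R := if 2^-1 <= x then 1 else 0.
Definition tl (x : R) : R := 2 * x - bit x.

Lemma mbit : measurable_fun setT (bit : mR -> mR).
Proof. by apply: measurable_fun_ifT => //; exact: measurable_fun_ler. Qed.
Lemma mtl : measurable_fun setT (tl : mR -> mR).
Proof. by apply: measurable_funB; [exact: measurable_funM|exact: mbit]. Qed.

(* [th0 x] and [th1 x] carry the binary digits of [x] of odd and even rank; under the uniform law they are independent and uniform. *)
Fixpoint th0n (n : nat) (x : R) : R :=
  if n is n'.+1 then (bit x + th0n n' (tl (tl x))) / 2 else 0.

Definition th0 (x : R) : R := limn (th0n ^~ x).
Definition th1 (x : R) : R := th0 (tl x).

Lemma th0n01 n x : 0 <= th0n n x <= 1.
Proof.
elim: n x => [|n IH] x /=; first by rewrite lexx ler01.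
by have := IH (tl (tl x)); rewrite /bit; case: ifP => _; lra.
Qed.

Lemma th0n_nd x : nondecreasing_seq (th0n ^~ x).
Proof.
apply/nondecreasing_seqP => n; elim: n x => [|n IH] x.
  by have /andP[] := th0n01 1 x.
by have := IH (tl (tl x)) => /=; lra.
Qed.

Lemma cvg_th0n x : th0n ^~ x @ \oo --> th0 x.
Proof.
apply: nondecreasing_is_cvgn; first exact: th0n_nd.
by exists 1 => _ [n _ <-]; have /andP[] := th0n01 n x.
Qed.

Lemma mth0n n : measurable_fun setT (th0n n : mR -> mR).
Proof.
elim: n => [|n IH] /=; first exact: measurable_cst.
apply: measurable_funM => //; apply: measurable_funD; first exact: mbit.
by do 2 (apply: measurableT_comp => //; try exact: mtl).
Qed.

Lemma mth0 : measurable_fun setT (th0 : mR -> mR).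
Proof.
apply: (@measurable_fun_cvg _ _ _ _ th0n) => // [n|x _]; first exact: mth0n.
exact: cvg_th0n.
Qed.

Lemma mth1 : measurable_fun setT (th1 : mR -> mR).
Proof. exact: (measurableT_comp mth0 mtl). Qed.

Lemma th01 x : 0 <= th0 x <= 1.
Proof.
apply/andP; split.
  apply: limr_ge; first by apply/cvg_ex; exists (th0 x); exact: cvg_th0n.
  by apply: nearW => n; have /andP[] := th0n01 n x.
apply: limr_le; first by apply/cvg_ex; exists (th0 x); exact: cvg_th0n.
by apply: nearW => n; have /andP[] := th0n01 n x.
Qed.

Lemma th0_rec x : th0 x = (bit x + th0 (tl (tl x))) / 2.
Proof.
apply/cvg_lim => //; rewrite -(cvg_shiftn 1%N).
rewrite [X in X @ _ --> _](_ : _ = fun n => (bit x + th0n n (tl (tl x))) / 2); last first.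
  by apply/funext => n; rewrite /= addn1.
by apply: cvgMl; apply: cvgD; [exact: cvg_cst|exact: cvg_th0n].
Qed.

Lemma th0_h0 x : 0 <= x < 1 -> th0 (h0 x) = th1 x / 2 /\ th1 (h0 x) = th0 x.
Proof.
move=> x01; have b : bit (h0 x) = 0 by rewrite /bit /h0; case: ifPn => //; lra.
have t : tl (h0 x) = x by rewrite /tl b /h0; lra.
by rewrite th0_rec b t add0r /th1 t.
Qed.

Lemma th0_h1 x : 0 <= x < 1 -> th0 (h1 x) = (1 + th1 x) / 2 /\ th1 (h1 x) = th0 x.
Proof.
move=> x01; have b : bit (h1 x) = 1 by rewrite /bit /h1; case: ifPn => //; lra.
have t : tl (h1 x) = x by rewrite /tl b /h1; lra.
by rewrite th0_rec b t /th1 t.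
Qed.

Let Fab (a b : R) := lam (th0 @^-1` `]-oo, a] `&` th1 @^-1` `]-oo, b]).

Let mF0 a : measurable (th0 @^-1` `]-oo, a]).
Proof. by apply: preimage_measurable; [exact: mth0|]. Qed.
Let mF1 a : measurable (th1 @^-1` `]-oo, a]).
Proof. by apply: preimage_measurable; [exact: mth1|]. Qed.

(* Halving exchanges [th0] and [th1]: this functional equation determines their joint distribution function. *)
Let Fab_rec (a b : R) : Fab a b = (2^-1%:E * (Fab b (2 * a) + Fab b (2 * a - 1)))%E.
Proof.
rewrite /Fab lam_halves; last by apply: measurableI.
congr (_ * (_ + _))%E.
- apply: lam_eq01.
  + by apply: preimage_measurable; [exact: mh0|exact: measurableI].
  + exact: measurableI.
  + move=> x x01 /=; have [-> ->] := th0_h0 x01; rewrite !in_itv/=.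
    by split=> -[? ?]; split; lra.
- apply: lam_eq01.
  + by apply: preimage_measurable; [exact: mh1|exact: measurableI].
  + exact: measurableI.
  + move=> x x01 /=; have [-> ->] := th0_h1 x01; rewrite !in_itv/=.
    by split=> -[? ?]; split; lra.
Qed.

Let F (a b : R) := fine (Fab a b).
Let FE a b : Fab a b = (F a b)%:E.
Proof. by rewrite fineK//; apply: (fin_num_measure lam); apply: measurableI; [exact: mF0|exact: mF1]. Qed.

Let F_bnd a b : 0 <= F a b <= 1.
Proof.
by rewrite -!lee_fin -FE measure_ge0/=; apply: (probability_le1 lam); apply: measurableI; [exact: mF0|exact: mF1].
Qed.

Let F_rec a b : F a b = (F b (2 * a) + F b (2 * a - 1)) / 2.
Proof. by apply: EFin_inj; rewrite -FE Fab_rec !FE -EFinD -EFinM mulrC. Qed.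

Let F_lt0l (a b : R) : a < 0 -> F a b = 0.
Proof.
move=> a0; rewrite /F /Fab (_ : _ `&` _ = set0) ?measure0//.
apply/seteqP; split=> x //= [+ _]; rewrite in_itv/=.
by have := th01 x; lra.
Qed.
Let F_lt0r (a b : R) : b < 0 -> F a b = 0.
Proof.
move=> a0; rewrite /F /Fab (_ : _ `&` _ = set0) ?measure0//.
apply/seteqP; split=> x //= [_]; rewrite in_itv/=.
by have := th01 (tl x); rewrite -/(th1 x); lra.
Qed.
Let F_ge1l (a a' b : R) : 1 <= a -> 1 <= a' -> F a b = F a' b.
Proof.
move=> a1 a1'; congr (fine (lam _)).
by apply/seteqP; split=> x /= [+ ?]; split => //; rewrite in_itv/=; have := th01 x; lra.
Qed.
Let F_ge1r (a b b' : R) : 1 <= b -> 1 <= b' -> F a b = F a b'.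
Proof.
move=> a1 a1'; congr (fine (lam _)).
apply/seteqP; split=> x /= [? +]; split => //; rewrite in_itv/=;
by have := th01 (tl x); rewrite -/(th1 x); lra.
Qed.
Let F11 : F 1 1 = 1.
Proof.
rewrite /F /Fab (_ : _ `&` _ = setT) ?probability_setT//.
apply/seteqP; split=> x //= _; rewrite !in_itv/=; have := th01 (tl x).
by have := th01 x; rewrite -/(th1 x); lra.
Qed.

(** At a = 1 both terms of the functional equation are equal to [F x 1]. *)
Let F_sw1 (x : R) : F 1 x = F x 1.
Proof.
rewrite F_rec (F_ge1r _ (b' := 1) (b := 2 * 1)) ?(F_ge1r _ (b' := 1) (b := 2 * 1 - 1)); lra.
Qed.

(** The functional equation contracts: for a in [0, 1[, one of the two terms on its right is a known
    boundary value, so the error is halved at each level. *)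
Let F_1r n a : `|F a 1 - clip a| <= (2^-1) ^+ n.
Proof.
elim: n a => [|n IH] a.
  by rewrite expr0; have := F_bnd a 1; have := clip01 a; rewrite ler_norml; lra.
have [a0|a0] := ltP a 0.
  by rewrite F_lt0l// clip_lt0// subrr normr0 exprn_ge0//; lra.
have [a1|a1] := leP 1 a.
  by rewrite (F_ge1l (a' := 1))// F11 clip_ge1// subrr normr0 exprn_ge0//; lra.
have R1 : F a 1 = (F (2 * a) 1 + F (2 * a - 1) 1) / 2.
  by rewrite F_rec !F_sw1.
rewrite R1 (clip_double a) exprS.
have [h|h] := ltP a 2^-1.
  rewrite (F_lt0l (a := 2 * a - 1)) ?(clip_lt0 (a := 2 * a - 1)); [|lra|lra].
  by have := IH (2 * a); rewrite !ler_norml; lra.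
rewrite (F_ge1l (a' := 1) (a := 2 * a))//; last lra.
rewrite F11 (clip_ge1 (a := 2 * a)); last lra.
by have := IH (2 * a - 1); rewrite !ler_norml; lra.
Qed.

Lemma half_pow_le0 (x : R) : (forall n, `|x| <= (2^-1) ^+ n) -> x = 0.
Proof.
move=> h; apply/eqP; rewrite -normr_le0; apply/ler_addgt0Pr => e e0; rewrite add0r.
have /cvgrPdist_lt/(_ _ e0) : (2^-1 : R) ^+ n @[n --> \oo] --> (0 : R).
  by apply: cvg_expr; rewrite ger0_norm; lra.
move=> [n _ /(_ n (leqnn n))]; rewrite sub0r normrN ger0_norm; last by apply: exprn_ge0; lra.
by move=> /ltW; exact: le_trans.
Qed.

Let F1r a : F a 1 = clip a.
Proof. by apply/eqP; rewrite -subr_eq0; apply/eqP/half_pow_le0 => n; exact: F_1r. Qed.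
Let F1l b : F 1 b = clip b.
Proof.
by rewrite F_sw1 F1r.
Qed.

(** The same contraction, with boundary values now supplied by [F1r] and [F1l]. The arguments swap
    at each level, hence the induction over both. *)
Let Fclip n a b : `|F a b - clip a * clip b| <= (2^-1) ^+ n.
Proof.
elim: n a b => [|n IH] a b.
  rewrite expr0; have := F_bnd a b; have := clip01 a; have := clip01 b.
  by rewrite ler_norml => /andP[? ?] /andP[? ?] /andP[? ?]; apply/andP; split; nra.
have p0 : 0 <= (2^-1 : R) ^+ n.+1 by rewrite exprn_ge0//; lra.
have [b0|b0] := ltP b 0.
  by rewrite F_lt0r// (clip_lt0 (a := b))// mulr0 subrr normr0.
have [b1|b1] := leP 1 b.
  by rewrite (F_ge1r _ (b' := 1))// F1r (clip_ge1 (a := b))// mulr1 subrr normr0.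
have [a0|a0] := ltP a 0.
  by rewrite F_lt0l// (clip_lt0 (a := a))// mul0r subrr normr0.
have [a1|a1] := leP 1 a.
  by rewrite (F_ge1l (a' := 1))// F1l (clip_ge1 (a := a))// mul1r subrr normr0.
rewrite F_rec (clip_double a) exprS.
have [h|h] := ltP a 2^-1.
  rewrite (F_lt0r _ (b := 2 * a - 1)) ?(clip_lt0 (a := 2 * a - 1)); [|lra|lra].
  by have := IH b (2 * a); rewrite !ler_norml; lra.
rewrite (F_ge1r _ (b' := 1) (b := 2 * a))//; last lra.
rewrite F1r (clip_ge1 (a := 2 * a)); last lra.
by have := IH b (2 * a - 1); rewrite !ler_norml; lra.
Qed.

Lemma Fsplit a b : lam (th0 @^-1` `]-oo, a] `&` th1 @^-1` `]-oo, b]) =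
  (lam `]-oo, a]%classic * lam `]-oo, b]%classic)%E.
Proof.
rewrite -/(Fab a b) FE !lam_ray -EFinM; congr EFin.
by apply/eqP; rewrite -subr_eq0; apply/eqP/half_pow_le0 => n; exact: Fclip.
Qed.

End Seeds.

Definition pfm (R : realType) d1 d2 (T1 : measurableType d1) (T2 : measurableType d2)
  (mu : {measure set T1 -> \bar R}) (f : T1 -> T2) (mf : measurable_fun setT f) :
  {measure set T2 -> \bar R}.
Proof. by refine (pushforward mu f). Defined.

Section SplitLaw.
Context {R : realType}.
Local Notation mR := (measurableTypeR R).
Local Notation lam := (@lam R).
Local Notation th0 := (@th0 R).
Local Notation th1 := (@th1 R).

Lemma measurable_th0 (A : set R) : measurable A -> measurable (th0 @^-1` A).
Proof. by move=> mA; apply: (preimage_measurable (T1 := mR) (T2 := mR)); [exact: mth0|]. Qed.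
Lemma measurable_th1 (A : set R) : measurable A -> measurable (th1 @^-1` A).
Proof. by move=> mA; apply: (preimage_measurable (T1 := mR) (T2 := mR)); [exact: mth1|]. Qed.

(** Independence passes from rays to Borel sets one coordinate at a time: with the other coordinate
    fixed, both sides are finite measures. *)
Lemma split_rect (A B : set R) : measurable A -> measurable B ->
  lam (th0 @^-1` A `&` th1 @^-1` B) = (lam A * lam B)%E.
Proof.
have step1 b (A' : set R) : measurable A' ->
    lam (th0 @^-1` A' `&` th1 @^-1` `]-oo, b]) = (lam A' * lam `]-oo, b]%classic)%E.
  move=> mA'; have mD : measurable (th1 @^-1` `]-oo, b]) by exact: measurable_th1.
  have /andP[c0 _] := clip01 b.
  have := @finite_measure_eq_ray R (pfm (mrestr lam mD) (@mth0 R))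
    (mscale (NngNum c0) lam) _ _ A' mA'.
  rewrite /mscale /pfm /= /pushforward /mrestr/= => -> //.
  - by rewrite lam_ray muleC.
  - move=> a; apply: (etrans (Fsplit a b)); rewrite muleC lam_ray /mscale.
    by congr (_ * _)%E.
  - by move=> a; rewrite [ltLHS](Fsplit a b) !lam_ray -EFinM ltry.
move=> mA mB; have mD : measurable (th0 @^-1` A) by exact: measurable_th0.
have fA : lam A \is a fin_num by exact: (fin_num_measure lam).
have cE : (fine (lam A))%:E = lam A by rewrite fineK.
have c0 : 0 <= fine (lam A) by rewrite fine_ge0.
have := @finite_measure_eq_ray R (pfm (mrestr lam mD) (@mth1 R))
  (mscale (NngNum c0) lam) _ _ B mB.
rewrite /mscale /pfm /= /pushforward /mrestr/= setIC => -> //.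
- by congr (_ * _)%E.
- by move=> a; rewrite setIC; apply: (etrans (step1 _ _ mA)); congr (_ * _)%E.
- by move=> a; rewrite setIC [ltLHS](step1 _ _ mA) lam_ray -cE -EFinM ltry.
Qed.

Definition thp (x : mR) : mR * mR := (th0 x, th1 x).
Lemma mthp : measurable_fun setT thp.
Proof. by apply/measurable_fun_pairP; split; [exact: mth0|exact: mth1]. Qed.

Lemma split_law (X : set (mR * mR)) : measurable X ->
  (lam \x lam)%E X = distribution lam (mkmfun mthp) X.
Proof.
move=> mX; apply: product_measure_unique => // A B mA mB.
by rewrite /distribution /pushforward /= -split_rect.
Qed.

(** By [split_law] a single seed can be integrated as two independent ones; this stands in for
    product spaces in everything that follows. *)
Lemma ge0_split (F : mR * mR -> \bar R) : measurable_fun setT F ->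
  (forall z, 0 <= F z)%E ->
  (\int[lam]_w F (th0 w, th1 w) = \int[lam]_x \int[lam]_y F (x, y))%E.
Proof.
move=> mF F0; rewrite -(fubini_tonelli1 F)//.
have := @ge0_integral_pushforward _ _ _ _ _ _ mthp lam setT F measurableT mF (fun y _ => F0 y).
rewrite preimage_setT => <-.
apply: eq_measure_integral; first exact: mthp.
by move=> H A mA _; exact/esym/split_law.
Qed.

Lemma ge0_split_swap (F : mR * mR -> \bar R) : measurable_fun setT F ->
  (forall z, 0 <= F z)%E ->
  (\int[lam]_w F (th0 w, th1 w) = \int[lam]_y \int[lam]_x F (x, y))%E.
Proof. move=> mF F0; rewrite (ge0_split mF F0); exact: (@fubini_tonelli _ _ mR mR R lam lam F mF F0). Qed.

Lemma integrable_split (F : mR * mR -> \bar R) :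
  (lam \x lam)%E.-integrable setT F ->
  lam.-integrable setT (F \o thp) /\
  (\int[lam]_w F (th0 w, th1 w) = \int[lam \x lam]_z F z)%E.
Proof.
move=> iF; have mF : measurable_fun setT F by case/integrableP: iF.
have i2 : lam.-integrable setT (F \o thp).
  apply/integrableP; split; first by apply: measurableT_comp => //; exact: mthp.
  have := @ge0_split (abse \o F) (measurableT_comp (@abse_measurable R setT) mF) (fun z => abse_ge0 _).
  move=> /= ->; rewrite -(fubini_tonelli1 (abse \o F))//=; last exact: measurableT_comp.
  by case/integrableP: iF.
split=> //.
have := @integral_pushforward _ _ _ _ _ _ mthp lam setT F mF.
rewrite preimage_setT => /(_ i2 measurableT) <-.
apply: eq_measure_integral; first exact: mthp.
by move=> H A mA _; exact/esym/split_law.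
Qed.

End SplitLaw.

(** * Expectation under the uniform law, and measure-preserving maps *)

Section Expectation.
Context {R : realType}.
Local Notation mR := (measurableTypeR R).
Local Notation lam := (@lam R).
Local Notation th0 := (@th0 R).
Local Notation th1 := (@th1 R).
Implicit Types f g : R -> R.

Definition E f : R := \int[lam]_x f x.
Definition Int f := lam.-integrable setT (EFin \o f).

Lemma Int_measurable f : Int f -> measurable_fun setT f.
Proof. by move=> /integrableP[/measurable_EFinP]. Qed.

Lemma E_EFin f : Int f -> (\int[lam]_x (f x)%:E = (E f)%:E)%E.
Proof. by move=> If; rewrite /E /Rintegral fineK//; exact: integrable_fin_num. Qed.

Lemma Int_le f g : measurable_fun setT f -> (forall x, `|f x| <= g x) -> Int g -> Int f.
Proof.
move=> mf fg Ig; apply: (le_integrable measurableT _ _ Ig); first exact/measurable_EFinP.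
by move=> x _ /=; rewrite lee_fin (le_trans (fg x))// ler_norm.
Qed.

Lemma Int_cst c : Int (cst c).
Proof. exact: finite_measure_integrable_cst. Qed.

Lemma Int_bounded f c : measurable_fun setT f -> (forall x, `|f x| <= c) -> Int f.
Proof. by move=> mf fc; apply: (Int_le mf fc (Int_cst c)). Qed.

Lemma IntD f g : Int f -> Int g -> Int (fun x => f x + g x).
Proof.
move=> If Ig; rewrite /Int (_ : _ \o _ = (EFin \o f) \+ (EFin \o g))%E//.
exact: integrableD.
Qed.

Lemma IntZ c f : Int f -> Int (fun x => c * f x).
Proof.
move=> If; rewrite /Int (_ : _ \o _ = (fun x => c%:E * (EFin \o f) x))%E//.
exact: integrableZl.
Qed.

Lemma IntN f : Int f -> Int (fun x => - f x).
Proof. by move=> /(IntZ (-1)); under eq_fun do rewrite mulN1r. Qed.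

Lemma IntB f g : Int f -> Int g -> Int (fun x => f x - g x).
Proof. by move=> If /IntN; exact: IntD. Qed.

Lemma Int_abs f : Int f -> Int (fun x => `|f x|).
Proof. by move=> /integrable_abse. Qed.

Lemma Int_sum (I : Type) (s : seq I) (F : I -> R -> R) :
  (forall i, Int (F i)) -> Int (fun x => \sum_(i <- s) F i x).
Proof.
move=> IF; elim: s => [|i s IH].
  by under eq_fun do rewrite big_nil; exact: Int_cst.
by under eq_fun do rewrite big_cons; exact: IntD.
Qed.

Lemma E_cst c : E (cst c) = c.
Proof. by rewrite /E Rintegral_cst//= probability_setT mulr1. Qed.

Lemma ED f g : Int f -> Int g -> E (fun x => f x + g x) = E f + E g.
Proof. by move=> *; rewrite /E RintegralD. Qed.

Lemma EZ c f : Int f -> E (fun x => c * f x) = c * E f.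
Proof. by move=> *; rewrite /E RintegralZl. Qed.

Lemma EN f : Int f -> E (fun x => - f x) = - E f.
Proof. by move=> If; under eq_fun do rewrite -mulN1r; rewrite EZ// mulN1r. Qed.

Lemma EB f g : Int f -> Int g -> E (fun x => f x - g x) = E f - E g.
Proof. by move=> *; rewrite /E RintegralB. Qed.

Lemma E_sum (I : Type) (s : seq I) (F : I -> R -> R) :
  (forall i, Int (F i)) -> E (fun x => \sum_(i <- s) F i x) = \sum_(i <- s) E (F i).
Proof.
move=> IF; elim: s => [|i s IH].
  by under eq_fun do rewrite big_nil; rewrite E_cst big_nil.
by under eq_fun do rewrite big_cons; rewrite ED// ?IH ?big_cons//; exact: Int_sum.
Qed.

Lemma E_le f g : Int f -> Int g -> (forall x, f x <= g x) -> E f <= E g.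
Proof. by move=> If Ig fg; apply: le_Rintegral. Qed.

Lemma E_ge0 f : (forall x, 0 <= f x) -> 0 <= E f.
Proof. by move=> f0; apply: Rintegral_ge0. Qed.

Lemma E_abs f : Int f -> `|E f| <= E (fun x => `|f x|).
Proof. by move=> If; apply: le_normr_Rintegral. Qed.

Lemma E_abs_le f c : measurable_fun setT f -> (forall x, `|f x| <= c) -> `|E f| <= c.
Proof.
move=> mf fc; have If := Int_bounded mf fc.
apply: (le_trans (E_abs If)); rewrite -[leRHS]E_cst; apply: E_le => //.
- exact: Int_abs.
- exact: Int_cst.
Qed.

Lemma E_dct (f_ : nat -> R -> R) f g : (forall n, measurable_fun setT (f_ n)) ->
  (forall x, f_ ^~ x @ \oo --> f x) -> (forall n x, `|f_ n x| <= g x) -> Int g ->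
  E (f_ n) @[n --> \oo] --> E f.
Proof.
move=> mf_ ff fg Ig.
have mf : measurable_fun setT f.
  by apply: (@measurable_fun_cvg _ _ _ _ f_) => // x _; exact: ff.
have [|||||If _ +] := @dominated_convergence _ mR R lam setT measurableT (fun n => EFin \o f_ n)
  (EFin \o f) (EFin \o g).
- by move=> n; apply/measurable_EFinP; exact: mf_.
- by apply/measurable_EFinP; exact: mf.
- by apply: aeW => x _; apply: cvg_EFin; [exact: nearW|exact: ff].
- exact: Ig.
- by apply: aeW => x n _ /=; rewrite lee_fin.
rewrite E_EFin//.
have -> : (fun n => \int[lam]_x (EFin \o f_ n) x)%E = (fun n => (E (f_ n))%:E).
  by apply/funext => n; rewrite -E_EFin//; exact: (Int_le (mf_ n) (fg n)).
by move/fine_cvgP => [].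
Qed.

Lemma E_ae f g (N : set R) : Int f -> measurable_fun setT g -> measurable N -> lam N = 0%E ->
  (forall x, ~ N x -> f x = g x) -> E f = E g.
Proof.
move=> If mg mN N0 fg; rewrite /E /Rintegral; congr fine.
apply: ae_eq_integral => //.
- by apply/measurable_EFinP; exact: Int_measurable If.
- by apply/measurable_EFinP; exact: mg.
- by exists N; split => // x /= h; apply: contrapT => /fg fgx; apply: h => _; rewrite fgx.
Qed.

Lemma E_prod f g : Int f -> Int g ->
  Int (fun w => f (th0 w) * g (th1 w)) /\
  E (fun w => f (th0 w) * g (th1 w)) = E f * E g.
Proof.
move=> If Ig; pose F (z : mR * mR) := (f z.1 * g z.2)%:E.
have mf := Int_measurable If; have mg := Int_measurable Ig.
have mF : measurable_fun setT F.
  by apply/measurable_EFinP; apply: measurable_funM; apply: measurableT_comp.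
have iF : (lam \x lam)%E.-integrable setT F.
  apply/integrable12ltyP => //.
  under eq_integral => x _.
    under eq_integral => y _ do rewrite /F /= normrM EFinM.
    rewrite ge0_integralZl//=; last first.
      by apply/measurable_EFinP; exact: measurableT_comp.
    rewrite E_EFin; last exact: Int_abs.
    over.
  rewrite ge0_integralZr//=.
  - by rewrite E_EFin ?ltry -?EFinM ?ltry//; exact: Int_abs.
  - by apply/measurable_EFinP; exact: measurableT_comp.
  - by rewrite lee_fin E_ge0.
have [i1 i2] := integrable_split iF; split; first exact: i1.
rewrite {1}/E /Rintegral [X in fine X](_ : _ = (E f * E g)%:E)//.
rewrite [LHS]i2 -integral12_prod_meas1//.
under eq_integral => x _.
  rewrite /fubini_F; under eq_integral => y _ do rewrite /F /= EFinM.
  rewrite integralZl// E_EFin//; over.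
by rewrite /= integralZr// E_EFin.
Qed.

(** Both orders of integration are recorded because the exchange argument [trotter] freezes the
    first seed in one step and the remaining ones in the other. *)
Lemma E_split_bounded (F : R -> R -> R) c :
  measurable_fun setT (fun z : mR * mR => F z.1 z.2) -> (forall x y, `|F x y| <= c) ->
  [/\ Int (fun w => F (th0 w) (th1 w)), Int (fun x => E (F x)),
    Int (fun y => E (F ^~ y)),
    E (fun w => F (th0 w) (th1 w)) = E (fun x => E (F x)) &
    E (fun w => F (th0 w) (th1 w)) = E (fun y => E (F ^~ y))].
Proof.
move=> mF Fc.
have mFx x : measurable_fun setT (F x).
  exact: (@measurable_fun_pair2 _ _ _ _ _ _ (fun z : mR * mR => F z.1 z.2) x mF).
have mFy y : measurable_fun setT (F ^~ y).
  exact: (@measurable_fun_pair1 _ _ _ _ _ _ (fun z : mR * mR => F z.1 z.2) y mF).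
pose G (z : mR * mR) := (F z.1 z.2)%:E.
have mG : measurable_fun setT G by exact/measurable_EFinP.
have iG : (lam \x lam)%E.-integrable setT G.
  apply/integrable12ltyP => //.
  apply: (@le_lt_trans _ _ (\int[lam]_x \int[lam]_y c%:E)%E); last first.
    have ic : (\int[lam]_(y in setT) c%:E)%E = c%:E.
      by rewrite integral_cst// [X in (_ * X)%E](_ : _ = 1%E) ?mule1//; exact: probability_setT.
    by under eq_integral do rewrite ic; rewrite ic ltry.
  apply: ge0_le_integral => //=.
  - by move=> x _; apply: integral_ge0 => y _; rewrite lee_fin.
  - apply: (@measurable_fun_fubini_tonelli_F _ _ _ _ _ lam (abse \o G)).
      exact: measurableT_comp.
    by move=> x; exact: abse_ge0.
  - move=> x _; apply: ge0_le_integral => //=.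
    + by apply/measurable_EFinP; apply: measurableT_comp => //; exact: mFx.
    + by move=> y _; rewrite lee_fin.
have [i1 i2] := integrable_split iG.
have IFx x : Int (F x) by exact: Int_bounded (mFx x) (Fc x).
have IFy y : Int (F ^~ y) by exact: Int_bounded (mFy y) (fun x => Fc x y).
have m1 : measurable_fun setT (fun x => E (F x)).
  apply/measurable_EFinP.
  rewrite (_ : _ \o _ = fun x => (\int[lam]_y (G (x, y)))%E).
    exact: (@measurable_fubini_F _ _ mR mR R lam lam G iG).
  by apply/funext => x /=; rewrite -E_EFin.
have m2 : measurable_fun setT (fun x => E (F ^~ x)).
  apply/measurable_EFinP.
  rewrite (_ : _ \o _ = fun y => (\int[lam]_x (G (x, y)))%E).
    exact: (@measurable_fubini_G _ _ mR mR R lam lam G iG).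
  by apply/funext => x /=; rewrite -E_EFin.
split => //; try by (apply: (@Int_bounded _ c) => // x; exact: E_abs_le).
- apply: EFin_inj; rewrite -E_EFin// [LHS]i2 -integral12_prod_meas1//.
  rewrite -E_EFin; last by apply: (@Int_bounded _ c) => // x; exact: E_abs_le.
  by apply: eq_integral => x _; rewrite -E_EFin.
- apply: EFin_inj; rewrite -E_EFin// [LHS]i2 -integral21_prod_meas1//.
  rewrite -E_EFin; last by apply: (@Int_bounded _ c) => // x; apply: E_abs_le.
  by apply: eq_integral => x _; rewrite -E_EFin.
Qed.

(** On a fixed probability space, a copy of a functional with the same law is its composition with
    such a map; the seeds and the final coupling are both of this kind. *)
Definition mpres (p : R -> R) := measurable_fun setT p /\
  forall A : set R, measurable A -> lam (p @^-1` A) = lam A.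

Lemma mpres_ge0 p (F : R -> \bar R) : mpres p -> measurable_fun setT F ->
  (forall x, 0 <= F x)%E -> (\int[lam]_x F (p x) = \int[lam]_x F x)%E.
Proof.
move=> [mp pp] mF F0.
have := @ge0_integral_pushforward _ _ mR mR R p mp lam setT F measurableT mF (fun y _ => F0 y).
rewrite preimage_setT => <-.
by apply: eq_measure_integral => //= A mA _; rewrite /pushforward pp.
Qed.

Lemma mpres_Int p f : mpres p -> Int f -> Int (f \o p).
Proof.
move=> pp If; have mf := Int_measurable If.
apply/integrableP; split.
  by apply/measurable_EFinP; apply: measurableT_comp => //; case: pp.
rewrite (mpres_ge0 (F := fun x => `|(f x)%:E|)%E)//.
- by case/integrableP: If.
- by apply/measurable_EFinP; exact: measurableT_comp.
Qed.

Lemma mpres_E p f : mpres p -> Int f -> E (f \o p) = E f.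
Proof.
move=> pp If; rewrite /E /Rintegral; congr fine.
have := @integral_pushforward _ _ mR mR R p pp.1 lam setT (EFin \o f) (measurable_int _ If).
rewrite preimage_setT => /(_ (mpres_Int pp If) measurableT) <-.
apply: eq_measure_integral; first exact: pp.1.
by move=> H A mA _; rewrite -[RHS](pp.2 A mA).
Qed.

Lemma mpres_comp p q : mpres p -> mpres q -> mpres (p \o q).
Proof.
move=> [mp pp] [mq qq]; split; first exact: measurableT_comp.
move=> A mA; rewrite comp_preimage qq ?pp//.
by apply: (preimage_measurable (T1 := mR) (T2 := mR)).
Qed.

Lemma mpres_th0 : mpres th0.
Proof.
split; first exact: mth0.
move=> A mA; have := split_rect mA measurableT.
by rewrite preimage_setT setIT probability_setT mule1.
Qed.

Lemma mpres_th1 : mpres th1.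
Proof.
split; first exact: mth1.
move=> A mA; have := split_rect measurableT mA.
by rewrite preimage_setT setTI probability_setT mul1e.
Qed.

End Expectation.
Arguments lam : simpl never.

Lemma integral_law (R : realType) d1 d2 (T1 : measurableType d1) (T2 : measurableType d2)
  (mu : {measure set T1 -> \bar R}) (nu : {measure set T2 -> \bar R})
  (f : T1 -> T2) (g : T2 -> \bar R) : measurable_fun setT f ->
  (forall A, measurable A -> mu (f @^-1` A) = nu A) ->
  measurable_fun setT g -> (forall x, 0 <= g x)%E ->
  (\int[mu]_x g (f x) = \int[nu]_x g x)%E.
Proof.
move=> mf law mg g0.
have := @ge0_integral_pushforward _ _ T1 T2 R f mf mu setT g measurableT mg (fun y _ => g0 y).
rewrite preimage_setT => <-.
rewrite -[LHS]/(\int[pfm mu mf]_y g y)%E.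
by apply: eq_measure_integral => A mA _; exact: law.
Qed.

(** * Measures with a density *)

Section Density.
Local Open Scope ereal_scope.
Context d (T : measurableType d) (R : realType) (mu : {measure set T -> \bar R}).
Variable k : T -> R.
Hypothesis mk : measurable_fun setT k.
Hypothesis k0 : forall x, (0 <= k x)%R.

Definition dens of measurable_fun setT k & (forall x, (0 <= k x)%R) :=
  fun A : set T => \int[mu]_(x in A) (k x)%:E.
Local Notation dk := (dens mk k0).

Let dens0 : dk set0 = 0.
Proof. by rewrite /dens integral_set0. Qed.
Let dens_ge0 A : 0 <= dk A.
Proof. by apply: integral_ge0 => x _; rewrite lee_fin. Qed.
Let dens_sigma : semi_sigma_additive dk.
Proof.
move=> F mF tF mUF; rewrite /dens; apply: cvg_toP.
  apply: ereal_nondecreasing_is_cvgn => m n mn.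
  by apply: lee_sum_nneg_natr => // i _ _; apply: integral_ge0 => x _; rewrite lee_fin.
rewrite ge0_integral_bigcup//=.
- by apply: measurable_funTS; apply/measurable_EFinP.
- by move=> x _; rewrite lee_fin.
Qed.

HB.instance Definition _ := isMeasure.Build _ _ _ dk dens0 dens_ge0 dens_sigma.

Import HBNNSimple.

(** The usual passage from indicators to simple functions to monotone limits. *)
Lemma ge0_integral_dens (f : T -> \bar R) : measurable_fun setT f -> (forall x, 0 <= f x) ->
  \int[dk]_x f x = \int[mu]_x (f x * (k x)%:E).
Proof.
move=> mf f0; pose f_ := nnsfun_approx measurableT mf.
have mkE : measurable_fun setT (EFin \o k) by exact/measurable_EFinP.
have ind A : measurable A -> \int[dk]_x (\1_A x)%:E = \int[mu]_x ((\1_A x)%:E * (k x)%:E).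
  move=> mA; rewrite integral_indic// setIT /= /dens integral_mkcond.
  by apply: eq_integral => x _; rewrite patchE indicE; case: ifP => _; rewrite ?mul1e ?mul0e.
have sf n : \int[dk]_x (f_ n x)%:E = \int[mu]_x ((f_ n x)%:E * (k x)%:E).
  under [LHS]eq_integral do rewrite fimfunE -fsumEFin//.
  rewrite ge0_integral_fsum//; last 2 first.
  - by move=> r; exact/measurable_EFinP/measurableT_comp.
  - by move=> r x _; rewrite EFinM nnfun_muleindic_ge0.
  under [RHS]eq_integral do rewrite fimfunE -fsumEFin//.
  under [RHS]eq_integral.
    move=> x xD; rewrite muleC ge0_mule_fsumr; last first.
      by move=> r; rewrite EFinM nnfun_muleindic_ge0.
    over.
  rewrite /= ge0_integral_fsum//; last 2 first.
  - move=> r; apply: emeasurable_funM => //.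
    by apply/measurable_EFinP/measurableT_comp.
  - by move=> r x _; rewrite mule_ge0 ?lee_fin// -lee_fin EFinM nnfun_muleindic_ge0.
  apply: eq_fsbigr => r /[!inE] -[x _ <-].
  have r0 : (0 <= f_ n x)%R by [].
  rewrite (_ : \int[dk]_y _ = (f_ n x)%:E * \int[dk]_y (\1_(f_ n @^-1` [set f_ n x]) y)%:E); last first.
    by rewrite -ge0_integralZl//; exact/measurable_EFinP/measurable_indic.
  rewrite ind// -ge0_integralZl//=.
  - by apply: eq_integral => y _; rewrite EFinM muleA [RHS]muleC.
  - by apply: emeasurable_funM => //; exact/measurable_EFinP/measurable_indic.
  - by move=> y _; rewrite mule_ge0 ?lee_fin.
transitivity (limn (fun n => \int[dk]_x (f_ n x)%:E)).
  rewrite -monotone_convergence//.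
  - by apply: eq_integral => x _; apply/esym/cvg_lim => //; exact: cvg_nnsfun_approx.
  - by move=> n; exact/measurable_EFinP/measurable_funTS.
  - by move=> n x _; rewrite lee_fin.
  - by move=> x _ a b ab; rewrite lee_fin; exact/lefP/nd_nnsfun_approx.
transitivity (limn (fun n => \int[mu]_x ((f_ n x)%:E * (k x)%:E))).
  by congr (limn _); apply/funext => n; exact: sf.
rewrite -monotone_convergence//.
- apply: eq_integral => x _; apply/cvg_lim => //.
  by apply: cvgeMr => //; exact: cvg_nnsfun_approx.
- by move=> n; apply: emeasurable_funM => //; exact/measurable_EFinP/measurable_funTS.
- by move=> n x _; rewrite mule_ge0 ?lee_fin.
- move=> x _ a b ab; apply: lee_wpmul2r; first by rewrite lee_fin.
  by rewrite lee_fin; exact/lefP/nd_nnsfun_approx.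
Qed.

Hypothesis k1 : \int[mu]_x (k x)%:E = 1.
Definition densP_def of \int[mu]_x (k x)%:E = 1 := dk.
Local Notation dp := (densP_def k1).
HB.instance Definition _ := Measure.on dp.
Let dp1 : dp setT = 1%:E. Proof. exact: k1. Qed.
HB.instance Definition _ := @Measure_isProbability.Build _ _ R dp dp1.
Definition densP : probability T R := dp.

Lemma densPE A : densP A = \int[mu]_(x in A) (k x)%:E. Proof. by []. Qed.

Lemma ge0_integral_densP (f : T -> \bar R) : measurable_fun setT f -> (forall x, 0 <= f x) ->
  \int[densP]_x f x = \int[mu]_x (f x * (k x)%:E).
Proof. exact: ge0_integral_dens. Qed.

End Density.

(** * Quantile transforms *)

Section Quantile.
Context {R : realType} d (S : measurableType d).
Local Notation mR := (measurableTypeR R).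
Local Notation lam := (@lam R).
Variable mu : S -> probability mR R.
Hypothesis mmu : forall x : R, measurable_fun setT (fun s => mu s `]-oo, x]%classic).

Let F s x := fine (mu s `]-oo, x]%classic).
Let FE s x : (F s x)%:E = mu s `]-oo, x]%classic.
Proof. by rewrite fineK// fin_num_measure. Qed.

Let mF x : measurable_fun setT (F ^~ x).
Proof. by apply: measurableT_comp => //; exact: mmu. Qed.

Let Xid s : {RV (mu s) >-> R} := @mkmfun _ _ mR R idfun (@measurable_id _ mR setT).
Let F_nd s x y : x <= y -> F s x <= F s y.
Proof.
by move=> xy; rewrite -lee_fin !FE; apply: le_measure; rewrite ?inE//; exact: subset_itvl.
Qed.

Let F_Ny s u : 0 < u -> exists x, F s x < u.
Proof.
move=> u0; have /fine_cvgP[_ /cvgrPdist_lt/(_ _ u0)] := cvg_cdfNy0 (Xid s).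
move=> [M [_ HM]]; exists (M - 1).
have := HM (M - 1); rewrite sub0r normrN => /(_ ltac:(lra)).
by rewrite ger0_norm//= fine_ge0.
Qed.

Let F_y s u : u < 1 -> exists x, u < F s x.
Proof.
rewrite -subr_gt0 => u1; have /fine_cvgP[_ /cvgrPdist_lt/(_ _ u1)] := cvg_cdfy1 (Xid s).
move=> [M [_ HM]]; exists (M + 1).
have h : `|1 - F s (M + 1)| < 1 - u by apply: (HM (M + 1)); lra.
by move: h; rewrite ltr_norml => /andP[]; lra.
Qed.

Let F_rc s x u : (forall e, 0 < e -> u <= F s (x + e)) -> u <= F s x.
Proof.
move=> h; have := @cdf_right_continuous _ _ _ _ (Xid s) x.
rewrite (_ : cdf (Xid s) x = (F s x)%:E); last by rewrite FE.
move=> /fine_cvgP[_ rc]; rewrite leNgt; apply/negP => Fu; rewrite -subr_gt0 in Fu.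
have := rc => /cvgrPdist_lt/(_ _ Fu) -[e /= e0 /(_ (x + e / 2))].
rewrite /ball_/= opprD addNKr normrN ger0_norm; last by lra.
move=> /(_ ltac:(lra) ltac:(lra)) hh.
have {hh} : `|F s x - F s (x + e / 2)| < u - F s x by exact: hh.
rewrite ltr_norml => /andP[+ _].
by have := h (e / 2) ltac:(lra); lra.
Qed.

(** The quantile function of the kernel [mu]. Outside of ]0, 1[ the set need not have an infimum;
    the value 0 there concerns a null set of levels only. *)
Definition quant (s : S) (u : R) : R :=
  if (0 < u) && (u < 1) then inf [set x | u <= F s x] else 0.

(** Right continuity of the distribution function makes the infimum attained, whence an equivalence
    with a large inequality. *)
Lemma quant_le s u x : 0 < u < 1 -> (quant s u <= x) = (u <= fine (mu s `]-oo, x]%classic)).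
Proof.
move=> u01; rewrite /quant u01; have /andP[u0 u1] := u01.
have [a Fa] := F_Ny s u0; have [b Fb] := F_y s u1.
have lb : has_lbound [set x | u <= F s x].
  exists a => y /= uy; rewrite leNgt; apply/negP => ya.
  by have := F_nd s (ltW ya); lra.
have hi : has_inf [set x | u <= F s x] by split => //; exists b; rewrite /= ltW.
apply/idP/idP => h; last exact: (ge_inf lb).
apply: F_rc => e e0.
have [y /= uy yl] := inf_adherent e0 hi.
by apply: (le_trans uy); apply: F_nd; lra.
Qed.

Lemma measurable_quant : measurable_fun setT (fun z : S * mR => quant z.1 z.2).
Proof.
apply: (measurability (@RGenCInfty.G R)).
  exact: RGenCInfty.measurableE.
move=> _ [_ [x ->] <-]; rewrite setTI.
have mu2 : measurable_fun setT (fun z : S * mR => z.2 : R) by exact: measurable_snd.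
have mo : measurable_fun setT (fun z : S * mR => (0 < z.2) && (z.2 < 1)).
  apply: measurable_and; apply: measurable_fun_ltr => //; exact: mu2.
have meas (y : R) : measurable [set z : S * mR | quant z.1 z.2 <= y].
  rewrite (_ : [set _ | _] = ([set z : S * mR | (0 < z.2) && (z.2 < 1)] `&` [set z | z.2 <= F z.1 y]) `|`
    (if 0 <= y then ~` [set z : S * mR | (0 < z.2) && (z.2 < 1)] else set0)); last first.
    apply/seteqP; split=> -[s u] /=.
      have [u01|u01] := boolP ((0 < u) && (u < 1)).
        by rewrite quant_le// => ?; left.
      rewrite /quant (negbTE u01) => y0; right; rewrite y0 /=; exact/negP.
    move=> [[u01 h]|]; first by rewrite quant_le.
    by case: ifPn => // y0 /= /negP u01; rewrite /quant (negbTE u01).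
  have m01 : measurable [set z : S * mR | (0 < z.2) && (z.2 < 1)].
    by rewrite -[X in measurable X]setTI; exact: (mo measurableT [set true]).
  apply: measurableU; first apply: measurableI => //.
    have mle : measurable_fun setT (fun z : S * mR => z.2 <= F z.1 y).
      apply: measurable_fun_ler; first exact: mu2.
      exact: (measurableT_comp (mF y) measurable_fst).
    by rewrite -[X in measurable X]setTI; exact: (mle measurableT [set true]).
  by case: ifP => _ //; exact: measurableC.
(* [meas] treats closed lower rays, whereas the generators are closed upper rays: [quant < x] means
   [quant <= x - 1 / (n + 1)] for some n. *)
rewrite (_ : _ @^-1` _ = ~` \bigcup_(n : nat) [set z : S * mR | quant z.1 z.2 <= x - n.+1%:R^-1]).
  by apply: measurableC; apply: bigcupT_measurable => n; exact: meas.
apply/seteqP; split=> z /=; rewrite in_itv/= andbT.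
  move=> h [n _ /= q]; have p : 0 < n.+1%:R^-1 :> R by rewrite invr_gt0.
  by have := le_trans h q; rewrite lerBrDl gerDr leNgt p.
move=> h; rewrite leNgt; apply/negP => xz; apply: h.
have := xz; rewrite -subr_gt0 => /ltr_add_invr [n]; rewrite add0r => hn.
by exists n => //=; rewrite lerBrDr addrC -lerBrDr ltW.
Qed.

Lemma quant_law s (A : set R) : measurable A -> lam (quant s @^-1` A) = mu s A.
Proof.
have mq : measurable_fun setT (quant s : mR -> mR).
  exact: (@measurable_fun_pair2 _ _ _ _ _ _ (fun z : S * mR => quant z.1 z.2) s measurable_quant).
move=> mA; have := @finite_measure_eq_ray R (pfm lam mq) (mu s) _ _ A mA.
rewrite /pfm /= /pushforward; apply.
- move=> a; have /andP[F0 F1] : 0 <= F s a <= 1.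
    by rewrite -!lee_fin FE measure_ge0 probability_le1.
  transitivity (lam `]-oo, (F s a)]%classic).
    have l0 : lam [set 0] = 0%E.
      apply/eqP; rewrite eq_le measure_ge0 andbT.
      rewrite (_ : 0%E = lam `]-oo, 0]%classic); last by rewrite lam_ray clipE lexx.
      by apply: le_measure; rewrite ?inE// => x /= ->; rewrite in_itv/=.
    have mq' : measurable (quant s @^-1` `]-oo, a]).
      by apply: (preimage_measurable (T1 := mR) (T2 := mR)).
    (* The level 0 has to be removed because [quant_le] holds in the open interval only. *)
    have key (B : set R) : measurable B -> lam B = lam (B `&` `]0, 1[).
      move=> mB; rewrite lam_setI01// (_ : B `&` `[0, 1[ = (B `&` [set 0]) `|` (B `&` `]0, 1[)).
        rewrite measureU ?[X in (X + _)%E](_ : _ = 0%E) ?add0e//.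
        + apply/eqP; rewrite eq_le measure_ge0 andbT -l0.
          by apply: le_measure; rewrite ?inE//; exact: measurableI.
        + exact: measurableI.
        + exact: measurableI.
        + by apply/seteqP; split=> x //= -[[_ ->] [_]]; rewrite in_itv/= ltxx.
      apply/seteqP; split=> x /=; rewrite !in_itv/=.
        move=> [Bx /andP[]]; rewrite le_eqVlt => /predU1P[x0|x0] x1; [left|right]; split => //.
        by rewrite x0 x1.
      by move=> [[Bx x0]|[Bx /andP[x0 x1]]]; split => //; [rewrite x0 lexx ltr01|rewrite (ltW x0) x1].
    rewrite [RHS]key//; apply: (etrans (key _ mq')); congr (lam _).
    apply/seteqP; split=> x /=; rewrite !in_itv/= => -[+ x01]; rewrite quant_le//.
  apply: (etrans (lam_ray _)); rewrite -FE; congr EFin; rewrite clipE.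
  by case: (lerP (F s a) 0) => ?; [lra|case: (lerP (F s a) 1) => ?; [by []|lra]].
- by move=> a; rewrite (@le_lt_trans _ _ 1%E) ?ltry//; apply: (probability_le1 lam);
    apply: (preimage_measurable (T1 := mR) (T2 := mR)).
Qed.

Lemma quant_integral s (f : R -> \bar R) : measurable_fun setT f -> (forall x, 0 <= f x)%E ->
  (\int[lam]_u f (quant s u) = \int[mu s]_x f x)%E.
Proof.
have mq : measurable_fun setT (quant s : mR -> mR).
  exact: (@measurable_fun_pair2 _ _ _ _ _ _ (fun z : S * mR => quant z.1 z.2) s measurable_quant).
by move=> mf f0; apply: (integral_law (nu := mu s)) => //; exact: quant_law.
Qed.

End Quantile.

(** * Affine changes of variable for Lebesgue measure *)

Section Affine.
Context {R : realType}.
Local Notation mR := (measurableTypeR R).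
Local Notation mu := (@lebesgue_measure R).

Lemma ge0_integral_affine (a b : R) (f : R -> \bar R) : 0 < a ->
  measurable_fun setT f -> (forall x, 0 <= f x)%E ->
  (\int[mu]_x f x = a%:E * \int[mu]_x f (a * x + b)%R)%E.
Proof.
move=> a0 mf f0.
have mg : measurable_fun setT (fun x : mR => a * x + b : mR).
  by apply: measurable_funD => //; exact: measurable_funM.
have law A : measurable A -> mu A = (a%:E * mu ((fun x => a * x + b)%R @^-1` A))%E.
  move=> mA; pose m' := mscale (NngNum (ltW a0)) (pfm mu mg).
  rewrite (@lebesgue_measure_unique R m')// => _ [[x y] /= _ <-].
  rewrite /m' /mscale /pfm /= /pushforward.
  rewrite (_ : _ @^-1` _ = `](x - b) / a, (y - b) / a]%classic); last first.
    apply/seteqP; split=> z /=; rewrite !in_itv/= => /andP[h1 h2]; apply/andP; split.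
    - by rewrite ltr_pdivrMr// mulrC; lra.
    - by rewrite ler_pdivlMr// mulrC; lra.
    - by move: h1; rewrite ltr_pdivrMr// mulrC; lra.
    - by move: h2; rewrite ler_pdivlMr// mulrC; lra.
  rewrite !lebesgue_measure_itv/= !lte_fin ltr_pM2r ?invr_gt0// ltrD2r.
  case: ifP => _; last by rewrite mule0.
  by rewrite -!EFinB -EFinM; congr EFin; field; lra.
rewrite (integral_law (nu := pfm mu mg) mg)// (_ : a%:E = (NngNum (ltW a0))%:num%:E)//.
rewrite -(ge0_integral_mscale (pfm mu mg))//.
by apply: eq_measure_integral => // A mA _; exact: law.
Qed.

Lemma ge0_integral_opp (f : R -> \bar R) :
  measurable_fun setT f -> (forall x, 0 <= f x)%E ->
  (\int[mu]_x f x = \int[mu]_x f (- x)%R)%E.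
Proof.
move=> mf f0.
have mg : measurable_fun setT (-%R : mR -> mR) by exact: oppr_measurable.
by rewrite (integral_law (nu := mu) mg)// => A mA; exact: lebesgue_measureN.
Qed.

End Affine.

(** * Exponential and normal variables as functions of a seed *)

Section NormalExp.
Context {R : realType}.
Local Notation mR := (measurableTypeR R).
Local Notation lam := (@lam R).
Local Notation th0 := (@th0 R).
Local Notation th1 := (@th1 R).
Local Notation mu := (@lebesgue_measure R).

Definition qof (P : probability mR R) (u : R) : R := quant (fun _ : mR => P) 0 u.

Lemma qof_le P u x : 0 < u < 1 -> (qof P u <= x) = (u <= fine (P `]-oo, x]%classic)).
Proof. by move=> u01; rewrite /qof quant_le// => ?; exact: measurable_cst. Qed.

Lemma measurable_qof P : measurable_fun setT (qof P : mR -> mR).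
Proof.
have mq := @measurable_quant R _ mR (fun _ : mR => P) (fun=> measurable_cst _).
exact: (@measurable_fun_pair2 _ _ _ _ _ _ _ (0 : mR) mq).
Qed.

Lemma qof_integral P (f : R -> \bar R) : measurable_fun setT f -> (forall x, 0 <= f x)%E ->
  (\int[lam]_u f (qof P u) = \int[P]_x f x)%E.
Proof. by move=> mf f0; rewrite (@quant_integral R _ mR (fun _ : mR => P))// => ?; exact: measurable_cst. Qed.

Definition expP : probability mR R := @densP _ mR R mu (exponential_pdf 1)
  (measurable_exponential_pdf 1) (fun x => exponential_pdf_ge0 ler01 x) (integral_exponential_pdf ltr01).

Definition expl (s : R) : R := qof expP s.

Lemma measurable_expl : measurable_fun setT (expl : mR -> mR).
Proof. exact: measurable_qof. Qed.

Lemma expl_integral (f : R -> \bar R) : measurable_fun setT f -> (forall x, 0 <= f x)%E ->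
  (\int[lam]_s f (expl s) = \int[mu]_x (f x * (exponential_pdf 1 x)%:E))%E.
Proof. by move=> mf f0; rewrite qof_integral// ge0_integral_densP. Qed.

Lemma expP_le0 x : x <= 0 -> expP `]-oo, x]%classic = 0%E.
Proof.
move=> x0; rewrite densPE.
rewrite -integral_itv_bndo_bndc; last first.
  by apply: measurable_funTS; apply/measurable_EFinP; exact: measurable_exponential_pdf.
rewrite integral0_eq// => y /=; rewrite in_itv/= => yx.
by rewrite lt0_exponential_pdf// (lt_le_trans yx).
Qed.

Lemma expl_gt0 s : 0 < s < 1 -> 0 < expl s.
Proof.
move=> s01; rewrite ltNge; apply/negP; rewrite qof_le// expP_le0//=.
by move: s01 => /andP[]; lra.
Qed.

Lemma expl_ge0 s : 0 <= expl s.
Proof.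
have [s01|s01] := boolP ((0 < s) && (s < 1)); first by rewrite ltW// expl_gt0.
by rewrite /expl /qof /quant (negbTE s01).
Qed.

Lemma npdfE (m s x : R) : 0 < s -> normal_pdf m s x =
  (s * Num.sqrt (pi * 2))^-1 * expR (- (x - m) ^+ 2 / (s ^+ 2 * 2)).
Proof.
move=> s0; rewrite /normal_pdf gt_eqF// /normal_peak /normal_fun.
rewrite -(mulr_natr (s ^+ 2 * pi) 2) -(mulr_natr (s ^+ 2) 2).
by rewrite -mulrA sqrtrM ?sqr_ge0// sqrtr_sqr ger0_norm// ltW.
Qed.

Definition gzP : probability mR R := @densP _ mR R mu (normal_pdf 0 1)
  (measurable_normal_pdf 0 1) (normal_pdf_ge0 0 1) (integral_normal_pdf 0 1).
Definition gz0 (s : R) : R := qof gzP s.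

Lemma measurable_gz0 : measurable_fun setT (gz0 : mR -> mR).
Proof. exact: measurable_qof. Qed.

Lemma gz0_integral (f : R -> \bar R) : measurable_fun setT f -> (forall x, 0 <= f x)%E ->
  (\int[lam]_s f (gz0 s) = \int[mu]_x (f x * (normal_pdf 0 1 x)%:E))%E.
Proof. by move=> mf f0; rewrite qof_integral// ge0_integral_densP. Qed.

Lemma gz0_scale (s : R) (f : R -> \bar R) : 0 < s -> measurable_fun setT f ->
  (forall x, 0 <= f x)%E ->
  (\int[lam]_w f (s * gz0 w)%R = \int[mu]_x (f x * (normal_pdf 0 s x)%:E))%E.
Proof.
move=> s0 mf f0.
have msf : measurable_fun setT (fun x : R => f (s * x)).
  by apply: measurableT_comp => //; exact: measurable_funM.
rewrite (gz0_integral msf (fun x => f0 _)).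
rewrite [RHS](ge0_integral_affine (a := s) 0 s0); last 2 first.
- by apply: emeasurable_funM => //; apply/measurable_EFinP; exact: measurable_normal_pdf.
- by move=> x; rewrite mule_ge0// lee_fin normal_pdf_ge0.
rewrite -ge0_integralZl//=.
- apply: eq_integral => x _; rewrite addr0 muleCA; congr (_ * _)%E.
  rewrite -EFinM; congr EFin; rewrite !npdfE// !subr0 mul1r expr1n mul1r.
  rewrite invfM mulrA mulrA divff ?gt_eqF// mul1r; congr (_ * expR _).
  by field; rewrite gt_eqF.
- apply: emeasurable_funM.
    apply: measurableT_comp => //; apply: measurable_funD => //; exact: measurable_funM.
  apply/measurable_EFinP; apply: measurableT_comp; first exact: measurable_normal_pdf.
  by apply: measurable_funD => //; exact: measurable_funM.
- by move=> x _; rewrite mule_ge0// lee_fin normal_pdf_ge0.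
- by rewrite lee_fin ltW.
Qed.

Lemma gz0_sym (f : R -> \bar R) : measurable_fun setT f -> (forall x, 0 <= f x)%E ->
  (\int[lam]_w f (- gz0 w)%R = \int[lam]_w f (gz0 w))%E.
Proof.
move=> mf f0; rewrite (gz0_integral (f := fun x => f (- x)))//; last first.
  by apply: measurableT_comp => //; exact: oppr_measurable.
rewrite gz0_integral// [RHS]ge0_integral_opp.
- by apply: eq_integral => x _; rewrite !npdfE// !subr0 sqrrN.
- apply: emeasurable_funM => //; apply/measurable_EFinP; exact: measurable_normal_pdf.
- by move=> x; rewrite mule_ge0// lee_fin normal_pdf_ge0.
Qed.

(** Completing the square. The left side is the joint density of X and aX + bY; the right side is
    the marginal density of the sum times the conditional density of X, whose integral in x is 1. *)
Lemma npdf_convolution (a b x z : R) : 0 < a -> 0 < b -> let s := Num.sqrt (a ^+ 2 + b ^+ 2) in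
  normal_pdf 0 1 x * normal_pdf (a * x) b z =
  normal_pdf 0 s z * normal_pdf (a * z / s ^+ 2) (b / s) x.
Proof.
move=> a0 b0 s; have s2 : s ^+ 2 = a ^+ 2 + b ^+ 2.
  by rewrite sqr_sqrtr// addr_ge0// sqr_ge0.
have s0 : 0 < s by rewrite sqrtr_gt0 addr_gt0// exprn_gt0.
have p0 : 0 < Num.sqrt (pi * 2) :> R by rewrite sqrtr_gt0 mulr_gt0// pi_gt0.
rewrite !npdfE ?divr_gt0// mulrACA [RHS]mulrACA -!expRD; congr (_ * expR _).
  by field; rewrite !gt_eqF.
have sn : a ^+ 2 + b ^+ 2 != 0 by rewrite -s2 gt_eqF// exprn_gt0.
rewrite expr_div_n s2; field.
by rewrite sn (gt_eqF b0).
Qed.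

Lemma gz0_conv_pos (a b : R) (f : R -> \bar R) : 0 < a -> 0 < b ->
  measurable_fun setT f -> (forall x, 0 <= f x)%E ->
  (\int[lam]_w f (a * gz0 (th0 w) + b * gz0 (th1 w))%R =
   \int[lam]_w f (Num.sqrt (a ^+ 2 + b ^+ 2) * gz0 w)%R)%E.
Proof.
move=> a0 b0 mf f0; set s := Num.sqrt _.
have s0 : 0 < s by rewrite sqrtr_gt0 addr_gt0// exprn_gt0.
have mF : measurable_fun setT (fun z : mR * mR => f (a * gz0 z.1 + b * gz0 z.2)).
  apply: measurableT_comp => //; apply: measurable_funD; apply: measurable_funM => //;
  by apply: measurableT_comp => //; exact: measurable_gz0.
rewrite (ge0_split (F := fun z => f (a * gz0 z.1 + b * gz0 z.2)))//=.
have ml1 c : measurable_fun setT (fun y : mR => c + b * y : R).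
  by apply: measurable_funD => //; exact: measurable_funM.
have mlin : measurable_fun setT (fun z : mR * mR => a * z.1 + b * z.2 : R).
  by apply: measurable_funD; exact: measurable_funM.
have mpdf2 : measurable_fun setT (fun z : mR * mR => normal_pdf (a * z.1) b z.2 : R).
  rewrite (_ : (fun z : mR * mR => _) = fun z : mR * mR => (b * Num.sqrt (pi * 2))^-1 *
    expR (- (z.2 - a * z.1) ^+ 2 / (b ^+ 2 * 2))); last by apply/funext => z; rewrite npdfE.
  apply: measurable_funM => //; apply: measurableT_comp; first exact: measurable_expR.
  apply: measurable_funM => //; apply: measurable_funN; apply: measurable_funX.
  by apply: measurable_funB => //; exact: measurable_funM.
pose G x := (\int[mu]_y (f (a * x + b * y)%R * (normal_pdf 0 1 y)%:E))%E.
have mpdf1 : measurable_fun setT (EFin \o normal_pdf (0 : R) 1).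
  by apply/measurable_EFinP; exact: measurable_normal_pdf.
have mG : measurable_fun setT G.
  apply: (@measurable_fun_fubini_tonelli_F _ _ mR mR R mu
    (fun z => (f (a * z.1 + b * z.2)%R * (normal_pdf 0 1 z.2)%:E)%E)).
    apply: emeasurable_funM; first exact: measurableT_comp.
    exact: (measurableT_comp mpdf1 measurable_snd).
  by move=> z; rewrite mule_ge0// lee_fin normal_pdf_ge0.
have G0 x : (0 <= G x)%E by apply: integral_ge0 => y _; rewrite mule_ge0// lee_fin normal_pdf_ge0.
transitivity (\int[lam]_x G (gz0 x))%E.
  apply: eq_integral => x _; rewrite (gz0_integral (f := fun y => f (a * gz0 x + b * y)))//.
  exact: (measurableT_comp mf (ml1 _)).
rewrite gz0_integral//.
have GE x : G x = (\int[mu]_z (f z * (normal_pdf (a * x) b z)%:E))%E.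
  rewrite [RHS](ge0_integral_affine (a := b) (a * x) b0); last 2 first.
  - by apply: emeasurable_funM => //; apply/measurable_EFinP; exact: measurable_normal_pdf.
  - by move=> y; rewrite mule_ge0// lee_fin normal_pdf_ge0.
  rewrite -ge0_integralZl//=.
  + apply: eq_integral => y _; rewrite muleCA addrC; congr (_ * _)%E.
    rewrite -EFinM; congr EFin; rewrite !npdfE// subr0 addrK mul1r expr1n mul1r.
    rewrite invfM mulrA mulrA divff ?gt_eqF// mul1r; congr (_ * expR _).
    by field; rewrite gt_eqF.
  + apply: emeasurable_funM.
      apply: measurableT_comp => //; apply: measurable_funD => //; exact: measurable_funM.
    apply/measurable_EFinP; apply: measurableT_comp; first exact: measurable_normal_pdf.
    by apply: measurable_funD => //; exact: measurable_funM.
  + by move=> y _; rewrite mule_ge0// lee_fin normal_pdf_ge0.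
  + by rewrite lee_fin ltW.
under eq_integral => x _.
  rewrite GE muleC -ge0_integralZl//=; last 3 first.
  - by apply: emeasurable_funM => //; apply/measurable_EFinP; exact: measurable_normal_pdf.
  - by move=> y _; rewrite mule_ge0// lee_fin normal_pdf_ge0.
  - by rewrite lee_fin normal_pdf_ge0.
  under eq_integral => z _ do rewrite muleCA -EFinM npdf_convolution// EFinM muleA -/s.
  over.
rewrite (fubini_tonelli (m1 := mu) (m2 := mu) (fun p : mR * mR => f p.2 * (normal_pdf 0 s p.2)%:E *
  (normal_pdf (a * p.2 / s ^+ 2) (b / s) p.1)%:E)%E)/=; last 2 first.
- apply: emeasurable_funM.
    apply: emeasurable_funM; first exact: measurableT_comp.
    by apply/measurable_EFinP; apply: measurableT_comp => //; exact: measurable_normal_pdf.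
  apply/measurable_EFinP.
  have bs0 : 0 < b / s by rewrite divr_gt0.
  rewrite (_ : (fun z : mR * mR => _) = fun z : mR * mR => ((b/s) * Num.sqrt (pi * 2))^-1 *
    expR (- (z.1 - a * z.2 / s ^+ 2) ^+ 2 / ((b/s) ^+ 2 * 2))); last by apply/funext => z; rewrite npdfE.
  apply: measurable_funM => //; apply: measurableT_comp; first exact: measurable_expR.
  apply: measurable_funM => //; apply: measurable_funN; apply: measurable_funX.
  apply: measurable_funB => //; apply: measurable_funM => //; exact: measurable_funM.
- by move=> z; rewrite !mule_ge0// lee_fin normal_pdf_ge0.
rewrite gz0_scale//; apply: eq_integral => z _.
rewrite ge0_integralZl//=.
- by rewrite integral_normal_pdf mule1.
- by apply/measurable_EFinP; exact: measurable_normal_pdf.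
- by move=> y _; rewrite lee_fin normal_pdf_ge0.
- by rewrite mule_ge0// lee_fin normal_pdf_ge0.
Qed.

Lemma gz0_abs (a : R) (f : R -> \bar R) : measurable_fun setT f -> (forall x, 0 <= f x)%E ->
  (\int[lam]_w f (a * gz0 w)%R = \int[lam]_w f (`|a| * gz0 w)%R)%E.
Proof.
move=> mf f0; have [a0|a0] := ltP a 0; last by rewrite ger0_norm.
rewrite ltr0_norm// -(gz0_sym (f := fun x => f (- a * x)))//; last first.
  by apply: measurableT_comp => //; exact: measurable_funM.
by apply: eq_integral => x _; rewrite mulrNN.
Qed.

(** Symmetry reduces to nonnegative coefficients. A zero coefficient is treated apart, as the
    density argument of [gz0_conv_pos] needs positive standard deviations. *)
Lemma gz0_conv (a b : R) (f : R -> \bar R) :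
  measurable_fun setT f -> (forall x, 0 <= f x)%E ->
  (\int[lam]_w f (a * gz0 (th0 w) + b * gz0 (th1 w))%R =
   \int[lam]_w f (Num.sqrt (a ^+ 2 + b ^+ 2) * gz0 w)%R)%E.
Proof.
move=> mf f0.
have mF c d : measurable_fun setT (fun z : mR * mR => f (c * gz0 z.1 + d * gz0 z.2)).
  apply: measurableT_comp => //; apply: measurable_funD; apply: measurable_funM => //;
  by apply: measurableT_comp => //; exact: measurable_gz0.
have mc c : measurable_fun setT (fun y : R => f (c + y)).
  by apply: measurableT_comp => //; exact: measurable_funD.
have mc' c : measurable_fun setT (fun y : R => f (y + c)).
  by apply: measurableT_comp => //; exact: measurable_funD.
have -> : (\int[lam]_w f (a * gz0 (th0 w) + b * gz0 (th1 w))%R =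
    \int[lam]_w f (`|a| * gz0 (th0 w) + `|b| * gz0 (th1 w))%R)%E.
  rewrite (ge0_split (F := fun z => f (a * gz0 z.1 + b * gz0 z.2)))//=.
  have e1 (x : mR) : (\int[lam]_y f (a * gz0 x + b * gz0 y)%R = \int[lam]_y f (a * gz0 x + `|b| * gz0 y)%R)%E.
    exact: (gz0_abs b (mc (a * gz0 x)) (fun y => f0 _)).
  have e2 (x : mR) : (\int[lam]_y f (a * gz0 y + `|b| * gz0 x)%R = \int[lam]_y f (`|a| * gz0 y + `|b| * gz0 x)%R)%E.
    exact: (gz0_abs a (mc' (`|b| * gz0 x)) (fun y => f0 _)).
  under eq_integral => x _ do rewrite e1.
  rewrite (fubini_tonelli (m1 := lam) (m2 := lam) (fun z : mR * mR => f (a * gz0 z.1 + `|b| * gz0 z.2)))//.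
  under eq_integral => x _ do rewrite e2.
  by rewrite -(ge0_split_swap (F := fun z => f (`|a| * gz0 z.1 + `|b| * gz0 z.2))).
rewrite -(real_normK (num_real a)) -(real_normK (num_real b)).
have := normr_ge0 a; have := normr_ge0 b; move: `|a| `|b| => {}a {}b.
rewrite le_eqVlt => /predU1P[<-|b0].
  move=> a0; under eq_integral do rewrite mul0r addr0.
  rewrite expr0n/= addr0 sqrtr_sqr ger0_norm//.
  apply: (mpres_ge0 (p := th0) (F := fun w => f (a * gz0 w))) => //; first exact: mpres_th0.
  by apply: measurableT_comp => //; apply: measurable_funM => //; exact: measurable_gz0.
rewrite le_eqVlt => /predU1P[<-|a0]; last exact: gz0_conv_pos.
under eq_integral do rewrite mul0r add0r.
rewrite expr0n/= add0r sqrtr_sqr (ger0_norm (ltW b0)).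
apply: (mpres_ge0 (p := th1) (F := fun w => f (b * gz0 w))) => //; first exact: mpres_th1.
by apply: measurableT_comp => //; apply: measurable_funM => //; exact: measurable_gz0.
Qed.

Lemma Int_ge0 (f : R -> R) : measurable_fun setT f -> (forall x, 0 <= f x) ->
  (\int[lam]_x (f x)%:E < +oo)%E -> Int f.
Proof.
move=> mf f0 h; apply/integrableP; split; first exact/measurable_EFinP.
by under eq_integral do rewrite /= ger0_norm//.
Qed.

Lemma expR_ge_sqr (y : R) : 0 <= y -> y ^+ 2 / 4 <= expR y.
Proof.
move=> y0; rewrite (_ : y = y / 2 + y / 2); last by field.
rewrite expRD (_ : (y / 2 + y / 2) ^+ 2 / 4 = (y/2) * (y/2)); last by field.
have h : y / 2 <= expR (y / 2) by have := expR_ge1Dx (y / 2); lra.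
by apply: ler_pM => //; lra.
Qed.

Lemma Int_gz0_4 : Int (fun w => gz0 w ^+ 4).
Proof.
have m4 : measurable_fun setT (fun x : mR => x ^+ 4 : R) by exact: measurable_funX.
apply: Int_ge0.
- by apply: measurable_funX; exact: measurable_gz0.
- by move=> x; rewrite (exprM _ 2 2) sqr_ge0.
rewrite (gz0_integral (f := fun x => (x ^+ 4)%:E)); last 2 first.
- exact/measurable_EFinP.
- by move=> x; rewrite lee_fin (exprM _ 2 2) sqr_ge0.
(* Domination by a normal density of standard deviation 2: with y = 3 x^2 / 8 one has x^4 = (64 / 9)
   y^2 <= 64 e^y, and the ratio of the two normalisations gives the remaining factor 2. *)
apply: (@le_lt_trans _ _ (\int[mu]_x (128%:E * (normal_pdf 0 2 x)%:E))%E).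
  apply: ge0_le_integral => //.
  - by move=> x _; rewrite mule_ge0// ?lee_fin ?normal_pdf_ge0// (exprM _ 2 2) sqr_ge0.
  - by apply: emeasurable_funM; apply/measurable_EFinP => //; exact: measurable_normal_pdf.
  - by apply: emeasurable_funM => //; apply/measurable_EFinP; exact: measurable_normal_pdf.
  - move=> x _; rewrite -!EFinM lee_fin !npdfE//.
    set y := x ^+ 2 * (3 / 8).
    have y0 : 0 <= y by rewrite mulr_ge0// ?sqr_ge0//; lra.
    have -> : expR (- (x - 0) ^+ 2 / (2 ^+ 2 * 2)) = expR y * expR (- (x - 0) ^+ 2 / (1 ^+ 2 * 2)).
      by rewrite -expRD; congr expR; rewrite /y; field.
    have h4 : x ^+ 4 <= 64 * expR y.
      have -> : x ^+ 4 = (64 / 9) * y ^+ 2 by rewrite /y; field.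
      by have := expR_ge_sqr y0; have := expR_gt0 y; lra.
    have p0 : 0 < Num.sqrt (pi * 2) :> R by rewrite sqrtr_gt0 mulr_gt0// pi_gt0.
    set e2 := expR (_ / _) ; set r := Num.sqrt _ in p0 *; set e1 := expR y in h4 *.
    have -> : 128 * ((2 * r)^-1 * (e1 * e2)) = (64 * e1) * (r^-1 * e2) by field; rewrite gt_eqF.
    rewrite mul1r; apply: ler_wpM2r => //.
    by rewrite mulr_ge0 ?expR_ge0// invr_ge0 ltW.
rewrite ge0_integralZl//=.
- by rewrite integral_normal_pdf mule1 ltry.
- by apply/measurable_EFinP; exact: measurable_normal_pdf.
- by move=> x _; rewrite lee_fin normal_pdf_ge0.
Qed.

Lemma Int_pow4 (f : R -> R) : measurable_fun setT f -> Int (fun w => f w ^+ 4) ->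
  [/\ Int f, Int (fun w => f w ^+ 2) & Int (fun w => f w ^+ 3)].
Proof.
move=> mf I4; have I : Int (fun w => 1 + f w ^+ 4) by apply: IntD => //; exact: Int_cst.
have b k (y : R) : (k <= 4)%N -> `|y ^+ k| <= 1 + y ^+ 4.
  move=> k4; rewrite -[y ^+ 4]ger0_norm ?exprn_even_ge0// !normrX; have := normr_ge0 y.
  move: `|y| => {}y y0; have y4 : 0 <= y ^+ 4 by exact: exprn_ge0.
  have [y1|y1] := leP y 1; first by have := exprn_ile1 k y0 y1; lra.
  by have := ler_weXn2l (ltW y1) k4; lra.
split.
- by apply: (Int_le mf _ I) => x; have := b 1%N (f x) isT; rewrite expr1.
- by apply: (Int_le (measurable_funX 2 mf) _ I) => x; exact: b.
- by apply: (Int_le (measurable_funX 3 mf) _ I) => x; exact: b.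
Qed.

End NormalExp.

(** * Sums over independent seeds, and the exchange of summands *)

Section SumsOfSeeds.
Context {R : realType}.
Local Notation mR := (measurableTypeR R).
Local Notation lam := (@lam R).
Local Notation th0 := (@th0 R).
Local Notation th1 := (@th1 R).

(* The [sd k] are independent uniform seeds extracted from a single one. *)
Definition sd (k : nat) (w : R) : R := th0 (iter k th1 w).

Lemma sdS k w : sd k.+1 w = sd k (th1 w). Proof. by rewrite /sd iterSr. Qed.

Lemma mpres_id : mpres (@idfun R). Proof. by split; first exact: measurable_id. Qed.
Lemma mpres_iter1 k : mpres (iter k th1).
Proof. by elim: k => [|k IH]; [exact: mpres_id|exact: (mpres_comp mpres_th1 IH)]. Qed.
Lemma mpres_sd k : mpres (sd k).
Proof. exact: (mpres_comp mpres_th0 (mpres_iter1 k)). Qed.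
Lemma measurable_sd k : measurable_fun setT (sd k : R -> R).
Proof. by case: (mpres_sd k). Qed.

Definition Sv (I : Type) (n : nat) (xi : I -> R -> R) (w : R) (i : I) : R :=
  \sum_(k < n) xi i (sd k w).

Lemma Sv0 (I : Type) (xi : I -> R -> R) w i : Sv 0 xi w i = 0.
Proof. by rewrite /Sv big_ord0. Qed.
Lemma SvS (I : Type) n (xi : I -> R -> R) w i :
  Sv n.+1 xi w i = xi i (th0 w) + Sv n xi (th1 w) i.
Proof.
rewrite /Sv big_ord_recl; congr (_ + _).
by apply: eq_bigr => k _; rewrite -sdS.
Qed.

Lemma measurable_Sv (I : Type) n (xi : I -> R -> R) i :
  (forall i, measurable_fun setT (xi i)) -> measurable_fun setT (fun w : R => Sv n xi w i).
Proof.
move=> mxi; apply: measurable_sum => k.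
by apply: measurableT_comp; [exact: mxi|exact: measurable_sd].
Qed.

(* Measurability of a functional on [I -> R], stated without choosing a sigma-algebra on this space. *)
Definition cmeas (I : Type) d' (Y : measurableType d') (f : (I -> R) -> Y) := forall d (T : measurableType d)
  (x : I -> T -> R), (forall i, measurable_fun setT (x i)) ->
  measurable_fun setT (fun t => f (fun i => x i t)).

Lemma trotter (I : Type) (f : (I -> R) -> R) c (xi eta : I -> R -> R) (dl : R) :
  cmeas f -> (forall x, `|f x| <= c) ->
  (forall i, measurable_fun setT (xi i)) -> (forall i, measurable_fun setT (eta i)) ->
  (forall x : I -> R, `|E (fun s => f (fun i => x i + xi i s)) -
             E (fun s => f (fun i => x i + eta i s))| <= dl) ->
  forall n (x : I -> R), `|E (fun w => f (fun i => x i + Sv n xi w i)) -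
             E (fun w => f (fun i => x i + Sv n eta w i))| <= n%:R * dl.
Proof.
move=> mf fc mxi meta dP; elim=> [|n IH] x.
  rewrite mul0r; under eq_fun do under eq_fun do rewrite Sv0.
  by under [X in _ - E X]eq_fun do under eq_fun do rewrite Sv0; rewrite subrr normr0.
have cmF (u v : I -> R -> R) : (forall i, measurable_fun setT (u i)) ->
    (forall i, measurable_fun setT (v i)) ->
    measurable_fun setT (fun z : mR * mR => f (fun i => x i + (u i z.1 + v i z.2))).
  move=> mu mv; apply: mf => i; apply: measurable_funD => //; apply: measurable_funD.
    by apply: measurableT_comp; [exact: mu|exact: measurable_fst].
  by apply: measurableT_comp; [exact: mv|exact: measurable_snd].
pose Fxx u v := f (fun i => x i + (xi i u + Sv n xi v i)).
pose Fxe u v := f (fun i => x i + (xi i u + Sv n eta v i)).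
pose Fee u v := f (fun i => x i + (eta i u + Sv n eta v i)).
have mS (u : I -> R -> R) : (forall i, measurable_fun setT (u i)) ->
    forall i, measurable_fun setT (fun w : R => Sv n u w i).
  by move=> mu i; exact: measurable_Sv.
have [i1 m1 m1' e1 _] := @E_split_bounded R Fxx c (cmF _ _ mxi (mS _ mxi)) (fun _ _ => fc _).
have [i2 m2 m2' e2 e2'] := @E_split_bounded R Fxe c (cmF _ _ mxi (mS _ meta)) (fun _ _ => fc _).
have [i3 m3 m3' _ e3'] := @E_split_bounded R Fee c (cmF _ _ meta (mS _ meta)) (fun _ _ => fc _).
have -> : E (fun w => f (fun i => x i + Sv n.+1 xi w i)) = E (fun w => Fxx (th0 w) (th1 w)).
  by congr E; apply/funext => w; rewrite /Fxx; congr f; apply/funext => i; rewrite SvS.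
have -> : E (fun w => f (fun i => x i + Sv n.+1 eta w i)) = E (fun w => Fee (th0 w) (th1 w)).
  by congr E; apply/funext => w; rewrite /Fee; congr f; apply/funext => i; rewrite SvS.
have d1 : `|E (fun w => Fxx (th0 w) (th1 w)) - E (fun w => Fxe (th0 w) (th1 w))| <= n%:R * dl.
  rewrite e1 e2 -(EB m1 m2); apply: E_abs_le; first exact: (measurable_funB (Int_measurable m1) (Int_measurable m2)).
  move=> u; have := IH (fun i => x i + xi i u).
  rewrite /Fxx /Fxe; congr (`|E _ - E _| <= _);
    by apply/funext => v; congr f; apply/funext => i; rewrite addrA.
have d2 : `|E (fun w => Fxe (th0 w) (th1 w)) - E (fun w => Fee (th0 w) (th1 w))| <= dl.
  rewrite e2' e3' -(EB m2' m3'); apply: E_abs_le; first exact: (measurable_funB (Int_measurable m2') (Int_measurable m3')).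
  move=> v; have := dP (fun i => x i + Sv n eta v i).
  rewrite /Fee /Fxe; congr (`|E _ - E _| <= _);
    by apply/funext => u; congr f; apply/funext => i; rewrite addrAC addrA.
rewrite -natr1 mulrDl mul1r -(subrKA (E (fun w => Fxe (th0 w) (th1 w)))).
exact: (le_trans (ler_normD _ _) (lerD d1 d2)).
Qed.

End SumsOfSeeds.

(** * The Lindeberg exchange argument *)

Section TestFunctions.
Context {R : realType}.
Local Notation mR := (measurableTypeR R).

(* Taylor expansion of order three with uniform bounds; [a] is the gradient and [b] half the Hessian. *)
Definition C3 (I : finType) (f : (I -> R) -> R) := exists C : R,
  exists a : (I -> R) -> I -> R, exists b : (I -> R) -> I -> I -> R,
  forall x h : I -> R, let H := \sum_i `|h i| in
  [/\ `|f x| <= C, forall i, `|a x i| <= C, forall i j, `|b x i j| <= C &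
   [/\ `|f (fun i => x i + h i) - f x| <= C * H,
      `|f (fun i => x i + h i) - f x - \sum_i a x i * h i| <= C * H ^+ 2 &
      `|f (fun i => x i + h i) - f x - \sum_i a x i * h i
         - \sum_i \sum_j b x i j * (h i * h j)| <= C * H ^+ 3] ].

Lemma ler_normM (x y a b : R) : `|x| <= a -> `|y| <= b -> `|x * y| <= a * b.
Proof. by move=> xa yb; rewrite normrM ler_pM. Qed.

Lemma ler_norm_add (x y a b : R) : `|x| <= a -> `|y| <= b -> `|x + y| <= a + b.
Proof. by move=> xa yb; rewrite (le_trans (ler_normD _ _))// lerD. Qed.

Lemma lin_bound (I : finType) (a h : I -> R) C : (forall i, `|a i| <= C) ->
  `|\sum_i a i * h i| <= C * \sum_i `|h i|.
Proof.
move=> aC; rewrite (le_trans (ler_norm_sum _ _ _))// mulr_sumr ler_sum// => i _.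
by rewrite normrM ler_wpM2r.
Qed.

Lemma C3_cst (I : finType) (c : R) : C3 (fun _ : I -> R => c).
Proof.
exists `|c|, (fun _ _ => 0), (fun _ _ _ => 0) => x h /=.
have H0 : 0 <= \sum_i `|h i| by apply: sumr_ge0.
split=> //; rewrite ?normr0//.
have -> : \sum_i \sum_j 0 * (h i * h j) = 0.
  by rewrite big1// => i _; rewrite big1// => j _; rewrite mul0r.
have -> : \sum_i 0 * h i = 0 by rewrite big1// => i _; rewrite mul0r.
by rewrite subrr 2!subr0 normr0; split; rewrite mulr_ge0 ?exprn_ge0.
Qed.

(** The factor 4 counts the terms of the third order remainder of a product; the other bounds need
    fewer. *)
Lemma C3_mul (I : finType) (f g : (I -> R) -> R) : C3 f -> C3 g -> C3 (fun x => f x * g x).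
Proof.
move=> [C [a [b fP]]] [D [a' [b' gP]]].
exists (4 * (C * D)), (fun x i => a x i * g x + f x * a' x i),
  (fun x i j => b x i j * g x + a x i * a' x j + f x * b' x i j) => x h /=.
have [fx ax bx [f1 f2 f3]] := fP x h; have [gx a'x b'x [g1 g2 g3]] := gP x h.
set H := \sum_i `|h i| in f1 f2 f3 g1 g2 g3 *.
have H0 : 0 <= H by apply: sumr_ge0.
have C0 : 0 <= C by exact: le_trans (normr_ge0 _) fx.
have D0 : 0 <= D by exact: le_trans (normr_ge0 _) gx.
have CD0 : 0 <= C * D by rewrite mulr_ge0.
have La := lin_bound h ax; have La' := lin_bound h a'x.
have [gH1] : `|g (fun i => x i + h i)| <= D by have [] := gP (fun i => x i + h i) h.
set F := f (fun i => _) in f1 f2 f3 *; set G := g (fun i => _) in g1 g2 g3 gH1 *.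
set Lf := \sum_i a x i * h i in La f2 f3 *; set Lg := \sum_i a' x i * h i in La' g2 g3 *.
set Qf := \sum_i \sum_j _ in f3; set Qg := \sum_i \sum_j _ in g3.
have -> : \sum_i (a x i * g x + f x * a' x i) * h i = Lf * g x + f x * Lg.
  rewrite /Lf /Lg mulr_suml mulr_sumr -big_split; apply: eq_bigr => i _ /=; ring.
have -> : \sum_i \sum_j (b x i j * g x + a x i * a' x j + f x * b' x i j) * (h i * h j) =
    Qf * g x + Lf * Lg + f x * Qg.
  rewrite /Qf /Lf /Lg /Qg mulr_suml mulr_suml mulr_sumr -!big_split; apply: eq_bigr => i _ /=.
  rewrite mulr_suml !mulr_sumr -!big_split; apply: eq_bigr => j _ /=; ring.
split.
- by have := ler_normM fx gx; lra.
- by move=> i; have := ler_norm_add (ler_normM (ax i) gx) (ler_normM fx (a'x i)); lra.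
- move=> i j; have := ler_norm_add (ler_norm_add (ler_normM (bx i j) gx)
    (ler_normM (ax i) (a'x j))) (ler_normM fx (b'x i j)); lra.
- have p1 : 0 <= C * D * H by rewrite mulr_ge0.
  have p2 : 0 <= C * D * H ^+ 2 by rewrite mulr_ge0 ?exprn_ge0.
  have p3 : 0 <= C * D * H ^+ 3 by rewrite mulr_ge0 ?exprn_ge0.
  split.
  + have -> : F * G - f x * g x = (F - f x) * G + f x * (G - g x) by ring.
    by have := ler_norm_add (ler_normM f1 gH1) (ler_normM fx g1); lra.
  + have -> : F * G - f x * g x - (Lf * g x + f x * Lg) =
      f x * (G - g x - Lg) + (F - f x - Lf) * g x + (F - f x) * (G - g x) by ring.
    have := ler_norm_add (ler_norm_add (ler_normM fx g2) (ler_normM f2 gx)) (ler_normM f1 g1).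
    by rewrite (_ : C * H * (D * H) = C * D * H ^+ 2); [lra|ring].
  + have -> : F * G - f x * g x - (Lf * g x + f x * Lg) - (Qf * g x + Lf * Lg + f x * Qg) =
      f x * (G - g x - Lg - Qg) + (F - f x - Lf - Qf) * g x
      + ((F - f x - Lf) * (G - g x) + Lf * (G - g x - Lg)) by ring.
    have := ler_norm_add (ler_norm_add (ler_normM fx g3) (ler_normM f3 gx))
      (ler_norm_add (ler_normM f2 g1) (ler_normM La g2)).
    rewrite (_ : C * H ^+ 2 * (D * H) = C * D * H ^+ 3); last ring.
    rewrite (_ : C * H * (D * H ^+ 2) = C * D * H ^+ 3); last ring.
    by lra.
Qed.

Lemma C3_lin (I : finType) (f g : (I -> R) -> R) (c : R) :
  C3 f -> C3 g -> C3 (fun x => f x + c * g x).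
Proof.
move=> [C [a [b fP]]] [D [a' [b' gP]]].
exists (C + `|c| * D), (fun x i => a x i + c * a' x i), (fun x i j => b x i j + c * b' x i j) => x h /=.
have [fx ax bx [f1 f2 f3]] := fP x h; have [gx a'x b'x [g1 g2 g3]] := gP x h.
have cc : `|c| <= `|c| by [].
have -> : \sum_i (a x i + c * a' x i) * h i = \sum_i a x i * h i + c * \sum_i a' x i * h i.
  by rewrite mulr_sumr -big_split; apply: eq_bigr => i _ /=; ring.
have -> : \sum_i \sum_j (b x i j + c * b' x i j) * (h i * h j) =
   \sum_i \sum_j b x i j * (h i * h j) + c * \sum_i \sum_j b' x i j * (h i * h j).
  rewrite mulr_sumr -big_split; apply: eq_bigr => i _ /=.
  by rewrite mulr_sumr -big_split; apply: eq_bigr => j _ /=; ring.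
split.
- exact: ler_norm_add fx (ler_normM cc gx).
- by move=> i; exact: ler_norm_add (ax i) (ler_normM cc (a'x i)).
- by move=> i j; exact: ler_norm_add (bx i j) (ler_normM cc (b'x i j)).
- rewrite !mulrDl -!mulrA; split.
  + have := ler_norm_add f1 (ler_normM cc g1); congr (`|_| <= _); ring.
  + have := ler_norm_add f2 (ler_normM cc g2); congr (`|_| <= _); ring.
  + have := ler_norm_add f3 (ler_normM cc g3); congr (`|_| <= _); ring.
Qed.

(** The logistic function: smooth, bounded, with derivative s (1 - s) polynomial in its value s, and
    at large slope close to the indicator of a ray. *)
Definition sigm (x : R) : R := (1 + expR (- x))^-1.

Lemma sigm01 x : 0 < sigm x < 1.
Proof.
rewrite /sigm invr_gt0 addr_gt0 ?expR_gt0//= invf_lt1 ?addr_gt0 ?expR_gt0//.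
by rewrite ltrDl expR_gt0.
Qed.

Lemma is_derive_sigm (x : R) : is_derive x 1 sigm (sigm x * (1 - sigm x)).
Proof.
have n0 : 1 + expR (- x) != 0 by rewrite gt_eqF// addr_gt0 ?expR_gt0.
rewrite /sigm; apply: is_derive_eq.
rewrite /GRing.scale/= ; field.
by [].
Qed.

(** Each application of the mean value theorem gains one power of h; [sigm_taylor] uses it once for
    each order. *)
Lemma MVT_pow (g dg : R -> R) (M : R) (k : nat) : (forall x : R, is_derive x 1 g (dg x)) ->
  (forall x, `|dg x| <= M * `|x| ^+ k) -> forall h, `|g h - g 0| <= M * `|h| ^+ k.+1.
Proof.
move=> gd dM h; have M0 : 0 <= M.
  by have := dM 1; rewrite normr1 expr1n mulr1; exact: le_trans.
have cg : continuous g.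
  by move=> x; apply: differentiable_continuous; apply/derivable1_diffP; have [] := gd x.
have key (c : R) : `|c| <= `|h| -> `|dg c * h| <= M * `|h| ^+ k.+1.
  move=> ch; rewrite normrM exprSr mulrA ler_wpM2r// (le_trans (dM c))// ler_wpM2l//.
  by rewrite lerXn2r// ?nnegrE.
have [h0|h0|<-] := ltgtP 0 h; last by rewrite subrr !normr0 expr0n/= mulr0.
- have [c /[!in_itv]/= /andP[c1 c2] ->] := MVT h0 (fun x _ => gd x) (continuous_subspaceT cg).
  by rewrite subr0; apply: key; rewrite !ger0_norm ?ltW.
- have [c /[!in_itv]/= /andP[c1 c2] e] := MVT h0 (fun x _ => gd x) (continuous_subspaceT cg).
  rewrite distrC e sub0r mulrN normrN; apply: key.
  by rewrite !ltr0_norm// lerN2 ltW.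
Qed.

Lemma sigm_taylor x h : let s := sigm x in
  [/\ `|sigm (x + h) - s| <= `|h|,
      `|sigm (x + h) - s - s * (1 - s) * h| <= `|h| ^+ 2 &
      `|sigm (x + h) - s - s * (1 - s) * h - s * (1 - s) * (1 - 2 * s) / 2 * h ^+ 2| <= 2 * `|h| ^+ 3].
Proof.
move=> s; have /andP[s0 s1] : 0 < s < 1 := sigm01 x.
have ds (y : R) : is_derive y 1 (fun h => sigm (x + h)) (sigm (x + y) * (1 - sigm (x + y))).
  have := @is_derive1_comp _ sigm (fun h => x + h) y _ _ (is_derive_sigm (x + y)) _.
  move=> /(_ 1); rewrite mulr1; apply.
  by apply: is_derive_eq; rewrite add0r ?mulr1 // /GRing.scale/= mulr1.
have T1 (y : R) : `|sigm (x + y) - s| <= `|y|.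
  have := @MVT_pow _ _ 1 0 ds; rewrite addr0 => /(_ _ y); rewrite mul1r expr1; apply.
  move=> z; rewrite mul1r expr0; have /andP[? ?] := sigm01 (x + z).
  by rewrite ger0_norm; nra.
have T2 (y : R) : `|sigm (x + y) - s - s * (1 - s) * y| <= `|y| ^+ 2.
  have d2 (z : R) : is_derive z 1 (fun h => sigm (x + h) - s * (1 - s) * h)
      (sigm (x + z) * (1 - sigm (x + z)) - s * (1 - s)).
    by apply: is_derive_eq; rewrite /GRing.scale/=; ring.
  have := @MVT_pow _ _ 1 1 d2; rewrite addr0 mulr0 subr0 => /(_ _ y).
  rewrite mul1r addrAC; apply.
  move=> z; rewrite mul1r expr1.
  have -> : sigm (x + z) * (1 - sigm (x + z)) - s * (1 - s) =
    (sigm (x + z) - s) * (1 - sigm (x + z) - s) by ring.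
  rewrite -[leRHS]mulr1; apply: ler_normM (T1 z) _.
  by have /andP[? ?] := sigm01 (x + z); rewrite ler_norml; apply/andP; split; lra.
split; [exact: T1|exact: T2|].
have d3 (z : R) : is_derive z 1 (fun h => sigm (x + h) - s * (1 - s) * h
     - s * (1 - s) * (1 - 2 * s) / 2 * h ^+ 2)
    (sigm (x + z) * (1 - sigm (x + z)) - s * (1 - s) - s * (1 - s) * (1 - 2 * s) * z).
  by apply: is_derive_eq; rewrite /GRing.scale/=; field.
have := @MVT_pow _ _ 2 2 d3; rewrite addr0 mulr0 subr0 expr0n/= mulr0 subr0 => /(_ _ h).
rewrite (_ : _ - _ - _ - s = sigm (x + h) - s - s * (1 - s) * h - s * (1 - s) * (1 - 2 * s) / 2 * h ^+ 2); last by ring.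
apply=> z.
(* The derivative of the third remainder is (1 - 2s) times the second remainder minus the square of
   the first, each of order z^2. *)
have -> : sigm (x + z) * (1 - sigm (x + z)) - s * (1 - s) - s * (1 - s) * (1 - 2 * s) * z =
   (1 - 2 * s) * (sigm (x + z) - s - s * (1 - s) * z) - (sigm (x + z) - s) * (sigm (x + z) - s) by ring.
have b1 : `|1 - 2 * s| <= 1 by rewrite ler_norml; apply/andP; split; lra.
have := ler_norm_add (ler_normM b1 (T2 z)) (_ : `|- ((sigm (x + z) - s) * (sigm (x + z) - s))| <= `|z| * `|z|).
rewrite normrN => /(_ (ler_normM (T1 z) (T1 z))).
by rewrite -expr2; lra.
Qed.

Lemma C3_sigm (I : finType) (i0 : I) (k l : R) : C3 (fun x : I -> R => sigm (k * x i0 + l)).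
Proof.
(* At least 1, so that [K ^+ 3] dominates the lower powers. *)
pose K := `|k| + 1.
exists (2 * K ^+ 3 ),
  (fun x i => if i == i0 then sigm (k * x i0 + l) * (1 - sigm (k * x i0 + l)) * k else 0),
  (fun x i j => if (i == i0) && (j == i0) then let s := sigm (k * x i0 + l) in
     s * (1 - s) * (1 - 2 * s) / 2 * k ^+ 2 else 0) => x h /=.
have K1 : 1 <= K by rewrite /K lerDr.
have kK : `|k| <= K by rewrite /K lerDl.
have K2 : K <= K ^+ 3 by rewrite -[leLHS]expr1 ler_weXn2l.
have K3 : K ^+ 2 <= K ^+ 3 by rewrite ler_weXn2l.
have /andP[s0 s1] := sigm01 (k * x i0 + l); set s := sigm (k * x i0 + l) in s0 s1 *.
have hH : `|h i0| <= \sum_i `|h i|.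
  by rewrite (bigD1 i0)//= lerDl sumr_ge0.
set H := \sum_i `|h i| in hH *.
have H0 : 0 <= H by exact: le_trans hH.
have khK : `|k * h i0| <= K * H by exact: ler_normM.
have -> : k * (x i0 + h i0) + l = k * x i0 + l + k * h i0 by ring.
have [T1 T2 T3] := sigm_taylor (k * x i0 + l) (k * h i0); rewrite -/s in T1 T2 T3.
have -> : \sum_i (if i == i0 then s * (1 - s) * k else 0) * h i = s * (1 - s) * (k * h i0).
  rewrite (bigD1 i0)//= eqxx big1 ?addr0 ?mulrA// => i ii0.
  by rewrite (negbTE ii0) mul0r.
have -> : \sum_i \sum_j (if (i == i0) && (j == i0) then s * (1 - s) * (1 - 2 * s) / 2 * k ^+ 2 else 0) *
    (h i * h j) = s * (1 - s) * (1 - 2 * s) / 2 * (k * h i0) ^+ 2.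
  rewrite (bigD1 i0)//= [X in _ + X]big1 ?addr0; last first.
    by move=> i ii0; rewrite big1// => j _; rewrite (negbTE ii0) mul0r.
  rewrite (bigD1 i0)//= !eqxx/= big1 ?addr0; last first.
    by move=> i ii0; rewrite (negbTE ii0) mul0r.
  by ring.
have ss : `|s * (1 - s)| <= 1 by rewrite ger0_norm; nra.
split.
- by rewrite ger0_norm; lra.
- move=> i; case: ifP => _; last by rewrite normr0; lra.
  by have := ler_normM ss kK; lra.
- move=> i j; case: ifP => _; last by rewrite normr0; lra.
  have k2 : `|k ^+ 2| <= K ^+ 2 by rewrite normrX lerXn2r ?nnegrE//; lra.
  have s2 : `|(1 - 2 * s) / 2| <= 1 by rewrite ler_norml; apply/andP; split; lra.
  by rewrite -mulrA; have := ler_normM (ler_normM ss s2) k2; rewrite -!mulrA; lra.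
- split.
  + apply: (le_trans T1); apply: (le_trans khK); rewrite ler_wpM2r//; lra.
  + apply: (le_trans T2); apply: (@le_trans _ _ ((K * H) ^+ 2)).
      by rewrite lerXn2r// nnegrE ?mulr_ge0//; lra.
    by rewrite exprMn ler_wpM2r ?exprn_ge0//; lra.
  + apply: (le_trans T3); rewrite -mulrA ler_wpM2l// -exprMn lerXn2r// nnegrE ?mulr_ge0//; lra.
Qed.

End TestFunctions.

Section Lindeberg.
Context {R : realType}.
Local Notation mR := (measurableTypeR R).
Local Notation lam := (@lam R).
Local Notation th0 := (@th0 R).
Local Notation th1 := (@th1 R).

Definition tst (I : finType) (f : (I -> R) -> R) := C3 f /\ cmeas f.

Lemma tst_cst (I : finType) (c : R) : tst (fun _ : I -> R => c).
Proof. by split; [exact: C3_cst|move=> d T x mx; exact: measurable_cst]. Qed.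

Lemma tst_mul (I : finType) (f g : (I -> R) -> R) : tst f -> tst g -> tst (fun x => f x * g x).
Proof.
move=> [f1 f2] [g1 g2]; split; first exact: C3_mul.
by move=> d T x mx; apply: measurable_funM; [exact: f2|exact: g2].
Qed.

Lemma tst_lin (I : finType) (f g : (I -> R) -> R) c : tst f -> tst g -> tst (fun x => f x + c * g x).
Proof.
move=> [f1 f2] [g1 g2]; split; first exact: C3_lin.
move=> d T x mx; apply: measurable_funD; first exact: f2.
by apply: measurable_funM => //; exact: g2.
Qed.

Lemma continuous_sigm : continuous (@sigm R).
Proof.
move=> x; apply: differentiable_continuous; apply/derivable1_diffP.
by have [] := is_derive_sigm x.
Qed.

Lemma measurable_sigm : measurable_fun setT (@sigm R).
Proof. exact: continuous_measurable_fun continuous_sigm. Qed.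

Lemma tst_sigm (I : finType) (i : I) k l : tst (fun x : I -> R => sigm (k * x i + l)).
Proof.
split; first exact: C3_sigm.
move=> d T x mx; apply: measurableT_comp; first exact: measurable_sigm.
by apply: measurable_funD => //; apply: measurable_funM => //; exact: mx.
Qed.

Lemma tst_prod (I : finType) (J : Type) (s : seq J) (f : J -> (I -> R) -> R) :
  (forall j, tst (f j)) -> tst (fun x => \prod_(j <- s) f j x).
Proof.
move=> fj; elim: s => [|j s IH].
  by under eq_fun do rewrite big_nil; exact: tst_cst.
by under eq_fun do rewrite big_cons; exact: tst_mul.
Qed.

Lemma tst_bound (I : finType) (f : (I -> R) -> R) : tst f -> exists c, forall x, `|f x| <= c.
Proof. by move=> [[C [a [b fP]]] _]; exists C => x; have [] := fP x x. Qed.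

Lemma tst_lip (I : finType) (f : (I -> R) -> R) : tst f -> exists2 c, 0 <= c &
  forall x y : I -> R, `|f y - f x| <= c * \sum_i `|y i - x i|.
Proof.
move=> [[C [a [b fP]]] _]; exists C; first by have [h _ _ _] := fP (fun=> 0) (fun=> 0); exact: le_trans h.
move=> x y; have [_ _ _ [+ _ _]] := fP x (fun i => y i - x i).
by congr (`|f _ - _| <= _); apply/funext => i; rewrite addrC subrK.
Qed.

(** Continuity for pointwise convergence of the coordinates, which is the form that dominated
    convergence uses; [I] may be infinite. *)
Definition seqcont (I : Type) (f : (I -> R) -> R) := forall (x_ : nat -> I -> R) (x : I -> R),
  (forall i, x_ ^~ i @ \oo --> x i) -> f \o x_ @ \oo --> f x.

Lemma tst_seqcont (I : finType) (f : (I -> R) -> R) : tst f -> seqcont f.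
Proof.
move=> /tst_lip[c c0 fc] x_ x xx; apply/cvgrPdist_le => e e0.
have s0 : (fun n => c * \sum_i `|x_ n i - x i|) @ \oo --> (0 : R).
  rewrite -[X in _ --> X](mulr0 c); apply: cvgMr.
  suff H (r : seq I) : (fun n => \sum_(i <- r) `|x_ n i - x i|) @ \oo --> (0 : R) by exact: H.
  elim: r => [|i r IH]; first by under eq_fun do rewrite big_nil; exact: cvg_cst.
  have hi : `|x_ n i - x i| @[n --> \oo] --> (0 : R).
    apply/cvgr0Pnorm_lt => d d0; have /cvgrPdist_lt/(_ _ d0) := xx i; apply: filterS => n.
    by rewrite normr_id distrC.
  by under eq_fun do rewrite big_cons; have := cvgD hi IH; rewrite addr0; exact.
have /cvgrPdist_lt/(_ _ e0) := s0; apply: filterS => n.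
rewrite sub0r normrN distrC => h; apply: (le_trans (fc _ _)).
by apply: ltW; apply: le_lt_trans h; exact: ler_norm.
Qed.

Definition mom4 (I : Type) (xi : I -> R -> R) :=
  forall i, measurable_fun setT (xi i) /\ Int (fun s => xi i s ^+ 4).

Lemma Int_mul (f g : R -> R) : measurable_fun setT f -> measurable_fun setT g ->
  Int (fun s => f s ^+ 2) -> Int (fun s => g s ^+ 2) -> Int (fun s => f s * g s).
Proof.
move=> mf mg If Ig; apply: (Int_le _ _ (IntD If Ig)); first exact: measurable_funM.
by move=> x; rewrite ler_norml; apply/andP; split; nra.
Qed.

Lemma mom4_Int (I : Type) (xi : I -> R -> R) i j : mom4 xi ->
  Int (xi i) /\ Int (fun s => xi i s * xi j s).
Proof.
move=> h; have [mi i4] := h i; have [mj j4] := h j.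
have [I1 I2 _] := Int_pow4 mi i4; have [_ J2 _] := Int_pow4 mj j4.
by split=> //; exact: Int_mul.
Qed.

(** The coefficients [a] and [b] are chosen before [xi], so that two families with the same first
    two moments share the polynomial part. The cubic remainder is paid with fourth moments. *)
Lemma third_order (I : finType) (f : (I -> R) -> R) : tst f ->
  exists2 C, 0 <= C & exists a : (I -> R) -> I -> R, exists b : (I -> R) -> I -> I -> R,
  forall xi : I -> R -> R, mom4 xi -> forall (x : I -> R) (t : R), 0 <= t ->
  `|E (fun s => f (fun i => x i + t * xi i s)) -
    (f x + \sum_i a x i * (t * E (xi i)) + \sum_i \sum_j b x i j * (t ^+ 2 * E (fun s => xi i s * xi j s)))|
  <= C * (1 + \sum_i E (fun s => xi i s ^+ 4)) * t ^+ 3.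
Proof.
move=> tf; have [[C [a [b fP]]] mf] := tf.
have C0 : 0 <= C by have [h _ _ _] := fP (fun=> 0) (fun=> 0); exact: le_trans h.
exists (C * #|I|%:R ^+ 3); first by rewrite mulr_ge0// exprn_ge0.
exists a, b => xi mxi x t t0.
pose A s := 1 + \sum_i xi i s ^+ 4.
have IA : Int A.
  by apply: IntD; [exact: Int_cst|apply: Int_sum => i; exact: (mxi i).2].
have A1 s : 1 <= A s by rewrite lerDl sumr_ge0// => i _; rewrite exprn_even_ge0.
have EA : E A = 1 + \sum_i E (fun s => xi i s ^+ 4).
  rewrite ED ?E_cst ?E_sum//; [by move=> i; exact: (mxi i).2|exact: Int_cst|].
  by apply: Int_sum => i; exact: (mxi i).2.
have sumA s : (\sum_i `|xi i s|) ^+ 3 <= #|I|%:R ^+ 3 * A s.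
  (* This fourth root bounds every coordinate, and it is at least 1, so its cube is at most
     [A s]. *)
  pose z := Num.sqrt (Num.sqrt (A s)).
  have A0 : 0 <= A s by exact: le_trans (A1 s).
  have z4 : z ^+ 4 = A s by rewrite (exprM _ 2 2) sqr_sqrtr ?sqrtr_ge0// sqr_sqrtr.
  have z0 : 0 <= z by exact: sqrtr_ge0.
  have z1 : 1 <= z by rewrite -(@ler_pXn2r _ 4)// ?nnegrE// expr1n z4.
  have xz i : `|xi i s| <= z.
    rewrite -(@ler_pXn2r _ 4)// ?nnegrE// z4 -normrX ger0_norm ?exprn_even_ge0//.
    rewrite /A (bigD1 i)//= addrCA lerDl addr_ge0// sumr_ge0// => j _.
    by rewrite exprn_even_ge0.
  have sz : \sum_i `|xi i s| <= #|I|%:R * z.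
    by rewrite mulr_natl -sumr_const ler_sum.
  apply: (@le_trans _ _ ((#|I|%:R * z) ^+ 3)).
    by rewrite lerXn2r// nnegrE ?sumr_ge0// mulr_ge0.
  by rewrite exprMn ler_wpM2l ?exprn_ge0// -z4 ler_weXn2l.
pose P s := f x + \sum_i a x i * (t * xi i s) + \sum_i \sum_j b x i j * (t ^+ 2 * (xi i s * xi j s)).
have I1 i : Int (fun s => a x i * (t * xi i s)).
  by do 2 apply: IntZ; have [] := mom4_Int i i mxi.
have I2 i j : Int (fun s => b x i j * (t ^+ 2 * (xi i s * xi j s))).
  by do 2 apply: IntZ; have [] := mom4_Int i j mxi.
have I2' i : Int (fun s => \sum_j b x i j * (t ^+ 2 * (xi i s * xi j s))) by exact: Int_sum.
have IP : Int P.
  by apply: IntD; [apply: IntD; [exact: Int_cst|exact: Int_sum]|exact: Int_sum].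
have EP : E P = f x + \sum_i a x i * (t * E (xi i)) +
    \sum_i \sum_j b x i j * (t ^+ 2 * E (fun s => xi i s * xi j s)).
  rewrite ED; [|by apply: IntD; [exact: Int_cst|exact: Int_sum]|exact: Int_sum].
  rewrite ED; [|exact: Int_cst|exact: Int_sum].
  rewrite E_cst E_sum// E_sum//.
  congr (_ + _ + _).
    by apply: eq_bigr => i _; rewrite !EZ//; [have [] := mom4_Int i i mxi|
      apply: IntZ; have [] := mom4_Int i i mxi].
  apply: eq_bigr => i _; rewrite E_sum//; apply: eq_bigr => j _.
  by rewrite !EZ//; [have [] := mom4_Int i j mxi|apply: IntZ; have [] := mom4_Int i j mxi].
have [c fc] := tst_bound tf.
have If : Int (fun s => f (fun i => x i + t * xi i s)).
  apply: (@Int_bounded _ _ c) => //; apply: (mf _ _ (fun i s => x i + t * xi i s)) => i.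
  by apply: measurable_funD => //; apply: measurable_funM => //; exact: (mxi i).1.
rewrite -EP -EB// (le_trans (E_abs (IntB If IP)))// -EA.
rewrite (_ : C * _ * E A * t ^+ 3 = E (fun s => (C * #|I|%:R ^+ 3 * t ^+ 3) * A s)); last by rewrite EZ//; ring.
apply: E_le; [exact: Int_abs (IntB If IP)|exact: IntZ|] => s /=.
have [_ _ _ [_ _ h3]] := fP x (fun i => t * xi i s).
rewrite /P (_ : \sum_i \sum_j b x i j * (t ^+ 2 * (xi i s * xi j s)) =
  \sum_i \sum_j b x i j * (t * xi i s * (t * xi j s))); last first.
  by apply: eq_bigr => i _; apply: eq_bigr => j _; ring.
rewrite !opprD !addrA; apply: (le_trans h3).
under eq_bigr do rewrite normrM (ger0_norm t0).
rewrite -mulr_sumr exprMn mulrCA (_ : _ * t ^+ 3 * A s = t ^+ 3 * (C * (#|I|%:R ^+ 3 * A s))); last ring.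
by rewrite ler_wpM2l ?exprn_ge0// ler_wpM2l.
Qed.

(** There are n exchanges, each costing n^(-3/2). The constant does not depend on n. *)
Lemma lindeberg (I : finType) (f : (I -> R) -> R) (xi eta : I -> R -> R) :
  tst f -> mom4 xi -> mom4 eta -> (forall i, E (xi i) = E (eta i)) ->
  (forall i j, E (fun s => xi i s * xi j s) = E (fun s => eta i s * eta j s)) ->
  exists C, forall n, (0 < n)%N ->
   `|E (fun w => f (fun i => (Num.sqrt n%:R)^-1 * Sv n xi w i)) -
     E (fun w => f (fun i => (Num.sqrt n%:R)^-1 * Sv n eta w i))| <= C * (Num.sqrt n%:R)^-1.
Proof.
move=> tf mxi meta e1 e2.
have [C C0 [a [b h]]] := third_order tf.
pose D := C * (1 + \sum_i E (fun s => xi i s ^+ 4)) + C * (1 + \sum_i E (fun s => eta i s ^+ 4)).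
exists D => n n0; set t := (Num.sqrt n%:R)^-1.
have t0 : 0 <= t by rewrite invr_ge0 sqrtr_ge0.
have nt : n%:R * t ^+ 3 = t.
  have s0 : 0 < Num.sqrt n%:R :> R by rewrite sqrtr_gt0 ltr0n.
  have -> : n%:R = Num.sqrt n%:R ^+ 2 :> R by rewrite sqr_sqrtr.
  by rewrite /t; field; rewrite gt_eqF.
have [c fc] := tst_bound tf; have [_ mf] := tf.
have step x : `|E (fun s => f (fun i => x i + t * xi i s)) - E (fun s => f (fun i => x i + t * eta i s))|
    <= D * t ^+ 3.
  have h1 := h xi mxi x t t0; have h2 := h eta meta x t t0.
  rewrite (_ : f x + _ + _ = f x + \sum_i a x i * (t * E (eta i)) +
    \sum_i \sum_j b x i j * (t ^+ 2 * E (fun s => eta i s * eta j s))) in h1; last first.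
    congr (_ + _ + _); first by apply: eq_bigr => i _; rewrite e1.
    by apply: eq_bigr => i _; apply: eq_bigr => j _; rewrite e2.
  rewrite distrC in h2.
  rewrite mulrDl; have := ler_norm_add h1 h2.
  by rewrite addrA subrK.
have := @trotter R I f c (fun i s => t * xi i s) (fun i s => t * eta i s) (D * t ^+ 3) mf fc
  (fun i => measurable_funM (measurable_cst t) (mxi i).1)
  (fun i => measurable_funM (measurable_cst t) (meta i).1) step n (fun=> 0).
rewrite mulrCA nt; congr (`|E _ - E _| <= _); apply/funext => w; congr f; apply/funext => i;
  by rewrite add0r /Sv mulr_sumr.
Qed.

Lemma sigm_opp (x : R) : sigm (- x) = 1 - sigm x.
Proof.
rewrite /sigm opprK expRN; have := expR_gt0 x; set e := expR x => e0.
by field; rewrite !gt_eqF//; lra.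
Qed.

Lemma sigm_large (x : R) : 0 <= x -> 1 - sigm x <= (1 + x)^-1.
Proof.
move=> x0; have h1 := expR_ge1Dx x; have e0 := expR_gt0 x.
have -> : 1 - sigm x = (1 + expR x)^-1.
  by rewrite /sigm expRN; field; rewrite !gt_eqF//; lra.
by rewrite lef_pV2 ?posrE; lra.
Qed.

Lemma sigm_le0 (x : R) : x <= 0 -> sigm x <= (1 - x)^-1.
Proof.
move=> x0; have := @sigm_large (- x); rewrite sigm_opp.
by rewrite oppr_ge0 => /(_ x0); lra.
Qed.

(** The shift by -n sends the value at y = 0 to 0, hence the strict inequality in the limit; the
    slope n^2 outweighs it for y > 0. *)
Lemma sigm_step (y : R) : sigm (n%:R ^+ 2 * y - n%:R) @[n --> \oo] --> ((0 < y)%R%:R : R).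
Proof.
apply/cvgrPdist_lt => e e0.
have inv0 : (n.+1%:R^-1 : R) @[n --> \oo] --> (0 : R) by exact: cvg_harmonic.
case: (ltP 0 y) => [y0|y0].
  near=> n.
  have ny : 2 <= n%:R * y.
    rewrite -ler_pdivrMr//; near: n; exact: nbhs_infty_ger.
  have n0 : 0 <= n%:R :> R by [].
  have ne : n.+1%:R^-1 < e.
    near: n; have /cvgrPdist_lt/(_ _ e0) := inv0; apply: filterS => n.
    by rewrite sub0r normrN ger0_norm ?invr_ge0.
  have xn : n%:R <= n%:R ^+ 2 * y - n%:R by nra.
  have /andP[_ s1] := sigm01 (n%:R ^+ 2 * y - n%:R); rewrite ger0_norm ?subr_ge0 ?ltW//.
  apply: le_lt_trans ne; apply: (le_trans (sigm_large _)); first lra.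
  by rewrite lef_pV2 ?posrE -?natr1; lra.
near=> n.
have n0 : 0 <= n%:R :> R by [].
have ne : n.+1%:R^-1 < e.
  near: n; have /cvgrPdist_lt/(_ _ e0) := inv0; apply: filterS => n.
  by rewrite sub0r normrN ger0_norm ?invr_ge0.
have xn : n%:R ^+ 2 * y - n%:R <= - n%:R.
  by rewrite gerDr mulr_ge0_le0// exprn_ge0.
have /andP[s0 _] := sigm01 (n%:R ^+ 2 * y - n%:R); rewrite sub0r normrN ger0_norm ?ltW//.
apply: le_lt_trans ne; apply: (le_trans (sigm_le0 _)); first lra.
by rewrite lef_pV2 ?posrE -?natr1; lra.
Unshelve. all: by end_near.
Qed.

Lemma Int_bnd (f : R -> R) (a b : R) : measurable_fun setT f -> (forall x, a <= f x <= b) -> Int f.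
Proof.
move=> mf ab; apply: (@Int_bounded _ _ (`|a| + `|b|)) => // x.
have /andP[h1 h2] := ab x; have := ler_norm b; have := ler_norm (- a); rewrite normrN => ? ?.
have := normr_ge0 a; have := normr_ge0 b => ? ?.
by rewrite ler_norml; apply/andP; split; lra.
Qed.

Lemma lamE (A : set R) : measurable A -> lam A = (E (fun s => (s \in A)%:R))%:E.
Proof.
move=> mA; rewrite -E_EFin; first by have := integral_indic lam measurableT mA; rewrite setIT => <-.
by apply: (@Int_bnd _ 0 1); [exact: measurable_indic|move=> x; case: (x \in A); rewrite ?lexx ?ler01].
Qed.

(* The step function [sigm] at infinite slope recovers the indicator of a ray. *)
Lemma law_eq_sigm (Y Z : R -> R) : measurable_fun setT Y -> measurable_fun setT Z ->
  (forall k l : R, E (fun s => sigm (k * Y s + l)) = E (fun s => sigm (k * Z s + l))) ->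
  forall A, measurable A -> lam (Y @^-1` A) = lam (Z @^-1` A).
Proof.
move=> mY mZ h.
have ray (X : R -> R) (mX : measurable_fun setT X) a :
   E (fun s => sigm (n%:R ^+ 2 * X s + (- (n%:R ^+ 2 * a) - n%:R))) @[n --> \oo] --> E (fun s => (a < X s)%R%:R).
  apply: (@E_dct _ _ _ (cst 1)).
  - move=> n; apply: measurableT_comp; first exact: measurable_sigm.
    by apply: measurable_funD => //; apply: measurable_funM.
  - move=> x; have := @sigm_step (X x - a); rewrite subr_gt0; apply: cvg_trans.
    by apply: near_eq_cvg; near=> n; congr sigm; ring.
  - move=> n x; have /andP[? ?] := sigm01 (n%:R ^+ 2 * X x + (- (n%:R ^+ 2 * a) - n%:R)).
    by rewrite ger0_norm ?ltW.
  - exact: Int_cst.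
have e a : E (fun s => (a < Y s)%R%:R) = E (fun s => (a < Z s)%R%:R).
  apply: (cvg_unique _ (ray Y mY a)) => //=.
  by under eq_fun do rewrite h; exact: ray.
have mray (X : R -> R) (mX : measurable_fun setT X) a : measurable (X @^-1` `]-oo, a]%classic).
  by rewrite -[X @^-1` _]setTI; apply: mX.
have rayE (X : R -> R) (mX : measurable_fun setT X) a :
    lam (X @^-1` `]-oo, a]%classic) = (1 - E (fun s => (a < X s)%R%:R))%:E.
  rewrite lamE; last exact: mray.
  rewrite -[X in _ = (X - _)%:E]E_cst -EB.
  - congr (E _)%:E; apply/funext => s /=.
    have -> : (s \in X @^-1` `]-oo, a]) = (X s <= a).
      by apply/idP/idP; rewrite inE/= in_itv.
    by rewrite leNgt; case: (a < X s); rewrite ?subrr ?subr0.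
  - exact: Int_cst.
  - apply: (@Int_bnd _ 0 1); last by move=> x; case: (a < _); rewrite ?lexx ?ler01.
    have -> : (fun x => (a < X x)%R%:R : R) = \1_(X @^-1` `]a, +oo[%classic).
      apply/funext => x; rewrite indicE; congr (_ : bool)%:R.
      by apply/idP/idP; rewrite inE/= in_itv/= andbT.
    by apply: measurable_indic; rewrite -[X @^-1` _]setTI; apply: mX.
pose my := mY : measurable_fun setT (Y : mR -> mR).
pose mz := mZ : measurable_fun setT (Z : mR -> mR).
move=> A mA; apply: (@finite_measure_eq_ray R (pfm lam my) (pfm lam mz)) => //.
- by move=> a; apply: (etrans (rayE Y mY a)); rewrite e; exact: esym (rayE Z mZ a).
- by move=> a; apply: (eq_ind_r (fun z => z < +oo)%E _ (rayE Y mY a)); exact: ltry.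
Unshelve. all: by end_near.
Qed.

End Lindeberg.

(** * The joint law of finitely many independent uniform variables *)

Section IID.
Context {R : realType}.
Local Notation mR := (measurableTypeR R).
Local Notation lam := (@lam R).
Local Notation th0 := (@th0 R).
Local Notation th1 := (@th1 R).

Lemma measurable_fun_ray d (T : measurableType d) (f : T -> R) :
  (forall a, measurable [set t | f t <= a]) -> measurable_fun setT f.
Proof.
move=> h; apply: (@measurability _ _ T mR setT f _ (RGenOInfty.measurableE R)) => // _ [_ [x ->] <-].
rewrite setTI (_ : _ @^-1` _ = ~` [set t | f t <= x]); first exact: measurableC.
by apply/seteqP; split => t /=; rewrite in_itv/= andbT ltNge => /negP.
Qed.

Lemma prod_01 (I : Type) (s : seq I) (F : I -> R) : (forall i, 0 <= F i <= 1) -> 0 <= \prod_(i <- s) F i <= 1.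
Proof.
move=> h; elim: s => [|i s /andP[IH0 IH1]]; first by rewrite big_nil ler01 lexx.
by rewrite big_cons; have /andP[? ?] := h i; rewrite mulr_ge0//= mulr_ile1.
Qed.

Lemma Int_01 (f : R -> R) : measurable_fun setT f -> (forall x, 0 <= f x <= 1) -> Int f.
Proof. by move=> mf h; exact: (@Int_bnd _ _ 0 1). Qed.

Lemma E_prod_sd n (g : nat -> R -> R) : (forall k, measurable_fun setT (g k)) -> (forall k s, 0 <= g k s <= 1) ->
  E (fun w => \prod_(k < n) g k (sd k w)) = \prod_(k < n) E (g k).
Proof.
elim: n g => [|n IH] g mg g01.
  by under eq_fun do rewrite big_ord0; rewrite big_ord0 E_cst.
under eq_fun do rewrite big_ord_recl.
rewrite big_ord_recl -(IH (fun k => g k.+1))// -(E_prod (Int_01 (mg 0%N) (g01 0%N)) (_ : Int (fun w => \prod_(k < n) g k.+1 (sd k w)))).2; last first.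
  apply: Int_01 => [|x]; last exact: prod_01.
  by apply: measurable_prod => k _; apply: measurableT_comp => //; exact: measurable_sd.
by congr E; apply/funext => w; congr (_ * _); apply: eq_bigr => k _; rewrite -sdS.
Qed.

(* Independent uniform variables, with independence tested on products of functions. *)
Definition iidu (I : finType) (x : I -> R -> R) :=
  (forall i, measurable_fun setT (x i)) /\
  forall g : I -> R -> R, (forall i, measurable_fun setT (g i)) -> (forall i s, 0 <= g i s <= 1) ->
   E (fun w => \prod_i g i (x i w)) = \prod_i E (g i).

(** [cmeas] is applied to the sigma-algebra on [I -> R] generated by lower rectangles. These are
    stable by intersection, and on each of them both laws are the same product. *)
Lemma iidu_eq (I : finType) (x y : I -> R -> R) (F : (I -> R) -> \bar R) :
  iidu x -> iidu y -> cmeas F -> (forall z, 0 <= F z)%E ->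
  (\int[lam]_w F (x ^~ w) = \int[lam]_w F (y ^~ w))%E.
Proof.
move=> [mx ix] [my iy] mF F0.
pose rect (a : I -> R) := [set f : I -> R | forall i, f i <= a i].
pose G : set (set (I -> R)) := [set B | exists a, B = rect a].
pose S := g_sigma_algebraType G.
have mp i : measurable_fun [set: S] (fun f : S => f i).
  apply: measurable_fun_ray => a.
  rewrite (_ : [set t | _] = \bigcup_n (rect (fun j => if j == i then a else n%:R) : set S)); last first.
    apply/seteqP; split => f /= h.
      exists (\max_j Num.bound `|f j|)%N => //= j; case: eqP => [->//|_].
      rewrite (le_trans (ler_norm _))// ltW// (lt_le_trans (archi_boundP _))//.
      by rewrite ler_nat (leq_bigmax j).
    by case: h => n _ /(_ i); rewrite eqxx.
  apply: bigcup_measurable => n _; apply: sub_sigma_algebra.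
  by exists (fun j => if j == i then a else n%:R).
have mX (z : I -> R -> R) : (forall i, measurable_fun setT (z i)) ->
    measurable_fun [set: mR] (fun w => (z ^~ w : S)).
  move=> mz; apply: (@measurability _ _ mR S setT _ G) => // _ [_ [a ->] <-].
  rewrite setTI (_ : _ @^-1` _ = \big[setI/setT]_(i : I) (z i @^-1` `]-oo, a i])).
    by apply: bigsetI_measurable => i _; rewrite -[X in measurable X]setTI; apply: mz.
  apply/seteqP; split => w /=; first by move=> h; rewrite -bigcap_seq => i _ /=; rewrite in_itv/=; exact: h.
  by rewrite -bigcap_seq => h i; have := h i; rewrite /= in_itv/=; apply; rewrite mem_index_enum.
have mFS : measurable_fun [set: S] (F : S -> \bar R) by exact: (mF _ S (fun i f => f i)).
have lrect (z : I -> R -> R) a : (forall i, measurable_fun setT (z i)) ->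
    lam [set w | rect a (z ^~ w)] = (E (fun w => \prod_i (z i w <= a i)%R%:R))%:E.
  move=> mz; rewrite lamE; last first.
    rewrite -[X in measurable X]setTI; apply: (mX z mz) => //.
    by apply: sub_sigma_algebra; exists a.
  congr (E _)%:E; apply/funext => w; case: (boolP (w \in _)) => [|/negP]; rewrite inE => h.
    by rewrite big1// => i _; rewrite h.
  have [i hi] : exists i, ~~ (z i w <= a i).
    by apply: contrapT => /forallNP h'; apply: h => i /=; have /negP := h' i; rewrite negbK.
  by rewrite (bigD1 i)//= (negbTE hi) mul0r.
have mle (a : R) : measurable_fun setT (fun s : R => (s <= a)%R%:R : R).
  rewrite (_ : (fun s => _) = \1_(`]-oo, a]%classic)); first exact: measurable_indic.
  by apply/funext => s; rewrite indicE; congr (_ : bool)%:R; apply/idP/idP; rewrite inE/= in_itv.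
have b01 (b : bool) : 0 <= (b%:R : R) <= 1 by case: b; rewrite ?lexx ?ler01.
apply: (etrans (y := (\int[pfm lam (mX y my)]_f F f)%E)); last first.
  by apply: esym; exact: (@integral_law _ _ _ mR S lam (pfm lam (mX y my)) _ F (mX y my) _ mFS F0).
apply: (@integral_law _ _ _ mR S lam (pfm lam (mX y my)) _ F (mX x mx) _ mFS F0).
move=> A mA; rewrite -[LHS]/(pfm lam (mX x mx) A).
apply: (@measure_unique _ R S G (fun n => rect (fun=> n%:R))) => //.
- move=> _ _ [a ->] [b ->]; exists (fun i => Num.min (a i) (b i)).
  apply/seteqP; split => f /=.
    by move=> [h1 h2] i; rewrite le_min h1 h2.
  by move=> h; split=> i; have := h i; rewrite le_min => /andP[].
- by move=> n; exists (fun=> n%:R).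
- apply/seteqP; split => f // _; exists (\max_j Num.bound `|f j|)%N => //= j.
  rewrite (le_trans (ler_norm _))// ltW// (lt_le_trans (archi_boundP _))//.
  by rewrite ler_nat (leq_bigmax j).
- move=> _ [a ->]; apply: (etrans (lrect x a mx)); apply: (etrans _ (esym (lrect y a my))).
  by rewrite (ix (fun i s => (s <= a i)%R%:R))// (iy (fun i s => (s <= a i)%R%:R)).
- by move=> n; apply: (eq_ind_r (fun z => z < +oo)%E _ (lrect x _ mx)); exact: ltry.
Qed.

(** Test functions are moved along [sg]; an index outside of its image receives the constant 1, and
    injectivity prevents two of them from meeting. *)
Lemma iidu_comp (I J : finType) (x : I -> R -> R) (sg : J -> I) : injective sg -> iidu x ->
  iidu (fun j => x (sg j)).
Proof.
move=> inj [mx ix]; split=> [j|g mg g01]; first exact: mx.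
have := ix (fun i s => \prod_(j | sg j == i) g j s).
have -> : (fun w => \prod_i \prod_(j | sg j == i) g j (x i w)) = (fun w => \prod_j g j (x (sg j) w)).
  apply/funext => w; rewrite [RHS](partition_big sg xpredT)//=.
  by apply: eq_bigr => i _; apply: eq_bigr => j /eqP ->.
move=> ->.
- rewrite [RHS](partition_big sg xpredT)//=; apply: eq_bigr => i _.
  case: (pickP (fun j => sg j == i)) => [j0 /eqP e|h].
    have eP j : (sg j == i) = (j == j0) by rewrite -e; apply/eqP/eqP => [/inj|->].
    by under eq_fun do under eq_bigl do rewrite eP; rewrite (eq_bigl _ _ eP) !big_pred1_eq; congr E; apply/funext => s; rewrite big_pred1_eq.
  by under eq_fun do rewrite big_pred0//; rewrite big_pred0// E_cst.
- by move=> i; under eq_fun do rewrite big_mkcond; apply: measurable_prod => j _; case: (sg j == i).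
- by move=> i s; rewrite big_mkcond; apply: prod_01 => j; case: ifP => // _; rewrite ler01 lexx.
Qed.

Lemma iidu_pair (I J : finType) (x : I -> R -> R) (y : J -> R -> R) : iidu x -> iidu y ->
  iidu (fun k : I + J => match k with inl i => fun w => x i (th0 w) | inr j => fun w => y j (th1 w) end).
Proof.
move=> [mx ix] [my iy]; split=> [[i|j]|g mg g01].
- by apply: measurableT_comp; [exact: mx|exact: mth0].
- by apply: measurableT_comp; [exact: my|exact: mth1].
rewrite big_sumType/= -ix// -iy//.
have I1 : Int (fun w => \prod_i g (inl i) (x i w)).
  by apply: Int_01 => [|w]; [apply: measurable_prod => i _; apply: measurableT_comp|exact: prod_01].
have I2 : Int (fun w => \prod_j g (inr j) (y j w)).
  by apply: Int_01 => [|w]; [apply: measurable_prod => i _; apply: measurableT_comp|exact: prod_01].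
by rewrite -(E_prod I1 I2).2; congr E; apply/funext => w; rewrite big_sumType.
Qed.

Lemma iidu_sd n (I : finType) (x : I -> R -> R) : iidu x ->
  iidu (fun (p : 'I_n * I) w => x p.2 (sd p.1 w)).
Proof.
move=> [mx ix]; split=> [[k i]|g mg g01] /=.
  by apply: measurableT_comp; [exact: mx|exact: measurable_sd].
have pr (F : 'I_n * I -> R) : \prod_p F p = \prod_k \prod_i F (k, i).
  by rewrite pair_bigA; apply: eq_bigr => -[].
under eq_fun do rewrite pr; rewrite pr /=.
under [RHS]eq_bigr => k _ do rewrite -(ix (fun i => g (k, i)))//.
case: n g mg g01 {pr} => [|n] g mg g01.
  by under eq_fun do rewrite big_ord0; rewrite big_ord0 E_cst.
pose h k (w : R) := \prod_i g (inord k, i) (x i w).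
rewrite (_ : \prod_k _ = \prod_(k < n.+1) E (h k)); last by apply: eq_bigr => k _; rewrite /h inord_val.
rewrite -E_prod_sd.
- by congr E; apply/funext => w; apply: eq_bigr => k _; rewrite /h inord_val.
- by move=> k; apply: measurable_prod => i _; apply: measurableT_comp.
- by move=> k s; exact: prod_01.
Qed.

Lemma iidu_id : iidu (fun (_ : unit) (w : R) => w).
Proof.
split=> [_|g mg g01]; first exact: measurable_id.
rewrite (bigD1 tt)//= [X in _ = _ * X]big1 ?mulr1; last by case.
by congr E; apply/funext => w; rewrite (bigD1 tt)//= big1 ?mulr1//; case.
Qed.

End IID.

(** * Gaussian variables as stable laws *)

Section Stable.
Context {R : realType}.
Local Notation mR := (measurableTypeR R).
Local Notation lam := (@lam R).
Local Notation th0 := (@th0 R).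
Local Notation th1 := (@th1 R).

Local Notation nrm n := (Num.sqrt n%:R)^-1.

(** Strict stability of index 2 for a whole family at once. Together with fourth moments it
    characterises centred Gaussian families, and it passes through linear maps and independent
    unions. *)
Definition stab (I : Type) (xi : I -> R -> R) :=
  (forall i, measurable_fun setT (xi i)) /\
  forall n, (0 < n)%N -> forall g : (I -> R) -> \bar R, cmeas g -> (forall x, 0 <= g x)%E ->
   (\int[lam]_w g (fun i => (nrm n * Sv n xi w i)%R) = \int[lam]_w g (xi ^~ w))%E.

(* Weak form of [stab], tested on bounded sequentially continuous functions only, hence preserved by pointwise limits. *)
Definition wstab (I : Type) (xi : I -> R -> R) :=
  (forall i, measurable_fun setT (xi i)) /\
  forall n, (0 < n)%N -> forall (f : (I -> R) -> R) c, cmeas f -> (forall x, `|f x| <= c) -> seqcont f ->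
   E (fun w => f (fun i => nrm n * Sv n xi w i)) = E (fun w => f (xi ^~ w)).

Lemma stab_wstab (I : Type) (xi : I -> R -> R) : stab xi -> wstab xi.
Proof.
move=> [mxi sxi]; split=> // n n0 f c mf fc _.
have I1 : Int (fun w => f (fun i => nrm n * Sv n xi w i)).
  apply: (@Int_bounded _ _ c) => //; apply: (mf _ mR (fun i w => nrm n * Sv n xi w i)) => i.
  by apply: measurable_funM => //; exact: measurable_Sv.
have I2 : Int (fun w => f (xi ^~ w)).
  by apply: (@Int_bounded _ _ c) => //; exact: (mf _ mR (fun i w => xi i w)).
have IC : Int (cst c : R -> R) := Int_cst c.
have h : E (fun w => f (fun i => nrm n * Sv n xi w i) + c) = E (fun w => f (xi ^~ w) + c).
  have g0 x : (0 <= (f x + c)%:E)%E.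
    by rewrite lee_fin; have := fc x; rewrite ler_norml => /andP[? _]; lra.
  have mg : cmeas (fun x => (f x + c)%:E).
    by move=> d T x mx; apply/measurable_EFinP; apply: measurable_funD => //; exact: mf.
  apply: EFin_inj; rewrite -(E_EFin (IntD I1 IC)) -(E_EFin (IntD I2 IC)).
  exact: sxi n n0 _ mg g0.
move: h; rewrite (ED I1 IC) (ED I2 IC); exact: addIr.
Qed.

(** Splitting each of n seeds in two, and extracting n seeds from each half of one seed, give arrays
    with the same law; after this exchange the two stabilities apply separately. *)
Lemma stab_pair (I J : Type) (xi : I -> R -> R) (eta : J -> R -> R) : stab xi -> stab eta ->
  stab (fun c : I + J => match c with inl i => fun w => xi i (th0 w) | inr j => fun w => eta j (th1 w) end).
Proof.
move=> [mxi sxi] [meta seta]; set pr := fun c : I + J => _.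
have mpr c : measurable_fun setT (pr c).
  by case: c => k; apply: measurableT_comp => //; [exact: mth0|exact: mth1].
split=> // n n0 g mg g0; set t := nrm n.
pose jn (x : I -> R) (y : J -> R) (c : I + J) := match c with inl i => x i | inr j => y j end.
pose G (z : 'I_n * (unit + unit) -> R) := g (jn (fun i => t * \sum_(k < n) xi i (z (k, inl tt)))
  (fun j => t * \sum_(k < n) eta j (z (k, inr tt)))).
have mG : cmeas G.
  move=> d T x mx; apply: (mg _ T (fun c w => jn _ _ c)) => -[i|j] /=.
    apply: measurable_funM => //; apply: measurable_sum => k.
    by apply: measurableT_comp => //; exact: mx.
  apply: measurable_funM => //; apply: measurable_sum => k.
  by apply: measurableT_comp => //; exact: mx.
have F1 := iidu_sd n (iidu_pair (@iidu_id R) (@iidu_id R)).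
pose sg (p : 'I_n * (unit + unit)) : 'I_n * unit + 'I_n * unit :=
  match p.2 with inl _ => inl (p.1, tt) | inr _ => inr (p.1, tt) end.
have isg : injective sg by move=> [k [[]|[]]] [l [[]|[]]] //= [->].
have F2 := iidu_comp isg (iidu_pair (iidu_sd n (@iidu_id R)) (iidu_sd n (@iidu_id R))).
have := iidu_eq F1 F2 mG (fun z => g0 _); rewrite /G /=.
have mSx i : measurable_fun setT (fun w : R => t * Sv n xi w i).
  by apply: measurable_funM => //; exact: measurable_Sv.
have mSe j : measurable_fun setT (fun w : R => t * Sv n eta w j).
  by apply: measurable_funM => //; exact: measurable_Sv.
rewrite (_ : (fun w => _) = (fun w => g (fun i => t * Sv n pr w i))); last first.
  by apply/funext => w; congr g; apply/funext => -[i|j].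
move=> ->.
have mj (x : I -> R -> R) (y : J -> R -> R) : (forall i, measurable_fun setT (x i)) ->
    (forall j, measurable_fun setT (y j)) ->
    measurable_fun setT (fun z : mR * mR => g (jn (x ^~ z.1) (y ^~ z.2))).
  move=> mx my; apply: (mg _ _ (fun c (z : mR * mR) => jn (x ^~ z.1) (y ^~ z.2) c)) => -[i|j] /=.
    by apply: measurableT_comp; [exact: mx|exact: measurable_fst].
  by apply: measurableT_comp; [exact: my|exact: measurable_snd].
transitivity (\int[lam]_x \int[lam]_y g (jn (fun i => t * Sv n xi x i)%R (fun j => t * Sv n eta y j)%R))%E.
  rewrite -(@ge0_split R (fun z => g (jn (fun i => t * Sv n xi z.1 i) (fun j => t * Sv n eta z.2 j)))) //.
  exact: mj mSx mSe.
have mc (x : I -> R) : cmeas (fun y => g (jn x y)).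
  by move=> d T y my; apply: (mg _ T (fun c w => jn x (y ^~ w) c)) => -[i|j] //=.
have mc' (y : J -> R) : cmeas (fun x => g (jn x y)).
  by move=> d T x mx; apply: (mg _ T (fun c w => jn (x ^~ w) y c)) => -[i|j] //=.
under eq_integral => x _ do rewrite (seta n n0 (fun y => g (jn (fun i => t * Sv n xi x i) y)))//.
transitivity (\int[lam]_y \int[lam]_x g (jn (fun i => t * Sv n xi x i)%R (eta ^~ y)))%E.
  rewrite -(@ge0_split R (fun z => g (jn (fun i => t * Sv n xi z.1 i) (eta ^~ z.2)))) //; last exact: mj mSx meta.
  rewrite -(@ge0_split_swap R (fun z => g (jn (fun i => t * Sv n xi z.1 i) (eta ^~ z.2)))) //.
  exact: mj mSx meta.
under eq_integral => y _ do rewrite (sxi n n0 (fun x => g (jn x (eta ^~ y))))//.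
rewrite -(@ge0_split_swap R (fun z => g (jn (xi ^~ z.1) (eta ^~ z.2)))) //; last exact: mj mxi meta.
by apply: eq_integral => w _; congr g; apply/funext => -[i|j].
Qed.

Definition linmap (I J : Type) (A : (I -> R) -> J -> R) :=
  [/\ forall j, cmeas (A ^~ j), forall x y j, A (fun i => x i + y i) j = A x j + A y j &
      forall c x j, A (fun i => c * x i) j = c * A x j].

Lemma Sv_lin (I J : Type) (A : (I -> R) -> J -> R) (xi : I -> R -> R) n w : linmap A ->
  Sv n (fun j w => A (xi ^~ w) j) w = A (Sv n xi w).
Proof.
move=> [_ AD AZ]; apply/funext => j; elim: n w => [|n IH] w.
  rewrite Sv0 (_ : Sv 0 xi w = fun i => 0 * 0); last by apply/funext => i; rewrite Sv0 mul0r.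
  by rewrite (AZ 0 (fun=> 0)) mul0r.
rewrite SvS IH -AD; congr A; apply/funext => i; by rewrite SvS.
Qed.

Lemma stab_lin (I J : Type) (A : (I -> R) -> J -> R) (xi : I -> R -> R) : linmap A -> stab xi ->
  stab (fun j w => A (xi ^~ w) j).
Proof.
move=> lA [mxi sxi]; have [mA _ AZ] := lA.
split=> [j|n n0 g mg g0]; first exact: (mA j _ mR (fun i w => xi i w)).
have := sxi n n0 (g \o A) _ (fun x => g0 _); rewrite /comp => <-; last first.
  by move=> d T x mx; apply: (mg _ T (fun j t => A (x ^~ t) j)) => j; exact: mA.
apply: eq_integral => w _; rewrite (Sv_lin _ _ _ lA); congr g.
by apply/funext => j; rewrite AZ.
Qed.

Lemma wstab_lin (I J : Type) (A : (I -> R) -> J -> R) (xi : I -> R -> R) : linmap A ->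
  (forall j, seqcont (A ^~ j)) -> wstab xi -> wstab (fun j w => A (xi ^~ w) j).
Proof.
move=> lA cA [mxi sxi]; have [mA _ AZ] := lA.
split=> [j|n n0 f c mf fc cf]; first exact: (mA j _ mR (fun i w => xi i w)).
have := sxi n n0 (f \o A) c _ (fun x => fc _) _; rewrite /comp => <-.
- congr E; apply/funext => w; rewrite (Sv_lin _ _ _ lA); congr f.
  by apply/funext => j; rewrite AZ.
- by move=> d T x mx; apply: (mf _ T (fun j t => A (x ^~ t) j)) => j; exact: mA.
- by move=> x_ x xx; apply: (cf (fun n => A (x_ n))) => j; exact: cA.
Qed.

Lemma wstab_lim (I : Type) (xi_ : nat -> I -> R -> R) (xi : I -> R -> R) : (forall l, wstab (xi_ l)) ->
  (forall i w, xi_ ^~ i ^~ w @ \oo --> xi i w) -> wstab xi.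
Proof.
move=> sxi cxi.
have mxi i : measurable_fun setT (xi i).
  by apply: (@measurable_fun_cvg _ _ _ _ (fun l => xi_ l i)) => [l|x _]; [exact: (sxi l).1|exact: cxi].
split=> // n n0 f c mf fc cf.
have mS (x : I -> R -> R) : (forall i, measurable_fun setT (x i)) ->
    measurable_fun setT (fun w => f (fun i => nrm n * Sv n x w i)).
  move=> mx; apply: (mf _ mR (fun i w => nrm n * Sv n x w i)) => i.
  by apply: measurable_funM => //; exact: measurable_Sv.
have c1 : E (fun w => f (fun i => nrm n * Sv n (xi_ l) w i)) @[l --> \oo] -->
    E (fun w => f (fun i => nrm n * Sv n xi w i)).
  apply: (@E_dct _ _ _ (cst c)) => [l|x|l x|]; [by apply: mS; exact: (sxi l).1| |exact: fc|exact: Int_cst].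
  apply: (cf (fun l i => nrm n * Sv n (xi_ l) x i)) => i; apply: cvgMr.
  rewrite /Sv; elim: n {n0 mS} => [|n IH]; first by under eq_fun do rewrite big_ord0; rewrite big_ord0; exact: cvg_cst.
  by under eq_fun do rewrite big_ord_recr; rewrite big_ord_recr; apply: cvgD => //; exact: cxi.
have c2 : E (fun w => f (xi_ l ^~ w)) @[l --> \oo] --> E (fun w => f (xi ^~ w)).
  apply: (@E_dct _ _ _ (cst c)) => [l|x|l x|]; [|by apply: (cf (fun l i => xi_ l i x)) => i; exact: cxi|exact: fc|exact: Int_cst].
  by apply: (mf _ mR (fun i w => xi_ l i w)); exact: (sxi l).1.
apply: (cvg_unique _ c1) => //=.
by under eq_fun do rewrite ((sxi _).2 n n0 f c)//.
Qed.

(** A sum reads several seeds: the exceptional set is the union of the preimages of [N] under all of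
    them, still null. *)
Lemma wstab_ae (I : Type) (xi eta : I -> R -> R) (N : set R) : measurable N -> lam N = 0%E ->
  (forall i w, ~ N w -> xi i w = eta i w) -> (forall i, measurable_fun setT (eta i)) ->
  wstab xi -> wstab eta.
Proof.
move=> mN N0 e meta [mxi sxi]; split=> // n n0 f c mf fc cf.
have mS (x : I -> R -> R) : (forall i, measurable_fun setT (x i)) ->
    measurable_fun setT (fun w => f (fun i => nrm n * Sv n x w i)).
  move=> mx; apply: (mf _ mR (fun i w => nrm n * Sv n x w i)) => i.
  by apply: measurable_funM => //; exact: measurable_Sv.
have mI (x : I -> R -> R) : (forall i, measurable_fun setT (x i)) ->
    measurable_fun setT (fun w => f (x ^~ w)) by move=> mx; exact: (mf _ mR (fun i w => x i w)).
have e1 : E (fun w => f (xi ^~ w)) = E (fun w => f (eta ^~ w)).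
  apply: (E_ae _ _ mN N0) => [||w Nw]; [exact: (Int_bounded (mI _ mxi) (fun _ => fc _))|exact: mI|].
  by congr f; apply/funext => i; exact: e.
rewrite -e1 -(sxi n n0 f c)//; apply/esym.
have mk k : measurable (sd k @^-1` N : set R).
  by rewrite -[X in measurable X]setTI; apply: measurable_sd.
have Nn : lam (\bigcup_k (sd k @^-1` N)) = 0%E.
  apply: measure_negligible; first exact: (bigcup_measurable (fun k _ => mk k)).
  apply: negligible_bigcup => k; apply/negligibleP; first exact: mk.
  by rewrite -N0; exact: (mpres_sd k).2.
apply: (E_ae _ _ (bigcup_measurable (fun k _ => mk k)) Nn) => [||w Nw].
- exact: (Int_bounded (mS _ mxi) (fun _ => fc _)).
- exact: mS.
- congr f; apply/funext => i; congr (_ * _); apply: eq_bigr => k _; apply: e => Nk.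
  by apply: Nw; exists k.
Qed.

(** By stability neither expectation changes when the family is replaced by its n-fold sums, while
    the bound of [lindeberg] tends to 0 with n. *)
Lemma wstab_eq (I : finType) (xi eta : I -> R -> R) (f : (I -> R) -> R) :
  wstab xi -> wstab eta -> tst f -> mom4 xi -> mom4 eta -> (forall i, E (xi i) = E (eta i)) ->
  (forall i j, E (fun s => xi i s * xi j s) = E (fun s => eta i s * eta j s)) ->
  E (fun w => f (xi ^~ w)) = E (fun w => f (eta ^~ w)).
Proof.
move=> [mxi sxi] [meta seta] tf x4 e4 e1 e2.
have [C CP] := lindeberg tf x4 e4 e1 e2; have [c fc] := tst_bound tf.
apply/eqP; rewrite -subr_eq0 -normr_eq0 -[_ == 0]negbK; apply/negP => n0.
have d0 : 0 < `|E (fun w => f (xi ^~ w)) - E (fun w => f (eta ^~ w))| by rewrite lt0r n0 normr_ge0.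
(* The number of summands will be [k ^ 2], whose square root is exact; [k > C / d] contradicts the
   bound. *)
set d := `|_| in d0 CP n0; pose k := (Num.bound `|C / d|).+1.
have := CP (k ^ 2)%N; rewrite expn_gt0 /= => /(_ isT).
rewrite (sxi _ _ f c)// ?(seta _ _ f c)//; [|exact: tf.2|exact: tst_seqcont|exact: tf.2|exact: tst_seqcont].
rewrite -/d natrX sqrtr_sqr ger0_norm// => h.
have k0 : 0 < k%:R :> R by rewrite ltr0n.
have : C / d < k%:R.
  apply: (le_lt_trans (ler_norm _)); apply: (lt_trans (archi_boundP (normr_ge0 _))).
  by rewrite ltr_nat ltnS.
rewrite ltr_pdivrMr// => h2; move: h; rewrite ler_pdivlMr//; lra.
Qed.

(** Instead of being evaluated, the second moment is shown to be positive and divided out, so that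
    [gz] has variance 1. *)
Definition gvar : R := E (fun w => gz0 w ^+ 2).
Definition gz (w : R) : R := (Num.sqrt gvar)^-1 * gz0 w.

Lemma gvar_gt0 : 0 < gvar.
Proof.
have m0 := @measurable_gz0 R; have [I1 I2 _] := Int_pow4 m0 (@Int_gz0_4 R).
rewrite lt0r; apply/andP; split; last by apply: E_ge0 => x; exact: sqr_ge0.
apply/negP => /eqP h.
have m1 : measurable (gz0 @^-1` [set (0:R)] : set R).
  by rewrite -[X in measurable X]setTI; apply: m0.
have z0 : lam (gz0 @^-1` [set 0]) = 0%E.
  have := gz0_integral (f := fun x : R => (x \in [set (0:R)])%:R%:E) _ _.
  rewrite lamE// -E_EFin; last by apply: Int_01 => [|w]; [exact: measurable_indic|case: (_ \in _); rewrite ?lexx ?ler01].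
  have -> : (fun w : R => (w \in gz0 @^-1` [set (0:R)])%:R%:E) = (fun w => ((gz0 w \in [set (0:R)])%:R : R)%:E).
    by apply/funext => w; congr ((_ : bool)%:R : R)%:E; apply/idP/idP; rewrite !inE.
  move=> ->; last 2 first.
  - by apply/measurable_EFinP; exact: measurable_indic.
  - by move=> x; rewrite lee_fin.
  rewrite (ae_eq_integral (cst 0%E))//; first exact: integral0.
  - apply: emeasurable_funM; first by apply/measurable_EFinP; exact: measurable_indic.
    by apply/measurable_EFinP; exact: measurable_normal_pdf.
  - exists [set (0:R)]; split; [exact: measurable_set1|exact: lebesgue_measure_set1|].
    move=> x /= h'; apply: contrapT => x0; apply: h' => _.
    have -> : (x \in [set (0:R)]) = false by apply/negP; rewrite inE.
    by rewrite mul0e.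
have /(ae_eq_integral_abs lam measurableT _).1 : (\int[lam]_w `|(gz0 w ^+ 2)%:E| = 0)%E.
  under eq_integral do rewrite gee0_abs ?lee_fin ?sqr_ge0//.
  by rewrite E_EFin// -/gvar h.
move=> /(_ _)[]; first by apply/measurable_EFinP; exact: Int_measurable I2.
move=> N [mN N0 NP].
have : (lam setT <= lam ((N : set R) `|` (gz0 @^-1` [set 0%R])))%E.
  apply: le_measure; rewrite ?inE//; first exact: measurableU.
  move=> w _; apply: contrapT => /not_orP[Nw w0]; apply: Nw; apply: NP => /= h'.
  case: (h' I) => h2; apply: w0; apply/eqP; rewrite -sqrf_eq0; exact/eqP.
rewrite probability_setT => h1; have := le_trans h1 (measureU2 lam mN m1).
have -> : (lam N + lam (gz0 @^-1` [set 0%R]) = 0)%E by rewrite -[RHS]adde0; congr (_ + _)%E.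
by rewrite lee_fin ler10.
Qed.

Lemma measurable_gz : measurable_fun setT gz.
Proof. by apply: measurable_funM => //; exact: measurable_gz0. Qed.

Lemma Int_gz4 : Int (fun w => gz w ^+ 4).
Proof. by under eq_fun do rewrite exprMn; apply: IntZ; exact: Int_gz0_4. Qed.

Lemma E_gz2 : E (fun w => gz w ^+ 2) = 1.
Proof.
have [I1 I2 _] := Int_pow4 (@measurable_gz0 R) (@Int_gz0_4 R).
under eq_fun do rewrite exprMn; rewrite EZ// exprVn sqr_sqrtr ?(ltW gvar_gt0)//.
by rewrite mulVf// gt_eqF// gvar_gt0.
Qed.

Lemma gz_sym (f : R -> \bar R) : measurable_fun setT f -> (forall x, 0 <= f x)%E ->
  (\int[lam]_w f (- gz w)%R = \int[lam]_w f (gz w))%E.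
Proof.
move=> mf f0; rewrite /gz; under eq_integral do rewrite -mulrN.
apply: (gz0_sym (f := fun x => f ((Num.sqrt gvar)^-1 * x)%R)) => //.
by apply: measurableT_comp => //; exact: measurable_funM.
Qed.

Lemma E_gz : E gz = 0.
Proof.
have [I1 _ _] := Int_pow4 measurable_gz Int_gz4.
pose pos (x : R) := Num.max x 0.
have mpos : measurable_fun setT pos by apply: measurable_maxr.
have Ip : Int (fun w => pos (gz w)).
  apply: (Int_le _ _ (Int_abs I1)); first by apply: measurableT_comp => //; exact: measurable_gz.
  by move=> x; rewrite /pos; have [h|h] := lerP 0 (gz x); rewrite ?normr0.
have In : Int (fun w => pos (- gz w)).
  apply: (Int_le _ _ (Int_abs I1)).
    by apply: measurableT_comp => //; apply: measurableT_comp => //; exact: measurable_gz.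
  by move=> x; rewrite /pos; have [h|h] := lerP 0 (- gz x); rewrite ?normr0 ?normrN.
have : (fun w => gz w) = (fun w => pos (gz w) - pos (- gz w)).
  by apply/funext => x; rewrite /pos /Num.max; do 2 case: ifP; lra.
rewrite -[gz]/(fun w => gz w) => ->; rewrite EB//; apply/eqP; rewrite subr_eq0; apply/eqP.
apply: EFin_inj; rewrite -!E_EFin//; apply: esym.
apply: (gz_sym (f := fun x => (pos x)%:E)); first exact/measurable_EFinP.
by move=> x; rewrite lee_fin le_max lexx orbT.
Qed.

(** Seeds are added one at a time, through [gz0_conv] with coefficients 1 and the square root of
    k. *)
Lemma stab_gz : stab (fun _ : unit => gz).
Proof.
split=> [_|n n0 g mg g0]; first exact: measurable_gz.
pose f (x : R) := g (fun _ => x).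
have mf : measurable_fun setT f by apply: (mg _ mR (fun _ x => x)) => _; exact: measurable_id.
have f0 x : (0 <= f x)%E by exact: g0.
rewrite (_ : (fun w => g _) = (fun w => f (nrm n * Sv n (fun _ : unit => gz) w tt)%R)); last first.
  by apply/funext => w; congr g; apply/funext => -[].
have key k (h : R -> \bar R) : measurable_fun setT h -> (forall x, 0 <= h x)%E ->
   (\int[lam]_w h (Sv k (fun _ : unit => gz) w tt) = \int[lam]_w h (Num.sqrt k%:R * gz w)%R)%E.
  elim: k h => [|k IH] h mh hh.
    by apply: eq_integral => w _; rewrite Sv0 sqrtr0 mul0r.
  have mhc c : measurable_fun setT (fun y : R => h (c + y)%R).
    by apply: measurableT_comp => //; exact: measurable_funD.
  under eq_integral do rewrite SvS.
  rewrite (@ge0_split R (fun z => h (gz z.1 + Sv k (fun _ : unit => gz) z.2 tt)%R))//; last first.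
    apply: measurableT_comp => //; apply: measurable_funD.
      by apply: measurableT_comp; [exact: measurable_gz|exact: measurable_fst].
    apply: (@measurableT_comp _ _ _ _ _ _ (fun w : R => Sv k (fun _ : unit => gz) w tt)); last exact: measurable_snd.
    by apply: measurable_Sv => _; exact: measurable_gz.
  under eq_integral => x _ do rewrite /= (IH (fun y => h (gz x + y)%R))//.
  rewrite -(@ge0_split R (fun z => h (gz z.1 + Num.sqrt k%:R * gz z.2)%R))//; last first.
    apply: measurableT_comp => //; apply: measurable_funD.
      by apply: measurableT_comp; [exact: measurable_gz|exact: measurable_fst].
    apply: measurable_funM => //.
    by apply: measurableT_comp; [exact: measurable_gz|exact: measurable_snd].
  have := @gz0_conv R 1 (Num.sqrt k%:R) (fun x => h ((Num.sqrt gvar)^-1 * x)%R) _ (fun x => hh _).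
  rewrite expr1n sqr_sqrtr// nat1r => H; rewrite /gz.
  under eq_integral do rewrite /= mulrCA -mulrDr -[in X in h (_ * (X + _))%R](mul1r (gz0 _)).
  rewrite H; last by apply: measurableT_comp => //; exact: measurable_funM.
  by apply: eq_integral => w _; rewrite mulrCA.
rewrite (key n (fun x => f (nrm n * x)%R))//; last first.
  by apply: measurableT_comp => //; exact: measurable_funM.
apply: eq_integral => w _; rewrite mulrA mulVf ?mul1r//.
by rewrite gt_eqF// sqrtr_gt0 ltr0n.
Qed.

Lemma gauss_law (sg : R) : exists m s : R, forall A : set R, measurable A ->
  lam ((fun w => sg * gz w) @^-1` A) = if s == 0 then \d_m A else normal_prob m s A.
Proof.
exists 0, (`|sg| * (Num.sqrt gvar)^-1) => A mA.
have v0 : 0 < (Num.sqrt gvar)^-1 by rewrite invr_gt0 sqrtr_gt0 gvar_gt0.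
rewrite mulf_eq0 (gt_eqF v0) orbF normr_eq0; case: eqP => [->|/eqP sn0].
  rewrite /dirac/= indicE; under eq_fun do rewrite mul0r.
  case: (boolP (0 \in A)) => A0; rewrite /preimage/=.
    rewrite (_ : [set _ | _] = setT) ?probability_setT//; apply/seteqP; split => // x _ /=.
    by move: A0; rewrite inE.
  rewrite (_ : [set _ | _] = set0) ?measure0//; apply/seteqP; split => // x /=.
  by move: A0; rewrite notin_setE.
have p0 : 0 < `|sg| * (Num.sqrt gvar)^-1 by rewrite mulr_gt0// normr_gt0.
have mE : measurable_fun setT (fun x : R => (\1_A x : R)%:E).
  by apply/measurable_EFinP; exact: measurable_indic.
have E0 (x : R) : (0 <= (\1_A x : R)%:E)%E by rewrite lee_fin.
have h1 := gz0_abs (sg * (Num.sqrt gvar)^-1) mE E0.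
have h2 := gz0_scale p0 mE E0.
rewrite normrM (gtr0_norm v0) in h1.
have mS : measurable ((fun w => sg * gz w) @^-1` A : set R).
  rewrite -[X in measurable X]setTI; suff m : measurable_fun setT (fun w => sg * gz w) by exact: m.
  by apply: measurable_funM => //; exact: measurable_gz.
rewrite lamE// -E_EFin; last first.
  by apply: Int_01 => [|w]; [exact: measurable_indic|case: (_ \in _); rewrite ?lexx ?ler01].
transitivity (\int[lam]_w (\1_A (sg / Num.sqrt gvar * gz0 w))%:E)%E.
  apply: eq_integral => w _; congr (EFin _); rewrite indicE; congr (_ : bool)%:R.
  by rewrite -mulrA; apply/idP/idP; rewrite !inE.
rewrite h1 h2 /normal_prob [RHS]integral_mkcond; apply: eq_integral => x _.
by rewrite patchE indicE; case: (x \in A); rewrite ?mul1e ?mul0e.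
Qed.

(* Lindeberg's theorem compares [n]-fold sums of [X] with those of a Gaussian variable, and both are stable. *)
Lemma wstab_gauss (X : R -> R) : wstab (fun _ : unit => X) -> Int (fun s => X s ^+ 4) -> E X = 0 ->
  exists m s : R, forall A : set R, measurable A ->
  lam (X @^-1` A) = if s == 0 then \d_m A else normal_prob m s A.
Proof.
move=> sX X4 EX; have mX : measurable_fun setT X := sX.1 tt.
have [_ X2 _] := Int_pow4 mX X4; have [G1 G2 _] := Int_pow4 measurable_gz Int_gz4.
pose sg := Num.sqrt (E (fun s => X s ^+ 2)).
have sg2 : sg ^+ 2 = E (fun s => X s ^+ 2) by rewrite sqr_sqrtr// E_ge0// => x; exact: sqr_ge0.
have [m [s ms]] := gauss_law sg; exists m, s => A mA; rewrite -ms//.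
apply: (law_eq_sigm mX _ _ mA) => [|k l]; first by apply: measurable_funM => //; exact: measurable_gz.
have lA : @linmap unit unit (fun x _ => sg * x tt).
  split=> [_ d T x mx|x y _|c x _]; [|exact: mulrDr|exact: mulrCA].
  by apply: measurable_funM => //; exact: mx.
apply: (@wstab_eq unit (fun _ => X) (fun _ w => sg * gz w) (fun x => sigm (k * x tt + l)) sX).
- by apply: (@stab_wstab unit (fun _ w => sg * gz w)); exact: (stab_lin lA stab_gz).
- exact: tst_sigm.
- by move=> _; split.
- move=> _; split; first by apply: measurable_funM => //; exact: measurable_gz.
  by under eq_fun do rewrite exprMn; apply: IntZ; exact: Int_gz4.
- by move=> _; rewrite EX EZ// E_gz mulr0.
- move=> _ _; rewrite -[LHS]sg2 (_ : (fun s => _) = (fun w => sg ^+ 2 * gz w ^+ 2)); last by apply/funext => w; ring.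
  by rewrite EZ// E_gz2 mulr1.
Qed.

End Stable.

(** * Variables with a finite fourth moment *)

Section FourthMoments.
Context {R : realType}.
Local Notation mR := (measurableTypeR R).
Local Notation lam := (@lam R).
Local Notation th0 := (@th0 R).
Local Notation th1 := (@th1 R).

Definition L4 (f : R -> R) := measurable_fun setT f /\ Int (fun s => f s ^+ 4).

Lemma L4_cst c : L4 (fun _ => c).
Proof. by split; [exact: measurable_cst|exact: (Int_cst (c ^+ 4))]. Qed.

Lemma L4Z c f : L4 f -> L4 (fun w => c * f w).
Proof.
move=> [mf If]; split; first exact: measurable_funM.
by under eq_fun do rewrite exprMn; exact: IntZ.
Qed.

Lemma L4D f g : L4 f -> L4 g -> L4 (fun w => f w + g w).
Proof.
move=> [mf If] [mg Ig]; split; first exact: measurable_funD.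
apply: (Int_le _ _ (IntZ 8 (IntD If Ig))); first by apply: measurable_funX; exact: measurable_funD.
move=> x; rewrite ger0_norm ?exprn_even_ge0//; set a := f x; set b := g x.
(* A factored certificate for (a + b)^4 <= 8 (a^4 + b^4); the quadratic factor is 5 (a + b)^2 + 2
   a^2 + 2 b^2. *)
have : 0 <= (a - b) ^+ 2 * (7 * a ^+ 2 + 10 * a * b + 7 * b ^+ 2).
  apply: mulr_ge0; [exact: sqr_ge0|].
  by have := sqr_ge0 (a + b); have := sqr_ge0 a; have := sqr_ge0 b; nra.
by rewrite (_ : (a - b) ^+ 2 * _ = 8 * (a ^+ 4 + b ^+ 4) - (a + b) ^+ 4); [lra|ring].
Qed.

Lemma L4N f : L4 f -> L4 (fun w => - f w).
Proof. by move/(L4Z (-1)); under eq_fun do rewrite mulN1r. Qed.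

Lemma L4_sum (I : Type) (s : seq I) (F : I -> R -> R) : (forall i, L4 (F i)) ->
  L4 (fun w => \sum_(i <- s) F i w).
Proof.
move=> h; elim: s => [|i s IH]; first by under eq_fun do rewrite big_nil; exact: L4_cst.
by under eq_fun do rewrite big_cons; exact: L4D.
Qed.

Lemma L4_mpres p f : mpres p -> L4 f -> L4 (fun w => f (p w)).
Proof.
move=> mp [mf If]; split; first by apply: measurableT_comp => //; exact: mp.1.
exact: (mpres_Int mp If).
Qed.

Lemma L4_Int f : L4 f -> Int f.
Proof. by move=> [mf If]; have [] := Int_pow4 mf If. Qed.

Lemma L4_Int_mul f g : L4 f -> L4 g -> Int (fun w => f w * g w).
Proof.
move=> [mf If] [mg Ig]; have [_ f2 _] := Int_pow4 mf If; have [_ g2 _] := Int_pow4 mg Ig.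
exact: Int_mul.
Qed.

Lemma L4_gz : L4 gz.
Proof. by split; [exact: measurable_gz|exact: Int_gz4]. Qed.

Lemma cov_add f f' g g' : L4 f -> L4 f' -> L4 g -> L4 g' -> E g = 0 -> E g' = 0 ->
  E (fun w => (f (th0 w) + g (th1 w)) * (f' (th0 w) + g' (th1 w))) =
  E (fun w => f w * f' w) + E (fun w => g w * g' w).
Proof.
move=> lf lf' lg lg' g0 g0'.
have [I1 e1] := E_prod (L4_Int lf) (L4_Int lg'); have [I2 e2] := E_prod (L4_Int lf') (L4_Int lg).
have J1 := mpres_Int (@mpres_th0 R) (L4_Int_mul lf lf').
have J2 := mpres_Int (@mpres_th1 R) (L4_Int_mul lg lg').
rewrite (_ : (fun w => _) = (fun w => (f (th0 w) * f' (th0 w) + g (th1 w) * g' (th1 w)) +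
   (f (th0 w) * g' (th1 w) + f' (th0 w) * g (th1 w)))); last by apply/funext => w; ring.
rewrite ED; [|exact: (IntD J1 J2)|exact: (IntD I1 I2)].
rewrite (ED J1 J2) (ED I1 I2) e1 e2 g0 g0' !mulr0 !addr0; congr (_ + _).
  exact: (mpres_E (@mpres_th0 R) (L4_Int_mul lf lf')).
exact: (mpres_E (@mpres_th1 R) (L4_Int_mul lg lg')).
Qed.

End FourthMoments.

Lemma geo_sum_le (R : realType) n (z : R) : 0 <= z < 1 -> \sum_(l < n) z ^+ l <= (1 - z)^-1.
Proof.
move=> /andP[z0 z1]; rewrite -[leRHS]mul1r ler_pdivlMr ?subr_gt0//.
have -> : (\sum_(l < n) z ^+ l) * (1 - z) = 1 - z ^+ n.
  have := subrX1 z n; lra.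
by rewrite lerBlDr lerDl exprn_ge0.
Qed.

(** * Construction of the Brownian bridge *)

Section Bridge.
Context {R : realType}.
Local Notation mR := (measurableTypeR R).
Local Notation lam := (@lam R).
Local Notation th0 := (@th0 R).
Local Notation th1 := (@th1 R).

(** The linear interpolation of the value at the midpoint; its height 1/2 is the standard deviation
    of the bridge there. *)
Definition tent (t : R) : R := Num.max 0 (Num.min t (1 - t)).

Lemma tentE t : tent t = if (0 <= t) && (t <= 1) then if t <= 1 / 2 then t else 1 - t else 0.
Proof.
by rewrite /tent /Num.max /Num.min; do ![case: ifP]; lra.
Qed.

Lemma continuous_tent : continuous tent.
Proof.
suff h : continuous ((fun=> 0 : R^o) \max ((fun t => t : R^o) \min (fun t : R => 1 - t : R^o))) by exact: h.
move=> t; apply: continuous_max; first exact: cvg_cst.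
apply: continuous_min; first exact: cvg_id.
by apply: cvgB; [exact: cvg_cst|exact: cvg_id].
Qed.

(** The Brownian scaling for an interval of length 1/2. *)
Let s2 : R := (Num.sqrt 2)^-1.

Lemma s2E : s2 ^+ 2 = 1 / 2.
Proof. by rewrite exprVn sqr_sqrtr// div1r. Qed.

(* Levy's midpoint construction of the bridge, as a self-similar recursion. *)
Fixpoint bL (l : nat) (w : R) (t : R) : R := if l is l'.+1 then
  tent t * gz (th0 w) + s2 * (bL l' (th0 (th1 w)) (2 * t) + bL l' (th1 (th1 w)) (2 * t - 1)) else 0.

Lemma stab_bL l : stab (fun t w => bL l w t).
Proof.
elim: l => [|l IH].
  have lA : @linmap R unit R (fun x t => 0 * x tt).
    split=> [t d T x mx|x y t|c x t]; [|ring|ring].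
    by apply: measurable_funM => //; exact: mx.
  have := stab_lin lA (@stab_gz R).
  by rewrite (_ : (fun j w => _) = (fun t w => bL 0 w t))//; apply/funext => t; apply/funext => w; rewrite mul0r.
have lA : @linmap R (unit + (R + R)) R (fun x t => tent t * x (inl tt) +
    s2 * (x (inr (inl (2 * t))) + x (inr (inr (2 * t - 1))))).
  split=> [t d T x mx|x y t|c x t]; [|ring|ring].
  by apply: measurable_funD; apply: measurable_funM => //; apply: measurable_funD.
exact: (stab_lin lA (stab_pair (@stab_gz R) (stab_pair IH IH))).
Qed.

Lemma measurable_bL l t : measurable_fun setT (fun w => bL l w t).
Proof. exact: (stab_bL l).1. Qed.

Lemma bL_supp l w t : ~~ ((0 < t) && (t < 1)) -> bL l w t = 0.
Proof.
elim: l w t => // l IH w t h /=; rewrite !IH; [|lra|lra].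
have -> : tent t = 0 by rewrite tentE; do ![case: ifP]; lra.
by rewrite mul0r addr0 mulr0 addr0.
Qed.

Lemma continuous_bL l w : continuous (bL l w).
Proof.
elim: l w => [|l IH] w t; first exact: cvg_cst.
rewrite /=; apply: cvgD; first by apply: cvgMl; exact: continuous_tent.
apply: cvgMr; apply: cvgD.
  apply: (@continuous_comp R R R (fun t => 2 * t) (bL l (th0 (th1 w)))); last exact: IH.
  by apply: cvgMr; exact: cvg_id.
apply: (@continuous_comp R R R (fun t => 2 * t - 1) (bL l (th1 (th1 w)))); last exact: IH.
by apply: cvgB; [apply: cvgMr; exact: cvg_id|exact: cvg_cst].
Qed.

Lemma mpres01 : mpres (fun w : R => th0 (th1 w)).
Proof. exact: mpres_comp mpres_th0 mpres_th1. Qed.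
Lemma mpres11 : mpres (fun w : R => th1 (th1 w)).
Proof. exact: mpres_comp mpres_th1 mpres_th1. Qed.

Lemma L4_bL l t : L4 (fun w => bL l w t).
Proof.
elim: l t => [|l IH] t /=; first exact: L4_cst.
apply: L4D; first by apply: L4Z; exact: (L4_mpres mpres_th0 L4_gz).
by apply: L4Z; apply: L4D; [exact: (L4_mpres mpres01 (IH _))|exact: (L4_mpres mpres11 (IH _))].
Qed.

Lemma E_bL l t : E (fun w => bL l w t) = 0.
Proof.
elim: l t => [|l IH] t /=; first exact: (E_cst 0).
have I0 := L4_Int (L4_mpres mpres_th0 (@L4_gz R)).
have I1 := L4_Int (L4_mpres mpres01 (L4_bL l (2 * t))).
have I2 := L4_Int (L4_mpres mpres11 (L4_bL l (2 * t - 1))).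
rewrite ED; [|exact: IntZ|by apply: IntZ; exact: IntD].
rewrite (EZ (tent t) I0) EZ; last exact: IntD.
rewrite ED// (mpres_E mpres01 (L4_Int (L4_bL l (2 * t)))) (mpres_E mpres11 (L4_Int (L4_bL l (2 * t - 1)))).
by rewrite !IH (mpres_E mpres_th0 (L4_Int (@L4_gz R))) E_gz addr0 !mulr0 addr0.
Qed.

Fixpoint KL (l : nat) (s t : R) : R := if l is l'.+1 then
  tent s * tent t + (KL l' (2 * s) (2 * t) + KL l' (2 * s - 1) (2 * t - 1)) / 2 else 0.

Lemma cov_bL l s t : E (fun w => bL l w s * bL l w t) = KL l s t.
Proof.
elim: l s t => [|l IH] s t /=; first by under eq_fun do rewrite mul0r; exact: (E_cst 0).
pose g u w := s2 * (bL l (th0 w) (2 * u) + bL l (th1 w) (2 * u - 1)).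
have Lg u : L4 (g u).
  by apply: L4Z; apply: L4D; [exact: (L4_mpres mpres_th0 (L4_bL l _))|exact: (L4_mpres mpres_th1 (L4_bL l _))].
have Eg u : E (g u) = 0.
  have I1 := L4_Int (L4_mpres mpres_th0 (L4_bL l (2 * u))).
  have I2 := L4_Int (L4_mpres mpres_th1 (L4_bL l (2 * u - 1))).
  rewrite /g EZ; last exact: IntD.
  rewrite ED// (mpres_E mpres_th0 (L4_Int (L4_bL l (2 * u)))) (mpres_E mpres_th1 (L4_Int (L4_bL l (2 * u - 1)))).
  by rewrite !E_bL addr0 mulr0.
rewrite (cov_add (f := fun w => tent s * gz w) (f' := fun w => tent t * gz w) (g := g s) (g' := g t))//; last 2 first.
- by apply: L4Z; exact: L4_gz.
- by apply: L4Z; exact: L4_gz.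
congr (_ + _).
  rewrite (_ : (fun w => _) = (fun w => tent s * tent t * gz w ^+ 2)); last by apply/funext => w; ring.
  have [_ G2 _] := Int_pow4 (@measurable_gz R) (@Int_gz4 R).
  by rewrite EZ// E_gz2 mulr1.
rewrite (_ : (fun w => _) = (fun w => (1 / 2) * ((bL l (th0 w) (2 * s) + bL l (th1 w) (2 * s - 1)) *
  (bL l (th0 w) (2 * t) + bL l (th1 w) (2 * t - 1))))); last first.
  by apply/funext => w; rewrite -s2E /g; ring.
rewrite EZ; last first.
  by apply: L4_Int_mul; apply: L4D; [exact: (L4_mpres mpres_th0 (L4_bL l _))|exact: (L4_mpres mpres_th1 (L4_bL l _))|
    exact: (L4_mpres mpres_th0 (L4_bL l _))|exact: (L4_mpres mpres_th1 (L4_bL l _))].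
rewrite (cov_add (f := fun w => bL l w (2 * s)) (f' := fun w => bL l w (2 * t))
  (g := fun w => bL l w (2 * s - 1)) (g' := fun w => bL l w (2 * t - 1))) ?E_bL//; [|exact: L4_bL..].
by rewrite !IH mulrC div1r.
Qed.

(** Extended by 0 outside of the open square, so that [KB_rec] holds for all reals and the copies on
    the two halves have disjoint supports. *)
Definition KB (s t : R) : R := if (0 < s < 1) && (0 < t < 1) then Num.min s t - s * t else 0.

Lemma KB_in s t : 0 <= s <= 1 -> 0 <= t <= 1 -> KB s t = Num.min s t - s * t.
Proof.
move=> /andP[s0 s1] /andP[t0 t1]; rewrite /KB; case: ifPn => // h.
have : s = 0 \/ s = 1 \/ t = 0 \/ t = 1 by lra.
by move=> [e|[e|[e|e]]]; rewrite e /Num.min; case: ifP; lra.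
Qed.

Lemma KB_outl s t : s <= 0 \/ 1 <= s -> KB s t = 0.
Proof. by move=> h; rewrite /KB; case: ifP => //; lra. Qed.

Lemma KB_outr s t : t <= 0 \/ 1 <= t -> KB s t = 0.
Proof. by move=> h; rewrite /KB; case: ifP => //; lra. Qed.

Lemma tent_out t : t <= 0 \/ 1 <= t -> tent t = 0.
Proof. by move=> h; rewrite tentE; do ![case: ifP]; lra. Qed.

Lemma KB_rec s t : KB s t = tent s * tent t + (KB (2 * s) (2 * t) + KB (2 * s - 1) (2 * t - 1)) / 2.
Proof.
have [hs|/andP[s0 s1]] : (s <= 0 \/ 1 <= s) \/ 0 < s < 1 by lra.
  by rewrite (KB_outl t hs) (tent_out hs) !KB_outl; lra.
have [ht|/andP[t0 t1]] : (t <= 0 \/ 1 <= t) \/ 0 < t < 1 by lra.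
  by rewrite (KB_outr s ht) (tent_out ht) !KB_outr; lra.
rewrite KB_in; [|lra|lra].
have tl u : 0 < u -> u <= 1 / 2 -> tent u = u by move=> ? ?; rewrite tentE; do ![case: ifP]; lra.
have tr u : u < 1 -> 1 / 2 <= u -> tent u = 1 - u by move=> ? ?; rewrite tentE; do ![case: ifP]; lra.
have [hs|hs] := leP s (1 / 2); have [ht|ht] := leP t (1 / 2).
- rewrite !tl// KB_in; [|lra|lra].
  by rewrite KB_outl; [rewrite /Num.min; do ![case: ifP]; lra|lra].
- rewrite (tl s)// (tr t)//; last lra.
  rewrite KB_outr; last lra.
  by rewrite KB_outl; [rewrite /Num.min; do ![case: ifP]; lra|lra].
- rewrite (tr s)// ?(tl t)//; last lra.
  rewrite KB_outl; last lra.
  by rewrite KB_outr; [rewrite /Num.min; do ![case: ifP]; lra|lra].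
- rewrite !tr//; [|lra|lra].
  rewrite KB_outl; last lra.
  by rewrite KB_in; [rewrite /Num.min; do ![case: ifP]; lra|lra|lra].
Qed.

(** The indicator is what makes the induction contract: among 2s and 2s - 1 at most one lies in ]0,
    1[, so only one of the two averaged errors survives. *)
Lemma KL_KB l s t : `|KB s t - KL l s t| <= (1 / 2) ^+ l * (0 < s < 1)%R%:R.
Proof.
elim: l s t => [|l IH] s t /=.
  rewrite subr0 mul1r /KB; case: (boolP (0 < s < 1)) => /= hs; last by rewrite normr0.
  by case: (boolP (0 < t < 1)) => /= ht; rewrite ?normr0 ?ler01// /Num.min; case: ifP => h;
    rewrite ler_norml; apply/andP; split; nra.
rewrite KB_rec.
have h1 := IH (2 * s) (2 * t); have h2 := IH (2 * s - 1) (2 * t - 1).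
set d1 := KB (2 * s) (2 * t) - _ in h1; set d2 := KB (2 * s - 1) _ - _ in h2.
rewrite (_ : _ - _ = (d1 + d2) / 2); last by rewrite /d1 /d2; field.
rewrite normrM (@ger0_norm _ (2^-1))// exprS.
have p0 : 0 <= (1 / 2 : R) ^+ l by rewrite exprn_ge0.
have := ler_norm_add h1 h2.
have : (1/2) ^+ l * (0 < 2 * s < 1)%R%:R + (1/2) ^+ l * (0 < 2 * s - 1 < 1)%R%:R <= (1/2) ^+ l * (0 < s < 1)%R%:R :> R.
  by rewrite -mulrDr ler_wpM2l//; do ![case: (boolP (_ && _)) => ?]; rewrite /=; lra.
by move=> ? ?; lra.
Qed.

Lemma cvg_KL s t : KL l s t @[l --> \oo] --> KB s t.
Proof.
apply/cvgrPdist_le => e e0.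
have h : `|1 / 2 : R| < 1 by rewrite ger0_norm; lra.
have /cvgrPdist_le/(_ _ e0) := cvg_expr h; apply: filterS => l; rewrite sub0r normrN ger0_norm ?exprn_ge0// => le.
apply: (le_trans (KL_KB l s t)); apply: le_trans le.
by case: (_ && _); rewrite ?mulr1// mulr0 exprn_ge0.
Qed.

(* [rb] and [cb] satisfy [4 * cb = rb^-4] and [2 * cb < 1]. *)
Definition rb : R := 9 / 10.
Definition cb : R := (10 / 9) ^+ 4 / 4.

Lemma rb01 : 0 <= rb < 1. Proof. by rewrite /rb; apply/andP; split; lra. Qed.
Lemma cb_gt0 : 0 < cb. Proof. by rewrite /cb divr_gt0// exprn_gt0// divr_gt0. Qed.
Lemma cb_lt : 0 <= 2 * cb < 1.
Proof.
by rewrite mulr_ge0 ?(ltW cb_gt0)//= /cb (exprM _ 2 2) !expr2; lra.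
Qed.
Lemma rb_small (c e : R) : 0 <= c -> 0 < e -> exists l, c * rb ^+ l < e.
Proof.
move=> c0 e0; have h : `|rb| < 1 by case/andP: rb01 => ? ?; rewrite ger0_norm.
have /cvgrPdist_lt/(_ e e0)[l _ hl] : c * rb ^+ n @[n --> \oo] --> (0 : R).
  by rewrite -[X in _ --> X](mulr0 c); apply: cvgMr; exact: cvg_expr.
exists l; have := hl l (leqnn l); rewrite sub0r normrN; apply: le_lt_trans; exact: ler_norm.
Qed.
Lemma rb4 : rb ^+ 4 = (4 * cb)^-1. Proof. by rewrite /rb /cb; field. Qed.

Definition dL l w t := bL l.+1 w t - bL l w t.

Lemma dL0 w t : dL 0 w t = tent t * gz (th0 w).
Proof. by rewrite /dL /= addr0 mulr0 addr0 subr0. Qed.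

Lemma dLS l w t : dL l.+1 w t = s2 * (dL l (th0 (th1 w)) (2 * t) + dL l (th1 (th1 w)) (2 * t - 1)).
Proof. by rewrite /dL /=; ring. Qed.

Lemma dL_supp l w t : ~~ ((0 < t) && (t < 1)) -> dL l w t = 0.
Proof. by move=> h; rewrite /dL !bL_supp// subrr. Qed.

(* [cb ^+ l * qL l] is summable almost surely and dominates the [l]-th level of the construction up to [rb ^+ 4 ^+ l]. *)
Fixpoint qL (l : nat) (w : R) : R := if l is l'.+1 then qL l' (th0 (th1 w)) + qL l' (th1 (th1 w))
  else gz (th0 w) ^+ 4.

Lemma qL_ge0 l w : 0 <= qL l w.
Proof. by elim: l w => [|l IH] w /=; [rewrite exprn_even_ge0|rewrite addr_ge0]. Qed.

(** The bumps of one level have disjoint supports, so at each t a single term remains, and it is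
    bounded by the sum over all nodes of the level, which does not depend on t. *)
Lemma dL_qL l w t : dL l w t ^+ 4 <= (1 / 4) ^+ l * qL l w.
Proof.
elim: l w t => [|l IH] w t.
  rewrite dL0 expr0 mul1r exprMn /=; apply: ler_piMl; first by rewrite exprn_even_ge0.
  have : 0 <= tent t <= 1 by rewrite tentE; do ![case: ifP]; lra.
  by move=> /andP[? ?]; rewrite exprn_ile1.
rewrite dLS exprMn (_ : s2 ^+ 4 = 1 / 4); last by rewrite (exprM _ 2 2) s2E; field.
rewrite [qL l.+1 w]/= (exprS _ l) -[X in _ <= X]mulrA; apply: ler_wpM2l; first lra.
have h1 := IH (th0 (th1 w)) (2 * t); have h2 := IH (th1 (th1 w)) (2 * t - 1).
have q1 := qL_ge0 l (th0 (th1 w)); have q2 := qL_ge0 l (th1 (th1 w)).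
have p0 : 0 <= (1 / 4 : R) ^+ l by rewrite exprn_ge0.
have [ht|ht] := leP t (1 / 2).
  by rewrite [X in _ + X]dL_supp ?addr0; [nra|lra].
by rewrite [X in X + _]dL_supp ?add0r; [nra|lra].
Qed.

Lemma Int_qL l : Int (qL l) /\ E (qL l) = 2 ^+ l * E (fun w => gz w ^+ 4).
Proof.
elim: l => [|l [I1 e1]] /=.
  split; first exact: (L4_mpres mpres_th0 L4_gz).2.
  by rewrite mul1r; exact: (mpres_E mpres_th0 (@Int_gz4 R)).
have J1 := mpres_Int mpres01 I1; have J2 := mpres_Int mpres11 I1.
split; first exact: (IntD J1 J2).
rewrite (ED J1 J2) (mpres_E mpres01 I1) (mpres_E mpres11 I1) e1 exprS; ring.
Qed.

Definition SL (w : R) : \bar R := (\sum_(l <oo) (cb ^+ l * qL l w)%:E)%E.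
Definition bgood : set R := [set w | SL w \is a fin_num].

Lemma cqL_ge0 l w : 0 <= cb ^+ l * qL l w.
Proof. by rewrite mulr_ge0 ?qL_ge0// exprn_ge0// /cb. Qed.

Lemma SL_ge0 w : (0 <= SL w)%E.
Proof. by apply: nneseries_ge0 => l _ _; rewrite lee_fin cqL_ge0. Qed.

Lemma measurable_SL : measurable_fun setT SL.
Proof.
apply: ge0_emeasurable_sum => [l w _ _|l _]; first by rewrite lee_fin cqL_ge0.
by apply/measurable_EFinP; apply: measurable_funM => //; exact: Int_measurable (Int_qL l).1.
Qed.

Lemma int_SL : (\int[lam]_w SL w < +oo)%E.
Proof.
rewrite integral_nneseries//; last 2 first.
- by move=> l; apply/measurable_EFinP; apply: measurable_funM => //; exact: Int_measurable (Int_qL l).1.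
- by move=> l w _; rewrite lee_fin cqL_ge0.
pose k := E (fun w : R => gz w ^+ 4).
have k0 : 0 <= k by apply: E_ge0 => w; rewrite exprn_even_ge0.
have tE l : (\int[lam]_w (cb ^+ l * qL l w)%:E = (k * (2 * cb) ^+ l)%:E)%E.
  rewrite (E_EFin (IntZ (cb ^+ l) (Int_qL l).1)) (EZ _ (Int_qL l).1) (Int_qL l).2 -/k (exprMn l 2 cb).
  by congr EFin; ring.
apply: (@le_lt_trans _ _ (k * (1 - 2 * cb)^-1)%:E); last exact: ltry.
have c1 := cb_lt.
apply: lime_le.
  by apply: is_cvg_nneseries => l _ _; rewrite tE lee_fin mulr_ge0// exprn_ge0//; case/andP: c1.
apply: nearW => n; under eq_bigr do rewrite tE.
by rewrite sumEFin lee_fin big_mkord -mulr_sumr ler_wpM2l// geo_sum_le.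
Qed.

Lemma bgood_ae : exists2 N, measurable N & lam N = 0%E /\ forall w, ~ N w -> bgood w.
Proof.
have : lam.-integrable setT SL.
  apply/integrableP; split; first exact: measurable_SL.
  by under eq_integral do rewrite gee0_abs ?SL_ge0//; exact: int_SL.
move=> /(integrable_ae measurableT)[N [mN N0 NP]]; exists N => //; split=> // w Nw.
by rewrite /bgood/=; apply: contrapT => h; apply: Nw; apply: NP => /= h'; apply: h; exact: h'.
Qed.

(** The random constant in front of the geometric rate at which the levels decrease uniformly in t;
    it has a fourth moment because [SL] is integrable. *)
Definition zb (w : R) : R := Num.sqrt (Num.sqrt (fine (SL w))).

Lemma zb_ge0 w : 0 <= zb w. Proof. exact: sqrtr_ge0. Qed.

Lemma zb4 w : zb w ^+ 4 = fine (SL w).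
Proof. by rewrite /zb (exprM _ 2 2) sqr_sqrtr ?sqrtr_ge0// sqr_sqrtr// fine_ge0// SL_ge0. Qed.

Lemma dL_le l w t : bgood w -> `|dL l w t| <= zb w * rb ^+ l.
Proof.
rewrite /bgood/= => fw.
have /andP[r0 _] := rb01.
rewrite -(@ler_pXn2r _ 4)// ?nnegrE ?mulr_ge0 ?exprn_ge0 ?zb_ge0//.
rewrite -normrX ger0_norm ?exprn_even_ge0// exprMn zb4.
have h : cb ^+ l * qL l w <= fine (SL w).
  rewrite -lee_fin fineK//; apply: (le_trans _ (nneseries_lim_ge l.+1 _)).
    by rewrite big_mkord big_ord_recr/= leeDr// sume_ge0// => i _; rewrite lee_fin cqL_ge0.
  by move=> i _ _; rewrite lee_fin cqL_ge0.
have c0 : 0 <= (4 * cb : R) ^- l by rewrite invr_ge0 exprn_ge0// mulr_ge0// ltW// cb_gt0.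
apply: (le_trans (dL_qL l w t)).
rewrite -exprM mulnC exprM rb4.
rewrite exprVn (_ : (1 / 4) ^+ l * qL l w = cb ^+ l * qL l w * (4 * cb) ^- l).
  by rewrite ler_wpM2r.
have c0' : cb ^+ l != 0 by rewrite expf_neq0// gt_eqF// cb_gt0.
have f0' : (4 : R) ^+ l != 0 by rewrite expf_neq0.
by rewrite (exprMn l 4 cb) (expr_div_n 1 4 l) expr1n; field; apply/andP.
Qed.

Lemma bL_sum l w t : bL l w t = \sum_(k < l) dL k w t.
Proof.
elim: l => [|l IH]; first by rewrite big_ord0.
by rewrite big_ord_recr/= -IH /dL -/(bL l.+1 w t) addrC subrK.
Qed.

(** The factor 10 is the sum of the geometric series of ratio [rb]. *)
Lemma bL_tail l k w t : bgood w -> `|bL (l + k) w t - bL l w t| <= 10 * zb w * rb ^+ l.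
Proof.
move=> gw; rewrite !bL_sum big_split_ord/= addrAC subrr add0r.
apply: (le_trans (ler_norm_sum _ _ _)).
apply: (@le_trans _ _ (\sum_(i < k) zb w * rb ^+ l * rb ^+ i)).
  by apply: ler_sum => i _; rewrite -mulrA -exprD; exact: dL_le.
have r0 := rb01.
have p0 : 0 <= zb w * rb ^+ l by rewrite mulr_ge0 ?zb_ge0// exprn_ge0//; case/andP: r0.
rewrite -mulr_sumr -[X in _ <= X]mulrA mulrC; apply: ler_wpM2r => //.
by apply: (le_trans (geo_sum_le k r0)); rewrite /rb -div1r ler_pdivrMr; lra.
Qed.

(* The paths are set to 0 on the null set where the construction does not converge uniformly. *)
Definition bl l (w t : R) : R := if w \in bgood then bL l w t else 0.
Definition bridge (w t : R) : R := limn (fun l => bl l w t).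

Lemma bl_tail l k w t : `|bl (l + k) w t - bl l w t| <= 10 * zb w * rb ^+ l.
Proof.
rewrite /bl; case: (boolP (w \in bgood)) => [|_]; first by rewrite inE; exact: bL_tail.
by rewrite subrr normr0 !mulr_ge0 ?zb_ge0 ?exprn_ge0//; case/andP: rb01.
Qed.

Lemma cvg_bl w t : bl l w t @[l --> \oo] --> bridge w t.
Proof.
apply: cauchy_cvg; apply: cauchy_exP => e e0.
have z0 : 0 <= 10 * zb w by rewrite mulr_ge0 ?zb_ge0.
have [l hl] := rb_small z0 e0; exists (bl l w t).
exists l => //= n /= ln; rewrite -(subnKC ln) /ball/= distrC.
by apply: le_lt_trans hl; exact: bl_tail.
Qed.

Lemma bridge_tail l w t : `|bridge w t - bl l w t| <= 10 * zb w * rb ^+ l.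
Proof.
have h : `|bl (n + l) w t - bl l w t| @[n --> \oo] --> `|bridge w t - bl l w t|.
  apply: cvg_norm; apply: cvgB; last exact: cvg_cst.
  by have := @cvg_bl w t; rewrite -(cvg_shiftn l).
apply: (cvgr_to_le h); apply: nearW => n; rewrite addnC; exact: bl_tail.
Qed.

Lemma bl0 w t : bl 0 w t = 0.
Proof. by rewrite /bl; case: ifP. Qed.

Lemma bridge_le w t : `|bridge w t| <= 10 * zb w.
Proof. by have := bridge_tail 0 w t; rewrite bl0 subr0 expr0 mulr1. Qed.

Lemma bl_le l w t : `|bl l w t| <= 10 * zb w.
Proof. by have := bl_tail 0 l w t; rewrite bl0 subr0 expr0 mulr1 add0n. Qed.

Lemma continuous_bl l w : continuous (bl l w).
Proof.
rewrite /bl; case: (w \in bgood); first exact: continuous_bL.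
by move=> t; exact: cvg_cst.
Qed.

Lemma continuous_bridge w : continuous (bridge w).
Proof.
move=> t; apply/cvgrPdist_lt => e e0.
have z0 : 0 <= 10 * zb w by rewrite mulr_ge0 ?zb_ge0.
have e3 : 0 < e / 3 by rewrite divr_gt0.
have [l hl] := rb_small z0 e3.
have /cvgrPdist_lt/(_ _ e3) := @continuous_bl l w t; apply: filterS => s hs.
have h1 := bridge_tail l w t; have h2 := bridge_tail l w s.
rewrite distrC in h2.
rewrite (_ : bridge w t - bridge w s = (bridge w t - bl l w t) + (bl l w t - bl l w s) +
  (bl l w s - bridge w s)); last by ring.
have := ler_norm_add (ler_norm_add h1 (lexx `|bl l w t - bl l w s|)) h2; lra.
Qed.

Lemma measurable_bgood : measurable bgood.
Proof.
rewrite (_ : bgood = SL @^-1` (EFin @` setT)); last first.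
  apply/seteqP; split => w; rewrite /bgood/= => h.
    by exists (fine (SL w)) => //; rewrite fineK.
  by case: h => r _ <-.
rewrite -[X in measurable X]setTI; apply: measurable_SL => //.
by apply: measurable_image_EFin; exact: measurableT.
Qed.

Lemma measurable_bl l t : measurable_fun setT (fun w => bl l w t).
Proof.
rewrite /bl; apply: measurable_fun_ifT => //; last exact: measurable_bL.
apply: (@measurable_fun_bool _ _ _ _ true); rewrite setTI (_ : _ @^-1` _ = bgood).
  exact: measurable_bgood.
by apply/seteqP; split => w /= h; [exact: set_mem|apply/esym/esym/mem_set].
Qed.

Lemma measurable_bridge t : measurable_fun setT (fun w => bridge w t).
Proof.
by apply: (@measurable_fun_cvg _ _ _ _ (fun l w => bl l w t)) => [l|x _]; [exact: measurable_bl|exact: cvg_bl].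
Qed.

Lemma L4_zb : L4 zb.
Proof.
have mf : measurable_fun setT (fun w => fine (SL w)) by apply: measurableT_comp => //; exact: measurable_SL.
have msq : measurable_fun setT (@Num.sqrt R) by apply: continuous_measurable_fun; exact: sqrt_continuous.
split; first by apply: measurableT_comp => //; apply: measurableT_comp.
under eq_fun do rewrite zb4.
apply: Int_ge0 => // [w|]; first by rewrite fine_ge0// SL_ge0.
apply: le_lt_trans int_SL; apply: ge0_le_integral => //.
- by move=> w _; rewrite lee_fin fine_ge0// SL_ge0.
- exact/measurable_EFinP.
- exact: measurable_SL.
- by move=> w _; have := SL_ge0 w; case: (SL w) => //= r r0; rewrite leey.
Qed.

Lemma L4_bridge t : L4 (fun w => bridge w t).
Proof.
split; first exact: measurable_bridge.
apply: (Int_le _ _ (L4Z 10 L4_zb).2); first by apply: measurable_funX; exact: measurable_bridge.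
by move=> w; rewrite normrX lerXn2r ?nnegrE ?mulr_ge0 ?zb_ge0// bridge_le.
Qed.

Lemma E_bl l s t : E (fun w => bl l w s * bl l w t) = KL l s t.
Proof.
rewrite -cov_bL; have [N mN [N0 NP]] := bgood_ae; apply/esym.
apply: (E_ae _ _ mN N0) => [||w /NP gw].
- by apply: L4_Int_mul; exact: L4_bL.
- by apply: measurable_funM; exact: measurable_bl.
- by rewrite /bl mem_set.
Qed.

Lemma cov_bridge s t : E (fun w => bridge w s * bridge w t) = KB s t.
Proof.
have Z2 : Int (fun w => (10 * zb w) * (10 * zb w)) by apply: L4_Int_mul; apply: L4Z; exact: L4_zb.
have c1 : E (fun w => bl l w s * bl l w t) @[l --> \oo] --> E (fun w => bridge w s * bridge w t).
  apply: (E_dct _ _ _ Z2) => [l|w|l w].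
  - by apply: measurable_funM; exact: measurable_bl.
  - by apply: cvgM; exact: cvg_bl.
  - by apply: ler_normM; exact: bl_le.
apply: (cvg_unique _ c1) => //=.
by under eq_fun do rewrite E_bl; exact: cvg_KL.
Qed.

Lemma E_bridge t : E (fun w => bridge w t) = 0.
Proof.
have c1 : E (fun w => bl l w t) @[l --> \oo] --> E (fun w => bridge w t).
  apply: (E_dct _ _ _ (L4_Int (L4Z 10 L4_zb))) => [l|w|l w]; [exact: measurable_bl|exact: cvg_bl|exact: bl_le].
apply: (cvg_unique _ c1) => //=.
have -> : (fun l => E (fun w => bl l w t)) = (fun _ => 0); last exact: cvg_cst.
apply/funext => l; rewrite -(E_bL l t); have [N mN [N0 NP]] := bgood_ae; apply/esym.
apply: (E_ae _ _ mN N0) => [||w /NP gw]; [exact: (L4_Int (L4_bL l t))|exact: measurable_bl|].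
by rewrite /bl mem_set.
Qed.

(** The bridge is a pointwise limit of finite levels, modified on a null set; both operations are
    allowed for [wstab] through bounded continuous test functions. *)
Lemma wstab_gz_bridge : wstab (fun c : unit + R => match c with
  inl _ => fun w => gz (th0 w) | inr t => fun w => bridge (th1 w) t end).
Proof.
have [N mN [N0 NP]] := bgood_ae.
pose pr l := fun c : unit + R => match c with
  inl _ => fun w => gz (th0 w) | inr t => fun w => bl l (th1 w) t end.
apply: (@wstab_lim _ _ pr) => [l|[u|t] w]; [|exact: cvg_cst|exact: cvg_bl].
have m1 : measurable (th1 @^-1` N) := measurable_th1 mN.
apply: (wstab_ae m1 _ _ _ (stab_wstab (stab_pair (@stab_gz R) (stab_bL l)))).
- by rewrite -N0; exact: (@mpres_th1 R).2.
- by move=> [u|t] w //= h; rewrite /bl mem_set//; apply: NP => h'; apply: h.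
- move=> [u|t]; first by apply: measurableT_comp; [exact: measurable_gz|exact: mth0].
  exact: (measurableT_comp (measurable_bl l t) (@mth1 R)).
Qed.

End Bridge.

(** * The beta distribution function and its integrals *)

Section Beta.
Context {R : realType}.
Local Notation mR := (measurableTypeR R).
Local Notation lam := (@lam R).
Local Notation mu := (@lebesgue_measure R).

Lemma is_derive_pow (n : nat) (g : R -> R) (x dg : R) : is_derive x 1 g dg ->
  is_derive x 1 (fun y => g y ^+ n) (n%:R * g x ^+ n.-1 * dg).
Proof.
move=> d; have -> : (fun y => g y ^+ n) = g ^+ n by apply/funext => y; rewrite exprfctE.
exact: (is_deriveX n d).
Qed.

(** By induction from x^a (1 - x)^(b+1) = x^a (1 - x)^b - x^(a+1) (1 - x)^b. The antiderivative is
    differentiable on the whole line, hence no boundary case at 0 and 1. *)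
Lemma antider (a b : nat) : exists F : R -> R, forall x : R, is_derive x 1 F (x ^+ a * (1 - x) ^+ b).
Proof.
elim: b a => [|b IH] a.
  exists (fun x => a.+1%:R^-1 * x ^+ a.+1) => x.
  have d := @is_derive_pow a.+1 id x 1 (is_derive_id _ _).
  by apply: is_derive_eq; rewrite /GRing.scale/= expr0; field.
have [F dF] := IH a; have [G dG] := IH a.+1.
by exists (fun x => F x - G x) => x; apply: is_derive_eq; rewrite /GRing.scale/= !exprS; ring.
Qed.

Lemma derive_continuous (F f : R -> R) : (forall x : R, is_derive x 1 F (f x)) -> continuous F.
Proof.
by move=> h x; apply: differentiable_continuous; apply/derivable1_diffP; have [] := h x.
Qed.

Lemma integral_FTC2 (F f : R -> R) (a b : R) : (forall x : R, is_derive x 1 F (f x)) -> continuous f ->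
  a <= b -> \int[mu]_(x in `[a, b]) f x = F b - F a.
Proof.
move=> dF cf; rewrite le_eqVlt => /predU1P[<-|ab].
  by rewrite subrr set_itv1 Rintegral_set1.
rewrite /Rintegral (@continuous_FTC2 _ f F)//.
- exact: continuous_subspaceT.
- have cF := derive_continuous dF; split.
  + by move=> x _; have [] := dF x.
  + by apply: cvg_at_right_filter; exact: cF.
  + by apply: cvg_at_left_filter; exact: cF.
- by move=> x _; rewrite derive1E; have [_] := dF x.
Qed.

Lemma E_leb (f : R -> R) : measurable_fun setT f -> E f = \int[mu]_(x in `[0, 1]) f x.
Proof.
move=> mf; rewrite /E /Rintegral; congr fine.
have mfE : measurable_fun setT (EFin \o f) by exact/measurable_EFinP.
have h (g : R -> \bar R) : measurable_fun setT g -> (forall x, 0 <= g x)%E ->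
    (\int[lam]_x g x = \int[mu]_(x in `[0%R, 1%R]) g x)%E.
  move=> mg g0; rewrite /lam integral_uniform// subr0 invr1 mul1e//.
rewrite integralE [RHS]integralE !h//.
- exact: measurable_funeneg.
- exact: measurable_funepos.
Qed.

Lemma continuous_pow (a b : nat) : continuous (fun x : R => x ^+ a * (1 - x) ^+ b).
Proof.
move=> x; apply: cvgM; first exact: exprn_continuous.
apply: (@continuous_comp R R R (fun x => 1 - x) (fun y => y ^+ b)); last exact: exprn_continuous.
by apply: cvgB; [exact: cvg_cst|exact: cvg_id].
Qed.

Lemma integral_beta (a b : nat) :
  \int[mu]_(x in `[0, 1]) (x ^+ a * (1 - x) ^+ b) = (a`! * b`!)%:R / (a + b).+1`!%:R.
Proof. by rewrite -beta_fun_fact /beta_fun Rintegral_mkcond. Qed.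

Lemma continuous_integrable (f : R -> R) (a b : R) : continuous f -> mu.-integrable `[a, b] (EFin \o f).
Proof.
move=> cf; apply: continuous_compact_integrable; first exact: segment_compact.
exact: continuous_subspaceT.
Qed.

Lemma integral_split (f : R -> R) (v : R) : continuous f -> 0 <= v <= 1 ->
  \int[mu]_(x in `[0, 1]) f x = \int[mu]_(x in `[0, v]) f x + \int[mu]_(x in `[v, 1]) f x.
Proof.
move=> cf /andP[v0 v1]; have := @Rintegral_itvB R f (BLeft 0) (BRight 1) v.
rewrite Rintegral_itv_obnd_cbnd; last first.
  apply: integrableS (continuous_integrable v 1 cf) => //.
  by apply: subset_itvr; rewrite bnd_simp.
by move=> <-; [rewrite addrC subrK|exact: continuous_integrable|rewrite bnd_simp|rewrite bnd_simp].
Qed.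

Variable m : nat.
Hypothesis m_gt0 : (0 < m)%N.

Definition Kc : R := ((2 * m).-1)`!%:R / (m.-1)`!%:R ^+ 2.
Definition hden (x : R) : R := Kc * (x ^+ m.-1 * (1 - x) ^+ m.-1).
Definition phi (x : R) : R := Kc * (x * (1 - x)) ^+ m.
Definition Fm : R -> R := sval (cid (antider m.-1 m.-1)).
Definition Hm (x : R) : R := Kc * (Fm x - Fm 0).

Lemma Kc_gt0 : 0 < Kc.
Proof. by rewrite divr_gt0 ?exprn_gt0// ltr0n fact_gt0. Qed.

Lemma dFm (x : R) : is_derive x 1 Fm (x ^+ m.-1 * (1 - x) ^+ m.-1).
Proof. exact: (svalP (cid (antider m.-1 m.-1))). Qed.

Lemma dHm (x : R) : is_derive x 1 Hm (hden x).
Proof. by have d := dFm x; apply: is_derive_eq; rewrite /GRing.scale/= subr0. Qed.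

Lemma dphi (x : R) : is_derive x 1 phi (m%:R * hden x * (1 - 2 * x)).
Proof.
have d1 : is_derive x 1 (fun x : R => x * (1 - x)) (1 - 2 * x).
  by apply: is_derive_eq; rewrite /GRing.scale/=; ring.
have d2 := @is_derive_pow m _ _ _ d1.
by rewrite /phi; apply: is_derive_eq; rewrite /GRing.scale/= /hden exprMn; ring.
Qed.

Lemma continuous_hden : continuous hden.
Proof. by move=> x; apply: cvgMr; exact: continuous_pow. Qed.

Lemma continuous_Hm : continuous Hm. Proof. exact: derive_continuous dHm. Qed.
Lemma continuous_phi : continuous phi. Proof. exact: derive_continuous dphi. Qed.

Lemma Hm0 : Hm 0 = 0. Proof. by rewrite /Hm subrr mulr0. Qed.

Lemma Hm1 : Hm 1 = 1.
Proof.
rewrite /Hm -(integral_FTC2 dFm _ ler01); last exact: continuous_pow.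
rewrite integral_beta /Kc -addSn prednK// natrM.
have -> : (m + m.-1)%N = (2 * m).-1 by rewrite mul2n -addnn; case: m m_gt0 => // k _; rewrite addnS.
have f0 k : k`!%:R != 0 :> R by rewrite pnatr_eq0 -lt0n fact_gt0.
by field; rewrite !f0.
Qed.

Lemma beta_cdfE (v : R) : 0 <= v -> beta_cdf m v = Hm v.
Proof.
move=> v0; rewrite /beta_cdf -/Kc /Hm -(integral_FTC2 dFm _ v0)//; exact: continuous_pow.
Qed.

Lemma hden01 (x : R) : 0 <= x <= 1 -> 0 <= hden x <= Kc.
Proof.
move=> /andP[x0 x1]; have K0 := Kc_gt0.
have h1 : 0 <= x ^+ m.-1 <= 1 by rewrite exprn_ge0//= exprn_ile1.
have h2 : 0 <= (1 - x) ^+ m.-1 <= 1 by rewrite exprn_ge0 ?subr_ge0//= exprn_ile1// ?subr_ge0//; lra.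
move: h1 h2 => /andP[? ?] /andP[? ?].
have h3 : 0 <= x ^+ m.-1 * (1 - x) ^+ m.-1 <= 1 by rewrite mulr_ge0//= mulr_ile1.
by rewrite /hden; move: h3 => /andP[? ?]; apply/andP; split; nra.
Qed.

Lemma Hm_le (x y : R) : 0 <= x -> x <= y -> y <= 1 -> 0 <= Hm y - Hm x <= Kc * (y - x).
Proof.
move=> x0; rewrite le_eqVlt => /predU1P[->|xy] y1; first by rewrite !subrr mulr0 lexx.
have [c /[!in_itv]/= /andP[c1 c2] ->] := MVT xy (fun x _ => dHm x) (continuous_subspaceT continuous_Hm).
have /andP[h0 h1] : 0 <= hden c <= Kc by apply: hden01; apply/andP; split; lra.
by rewrite mulr_ge0 ?subr_ge0 ?(ltW xy)//= ler_wpM2r// subr_ge0 ltW.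
Qed.

Lemma Hm01 (x : R) : 0 <= x <= 1 -> 0 <= Hm x <= 1.
Proof.
move=> /andP[x0 x1]; have := Hm_le (lexx 0) x0 x1; have := Hm_le x0 x1 (lexx 1).
by rewrite Hm0 Hm1 subr0; lra.
Qed.

(** An antiderivative of [Hm]: integration by parts leaves the integral of v [hden], and the
    derivative of [phi] is m (1 - 2v) [hden]. *)
Definition Psi (v : R) : R := phi v / (2 * m)%:R + Hm v * (v - 1 / 2).

Lemma m_neq0 : m%:R != 0 :> R. Proof. by rewrite pnatr_eq0 -lt0n. Qed.

Lemma dPsi (v : R) : is_derive v 1 Psi (Hm v).
Proof.
have d1 := dphi v; have d2 := dHm v; apply: is_derive_eq; rewrite /GRing.scale/= natrM.
by field; exact: m_neq0.
Qed.

Lemma phi0 : phi 0 = 0. Proof. by rewrite /phi mul0r expr0n gtn_eqF// mulr0. Qed.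
Lemma phi1 : phi 1 = 0. Proof. by rewrite /phi subrr mulr0 expr0n gtn_eqF// mulr0. Qed.

(** This will be the covariance of B(Hm v) with the path integral, and is the origin of the factor
    (v (1 - v))^m / (2m) in the corrections. *)
Lemma integral_cov (v : R) : 0 <= v <= 1 ->
  \int[mu]_(s in `[0, 1]) (Num.min (Hm v) (Hm s) - Hm v * Hm s) = phi v / (2 * m)%:R.
Proof.
move=> v01; have /andP[v0 v1] := v01.
have cg : continuous (fun s => Num.min (Hm v) (Hm s) - Hm v * Hm s).
  move=> s; apply: cvgB; last by apply: cvgMr; exact: continuous_Hm.
  suff h : continuous ((fun=> Hm v : R^o) \min (Hm : R -> R^o)) by exact: h.
  by move=> t; apply: continuous_min; [exact: cvg_cst|exact: continuous_Hm].
rewrite (integral_split cg v01).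
have i1 : \int[mu]_(s in `[0, v]) (Num.min (Hm v) (Hm s) - Hm v * Hm s) = (1 - Hm v) * Psi v - (1 - Hm v) * Psi 0.
  rewrite -(@integral_FTC2 (fun s => (1 - Hm v) * Psi s) (fun s => (1 - Hm v) * Hm s) 0 v _ _ v0).
  - apply: eq_Rintegral => s; rewrite inE/= in_itv/= => /andP[s0 s1].
    by have := Hm_le s0 s1 v1; rewrite minEle; case: ifP; lra.
  - by move=> x; have d := dPsi x; apply: is_derive_eq; rewrite /GRing.scale/=; ring.
  - by move=> x; apply: cvgMr; exact: continuous_Hm.
have i2 : \int[mu]_(s in `[v, 1]) (Num.min (Hm v) (Hm s) - Hm v * Hm s) = Hm v * (1 - Psi 1) - Hm v * (v - Psi v).
  rewrite -(@integral_FTC2 (fun s => Hm v * (s - Psi s)) (fun s => Hm v * (1 - Hm s)) v 1 _ _ v1).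
  - apply: eq_Rintegral => s; rewrite inE/= in_itv/= => /andP[s0 s1].
    by have := Hm_le v0 s0 s1; rewrite minEle; case: ifP; lra.
  - by move=> x; have d := dPsi x; apply: is_derive_eq; rewrite /GRing.scale/=; ring.
  - by move=> x; apply: cvgMr; apply: cvgB; [exact: cvg_cst|exact: continuous_Hm].
rewrite i1 i2 /Psi phi0 phi1 Hm0 Hm1 natrM; field; exact: m_neq0.
Qed.

(** Divided by 2m it becomes 1 / (4 (2m + 1)), the variance of the path integral. *)
Lemma integral_phi : \int[mu]_(s in `[0, 1]) phi s = m%:R / (2 * (2 * m + 1))%:R.
Proof.
have -> : \int[mu]_(s in `[0, 1]) phi s = Kc * \int[mu]_(s in `[0, 1]) (s ^+ m * (1 - s) ^+ m).
  rewrite -RintegralZl//; last by apply: continuous_integrable; exact: continuous_pow.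
  by apply: eq_Rintegral => s _; rewrite /phi exprMn.
rewrite integral_beta /Kc.
have f0 k : k`!%:R != 0 :> R by rewrite pnatr_eq0 -lt0n fact_gt0.
have -> : (m + m).+1`! = ((m + m).+1 * ((m + m) * (2 * m).-1`!))%N.
  rewrite factS -[in X in (_ * X)%N](prednK (n := (m + m)%N)) ?addn_gt0 ?m_gt0// factS prednK ?addn_gt0 ?m_gt0//.
  by rewrite mul2n addnn.
have -> : m`! = (m * m.-1`!)%N by rewrite -[in LHS](prednK m_gt0) factS prednK.
rewrite !natrM !natrD -natr1 !natrD.
have m0 := m_neq0; have m1 : 0 < m%:R :> R by rewrite ltr0n.
have n1 : m%:R + m%:R + 1 != 0 :> R by rewrite gt_eqF//; lra.
have n2 : m%:R + m%:R != 0 :> R by rewrite gt_eqF//; lra.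
rewrite addr0; move: n1 n2 m0 (f0 (2 * m).-1%N) (f0 m.-1).
move: (m%:R : R) ((2 * m).-1`!%:R : R) (m.-1`!%:R : R) => a b c n1 n2 a0 b0 c0.
by field; rewrite n1 n2 b0 c0.
Qed.

End Beta.

(** * Uniform continuity and dyadic Riemann sums *)

Section Riemann.
Context {R : realType}.
Local Notation mR := (measurableTypeR R).
Local Notation lam := (@lam R).

Lemma heine (f : R -> R) (e : R) : continuous f -> 0 < e -> exists2 d : R, 0 < d &
  forall x y : R, 0 <= x <= 1 -> `|x - y| < d -> `|f x - f y| < e.
Proof.
move=> cf e0.
have /compact_near_coveringP := @segment_compact R 0 1.
move=> /(_ _ (0 : R)^'+ (fun d x => forall y, `|x - y| < d -> `|f x - f y| < e) _) h.
have [d [d0 hd]] : exists d : R, 0 < d /\ `[(0:R), 1]%classic `<=` (fun x => forall y, `|x - y| < d -> `|f x - f y| < e).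
  apply: (@filter_ex _ ((0 : R)^'+)); apply: filterI; first exact: nbhs_right_gt.
  apply: h => x _.
  have e2 : 0 < e / 2 by rewrite divr_gt0.
  have /cvgrPdist_lt/(_ _ e2)/nbhs_ballP[n /= n0 hn] := cf x.
  have n2 : 0 < n / 2 by rewrite divr_gt0.
  exists (ball x (n / 2), [set d | d < n / 2]).
    split; [exact: nbhsx_ballx|exact: nbhs_right_lt].
  move=> [x' d] /= [xx' dn] y yd.
  have xx : `|x - x'| < n / 2 := xx'.
  have h1 : `|f x - f x'| < e / 2 by apply: hn; rewrite /ball/=; lra.
  have h2 : `|f x - f y| < e / 2.
    apply: hn; rewrite /ball/= -(subrKA x'); have := ler_normD (x - x') (x' - y); lra.
  by rewrite -(subrKA (f x)); have := ler_normD (f x' - f x) (f x - f y); rewrite (distrC (f x')); lra.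
by exists d => // x y x01 xy; apply: hd => //; rewrite /= in_itv.
Qed.

(* Dyadic Riemann sums: unlike the integral they are linear maps on paths that use finitely many coordinates. *)
Fixpoint Rs (l : nat) (f : R -> R) : R := if l is l'.+1 then
  (Rs l' (fun s => f (s / 2)) + Rs l' (fun s => f ((s + 1) / 2))) / 2 else f 0.

Lemma E_halves (f : R -> R) c : measurable_fun setT f -> (forall x, `|f x| <= c) ->
  E f = (E (fun s => f (s / 2)) + E (fun s => f ((s + 1) / 2))) / 2.
Proof.
move=> mf fc.
have h2 : 0 <= (2^-1 : R) by lra.
have key (g : R -> \bar R) : measurable_fun setT g -> (forall x, 0 <= g x)%E ->
   (\int[lam]_x g x = 2^-1%:E * (\int[lam]_x g (h0 x) + \int[lam]_x g (h1 x)))%E.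
  move=> mg g0.
  pose m2 := mscale (NngNum h2) (measure_add (pfm lam (@mh0 R)) (pfm lam (@mh1 R))).
  have m2E B : m2 B = (2^-1%:E * (lam (h0 @^-1` B) + lam (h1 @^-1` B)))%E.
    by rewrite /m2 /mscale/= /measure_add/= /msum big_ord_recl big_ord1.
  transitivity (\int[m2]_x g x)%E.
    by apply: eq_measure_integral => A mA _; apply: (etrans (lam_halves mA)); exact: esym (m2E A).
  rewrite /m2 ge0_integral_mscale; [|exact: measurableT|exact: mg|by move=> x _; exact: g0].
  rewrite [_%:num]/= (ge0_integral_measure_add (pfm lam (@mh0 R)) (pfm lam (@mh1 R)) measurableT (fun x _ => g0 x) mg).
  congr (_ * (_ + _))%E; apply: esym.
    exact: (@integral_law _ _ _ mR mR lam (pfm lam (@mh0 R)) h0 g (@mh0 R)).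
  exact: (@integral_law _ _ _ mR mR lam (pfm lam (@mh1 R)) h1 g (@mh1 R)).
have mh (h : R -> R) : measurable_fun setT h -> measurable_fun setT (fun s => f (h s)).
  by move=> mh; exact: measurableT_comp.
have If : Int f := Int_bounded mf fc.
have I0 : Int (fun s => f (h0 s)) := Int_bounded (mh _ (@mh0 R)) (fun _ => fc _).
have I1 : Int (fun s => f (h1 s)) := Int_bounded (mh _ (@mh1 R)) (fun _ => fc _).
have IC : Int (cst c : R -> R) := Int_cst c.
have := key (fun x => (f x + c)%:E) _ _.
rewrite (E_EFin (IntD If IC)) (E_EFin (IntD I0 IC)) (E_EFin (IntD I1 IC)) -EFinD -EFinM.
rewrite (ED If IC) (ED I0 IC) (ED I1 IC) E_cst => h.
have {}h : E f + c = 2^-1 * (E (fun s => f (h0 s)) + c + (E (fun s => f (h1 s)) + c)).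
  apply: EFin_inj; apply: h.
    by apply/measurable_EFinP; exact: measurable_funD.
  by move=> x; rewrite lee_fin; have := fc x; rewrite ler_norml => /andP[? _]; lra.
by rewrite -[E (fun s => f (s / 2))]/(E (fun s => f (h0 s))) -[E (fun s => f ((s + 1) / 2))]/(E (fun s => f (h1 s))); lra.
Qed.

(** Composing with [clip] makes a bound known on [0, 1] hold at every real, as [E_abs_le] asks. *)
Lemma E_clip (f : R -> R) c : measurable_fun setT f -> (forall x, `|f x| <= c) -> E f = E (fun s => f (clip s)).
Proof.
move=> mf fc; apply: (E_ae (N := ~` `[0, 1[%classic)) => [||||x].
- exact: Int_bounded mf fc.
- apply: measurableT_comp => //; rewrite /clip; apply: measurable_maxr => //; exact: measurable_minr.
- by apply: measurableC.
- by rewrite probability_setC// lam01 subee.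
- by move=> /= /contrapT; rewrite in_itv/= clipE => /andP[? ?]; do ![case: ifP]; [move=> ?; congr f|..]; lra.
Qed.

Lemma Rs_E (l : nat) (f : R -> R) c e : measurable_fun setT f -> (forall x, `|f x| <= c) ->
  (forall x y, 0 <= x <= 1 -> 0 <= y <= 1 -> `|x - y| <= (1 / 2) ^+ l -> `|f x - f y| <= e) ->
  `|E f - Rs l f| <= e.
Proof.
have mclip : measurable_fun setT (@clip R) by rewrite /clip; apply: measurable_maxr => //; exact: measurable_minr.
elim: l f => [|l IH] f mf fc h.
  rewrite (E_clip mf fc) /= -[X in _ - X]E_cst -EB; last 2 first.
  - by apply: (@Int_bounded _ _ c) => //; exact: measurableT_comp.
  - exact: Int_cst.
  apply: E_abs_le; first by apply: measurable_funB => //; exact: measurableT_comp.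
  move=> x; apply: h; rewrite ?clip01 ?lexx ?ler01// subr0 expr0.
  by have /andP[? ?] := clip01 x; rewrite ger0_norm.
rewrite (E_halves mf fc) /=.
have h0' : `|E (fun s => f (s / 2)) - Rs l (fun s => f (s / 2))| <= e.
  apply: IH => // [|x y /andP[? ?] /andP[? ?] xy].
    by apply: measurableT_comp => //; exact: (@mh0 R).
  apply: h; [lra|lra|]; rewrite -mulrBl normrM (@ger0_norm _ 2^-1); last lra.
  by rewrite exprS; lra.
have h1' : `|E (fun s => f ((s + 1) / 2)) - Rs l (fun s => f ((s + 1) / 2))| <= e.
  apply: IH => // [|x y /andP[? ?] /andP[? ?] xy].
    by apply: measurableT_comp => //; exact: (@mh1 R).
  apply: h; [lra|lra|]; rewrite -mulrBl opprD addrACA subrr addr0 normrM (@ger0_norm _ 2^-1); last lra.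
  by rewrite exprS; lra.
rewrite -mulrBl opprD addrACA normrM (@ger0_norm _ 2^-1); last lra.
have := ler_norm_add h0' h1'; lra.
Qed.

Lemma cvg_Rs (f : R -> R) c : continuous f -> (forall x, `|f x| <= c) -> Rs l f @[l --> \oo] --> E f.
Proof.
move=> cf fc; have mf := continuous_measurable_fun cf.
apply/cvgrPdist_le => e e0; have [d d0 hd] := heine cf e0.
have h : `|1 / 2 : R| < 1 by rewrite ger0_norm; lra.
have /cvgrPdist_lt/(_ _ d0) := cvg_expr h; apply: filterS => l.
rewrite sub0r normrN ger0_norm ?exprn_ge0// => ld.
apply: (Rs_E mf fc) => x y x01 _ xy; apply: ltW; apply: hd => //; exact: le_lt_trans ld.
Qed.

Lemma RsD l f g : Rs l (fun s => f s + g s) = Rs l f + Rs l g.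
Proof. by elim: l f g => //= l IH f g; rewrite !IH; ring. Qed.

Lemma RsZ l c f : Rs l (fun s => c * f s) = c * Rs l f.
Proof. by elim: l f => //= l IH f; rewrite !IH; ring. Qed.

Lemma measurable_Rs d (T : measurableType d) l (f : R -> T -> R) : (forall s, measurable_fun setT (f s)) ->
  measurable_fun setT (fun t => Rs l (f ^~ t)).
Proof.
elim: l f => [|l IH] f mf /=; first exact: mf.
apply: measurable_funM => //; apply: measurable_funD.
  by apply: (IH (fun s => f (s / 2))).
by apply: (IH (fun s => f ((s + 1) / 2))).
Qed.

Lemma cvg_Rs_pt (f_ : nat -> R -> R) (f : R -> R) l : (forall s, f_ ^~ s @ \oo --> f s) ->
  Rs l (f_ n) @[n --> \oo] --> Rs l f.
Proof.
elim: l f_ f => [|l IH] f_ f h /=; first exact: h.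
apply: cvgMl; apply: cvgD.
  by apply: (IH (fun n s => f_ n (s / 2)) (fun s => f (s / 2))).
by apply: (IH (fun n s => f_ n ((s + 1) / 2)) (fun s => f ((s + 1) / 2))).
Qed.

Lemma Int_Rs l (f : R -> R -> R) : (forall s, Int (f s)) -> Int (fun w => Rs l (f ^~ w)) /\
  E (fun w => Rs l (f ^~ w)) = Rs l (fun s => E (f s)).
Proof.
elim: l f => [|l IH] f If /=; first by split.
have [I1 e1] := IH (fun s => f (s / 2)) (fun s => If _).
have [I2 e2] := IH (fun s => f ((s + 1) / 2)) (fun s => If _).
have -> : (fun w => (Rs l (fun s => f (s / 2) w) + Rs l (fun s => f ((s + 1) / 2) w)) / 2) =
  (fun w => 2^-1 * (Rs l (fun s => f (s / 2) w) + Rs l (fun s => f ((s + 1) / 2) w))).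
  by apply/funext => w; rewrite mulrC.
split; first by apply: IntZ; exact: IntD.
by rewrite EZ; [rewrite ED// e1 e2 mulrC|exact: IntD].
Qed.

Lemma Rs_le l f c : (forall x, `|f x| <= c) -> `|Rs l f| <= c.
Proof.
elim: l f => [|l IH] f fc /=; first exact: fc.
have := ler_norm_add (IH (fun s => f (s / 2)) (fun s => fc _)) (IH (fun s => f ((s + 1) / 2)) (fun s => fc _)).
by rewrite normrM (@ger0_norm _ 2^-1); lra.
Qed.

End Riemann.

(** * The limiting process *)

Section Limits.
Context {R : realType}.
Local Notation mR := (measurableTypeR R).
Local Notation lam := (@lam R).
Local Notation th0 := (@th0 R).
Local Notation th1 := (@th1 R).
Local Notation mu := (@lebesgue_measure R).

Lemma continuous_clip : continuous (@clip R).
Proof.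
suff h : continuous ((fun=> 0 : R^o) \max ((fun t => t : R^o) \min (fun=> 1 : R^o))) by exact: h.
move=> t; apply: continuous_max; first exact: cvg_cst.
by apply: continuous_min; [exact: cvg_id|exact: cvg_cst].
Qed.

Lemma measurable_continuous (f : R -> R) : continuous f -> measurable_fun setT f.
Proof. by move=> cf; exact: continuous_measurable_fun. Qed.

Lemma clip_id (x : R) : 0 <= x <= 1 -> clip x = x.
Proof. by move=> /andP[? ?]; rewrite clipE; do ![case: ifP]; lra. Qed.

Lemma KB_clip (t u : R) : 0 <= u <= 1 -> KB t u = Num.min (clip t) u - clip t * u.
Proof.
move=> /andP[u0 u1]; have [ht|[ht|ht]] : 0 <= t <= 1 \/ t < 0 \/ 1 < t by lra.
- by rewrite clip_id// KB_in//; lra.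
- by rewrite KB_outl; [rewrite clip_lt0// minEle; case: ifP; lra|lra].
- by rewrite KB_outl; [rewrite clip_ge1 ?(ltW ht)// minEle; case: ifP; lra|lra].
Qed.

Lemma KB_le1 (s t : R) : `|KB s t| <= 1.
Proof.
rewrite /KB; case: ifP => [/andP[/andP[? ?] /andP[? ?]]|_]; last by rewrite normr0.
by rewrite minEle; case: ifP => ?; rewrite ler_norml; apply/andP; split; nra.
Qed.

Variable m : nat.
Hypothesis m_gt0 : (0 < m)%N.
Local Notation Hm := (@Hm R m).
Local Notation phi := (@phi R m).

(* [Hm] outside of [0, 1] is a polynomial and not a distribution function, hence the clipping. *)
Definition Hc (s : R) : R := Hm (clip s).

Lemma Hc01 s : 0 <= Hc s <= 1.
Proof. exact: Hm01 (clip01 s). Qed.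

Lemma continuous_Hc : continuous Hc.
Proof.
by move=> s; apply: (@continuous_comp R R R (@clip R) Hm); [exact: continuous_clip|exact: continuous_Hm].
Qed.

Lemma beta_cdf_Hc (v : R) : 0 <= v <= 1 -> beta_cdf m v = Hc v.
Proof. by move=> v01; rewrite /Hc clip_id// beta_cdfE//; case/andP: v01. Qed.

Lemma continuous_KBr (t : R) : continuous (fun s => KB t (Hc s)).
Proof.
have -> : (fun s => KB t (Hc s)) = (fun s => Num.min (clip t) (Hc s) - clip t * Hc s).
  by apply/funext => s; rewrite KB_clip// Hc01.
move=> s; apply: cvgB; last by apply: cvgMr; exact: continuous_Hc.
suff h : continuous ((fun=> clip t : R^o) \min (Hc : R -> R^o)) by exact: h.
by move=> u; apply: continuous_min; [exact: cvg_cst|exact: continuous_Hc].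
Qed.

(** The covariance of the bridge at t with its integral, see [cov_bridge_bI]. *)
Definition cov1 (t : R) : R := E (fun s => KB t (Hc s)).

Lemma Int_KBr t : Int (fun s => KB t (Hc s)).
Proof.
apply: (@Int_bounded _ _ 1); last by move=> x; exact: KB_le1.
(apply: measurable_continuous; exact: (@continuous_KBr t)).
Qed.

Lemma cov1_Hc (s : R) : cov1 (Hc s) = phi (clip s) / (2 * m)%:R.
Proof.
rewrite -(integral_cov m_gt0 (clip01 s)) /cov1 E_leb; last by (apply: measurable_continuous; exact: (@continuous_KBr _)).
apply: eq_Rintegral => u; rewrite inE/= in_itv/= => u01.
by rewrite KB_clip ?Hc01// (clip_id (Hc01 s)) /Hc (clip_id u01).
Qed.

Lemma cov1_lip (s t : R) : `|cov1 s - cov1 t| <= 2 * `|clip s - clip t|.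
Proof.
rewrite /cov1 -EB; [|exact: Int_KBr..].
apply: E_abs_le => [|x].
  by apply: measurable_funB; (apply: measurable_continuous; exact: (@continuous_KBr _)).
rewrite !KB_clip ?Hc01//; have /andP[u0 u1] := Hc01 x.
have h1 := ler_norm (clip s - clip t); have h2 := ler_norm (- (clip s - clip t)); rewrite normrN in h2.
by rewrite !minEle; do ![case: ifP => ?]; rewrite ler_norml; apply/andP; split; nra.
Qed.

Lemma continuous_cov1 : continuous cov1.
Proof.
move=> t; apply/cvgrPdist_lt => e e0.
have e2 : 0 < e / 2 by rewrite divr_gt0.
have /cvgrPdist_lt/(_ _ e2) := @continuous_clip t; apply: filterS => s hs.
by have := cov1_lip t s; lra.
Qed.

Lemma measurable_cov1_Hc : measurable_fun setT (fun s => cov1 (Hc s)).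
Proof.
apply: measurable_continuous => s.
by apply: (@continuous_comp R R R Hc cov1); [exact: continuous_Hc|exact: continuous_cov1].
Qed.

Lemma E_cov1 : E (fun s => cov1 (Hc s)) = (4 * (2 * m + 1))%:R^-1.
Proof.
rewrite E_leb; last exact: measurable_cov1_Hc.
transitivity ((2 * m)%:R^-1 * \int[mu]_(s in `[0, 1]) phi s).
  rewrite -RintegralZl//; last by apply: continuous_integrable; exact: continuous_phi.
  by apply: eq_Rintegral => u; rewrite inE/= in_itv/= => u01; rewrite cov1_Hc clip_id// mulrC.
rewrite (integral_phi m_gt0) !natrM natrD.
have m1 : 0 < m%:R :> R by rewrite ltr0n.
have n1 : 2 * m%:R + 1 != 0 :> R by rewrite gt_eqF//; lra.
rewrite natrM; have n2 : m%:R != 0 :> R by rewrite gt_eqF.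
by field; rewrite n1 n2.
Qed.

Definition bI (y : R) : R := E (fun s => bridge y (Hc s)).

Lemma continuous_bridge_Hc y : continuous (fun s => bridge y (Hc s)).
Proof.
move=> s; apply: (@continuous_comp R R R Hc (bridge y)); first exact: continuous_Hc.
exact: continuous_bridge.
Qed.

Lemma cvg_bI y : Rs l (fun s => bridge y (Hc s)) @[l --> \oo] --> bI y.
Proof. by apply: (cvg_Rs (c := 10 * zb y)); [exact: continuous_bridge_Hc|move=> x; exact: bridge_le]. Qed.

Lemma bI_le y : `|bI y| <= 10 * zb y.
Proof.
apply: E_abs_le; first by (apply: measurable_continuous; exact: (@continuous_bridge_Hc y)).
by move=> x; exact: bridge_le.
Qed.

Lemma measurable_bI : measurable_fun setT bI.
Proof.
apply: (@measurable_fun_cvg _ _ _ _ (fun l y => Rs l (fun s => bridge y (Hc s)))) => [l|y _].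
  by apply: measurable_Rs => s; exact: measurable_bridge.
exact: cvg_bI.
Qed.

Lemma L4_bI : L4 bI.
Proof.
split; first exact: measurable_bI.
apply: (Int_le _ _ (L4Z 10 L4_zb).2); first by apply: measurable_funX; exact: measurable_bI.
by move=> w; rewrite normrX lerXn2r ?nnegrE ?mulr_ge0 ?zb_ge0// bI_le.
Qed.

(** Expectation and path integral are exchanged through Riemann sums: for these it is finite
    linearity, and both sides pass to the limit, the first under the domination by [zb]. *)
Lemma E_mul_bI (f : R -> R) c : L4 f -> continuous (fun s => E (fun y => f y * bridge y (Hc s))) ->
  (forall s, `|E (fun y => f y * bridge y (Hc s))| <= c) ->
  E (fun y => f y * bI y) = E (fun s => E (fun y => f y * bridge y (Hc s))).
Proof.
move=> lf cf fc.
have c1 : E (fun y => f y * Rs l (fun s => bridge y (Hc s))) @[l --> \oo] --> E (fun y => f y * bI y).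
  apply: (@E_dct _ _ _ (fun y => `|f y| * (10 * zb y))) => [l|y|l y|].
  - by apply: measurable_funM; [exact: lf.1|apply: measurable_Rs => s; exact: measurable_bridge].
  - by apply: cvgMr; exact: cvg_bI.
  - by rewrite normrM ler_wpM2l// Rs_le// => x; exact: bridge_le.
  - have := Int_abs (L4_Int_mul lf (L4Z 10 (@L4_zb R))).
    by under eq_fun => y do rewrite normrM (@ger0_norm _ (10 * _)) ?mulr_ge0 ?zb_ge0//.
apply: (cvg_unique _ c1) => //=.
have -> : (fun l => E (fun y => f y * Rs l (fun s => bridge y (Hc s)))) =
   (fun l => Rs l (fun s => E (fun y => f y * bridge y (Hc s)))).
  apply/funext => l.
  rewrite -(Int_Rs l (fun s => L4_Int_mul lf (L4_bridge (Hc s)))).2.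
  by congr E; apply/funext => y; rewrite -RsZ.
exact: cvg_Rs cf fc.
Qed.

Lemma E_bI : E bI = 0.
Proof.
have := @E_mul_bI (fun=> 1) 0 (L4_cst 1).
have e s : E (fun y => 1 * bridge y (Hc s)) = 0.
  by under eq_fun do rewrite mul1r; exact: E_bridge.
have -> : (fun y => 1 * bI y) = bI by apply/funext => y; rewrite mul1r.
move=> ->; first by under eq_fun do rewrite e; exact: (E_cst 0).
- by move=> s; rewrite /continuous_at; under eq_fun do rewrite e; rewrite e; exact: cvg_cst.
- by move=> s; rewrite e normr0.
Qed.

Lemma cov_bridge_bI t : E (fun y => bridge y t * bI y) = cov1 t.
Proof.
rewrite (E_mul_bI (c := 1) (L4_bridge t)).
- by under eq_fun do rewrite cov_bridge.
- by under eq_fun do rewrite cov_bridge; exact: continuous_KBr.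
- by move=> s; rewrite cov_bridge KB_le1.
Qed.

Lemma cov1_le1 t : `|cov1 t| <= 1.
Proof.
by apply: E_abs_le => [|x]; [(apply: measurable_continuous; exact: (@continuous_KBr _))|exact: KB_le1].
Qed.

Lemma var_bI : E (fun y => bI y * bI y) = (4 * (2 * m + 1))%:R^-1.
Proof.
have e s : E (fun y => bI y * bridge y (Hc s)) = cov1 (Hc s).
  by rewrite -cov_bridge_bI; congr E; apply/funext => y; rewrite mulrC.
rewrite (E_mul_bI (c := 1) L4_bI).
- by under eq_fun do rewrite e; exact: E_cov1.
- under eq_fun do rewrite e; move=> s.
  by apply: (@continuous_comp R R R Hc cov1); [exact: continuous_Hc|exact: continuous_cov1].
- by move=> s; rewrite e cov1_le1.
Qed.

(** The inverse of the variance of [bI], hence the coefficient of the regression of the path on its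
    integral. *)
Let q4 : R := (4 * (2 * m + 1))%:R.

(* For [al ^+ 2 = 4 (2m+1)] this is a Brownian bridge in [t], and for [al = 2] the limit of the ratio process at [t = Hm v]; [corrected_path] only changes [al]. *)
Definition Zq (al x y t : R) : R := bridge y t - q4 * cov1 t * bI y + al * cov1 t * x.
Definition Zp (al : R) (t w : R) : R := Zq al (gz (th0 w)) (th1 w) t.

Lemma q4_gt0 : 0 < q4. Proof. by rewrite ltr0n muln_gt0 addn_gt0 orbT. Qed.

Lemma continuous_Zq al x y : continuous (Zq al x y).
Proof.
move=> t; rewrite /Zq; apply: cvgD; last by apply: cvgMl; apply: cvgMr; exact: continuous_cov1.
by apply: cvgB; [exact: continuous_bridge|apply: cvgMl; apply: cvgMr; exact: continuous_cov1].
Qed.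

(** [cov1 \o Hc] has integral 1 / q4, so the residual integrates to 0 and only the term in [x] is
    left. *)
Lemma E_Zq_Hc al x y : E (fun s => Zq al x y (Hc s)) = al * x / q4.
Proof.
have I1 : Int (fun s => bridge y (Hc s)).
  apply: (@Int_bounded _ _ (10 * zb y)); last by move=> s; exact: bridge_le.
  (apply: measurable_continuous; exact: (@continuous_bridge_Hc y)).
have I2 : Int (fun s => cov1 (Hc s)).
  by apply: (@Int_bounded _ _ 1); [exact: measurable_cov1_Hc|move=> s; exact: cov1_le1].
rewrite /Zq (_ : (fun s => _) = (fun s => bridge y (Hc s) + (al * x - q4 * bI y) * cov1 (Hc s))); last first.
  by apply/funext => s; ring.
rewrite ED//; last exact: IntZ.
rewrite EZ// E_cov1 -/(bI y) -/q4; have := q4_gt0 => h.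
by field; rewrite gt_eqF.
Qed.

(** The correction subtracts a multiple of [cov1] times the path integral, which is [al * x / q4];
    it therefore acts on the coefficient of [x] alone. *)
Lemma corrected_Zq (a al x y v : R) : 0 <= v <= 1 ->
  corrected_path m a (Zq al x y) v = Zq (al * (1 - a / q4)) x y (beta_cdf m v).
Proof.
move=> v01; rewrite /corrected_path.
have -> : \int[mu]_(s in `[0, 1]) Zq al x y (beta_cdf m s) = al * x / q4.
  rewrite -(E_Zq_Hc al x y) E_leb; last first.
    apply: measurable_continuous => s.
    by apply: (@continuous_comp R R R Hc (Zq al x y)); [exact: continuous_Hc|exact: continuous_Zq].
  by apply: eq_Rintegral => u; rewrite inE/= in_itv/= => u01; rewrite beta_cdf_Hc.
rewrite beta_cdf_Hc// /Zq cov1_Hc clip_id// /phi /Kc.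
have := q4_gt0; move: (q4) => q q0.
have f0 k : k`!%:R != 0 :> R by rewrite pnatr_eq0 -lt0n fact_gt0.
rewrite natrM; have m1 : m%:R != 0 :> R by rewrite pnatr_eq0 -lt0n.
by field; rewrite f0 m1 gt_eqF.
Qed.

(** The path integral is adjoined as one more coordinate, namely the limit of the Riemann sums,
    which are linear and use finitely many coordinates; [Zp] is then linear in the enlarged
    family. *)
Lemma wstab_Zp al : wstab (Zp al).
Proof.
pose I3 := (unit + R + unit)%type.
pose A l (x : unit + R -> R) (j : I3) : R := match j with
  | inl k => x k | inr _ => Rs l (fun s => x (inr (Hc s))) end.
have lA l : linmap (A l).
  split.
  - by move=> [k|u] d T x mx /=; [exact: mx|apply: measurable_Rs => s; exact: mx].
  - by move=> x y [k|u] //=; rewrite RsD.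
  - by move=> c x [k|u] //=; rewrite RsZ.
have cA l j : seqcont (A l ^~ j).
  move=> x_ x xx; case: j => [k|u]; first exact: xx.
  by apply: cvg_Rs_pt => s; exact: xx.
have s1 l := wstab_lin (lA l) (cA l) (@wstab_gz_bridge R).
pose tr (j : I3) (w : R) : R := match j with
  | inl (inl _) => gz (th0 w) | inl (inr t) => bridge (th1 w) t | inr _ => bI (th1 w) end.
have s2 : wstab tr.
  apply: (wstab_lim s1) => -[[u|t]|u] w /=; [exact: cvg_cst|exact: cvg_cst|].
  exact: cvg_bI.
pose B (x : I3 -> R) (t : R) : R := x (inl (inr t)) - q4 * cov1 t * x (inr tt) + al * cov1 t * x (inl (inl tt)).
have lB : linmap B.
  split=> [t d T x mx|x y t|c x t]; rewrite /B; [|ring|ring].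
  by apply: measurable_funD; [apply: measurable_funB => //|]; apply: measurable_funM => //.
have cB t : seqcont (B ^~ t).
  move=> x_ x xx; rewrite /B; apply: cvgD; last by apply: cvgMr; exact: xx.
  by apply: cvgB; [exact: xx|apply: cvgMr; exact: xx].
exact: (wstab_lin lB cB s2).
Qed.

Lemma Zq_split al t w : Zp al t w = (al * cov1 t * gz (th0 w)) + (bridge (th1 w) t - q4 * cov1 t * bI (th1 w)).
Proof. by rewrite /Zp /Zq addrC. Qed.

Lemma L4_bperp t : L4 (fun y => bridge y t - q4 * cov1 t * bI y).
Proof. by apply: L4D; [exact: L4_bridge|apply: L4N; apply: L4Z; exact: L4_bI]. Qed.

Lemma L4_Zp al t : L4 (Zp al t).
Proof.
rewrite (_ : Zp al t = fun w => al * cov1 t * gz (th0 w) + (bridge (th1 w) t - q4 * cov1 t * bI (th1 w))); last first.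
  by apply/funext => w; rewrite Zq_split.
apply: L4D; first by apply: L4Z; exact: (L4_mpres (@mpres_th0 R) (@L4_gz R)).
exact: (L4_mpres (@mpres_th1 R) (L4_bperp t)).
Qed.

Lemma E_bperp t : E (fun y => bridge y t - q4 * cov1 t * bI y) = 0.
Proof.
rewrite EB; [|exact: L4_Int (L4_bridge t)|by apply: IntZ; exact: L4_Int L4_bI].
by rewrite EZ ?E_bridge ?E_bI ?mulr0 ?subrr//; exact: L4_Int L4_bI.
Qed.

Lemma E_Zp al t : E (Zp al t) = 0.
Proof.
rewrite (_ : Zp al t = fun w => al * cov1 t * gz (th0 w) + (bridge (th1 w) t - q4 * cov1 t * bI (th1 w))); last first.
  by apply/funext => w; rewrite Zq_split.
have I1 := L4_Int (L4_mpres (@mpres_th0 R) (@L4_gz R)).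
rewrite ED; [|exact: IntZ|exact: (L4_Int (L4_mpres (@mpres_th1 R) (L4_bperp t)))].
rewrite (EZ _ I1) (mpres_E (@mpres_th0 R) (L4_Int (@L4_gz R))) E_gz mulr0 add0r.
by rewrite (mpres_E (@mpres_th1 R) (L4_Int (L4_bperp t))) E_bperp.
Qed.

(** The residual contributes [KB - q4 * cov1 * cov1] and the independent normal term
    [al ^+ 2 * cov1 * cov1]. *)
Lemma cov_Zp al s t : E (fun w => Zp al s w * Zp al t w) = KB s t + (al ^+ 2 - q4) * cov1 s * cov1 t.
Proof.
have -> : (fun w => Zp al s w * Zp al t w) = (fun w =>
    (al * cov1 s * gz (th0 w) + (bridge (th1 w) s - q4 * cov1 s * bI (th1 w))) *
    (al * cov1 t * gz (th0 w) + (bridge (th1 w) t - q4 * cov1 t * bI (th1 w)))).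
  by apply/funext => w; rewrite !Zq_split.
rewrite (cov_add (f := fun w => al * cov1 s * gz w) (f' := fun w => al * cov1 t * gz w)
  (L4Z _ (@L4_gz R)) (L4Z _ (@L4_gz R)) (L4_bperp s) (L4_bperp t) (E_bperp s) (E_bperp t)).
have [_ G2 _] := Int_pow4 (@measurable_gz R) (@Int_gz4 R).
have -> : E (fun w => al * cov1 s * gz w * (al * cov1 t * gz w)) = al ^+ 2 * cov1 s * cov1 t.
  rewrite (_ : (fun w => _) = (fun w => (al ^+ 2 * cov1 s * cov1 t) * gz w ^+ 2)); last by apply/funext => w; ring.
  by rewrite EZ// E_gz2 mulr1.
have Ib u := L4_Int_mul (L4_bridge u) L4_bI.
have Iss := L4_Int_mul (L4_bridge s) (L4_bridge t).
have Ibb := L4_Int_mul L4_bI L4_bI.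
rewrite (_ : (fun w => _ * (bridge w t - _)) = (fun w => (bridge w s * bridge w t - q4 * cov1 t * (bridge w s * bI w)) +
  (- (q4 * cov1 s) * (bridge w t * bI w) + (q4 * cov1 s * (q4 * cov1 t)) * (bI w * bI w)))); last first.
  by apply/funext => w; ring.
rewrite ED; [|by apply: IntB => //; exact: IntZ|by apply: IntD; exact: IntZ].
rewrite EB//; last exact: IntZ.
rewrite ED; [|exact: IntZ|exact: IntZ].
rewrite !EZ// cov_bridge !cov_bridge_bI var_bI -/q4; have := q4_gt0 => h.
by field; rewrite gt_eqF.
Qed.

End Limits.

(** * The bridges of the theorem and their invariance *)

Section BridgeProperties.
Context {R : realType}.
Local Notation mR := (measurableTypeR R).
Local Notation lam := (@lam R).
Local Notation th0 := (@th0 R).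
Local Notation th1 := (@th1 R).

Lemma cylinder_measurable d (T : measurableType d) (I : Type) (D : set I) (Z : I -> T -> R) (A : set (I -> R)) :
  (forall t, D t -> measurable_fun setT (Z t)) -> cylinder D A -> measurable [set w | A (fun t => Z t w)].
Proof.
move=> mZ cA; pose G := [set B : set (I -> R) | measurable [set w | B (fun t => Z t w)]].
suff : cylinder D `<=` G by apply.
apply: smallest_sub.
- split=> [|B mB|F mF]; rewrite /G/=.
  + by rewrite (_ : [set w | _] = set0)//; apply/seteqP; split.
  + rewrite (_ : [set w | _] = ~` [set w | B (fun t => Z t w)]); first exact: measurableC.
    by apply/seteqP; split => w /=; [case|].
  + rewrite (_ : [set w | _] = \bigcup_n [set w | F n (fun t => Z t w)]); first by apply: bigcup_measurable => n _; exact: mF.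
    by apply/seteqP; split => w /= [n _ h]; exists n.
- move=> _ [t Dt [B mB <-]]; rewrite /G/=.
  rewrite (_ : [set w | _] = Z t @^-1` B); first by rewrite -[X in measurable X]setTI; apply: mZ.
  by apply/seteqP; split => w /=; [case|].
Qed.

(** [corrected_Zq] holds for v in [0, 1] only; this allows its use under a cylinder set over
    [0, 1]. *)
Lemma cylinder_ext (I : Type) (D : set I) (A : set (I -> R)) (f g : I -> R) : cylinder D A ->
  (forall t, D t -> f t = g t) -> A f = A g.
Proof.
move=> cA fg; pose G := [set B : set (I -> R) | B f = B g].
suff : cylinder D `<=` G by apply.
apply: smallest_sub.
- split=> [|B mB|F mF]; rewrite /G//=.
  + by rewrite /setD/= mB.
  + by rewrite propeqE; split => -[n _ h]; exists n => //; move: h; rewrite mF.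
- by move=> _ [t Dt [B mB <-]]; rewrite /G/= /preimage/= fg.
Qed.

Variable m : nat.
Hypothesis m_gt0 : (0 < m)%N.

Local Notation q4 := ((4 * (2 * m + 1))%:R : R).

Lemma bridge_Zp al p : mpres p -> al ^+ 2 = q4 -> brownian_bridge lam (fun t w => Zp m al t (p w)).
Proof.
move=> mp al2; split.
- move=> n t a _; pose X w := \sum_(l < n) a l * Zp m al (t l) w.
  have LX : L4 X by apply: L4_sum => l; apply: L4Z; exact: L4_Zp.
  split; first by apply: (@measurableT_comp _ _ _ _ _ _ X) => //; [exact: LX.1|exact: mp.1].
  have lA : @linmap R R unit (fun x _ => \sum_(l < n) a l * x (t l)).
    split=> [_ d T x mx|x y _|c x _].
    + by apply: measurable_sum => l; apply: measurable_funM => //; exact: mx.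
    + by rewrite -big_split; apply: eq_bigr => l _; rewrite mulrDr.
    + by rewrite mulr_sumr; apply: eq_bigr => l _; rewrite mulrCA.
  have cA (j : unit) : seqcont (fun x : R -> R => \sum_(l < n) a l * x (t l)).
    move=> x_ x xx; rewrite /comp; elim: (index_enum _) => [|l r IH].
      by under eq_fun do rewrite big_nil; rewrite big_nil; exact: cvg_cst.
    under eq_fun do rewrite big_cons; rewrite big_cons; apply: cvgD; last exact: IH.
    by apply: cvgMr; exact: xx.
  have sX : wstab (fun _ : unit => X) := wstab_lin lA cA (wstab_Zp m al).
  have EX : E X = 0.
    rewrite /X E_sum; last by move=> l; apply: IntZ; exact: L4_Int (L4_Zp m al (t l)).
    rewrite big1// => l _; rewrite EZ; last exact: L4_Int (L4_Zp m al (t l)).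
    by rewrite E_Zp// mulr0.
  have [mm [s h]] := wstab_gauss sX LX.2 EX; exists mm, s => A mA.
  have mXA : measurable (X @^-1` A : set R) by rewrite -[X in measurable X]setTI; apply: LX.1.
  exact: etrans (mp.2 _ mXA) (h _ mA).
- move=> t _; rewrite unlock.
  have I := L4_Int (L4_mpres mp (L4_Zp m al t)).
  by rewrite E_EFin// (mpres_E mp (L4_Int (L4_Zp m al t))) E_Zp.
- move=> u v; rewrite !in_itv/= => u01 v01; rewrite unlock.
  have I := mpres_Int mp (L4_Int_mul (L4_Zp m al u) (L4_Zp m al v)).
  rewrite E_EFin//; congr EFin.
  rewrite (mpres_E mp (L4_Int_mul (L4_Zp m al u) (L4_Zp m al v))) cov_Zp// al2 subrr !mul0r addr0.
  by rewrite KB_in.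
- by move=> w; apply: continuous_subspaceT; exact: continuous_Zq.
Qed.

Lemma same_law_Zp al p : mpres p -> same_law lam `[0, 1]
  (fun v w => Zp m al (beta_cdf m v) (p w))
  (fun v w => corrected_path m (8 * (2 * m + 1)%N%:R) (fun t => Zp m al t (p w)) v).
Proof.
move=> mp A cA.
have q0 : q4 != 0 by rewrite gt_eqF// q4_gt0.
(* 8 (2m + 1) is twice [q4]. *)
have e8 : al * (1 - 8 * (2 * m + 1)%:R / q4) = - al.
  by move: q0; rewrite natrM => q0; field; move: q0; rewrite mulf_eq0 negb_or => /andP[].
pose bm v := beta_cdf m v : R.
have -> : [set w | A (fun v => corrected_path m (8 * (2 * m + 1)%N%:R) (fun t => Zp m al t (p w)) v)] =
   [set w | A (fun v => Zp m (- al) (bm v) (p w))].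
  apply/seteqP; split => w /=.
    rewrite (@cylinder_ext _ _ _ _ (fun v => Zp m (- al) (bm v) (p w)) cA)// => v.
    by rewrite /= in_itv/= => v01; rewrite /Zp corrected_Zq// e8.
  rewrite -(@cylinder_ext _ _ _ (fun v => corrected_path m (8 * (2 * m + 1)%N%:R) (fun t => Zp m al t (p w)) v) _ cA)// => v.
  by rewrite /= in_itv/= => v01; rewrite /Zp corrected_Zq// e8.
have mZ al' : measurable [set w | A (fun v => Zp m al' (bm v) w)].
  by apply: cylinder_measurable cA => t _; exact: (L4_Zp m al' _).1.
transitivity (lam [set w | A (fun v => Zp m al (bm v) w)]); first exact: (mp.2 _ (mZ al)).
transitivity (lam [set w | A (fun v => Zp m (- al) (bm v) w)]); last exact: esym (mp.2 _ (mZ (- al))).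
pose S := [set z : mR * mR | A (fun v => Zq m al z.1 z.2 (bm v))].
have mS : measurable S.
  apply: (cylinder_measurable _ cA) => t _.
  have m1 : measurable_fun setT (fun z : mR * mR => bridge z.2 (bm t)).
    by apply: (@measurableT_comp _ _ _ _ _ _ (fun y : R => bridge y (bm t))); [exact: measurable_bridge|exact: measurable_snd].
  have m2 : measurable_fun setT (fun z : mR * mR => bI m z.2).
    by apply: measurableT_comp; [exact: measurable_bI|exact: measurable_snd].
  apply: measurable_funD; last by apply: measurable_funM => //; exact: measurable_fst.
  by apply: measurable_funB => //; exact: measurable_funM.
have mI : measurable_fun setT (fun z : mR * mR => (\1_S z)%:E : \bar R).
  by apply/measurable_EFinP; exact: measurable_indic.
have I0 (z : mR * mR) : (0 <= (\1_S z)%:E :> \bar R)%E by rewrite lee_fin.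
have mgz : measurable_fun setT (fun z : mR * mR => (gz z.1, z.2) : mR * mR).
  apply/measurable_fun_pairP; split; last exact: measurable_snd.
 exact: (measurableT_comp (@measurable_gz R) (@measurable_fst _ _ mR mR)).
have mgz' : measurable_fun setT (fun z : mR * mR => (- gz z.1, z.2) : mR * mR).
  apply/measurable_fun_pairP; split; last exact: measurable_snd.
  have mn : measurable_fun setT (fun x : R => - gz x) by apply: measurableT_comp => //; exact: measurable_gz.
  exact: (measurableT_comp mn (@measurable_fst _ _ mR mR)).
have lE al' (f : mR * mR -> mR * mR) : (forall w, S (f (th0 w, th1 w)) <-> A (fun v => Zp m al' (bm v) w)) ->
   lam [set w | A (fun v => Zp m al' (bm v) w)] = (\int[lam]_w (\1_S (f (th0 w, th1 w)))%:E)%E.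
  move=> h; rewrite lamE// -E_EFin; last first.
    by apply: Int_01 => [|x]; [exact: measurable_indic|case: (_ \in _); rewrite ?lexx ?ler01].
  apply: eq_integral => w _; rewrite indicE; congr ((_ : bool)%:R : R)%:E.
  have [h1 h2] := h w; apply/idP/idP => hw; apply: mem_set.
    by apply: h2; exact: (set_mem hw).
  by apply: h1; exact: (set_mem hw).
rewrite (lE al (fun z => (gz z.1, z.2)))//.
rewrite (lE (- al) (fun z => (- gz z.1, z.2))); last first.
  by move=> w; rewrite /S/= /Zp; under eq_fun do rewrite /Zq mulrN -mulNr -[- (al * _)]mulNr.
rewrite (@ge0_split_swap R (fun z => (\1_S (gz z.1, z.2))%:E) (measurableT_comp mI mgz) (fun z => I0 _)).
rewrite (@ge0_split_swap R (fun z => (\1_S (- gz z.1, z.2))%:E) (measurableT_comp mI mgz') (fun z => I0 _)).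
(* With the seed of the bridge frozen, only the symmetry of [gz] is left to use. *)
apply: eq_integral => y _; apply/esym.
apply: (gz_sym (f := fun x => (\1_S (x, y))%:E)) => //.
by apply: (measurable_fun_pair1 _ mI).
Qed.

End BridgeProperties.

(** * Order statistics and exponential variables *)

Section OrderStatistics.
Context {R : realType}.
Local Notation mR := (measurableTypeR R).
Local Notation lam := (@lam R).
Local Notation th0 := (@th0 R).
Local Notation th1 := (@th1 R).
Local Notation mu := (@lebesgue_measure R).

Definition mlist d (T : measurableType d) (l : seq (T -> R)) :=
  forall i, measurable_fun setT (nth (fun=> 0) l i).

(** The analogue of [cmeas] for functionals of a list. The measurable parameter lets inductions on
    the list move its head into the parameter. *)
Definition pmeas d (S : measurableType d) d'' (Y : measurableType d'') (H : S -> seq R -> Y) :=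
  forall d' (T : measurableType d') (g : T -> S) (l : seq (T -> R)),
    measurable_fun setT g -> mlist l -> measurable_fun setT (fun t => H (g t) [seq f t | f <- l]).

Lemma mlist_cons d (T : measurableType d) (f : T -> R) l : measurable_fun setT f -> mlist l -> mlist (f :: l).
Proof. by move=> mf ml [|i] //=; exact: ml. Qed.

Lemma mlist_behead d (T : measurableType d) (f : T -> R) l : mlist (f :: l) -> measurable_fun setT f /\ mlist l.
Proof. by move=> h; split; [exact: (h 0%N)|move=> i; exact: (h i.+1)]. Qed.

Lemma pmeas_comp d (S : measurableType d) d1 (S' : measurableType d1) d'' (Y : measurableType d'') (H : S -> seq R -> Y)
  (g : S' -> S) : measurable_fun setT g -> pmeas H -> pmeas (fun s => H (g s)).
Proof.
move=> mg mH d' T g' l mg' ml; apply: (mH _ T (g \o g')) => //.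
exact: measurableT_comp.
Qed.

Lemma pmeas_cons d (S : measurableType d) d'' (Y : measurableType d'') (H : S -> seq R -> Y) :
  pmeas H -> pmeas (fun (z : S * mR) l => H z.1 (z.2 :: l)).
Proof.
move=> mH d' T g l mg ml; apply: (mH _ T (fun t => (g t).1) ((fun t => (g t).2) :: l)).
  exact: (measurableT_comp measurable_fst mg).
by apply: mlist_cons => //; exact: (measurableT_comp measurable_snd mg).
Qed.

Fixpoint insd (x : R) (l : seq R) : seq R := if l is y :: l' then
  if y <= x then x :: y :: l' else y :: insd x l' else [:: x].

(** The induction generalises the parameter space, since an entry already passed by the insertion
    joins the parameter. *)
Lemma pmeas_ins d (S : measurableType d) d'' (Y : measurableType d'') (H : S -> seq R -> Y) :
  pmeas H -> pmeas (fun (z : S * mR) l => H z.1 (insd z.2 l)).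
Proof.
move=> mH d' T g l mg; elim: l d S H g mH mg => [|f l IH] d S H g mH mg ml /=.
  apply: (mH _ T (fun t => (g t).1) [:: (fun t => (g t).2)]); first exact: (measurableT_comp measurable_fst mg).
  by apply: mlist_cons => //; exact: (measurableT_comp measurable_snd mg).
have [mf ml'] := mlist_behead ml.
have m2 : measurable_fun setT (fun t => (g t).2) := measurableT_comp measurable_snd mg.
have m1 : measurable_fun setT (fun t => (g t).1) := measurableT_comp measurable_fst mg.
rewrite (_ : (fun t => _) = (fun t => if f t <= (g t).2 then H (g t).1 ((g t).2 :: f t :: [seq f t | f <- l])
   else H (g t).1 (f t :: insd (g t).2 [seq f t | f <- l]))); last by apply/funext => t; case: ifP.
apply: measurable_fun_ifT.
- exact: measurable_fun_ler.
- by apply: (mH _ T (fun t => (g t).1) ((fun t => (g t).2) :: f :: l)) => //; apply: mlist_cons.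
- apply: (IH _ (S * mR)%type (fun z l => H z.1 (z.2 :: l)) (fun t => (((g t).1, f t), (g t).2)) _ _ ml').
    exact: pmeas_cons.
  apply/measurable_fun_pairP; split => //; exact/measurable_fun_pairP.
Qed.

(* Integral of [h] over decreasing lists of length [n] with entries in [0, a]. *)
Fixpoint In (n : nat) (h : seq R -> \bar R) (a : R) : \bar R := if n is n'.+1 then
  (\int[mu]_x (if (0 <= x <= a)%R then In n' (fun l => h (x :: l)) x else 0))%E else h [::].

Lemma In_ge0 n h a : (forall l, 0 <= h l)%E -> (0 <= In n h a)%E.
Proof.
elim: n h a => [|n IH] h a h0 /=; first exact: h0.
by apply: integral_ge0 => x _; case: ifP => // _; exact: IH.
Qed.

Lemma measurable_if01 d (T : measurableType d) (x a : T -> R) (f : T -> \bar R) : measurable_fun setT x ->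
  measurable_fun setT a -> measurable_fun setT f ->
  measurable_fun setT (fun t => if (0 <= x t <= a t)%R then f t else 0%E).
Proof.
move=> mx ma mf; apply: measurable_fun_ifT => //.
by apply: measurable_and; [apply: measurable_fun_ler|apply: measurable_fun_ler].
Qed.

Lemma measurable_if01lt d (T : measurableType d) (x a y : T -> R) (f : T -> \bar R) : measurable_fun setT x ->
  measurable_fun setT a -> measurable_fun setT y -> measurable_fun setT f ->
  measurable_fun setT (fun t => if (0 <= x t <= a t)%R && (y t < x t)%R then f t else 0%E).
Proof.
move=> mx ma my mf; apply: measurable_fun_ifT => //; apply: measurable_and; last exact: measurable_fun_ltr.
by apply: measurable_and; apply: measurable_fun_ler.
Qed.

Lemma pmeas_In n d (S : measurableType d) (H : S -> seq R -> \bar R) (a : S -> R) : pmeas H ->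
  (forall s l, 0 <= H s l)%E -> measurable_fun setT a -> measurable_fun setT (fun s => In n (H s) (a s)).
Proof.
elim: n d S H a => [|n IH] d S H a mH H0 ma /=.
  by apply: (mH _ S id [::]) => //; move=> i; rewrite nth_nil; exact: measurable_cst.
have mF : measurable_fun setT (fun z : S * mR => if (0 <= z.2 <= a z.1)%R then In n (fun l => H z.1 (z.2 :: l)) z.2 else 0%E).
  apply: measurable_if01; [exact: measurable_snd|exact: (measurableT_comp ma measurable_fst)|].
  apply: (IH _ (S * mR)%type (fun z l => H z.1 (z.2 :: l)) (fun z => z.2)) => //; [exact: pmeas_cons|exact: measurable_snd].
have F0 z : (0 <= (if (0 <= z.2 <= a z.1)%R then In n (fun l => H z.1 (z.2 :: l)) z.2 else 0 : \bar R))%E.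
  by case: ifP => // _; exact: In_ge0.
exact: (@measurable_fun_fubini_tonelli_F _ _ S mR R mu _ mF F0).
Qed.

Lemma integral_itv01 (f : R -> \bar R) (a : R) : measurable_fun setT f ->
  (\int[mu]_x (if (0 <= x <= a)%R then f x else 0) = \int[mu]_x (if (0 <= x < a)%R then f x else 0))%E.
Proof.
move=> mf; transitivity (\int[mu]_(x in `[0%R, a]) f x)%E.
  rewrite [RHS]integral_mkcond; apply: eq_integral => x _; rewrite patchE.
  by case: (boolP (x \in _)); rewrite ?notin_setE ?inE/= in_itv/=; [move=> ->|move/negP/negbTE => ->].
rewrite -integral_itv_bndo_bndc; last exact: measurable_funTS.
rewrite integral_mkcond; apply: eq_integral => x _; rewrite patchE.
by case: (boolP (x \in _)); rewrite ?notin_setE ?inE/= in_itv/=; [move=> ->|move/negP/negbTE => ->].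
Qed.

Definition smeas d (Y : measurableType d) (h : seq R -> Y) :=
  forall d' (T : measurableType d') (l : seq (T -> R)), mlist l ->
  measurable_fun setT (fun t => h [seq f t | f <- l]).

Lemma smeas_pmeas d (S : measurableType d) d'' (Y : measurableType d'') (h : seq R -> Y) :
  smeas h -> pmeas (fun _ : S => h).
Proof. by move=> mh d' T g l mg ml; exact: mh. Qed.

Lemma smeas_cons x (h : seq R -> \bar R) : smeas h -> smeas (fun l => h (x :: l)).
Proof.
move=> mh d T l ml; apply: (mh _ T ((fun=> x) :: l)).
by apply: mlist_cons => //; exact: measurable_cst.
Qed.

(** A new point can fall in n + 1 positions of a decreasing list of length n, and each position
    contributes the same integral over ordered lists. *)
Lemma In_ins n (h : seq R -> \bar R) (a : R) : smeas h -> (forall l, 0 <= h l)%E ->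
  (\int[mu]_x (if (0 <= x <= a)%R then In n (fun l => h (insd x l)) a else 0) = n.+1%:R%:E * In n.+1 h a)%E.
Proof.
elim: n h a => [|n IH] h a mh h0; first by rewrite mul1e.
pose A x y := In n (fun l => h (x :: y :: l)) y.
pose B x y := In n (fun l => h (y :: insd x l)) y.
have A0 x y : (0 <= A x y)%E by exact: In_ge0.
have B0 x y : (0 <= B x y)%E by exact: In_ge0.
have m1 := @measurable_fst _ _ mR mR; have m2 := @measurable_snd _ _ mR mR.
have mA : measurable_fun setT (fun z : mR * mR => A z.1 z.2).
  apply: (@pmeas_In n _ (mR * mR)%type (fun z l => h (z.1 :: z.2 :: l)) (fun z => z.2)) => //.
  move=> d' T g l mg ml; apply: (mh _ T ((fun t => (g t).1) :: (fun t => (g t).2) :: l)).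
  apply: mlist_cons; first exact: (measurableT_comp m1 mg).
  by apply: mlist_cons => //; exact: (measurableT_comp m2 mg).
have mh1 : pmeas (fun z : mR => fun l => h (z :: l)).
  move=> d' T g l mg ml; apply: (mh _ T (g :: l)); exact: mlist_cons.
have mB : measurable_fun setT (fun z : mR * mR => B z.1 z.2).
  apply: (@pmeas_In n _ (mR * mR)%type (fun z l => h (z.2 :: insd z.1 l)) (fun z => z.2)) => //.
  apply: (pmeas_comp (g := fun z : mR * mR => (z.2, z.1)) _ (pmeas_ins mh1)).
  by apply/measurable_fun_pairP; split; [exact: m2|exact: m1].
have mAx x : measurable_fun setT (A x) := measurable_fun_pair2 x mA.
have mBx x : measurable_fun setT (B x) := measurable_fun_pair2 x mB.
have mBy y : measurable_fun setT (B ^~ y) := measurable_fun_pair1 y mB.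
(* Either the inserted point is on top, which gives an ordered list at once, or it goes below the
   top entry y, where the induction hypothesis applies. *)
have E1 x : 0 <= x <= a -> (In n.+1 (fun l => h (insd x l)) a =
    \int[mu]_y (if (0 <= y <= x)%R then A x y else 0) +
    \int[mu]_y (if (0 <= y <= a)%R && (x < y)%R then B x y else 0))%E.
  move=> /andP[x0 xa]; rewrite -ge0_integralD//=.
  - apply: eq_integral => y _; case: (lerP y x) => yx.
      have -> : (0 <= y <= a) = (0 <= y) by rewrite (le_trans yx xa) andbT.
      rewrite andbT andbF adde0; case: ifP => // _; congr In.
    rewrite !andbT andbF add0e; case: ifP => // _; congr In.
  - by move=> y _; case: ifP.
  - by apply: (@measurable_if01 _ mR id (fun=> x) (A x)); [exact: measurable_id|exact: measurable_cst|exact: mAx].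
  - by move=> y _; case: ifP.
  - by apply: (@measurable_if01lt _ mR id (fun=> a) (fun=> x) (B x)); [exact: measurable_id|exact: measurable_cst|exact: measurable_cst|exact: mBx].
pose C x := (\int[mu]_y (if (0 <= y <= a)%R && (x < y)%R then B x y else 0))%E.
have mIn1 : measurable_fun setT (fun x : R => In n.+1 (fun l => h (x :: l)) x).
  exact: (@pmeas_In n.+1 _ mR (fun x l => h (x :: l)) id).
have In1_ge0 (x : R) : (0 <= In n.+1 (fun l => h (x :: l)) x)%E by apply: (@In_ge0 n.+1 (fun l => h (x :: l)) x) => l; exact: h0.
have mBif : measurable_fun setT (fun z : mR * mR => if (0 <= z.1 <= a)%R then (if (0 <= z.2 <= a)%R && (z.1 < z.2)%R then B z.1 z.2 else 0)%E else 0%E).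
  by apply: (@measurable_if01 _ (mR * mR)%type (fun z => z.1) (fun=> a)) => //; apply: measurable_if01lt.
have Bif0 (z : mR * mR) : (0 <= (if (0 <= z.1 <= a)%R then (if (0 <= z.2 <= a)%R && (z.1 < z.2)%R then B z.1 z.2 else 0) else 0 : \bar R))%E.
  by case: (0 <= z.1 <= a); [case: ((0 <= z.2 <= a) && (z.1 < z.2)) => //; exact: B0|].
transitivity (\int[mu]_x (if (0 <= x <= a)%R then In n.+1 (fun l => h (x :: l)) x else 0) +
   \int[mu]_x \int[mu]_y (if (0 <= x <= a)%R then (if (0 <= y <= a)%R && (x < y)%R then B x y else 0) else 0))%E.
  rewrite -ge0_integralD//=; last 4 first.
  - by move=> x _; case: ifP => // _; exact: In1_ge0.
  - by apply: (@measurable_if01 _ mR id (fun=> a)); [exact: measurable_id|exact: measurable_cst|exact: mIn1].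
  - by move=> x _; apply: integral_ge0 => y _; exact: (Bif0 (x, y)).
  - exact: (@measurable_fun_fubini_tonelli_F _ _ mR mR R mu _ mBif Bif0).
  apply: eq_integral => x _; case: ifP => xa; last by rewrite integral0 adde0.
  exact: E1.
rewrite (@fubini_tonelli _ _ mR mR R mu mu _ mBif Bif0)/=.
rewrite [X in (_ + X)%E](_ : _ = n.+1%:R%:E * In n.+2 h a)%E.
  by rewrite -[X in (X + _)%E]/(In n.+2 h a) -[X in (X + _)%E]mul1e -ge0_muleDl// -EFinD nat1r.
rewrite [In n.+2 h a]/= -ge0_integralZl//=; last 2 first.
- by apply: (@measurable_if01 _ mR id (fun=> a)); [exact: measurable_id|exact: measurable_cst|exact: mIn1].
- by move=> x _; case: ifP => // _; exact: In1_ge0.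
apply: eq_integral => y _; case: ifP => ya; last first.
  by rewrite mule0 [LHS]integral0_eq// => x _; rewrite if_same.
rewrite -[RHS](IH (fun l => h (y :: l)) y (smeas_cons y mh) (fun l => h0 _)).
rewrite -[RHS]/(\int[mu]_x (if (0 <= x <= y)%R then B x y else 0))%E.
rewrite [RHS](integral_itv01 y (mBy y)); apply: eq_integral => x _.
have /andP[y0 y1] := ya; case: (boolP (0 <= x < y)) => [/andP[x0 xy]|].
  by rewrite x0 xy (le_trans (ltW xy) y1).
by rewrite negb_and -ltNge -leNgt => /orP[x0|yx]; case: ifP => //; [rewrite leNgt x0|rewrite ltNge yx andbF].
Qed.

(* The sample sorted in decreasing order: insertion then matches the recursion on the seeds. *)
Fixpoint dl (n : nat) (w : R) : seq R := if n is n'.+1 then insd (th0 w) (dl n' (th1 w)) else [::].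

Lemma insd_sort (x : R) (s : seq R) : insd x (rev (sort <=%R s)) = rev (sort <=%R (x :: s)).
Proof.
have p l : perm_eq (insd x l) (x :: l).
  elim: l => //= y l IH; case: ifP => // _.
  by rewrite -(perm_cons y) in IH; apply: (perm_trans IH); rewrite (perm_catCA [:: y] [:: x] l).
have so l : sorted >=%R l -> sorted >=%R (insd x l).
  elim: l => //= y l IH pl; case: (lerP y x) => [yx|xy] /=; first by rewrite yx pl.
  have := IH (path_sorted pl); case: l pl {IH} => [|z l] /=; first by rewrite (ltW xy).
  by move=> /andP[zy pl]; case: ifP => _ /=; [rewrite (ltW xy)|rewrite zy].
apply: (@sorted_eq _ >=%R).
- by move=> a b c ba cb; exact: le_trans cb ba.
- by move=> a b /andP[? ?]; apply/eqP; rewrite eq_le; apply/andP.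
- by apply: so; rewrite rev_sorted; exact: sort_le_sorted.
- by rewrite rev_sorted; exact: sort_le_sorted.
- rewrite (permPl (p _)) perm_sym perm_rev perm_sort perm_cons.
  by rewrite perm_sym perm_rev perm_sort.
Qed.

Lemma dlE n w : dl n w = rev (sort <=%R (mkseq (fun k => sd k w) n)).
Proof.
elim: n w => // n IH w; rewrite /= IH insd_sort; congr (rev (sort _ _)).
rewrite /mkseq /= (iotaDl 1 0) -map_comp; congr (_ :: _).
by apply: eq_map => k /=; rewrite -sdS.
Qed.

Lemma measurable_dl d (Y : measurableType d) n d1 (S : measurableType d1) (K : S -> seq R -> Y)
    d2 (T : measurableType d2) (g : T -> S) (w : T -> R) :
  pmeas K -> measurable_fun setT g -> measurable_fun setT w -> measurable_fun setT (fun t => K (g t) (dl n (w t))).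
Proof.
elim: n d1 S K d2 T g w => [|n IH] d1 S K d2 T g w mK mg mw.
  by apply: (mK _ T g [::]) => // i; rewrite nth_nil; exact: measurable_cst.
apply: (IH _ (S * mR)%type (fun z l => K z.1 (insd z.2 l)) _ T (fun t => (g t, th0 (w t)))).
- exact: pmeas_ins.
- by apply/measurable_fun_pairP; split => //; exact: (measurableT_comp (@mth0 R) mw).
- exact: (measurableT_comp (@mth1 R) mw).
Qed.

Lemma integral_lam (f : R -> \bar R) : measurable_fun setT f -> (forall x, 0 <= f x)%E ->
  (\int[lam]_x f x = \int[mu]_x (if (0 <= x <= 1)%R then f x else 0))%E.
Proof.
move=> mf f0; rewrite /lam integral_uniform// subr0 invr1 mul1e integral_mkcond.
apply: eq_integral => x _; rewrite patchE.
by case: (boolP (x \in _)); rewrite ?notin_setE ?inE/= in_itv/=; [move=> ->|move/negP/negbTE => ->].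
Qed.

(** The factors of [In_ins] accumulate to n!, the density of the order statistics on the simplex. *)
Lemma integral_dl n (h : seq R -> \bar R) : smeas h -> (forall l, 0 <= h l)%E ->
  (\int[lam]_w h (dl n w) = n`!%:R%:E * In n h 1)%E.
Proof.
elim: n h => [|n IH] h mh h0.
  by rewrite mul1e; apply: (etrans (integral_cst lam measurableT (h [::]))); rewrite [X in (_ * X)%E](probability_setT lam) mule1.
have mi (x : R) : smeas (fun l => h (insd x l)).
  move=> d T l ml; apply: (pmeas_ins (smeas_pmeas (S := mR) mh) (g := fun=> (0, x))) => //.
have mi2 : pmeas (fun (x : mR) l => h (insd x l)).
  apply: (pmeas_comp (g := fun x : mR => (0 : mR, x)) _ (pmeas_ins (smeas_pmeas (S := mR) mh))).
  by apply/measurable_fun_pairP; split; [exact: measurable_cst|exact: measurable_id].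
have mF : measurable_fun setT (fun z : mR * mR => h (insd z.1 (dl n z.2))).
  apply: (@measurable_dl _ _ n _ mR _ _ (mR * mR)%type (fun z => z.1) (fun z => z.2) mi2).
    exact: measurable_fst.
  exact: measurable_snd.
transitivity (\int[lam]_w h (insd (th0 w) (dl n (th1 w))))%E; first by [].
rewrite (@ge0_split R (fun z => h (insd z.1 (dl n z.2))) mF (fun z => h0 _)).
under eq_integral => x _ do rewrite (IH (fun l => h (insd x l)) (mi x) (fun l => h0 _)).
have mIn1 : measurable_fun setT (fun x : R => In n (fun l => h (insd x l)) 1).
  exact: (@pmeas_In n _ mR _ (fun=> 1)).
have In0 (x : R) : (0 <= In n (fun l => h (insd x l)) 1)%E by apply: In_ge0.
rewrite ge0_integralZl//.
rewrite integral_lam// In_ins// muleA factS natrM EFinM [(_%:E * n`!%:R%:E)%E]muleC.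
by [].
Qed.

(** Partial sums taken from the tail, with the total at the head: a decreasing list, to be compared
    with [dl]. *)
Fixpoint sl (n : nat) (w : R) : seq R := if n is n'.+1 then
  (expl (th0 w) + head 0 (sl n' (th1 w))) :: sl n' (th1 w) else [::].

Lemma size_sl n w : size (sl n w) = n.
Proof. by elim: n w => //= n IH w; rewrite IH. Qed.

Lemma nth_sl n i w : nth 0 (sl n w) i = \sum_(i <= k < n) expl (sd k w).
Proof.
elim: n i w => [|n IH] i w; first by rewrite nth_nil big_geq.
case: i => [|i] /=; last by rewrite IH big_add1; apply: eq_bigr => k _; rewrite -sdS.
rewrite big_nat_recl// -nth0 IH; congr (_ + _).
by apply: eq_bigr => k _; rewrite -sdS.
Qed.

Lemma pmeas_head d (S : measurableType d) d'' (Y : measurableType d'') (H : S -> seq R -> Y) :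
  pmeas H -> pmeas (fun (z : S * mR) l => H z.1 ((z.2 + head 0 l) :: l)).
Proof.
move=> mH d' T g l mg ml.
have mh : measurable_fun setT (fun t => head 0 [seq f t | f <- l] : R).
  by case: l ml => [|f l] ml /=; [exact: measurable_cst|have [] := mlist_behead ml].
apply: (mH _ T (fun t => (g t).1) ((fun t => (g t).2 + head 0 [seq f t | f <- l]) :: l)).
  exact: (measurableT_comp measurable_fst mg).
apply: mlist_cons => //; apply: measurable_funD => //.
exact: (measurableT_comp measurable_snd mg).
Qed.

Lemma measurable_sl d (Y : measurableType d) n d1 (S : measurableType d1) (K : S -> seq R -> Y)
    d2 (T : measurableType d2) (g : T -> S) (w : T -> R) :
  pmeas K -> measurable_fun setT g -> measurable_fun setT w -> measurable_fun setT (fun t => K (g t) (sl n (w t))).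
Proof.
elim: n d1 S K d2 T g w => [|n IH] d1 S K d2 T g w mK mg mw.
  by apply: (mK _ T g [::]) => // i; rewrite nth_nil; exact: measurable_cst.
apply: (IH _ (S * mR)%type (fun z l => K z.1 ((z.2 + head 0 l) :: l)) _ T (fun t => (g t, expl (th0 (w t))))).
- exact: pmeas_head.
- apply/measurable_fun_pairP; split => //.
  exact: (measurableT_comp (@measurable_expl R) (measurableT_comp (@mth0 R) mw)).
- exact: (measurableT_comp (@mth1 R) mw).
Qed.

Local Notation p := (exponential_pdf (1 : R)).

Lemma exp_pdfE x : p x = if 0 <= x then expR (- x) else 0.
Proof.
case: (lerP 0 x) => x0.
  by rewrite exponential_pdfE// mul1r mulN1r.
rewrite /exponential_pdf patchE; case: (boolP (x \in _)) => //.
by rewrite inE/= in_itv/= andbT leNgt x0.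
Qed.

Lemma exp_pdf_add t s : p (t - s) * p s = if 0 <= s <= t then p t else 0.
Proof.
rewrite !exp_pdfE subr_ge0; case: (lerP s t) => st; rewrite ?andbF ?mul0r// andbT.
case: (lerP 0 s) => s0; rewrite ?mulr0// (le_trans s0 st) -expRD; congr expR; ring.
Qed.

Lemma exp_pdf0 x : 0 <= p x. Proof. exact: exponential_pdf_ge0. Qed.
Lemma mexp_pdf : measurable_fun setT (p : mR -> mR). Proof. exact: measurable_exponential_pdf. Qed.

(** The exponential densities telescope by [exp_pdf_add], so the joint density of the partial sums
    depends on the total alone. *)
Lemma integral_sl n (h : seq R -> \bar R) : smeas h -> (forall l, 0 <= h l)%E ->
  (\int[lam]_w h (sl n.+1 w) = \int[mu]_s ((p s)%:E * In n (fun l => h (s :: l)) s))%E.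
Proof.
have m1 := @measurable_fst _ _ mR mR; have m2 := @measurable_snd _ _ mR mR.
elim: n h => [|n IH] h mh h0.
  have mf : measurable_fun setT (fun x : R => h [:: x]).
    by apply: (mh _ mR [:: id]); apply: mlist_cons => // i; rewrite nth_nil; exact: measurable_cst.
  transitivity (\int[lam]_w h [:: expl (th0 w)])%E.
    by apply: eq_integral => w _; rewrite /= addr0.
  rewrite (mpres_ge0 (F := fun x => h [:: expl x]) (@mpres_th0 R))//; last first.
    exact: (measurableT_comp mf (@measurable_expl R)).
  rewrite (expl_integral mf (fun x => h0 _)); apply: eq_integral => x _; exact: muleC.
pose K t s := In n (fun l => h (t :: s :: l)) s.
have K0 t s : (0 <= K t s)%E by apply: In_ge0.
have mK d (T : measurableType d) (t s : T -> R) : measurable_fun setT t -> measurable_fun setT s ->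
    measurable_fun setT (fun x => K (t x) (s x)).
  move=> mt ms; apply: (@pmeas_In n _ T (fun x l => h (t x :: s x :: l)) s) => //.
  move=> d' T' g l mg ml; apply: (mh _ T' ((fun x => t (g x)) :: (fun x => s (g x)) :: l)).
  apply: mlist_cons; first exact: (measurableT_comp mt mg).
  by apply: mlist_cons => //; exact: (measurableT_comp ms mg).
pose hx u l := h ((u + head 0 l) :: l).
have mhx : pmeas (fun u : mR => hx u).
  have := pmeas_head (smeas_pmeas (S := mR) mh).
  move=> /(pmeas_comp (g := fun u : mR => (0 : mR, u)))/(_ _); apply.
  by apply/measurable_fun_pairP; split; [exact: measurable_cst|exact: measurable_id].
transitivity (\int[lam]_w hx (expl (th0 w)) (sl n.+1 (th1 w)))%E; first by [].
have mF : measurable_fun setT (fun z : mR * mR => hx (expl z.1) (sl n.+1 z.2)).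
  apply: (@measurable_sl _ _ n.+1 _ mR _ _ (mR * mR)%type (fun z => expl z.1) (fun z => z.2) mhx) => //.
  exact: (measurableT_comp (@measurable_expl R) m1).
rewrite (@ge0_split R (fun z => hx (expl z.1) (sl n.+1 z.2)) mF (fun z => h0 _)).
have shx u : smeas (hx u).
  by move=> d T l ml; apply: (mhx _ T (fun=> u)).
under eq_integral => x _ do rewrite (IH (hx (expl x)) (shx _) (fun l => h0 _)).
pose G u := (\int[mu]_s ((p s)%:E * K (u + s)%R s))%E.
have mGi : measurable_fun setT (fun z : mR * mR => ((p z.2)%:E * K (z.1 + z.2)%R z.2)%E).
  apply: emeasurable_funM; first by apply/measurable_EFinP; exact: (measurableT_comp mexp_pdf m2).
  by apply: mK => //; exact: measurable_funD.
have Gi0 (z : mR * mR) : (0 <= (p z.2)%:E * K (z.1 + z.2)%R z.2)%E.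
  by rewrite mule_ge0// lee_fin exp_pdf0.
have mG : measurable_fun setT G.
  exact: (@measurable_fun_fubini_tonelli_F _ _ mR mR R mu _ mGi Gi0).
have G0 u : (0 <= G u)%E by apply: integral_ge0 => s _; exact: (Gi0 (u, s)).
transitivity (\int[lam]_x G (expl x))%E; first by [].
rewrite (expl_integral mG G0).
pose L (u s : R) := ((p u * p s)%:E * K (u + s)%R s)%E.
have mL : measurable_fun setT (fun z : mR * mR => L z.1 z.2).
  apply: emeasurable_funM.
    apply/measurable_EFinP; apply: measurable_funM.
      exact: (measurableT_comp mexp_pdf m1).
    exact: (measurableT_comp mexp_pdf m2).
  by apply: mK => //; exact: measurable_funD.
have L0 (z : mR * mR) : (0 <= L z.1 z.2)%E by rewrite mule_ge0// lee_fin mulr_ge0 ?exp_pdf0.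
transitivity (\int[mu]_u \int[mu]_s L u s)%E.
  apply: eq_integral => u _; rewrite muleC /G -ge0_integralZl//=.
  - by apply: eq_integral => s _; rewrite /L EFinM muleA.
  - exact: (measurable_fun_pair2 u mGi).
  - by move=> s _; exact: (Gi0 (u, s)).
  - by rewrite lee_fin exp_pdf0.
rewrite (@fubini_tonelli _ _ mR mR R mu mu _ mL L0).
pose M (s t : R) := ((if (0 <= s <= t)%R then p t else 0%R)%:E * K t s)%E.
transitivity (\int[mu]_s \int[mu]_t M s t)%E.
  apply: eq_integral => s _; rewrite (@ge0_integral_affine R 1 (- s) (L ^~ s) ltr01 (measurable_fun_pair1 s mL) (fun u => L0 (u, s))).
  by rewrite mul1e; apply: eq_integral => t _; rewrite /= /L /M mul1r exp_pdf_add subrK.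
have mM : measurable_fun setT (fun z : mR * mR => M z.1 z.2).
  apply: emeasurable_funM; last exact: mK.
  apply/measurable_EFinP; apply: measurable_fun_ifT => //; last exact: (measurableT_comp mexp_pdf m2).
  by apply: measurable_and; apply: measurable_fun_ler.
have M0 (z : mR * mR) : (0 <= M z.1 z.2)%E.
  rewrite mule_ge0// lee_fin; case: ((0 <= z.1) && (z.1 <= z.2)) => //; exact: exp_pdf0.
rewrite (@fubini_tonelli _ _ mR mR R mu mu _ mM M0).
apply: eq_integral => t _; rewrite [In n.+1 _ _]/= -ge0_integralZl//=.
- by apply: eq_integral => s _; rewrite /M; case: ifP => // _; rewrite ?mul0e ?mule0.
- by apply: (@measurable_if01 _ mR id (fun=> t) (K t)); [exact: measurable_id|exact: measurable_cst|exact: (mK _ mR (fun=> t) id)].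
- by move=> s _; case: ((0 <= s) && (s <= t)) => //; exact: K0.
- by rewrite lee_fin exp_pdf0.
Qed.

Lemma mlist_div d (T : measurableType d) (c : T -> R) (l : seq (T -> R)) : measurable_fun setT c -> mlist l ->
  mlist [seq (fun t => f t * c t) | f <- l].
Proof.
move=> mc ml i; have [il|il] := ltnP i (size l); last first.
  by rewrite nth_default ?size_map//; exact: measurable_cst.
by rewrite (nth_map (fun=> 0))//; apply: measurable_funM.
Qed.

Lemma smeas_scale (c : R) (g : seq R -> \bar R) : smeas g -> smeas (fun l => g [seq x * c | x <- l]).
Proof.
move=> mg d T l ml; have := mg _ T _ (mlist_div (measurable_cst c) ml).
by under eq_fun do rewrite -map_comp; under [in X in _ -> X]eq_fun do rewrite -map_comp.
Qed.

Lemma measurable_In_cons n (h : seq R -> \bar R) : smeas h -> (forall l, 0 <= h l)%E ->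
  measurable_fun setT (fun x : R => In n (fun l => h (x :: l)) x).
Proof.
move=> mh h0; apply: (@pmeas_In n _ mR (fun x l => h (x :: l)) id) => //.
by move=> d' T g l mg ml; apply: (mh _ T (g :: l)); exact: mlist_cons.
Qed.

Lemma In_scale n (g : seq R -> \bar R) (c a : R) : 0 < c -> smeas g -> (forall l, 0 <= g l)%E ->
  (In n (fun l => g [seq (x * c^-1)%R | x <- l]) (c * a)%R = (c ^+ n)%:E * In n g a)%E.
Proof.
move=> c0; elim: n g a => [|n IH] g a mg g0; first by rewrite mul1e.
pose f x := (if (0 <= x <= c * a)%R then In n (fun l => g (x * c^-1 :: [seq (x * c^-1)%R | x <- l])%R) x else 0)%E.
have mf : measurable_fun setT (f : R -> _).
  apply: (@measurable_if01 _ mR id (fun=> c * a)) => //.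
  by apply: (measurable_In_cons n (h := fun l => g [seq (x * c^-1)%R | x <- l])) => //; exact: smeas_scale.
have f0 x : (0 <= f x)%E by rewrite /f; case: ifP => // _; apply: In_ge0.
transitivity (\int[mu]_x f x)%E; first by [].
rewrite (@ge0_integral_affine R c 0 f c0 mf f0) exprS EFinM -muleA; congr (_ * _)%E.
rewrite -ge0_integralZl//=; last 3 first.
- by apply: (@measurable_if01 _ mR id (fun=> a)) => //; exact: measurable_In_cons.
- by move=> x _; case: ifP => // _; apply: In_ge0.
- by rewrite lee_fin exprn_ge0// ltW.
apply: eq_integral => x _; rewrite /f addr0 pmulr_rge0// ler_pM2l//; case: ifP => _; last by rewrite mule0.
rewrite -(IH (fun l => g (x :: l)) x (smeas_cons x mg) (fun l => g0 _)); congr In.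
by apply/funext => l; rewrite mulrAC mulfV ?mul1r// gt_eqF.
Qed.

Lemma In_0 n (g : seq R -> \bar R) : smeas g -> (forall l, 0 <= g l)%E -> (In n g 0 = (0 ^+ n)%:E * g [::])%E.
Proof.
case: n => [|n] mg g0; first by rewrite mul1e.
rewrite exprS mul0r mul0e /= integral_itv01; last exact: measurable_In_cons.
by apply: integral0_eq => x _; case: ifP => // /andP[x0]; rewrite ltNge x0.
Qed.

(** Written as x times a power of x^2, the inverse has the correct value 0 at 0. *)
Lemma measurable_invr : measurable_fun setT (fun x : R => x^-1).
Proof.
rewrite (_ : (fun x => x^-1) = (fun x : R => x * (x ^+ 2) `^ (-1))); last first.
  apply/funext => x; rewrite powR_inv1 ?sqr_ge0//.
  have [->|x0] := eqVneq x 0; first by rewrite invr0 mul0r.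
  by rewrite expr2 invfM mulrA mulfV// mul1r.
apply: measurable_funM; first exact: measurable_id.
exact: (measurableT_comp (measurable_powR (-1)) (measurable_funX 2 (@measurable_id _ R setT))).
Qed.

(* The normalising constant of [integral_sl_scale]; it is only evaluated afterwards, on the constant function 1. *)
Definition gint n := (\int[mu]_s (p s * s ^+ n)%:E)%E.

(** Given the total s, the other partial sums divided by s are uniform on ordered lists in [0, 1],
    whatever s is; the total therefore integrates out into a constant. *)
Lemma integral_sl_scale n (g : seq R -> \bar R) : smeas g -> (forall l, 0 <= g l)%E ->
  (\int[lam]_w g [seq (x * (head 0 (sl n.+1 w))^-1)%R | x <- behead (sl n.+1 w)] = gint n * In n g 1)%E.
Proof.
move=> mg g0; pose h l := g [seq (x * (head 0 l)^-1)%R | x <- behead l].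
have minv := @measurable_invr.
have mh : smeas h.
  move=> d T [|f l] ml; first by rewrite /h /=; exact: measurable_cst.
  have [mf ml'] := mlist_behead ml.
  have := mg _ T _ (mlist_div (measurableT_comp minv mf) ml').
  by rewrite /h /=; under eq_fun do rewrite -map_comp; under [in X in _ -> X]eq_fun do rewrite -map_comp.
transitivity (\int[lam]_w h (sl n.+1 w))%E; first by [].
rewrite (integral_sl n mh (fun l => g0 _)) /gint.
rewrite -ge0_integralZr//=; last 3 first.
- by apply/measurable_EFinP; apply: measurable_funM; [exact: mexp_pdf|exact: measurable_funX].
- move=> s _; rewrite lee_fin exp_pdfE; case: (lerP 0 s) => s0; last by rewrite mul0r.
  by rewrite mulr_ge0 ?expR_ge0 ?exprn_ge0.
- exact: In_ge0.
apply: eq_integral => s _; rewrite EFinM -muleA.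
have [s0|s0|<-] := ltgtP 0 s.
- congr (_ * _)%E; have := In_scale n 1 s0 mg g0; rewrite mulr1 => <-; exact: erefl.
- by rewrite exp_pdfE leNgt s0 !mul0e.
- congr (_ * _)%E; rewrite /h /=; have := In_0 n (smeas_scale 0^-1 mg) (fun l => g0 _) => /= ->.
  case: n => [|n]; first by rewrite !mul1e.
  by rewrite exprS mul0r !mul0e.
Qed.

Lemma In_cst n (c : \bar R) (a : R) : (0 <= c)%E -> 0 <= a -> (In n (fun=> c) a = (a ^+ n / n`!%:R)%:E * c)%E.
Proof.
move=> c0 a0; have mc : smeas (fun=> c) by move=> d T l ml; exact: measurable_cst.
have fn0 : n`!%:R != 0 :> R by rewrite pnatr_eq0 -lt0n fact_gt0.
have e1 : (In n (fun=> c) 1 = (n`!%:R^-1)%:E * c)%E.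
  have h : (c = n`!%:R%:E * In n (fun=> c) 1)%E.
    have := integral_dl n mc (fun _ => c0).
    by rewrite (integral_cst lam measurableT c) [X in (_ * X)%E](probability_setT lam) mule1.
  by rewrite [in RHS]h muleA -EFinM mulVf// mul1e.
move: a0; rewrite le_eqVlt => /predU1P[<-|a0].
  rewrite (In_0 n mc)//; case: n fn0 e1 => [|n] fn0 e1; first by rewrite fact0 divr1.
  by rewrite exprS !mul0r.
by have := In_scale n 1 a0 mc (fun _ => c0); rewrite mulr1 => ->; rewrite e1 muleA -EFinM.
Qed.

Lemma gintE n : gint n = n`!%:R%:E.
Proof.
have m1 : smeas (fun=> 1%E : \bar R) by move=> d T l ml; exact: measurable_cst.
have fn0 : n`!%:R != 0 :> R by rewrite pnatr_eq0 -lt0n fact_gt0.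
have := integral_sl_scale n m1 (fun _ => lee01).
rewrite (integral_cst lam measurableT 1%E) [X in (_ * X)%E](probability_setT lam) mule1 In_cst// expr1n mule1 => h.
transitivity (gint n * (n`!%:R^-1%:E * n`!%:R%:E))%E; first by rewrite -EFinM mulVf// mule1.
by rewrite muleA -[n`!%:R^-1]mul1r -h mul1e.
Qed.

Lemma order_law n (g : seq R -> \bar R) : smeas g -> (forall l, 0 <= g l)%E ->
  (\int[lam]_w g (dl n w) =
   \int[lam]_w g [seq (x * (head 0 (sl n.+1 w))^-1)%R | x <- behead (sl n.+1 w)])%E.
Proof. by move=> mg g0; rewrite integral_dl// integral_sl_scale// gintE. Qed.

Lemma gamma_law n (f : R -> \bar R) : measurable_fun setT f -> (forall x, 0 <= f x)%E ->
  (\int[lam]_w f (\sum_(k < n.+1) expl (sd k w))%R = \int[mu]_s ((p s * (s ^+ n / n`!%:R))%:E * f s))%E.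
Proof.
move=> mf f0; have mh : smeas (fun l => f (head 0 l)).
  move=> d T [|g l] ml; first exact: (measurable_cst (f 0)).
  by have [mg _] := mlist_behead ml; exact: (measurableT_comp mf mg).
have := integral_sl n mh (fun l => f0 _).
under eq_integral do rewrite -nth0 nth_sl big_mkord.
move=> ->; apply: eq_integral => s _ /=; rewrite EFinM -muleA.
case: (lerP 0 s) => s0; first by rewrite In_cst.
by rewrite exp_pdfE leNgt s0 !mul0e.
Qed.

End OrderStatistics.

(** * Gamma variables, their ratio, and its moments *)

Section GammaBeta.
Context {R : realType}.
Local Notation mR := (measurableTypeR R).
Local Notation lam := (@lam R).
Local Notation th0 := (@th0 R).
Local Notation th1 := (@th1 R).
Local Notation mu := (@lebesgue_measure R).
Local Notation p := (exponential_pdf (1 : R)).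
Variable m : nat.
Hypothesis m_gt0 : (0 < m)%N.

Definition gsum (s : R) : R := \sum_(l < m) expl (sd l s).

Lemma measurable_gsum : measurable_fun setT gsum.
Proof.
apply: measurable_sum => l.
exact: (measurableT_comp (@measurable_expl R) (measurable_sd l)).
Qed.

Lemma gsum_ge0 s : 0 <= gsum s.
Proof. by apply: sumr_ge0 => l _; exact: expl_ge0. Qed.

(** The Gamma density of shape n + 1. *)
Definition gpdf (n : nat) (s : R) : R := p s * (s ^+ n / n`!%:R).

Lemma gpdf_ge0 n s : 0 <= gpdf n s.
Proof.
rewrite /gpdf exp_pdfE; case: (lerP 0 s) => s0; last by rewrite mul0r.
by rewrite mulr_ge0 ?expR_ge0// divr_ge0 ?exprn_ge0.
Qed.

Lemma measurable_gpdf n : measurable_fun setT (gpdf n : mR -> mR).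
Proof.
apply: measurable_funM; first exact: mexp_pdf.
apply: measurable_funM; [exact: measurable_funX|exact: measurable_cst].
Qed.

Lemma integral_gpdf n k : (\int[mu]_s ((gpdf n s)%:E * (s ^+ k)%:E) = ((n + k)`!%:R / n`!%:R)%:E)%E.
Proof.
transitivity ((n`!%:R^-1)%:E * @gint R (n + k))%E; last by rewrite gintE -EFinM mulrC.
rewrite /gint -ge0_integralZl//=.
- by apply: eq_integral => s _; rewrite -!EFinM /gpdf exprD; congr (_%:E); ring.
- apply/measurable_EFinP; apply: measurable_funM; [exact: mexp_pdf|exact: measurable_funX].
- move=> s _; rewrite lee_fin exp_pdfE; case: (lerP 0 s) => s0; last by rewrite mul0r.
  by rewrite mulr_ge0 ?expR_ge0// exprn_ge0.
Qed.

Lemma gsum_law (f : R -> \bar R) : measurable_fun setT f -> (forall x, 0 <= f x)%E ->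
  (\int[lam]_w f (gsum w) = \int[mu]_s ((gpdf m.-1 s)%:E * f s))%E.
Proof. by move=> mf f0; rewrite -gamma_law// prednK. Qed.

Lemma gsum_moment k : Int (fun s => gsum s ^+ k) /\
  E (fun s => gsum s ^+ k) = (m.-1 + k)`!%:R / m.-1`!%:R.
Proof.
have h : (\int[lam]_w (gsum w ^+ k)%:E = ((m.-1 + k)`!%:R / m.-1`!%:R)%:E)%E.
  rewrite -integral_gpdf.
  transitivity (\int[lam]_w (fun x => (`|x| ^+ k)%:E) (gsum w))%E.
    by apply: eq_integral => w _; rewrite ger0_norm// gsum_ge0.
  rewrite (gsum_law (f := fun x => (`|x| ^+ k)%:E)).
  - apply: eq_integral => s _; rewrite -!EFinM /gpdf exp_pdfE; case: (lerP 0 s) => s0; last by rewrite !mul0r.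
    by rewrite ger0_norm.
  - by apply/measurable_EFinP/measurable_funX; exact: normr_measurable.
  - by move=> x; rewrite lee_fin exprn_ge0.
have mg : measurable_fun setT (fun s => gsum s ^+ k) := measurable_funX k measurable_gsum.
have I : Int (fun s => gsum s ^+ k).
  by apply: Int_ge0 => [//|s|]; [rewrite exprn_ge0// gsum_ge0|rewrite h ltry].
split=> //; apply: EFin_inj; rewrite -(E_EFin I); exact: h.
Qed.

Lemma L4_gsum : L4 gsum.
Proof. by split; [exact: measurable_gsum|exact: (gsum_moment 4).1]. Qed.

Lemma E_gsum : E gsum = m%:R.
Proof.
have := (gsum_moment 1).2; rewrite (_ : (fun s => gsum s ^+ 1) = gsum)// => ->.
rewrite addn1 prednK// -{1}(prednK m_gt0) factS prednK// natrM mulfK//.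
Qed.

Lemma E_gsum2 : E (fun s => gsum s ^+ 2) = m%:R * (m%:R + 1).
Proof.
rewrite (gsum_moment 2).2 addn2 prednK// -{1}(prednK m_gt0) !factS prednK// !natrM.
rewrite !mulrA mulfK ?pnatr_eq0 -?lt0n ?fact_gt0//.
by rewrite -natr1 mulrC.
Qed.

(* [bU] and [bV] are the Gamma(m) spacings of one block, up to the total sums. *)
Definition bU (s : R) := gsum (th0 s).
Definition bV (s : R) := gsum (th1 s).
Definition bW (s : R) := bU s / (bU s + bV s).

Lemma L4_bU : L4 bU. Proof. exact: (L4_mpres (@mpres_th0 R) L4_gsum). Qed.
Lemma L4_bV : L4 bV. Proof. exact: (L4_mpres (@mpres_th1 R) L4_gsum). Qed.
Lemma bU_ge0 s : 0 <= bU s. Proof. exact: gsum_ge0. Qed.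
Lemma bV_ge0 s : 0 <= bV s. Proof. exact: gsum_ge0. Qed.

Lemma measurable_bW : measurable_fun setT bW.
Proof.
have [mU _] := L4_bU; have [mV _] := L4_bV.
by apply: measurable_funM; [exact: mU|exact: (measurableT_comp measurable_invr (measurable_funD mU mV))].
Qed.

Definition hd (w : R) : R := if 0 <= w <= 1 then hden m w else 0.

Lemma hd_ge0 w : 0 <= hd w.
Proof. by rewrite /hd; case: ifP => // w01; case/andP: (hden01 m w01). Qed.

Lemma measurable_hd : measurable_fun setT (hd : mR -> mR).
Proof.
apply: measurable_fun_ifT => //.
- by apply: measurable_and; apply: measurable_fun_ler.
- by apply: measurable_continuous; exact: continuous_hden.
Qed.

(** The factor r is the Jacobian. The right side is a product, that is, the sum and the ratio are
    independent. *)
Lemma gpdf_prod (r w : R) : 0 < r ->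
  r * (gpdf m.-1 (r * w) * gpdf m.-1 (r - r * w)) = gpdf (2 * m).-1 r * hd w.
Proof.
move=> r0; rewrite /gpdf /hd !exp_pdfE (pmulr_rge0 _ r0) (ltW r0) subr_ge0 ger_pMr//.
case: (lerP 0 w) => w0; last by rewrite !mul0r !mulr0.
case: (lerP w 1) => w1 /=; last by rewrite !mul0r !mulr0.
rewrite /hden /Kc.
have -> : expR (- r) = expR (- (r * w)) * expR (- (r - r * w)) by rewrite -expRD; congr expR; ring.
have -> : (2 * m).-1 = (m.-1 + m.-1).+1 by lia.
have f1 : m.-1`!%:R != 0 :> R by rewrite pnatr_eq0 -lt0n fact_gt0.
have f2 : (m.-1 + m.-1).+1`!%:R != 0 :> R by rewrite pnatr_eq0 -lt0n fact_gt0.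
have -> : r - r * w = r * (1 - w) by ring.
rewrite !exprMn exprS exprD.
move: f1 f2; move: (_%:R) (_%:R) (expR _) (expR _) (r ^+ _) (w ^+ _) ((1 - w) ^+ _) => a b c d e f g a0 b0.
by field; rewrite a0 b0.
Qed.

(* The substitution [(u, v) = (r w, r (1 - w))]. *)
Lemma gamma_beta (F : R * R -> \bar R) : measurable_fun setT (F : mR * mR -> \bar R) -> (forall z, 0 <= F z)%E ->
  (\int[lam]_s F (bU s, bV s) =
   \int[mu]_r ((gpdf (2 * m).-1 r)%:E * \int[mu]_w ((hd w)%:E * F (r * w, r - r * w)%R)))%E.
Proof.
move=> mF F0; have m1 := @measurable_fst _ _ mR mR; have m2 := @measurable_snd _ _ mR mR.
pose q := gpdf m.-1.
have mq d (T : measurableType d) (f : T -> R) : measurable_fun setT f -> measurable_fun setT (fun t => q (f t)).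
  by move=> mf; exact: (measurableT_comp (measurable_gpdf m.-1) mf).
have mFp d (T : measurableType d) (f g : T -> R) : measurable_fun setT f -> measurable_fun setT g ->
    measurable_fun setT (fun t => F (f t, g t)).
  by move=> mf mg; apply: (measurableT_comp mF); exact/measurable_fun_pairP.
have mGs := measurable_gsum.
have mF1 : measurable_fun setT (fun z : mR * mR => F (gsum z.1, gsum z.2)).
  by apply: mFp; [exact: (measurableT_comp mGs m1)|exact: (measurableT_comp mGs m2)].
transitivity (\int[lam]_w (fun z : mR * mR => F (gsum z.1, gsum z.2)) (th0 w, th1 w))%E; first by [].
rewrite (@ge0_split R _ mF1 (fun z => F0 _)) /=.
pose L (s t : R) := ((q s)%:E * ((q t)%:E * F (s, t)))%E.
have mL : measurable_fun setT (fun z : mR * mR => L z.1 z.2).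
  apply: emeasurable_funM; first by apply/measurable_EFinP; exact: mq.
  by apply: emeasurable_funM; [apply/measurable_EFinP; exact: mq|exact: mFp].
have q0 s : 0 <= q s by exact: gpdf_ge0.
have L0 s t : (0 <= L s t)%E by rewrite !mule_ge0// lee_fin.
have mK : measurable_fun setT (fun z : mR * mR => ((q z.2)%:E * F (z.1, z.2))%E).
  by apply: emeasurable_funM; [apply/measurable_EFinP; exact: mq|exact: mFp].
have K0 (z : mR * mR) : (0 <= (q z.2)%:E * F (z.1, z.2))%E by rewrite mule_ge0// lee_fin.
pose K s := (\int[mu]_t ((q t)%:E * F (s, t)))%E.
have mKK : measurable_fun setT (K : mR -> _) by exact: (@measurable_fun_fubini_tonelli_F _ _ mR mR R mu _ mK K0).
have KK0 s : (0 <= K s)%E by apply: integral_ge0 => t _; exact: (K0 (s, t)).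
transitivity (\int[lam]_x K (gsum x))%E.
  apply: eq_integral => x _; rewrite (gsum_law (f := fun t => F (gsum x, t)))//.
  exact: (measurable_fun_pair2 (gsum x) mF).
rewrite (gsum_law mKK KK0).
transitivity (\int[mu]_s \int[mu]_t L s t)%E.
  apply: eq_integral => s _; rewrite /K -ge0_integralZl//=.
  - exact: (measurable_fun_pair2 s mK).
  - by move=> t _; exact: (K0 (s, t)).
  - by rewrite lee_fin; exact: q0.
transitivity (\int[mu]_s \int[mu]_r L s (r - s)%R)%E.
  apply: eq_integral => s _; rewrite (@ge0_integral_affine R 1 (- s) (L s) ltr01 (measurable_fun_pair2 s mL) (L0 s)).
  by rewrite mul1e; apply: eq_integral => r _; rewrite mul1r.
have mL2 : measurable_fun setT (fun z : mR * mR => L z.1 (z.2 - z.1)).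
  have mB : measurable_fun setT (fun z : mR * mR => z.2 - z.1) by exact: measurable_funB.
  apply: emeasurable_funM; first by apply/measurable_EFinP; exact: mq.
  by apply: emeasurable_funM; [apply/measurable_EFinP; exact: mq|exact: mFp].
rewrite (@fubini_tonelli _ _ mR mR R mu mu _ mL2 (fun z => L0 _ _)).
apply: eq_integral => r _ /=.
have mLr : measurable_fun setT (fun s : R => L s (r - s)) := measurable_fun_pair1 r mL2.
have [r0|r0] := ltP 0 r.
  rewrite (@ge0_integral_affine R r 0 (fun s => L s (r - s)) r0 mLr (fun s => L0 _ _)).
  pose A w := L (r * w + 0) (r - (r * w + 0)).
  pose B w := ((hd w)%:E * F (r * w, r - r * w)%R)%E.
  have mA : measurable_fun setT (A : mR -> _).
    apply: (measurableT_comp mLr (_ : measurable_fun setT (fun w : mR => r * w + 0))).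
    by apply: measurable_funD => //; exact: measurable_funM.
  have A0 w : (0 <= A w)%E by exact: L0.
  have mB : measurable_fun setT (B : mR -> _).
    apply: emeasurable_funM; first by apply/measurable_EFinP; exact: measurable_hd.
    by apply: (@mFp _ mR (fun w => r * w) (fun w => r - r * w)); [exact: measurable_funM|apply: measurable_funB => //; exact: measurable_funM].
  have B0 w : (0 <= B w)%E by rewrite mule_ge0// lee_fin hd_ge0.
  rewrite -[LHS]/(r%:E * \int[mu]_w A w)%E -[RHS]/((gpdf (2 * m).-1 r)%:E * \int[mu]_w B w)%E.
  have r0' : (0 <= r%:E)%E by rewrite lee_fin ltW.
  have g0 : (0 <= (gpdf (2 * m).-1 r)%:E)%E by rewrite lee_fin gpdf_ge0.
  rewrite -(ge0_integralZl mu measurableT mA (fun w _ => A0 w) r0').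
  rewrite -(ge0_integralZl mu measurableT mB (fun w _ => B0 w) g0).
  rewrite /A /B.
  apply: eq_integral => w _; rewrite addr0 /L !muleA -!EFinM -gpdf_prod//.
  by rewrite mulrA.
have -> : gpdf (2 * m).-1 r = 0.
  rewrite /gpdf exp_pdfE; case: (lerP 0 r) => r1; last by rewrite mul0r.
  have -> : r = 0 by apply/eqP; rewrite eq_le r0 r1.
  have -> : (2 * m).-1 = (2 * m).-2.+1 by lia.
  by rewrite expr0n /= mul0r mulr0.
rewrite mul0e; transitivity (\int[mu]_s (if (0 <= s <= r)%R then L s (r - s)%R else 0))%E.
  apply: eq_integral => s _; case: ifPn => // h; rewrite /L /q /gpdf !exp_pdfE subr_ge0.
  by case: (0 <= s) h; case: (s <= r) => // _; rewrite ?mul0r ?mul0e ?mule0.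
rewrite (integral_itv01 r mLr); apply: integral0_eq => s _; case: ifP => // /andP[s0 sr].
by move: (lt_le_trans (le_lt_trans s0 sr) r0); rewrite ltxx.
Qed.

(** The quotient of factorials is the k-th moment of the Gamma law of shape 2m, which separates from
    the ratio. *)
Lemma bW_law (g : R -> \bar R) (k : nat) : measurable_fun setT g -> (forall x, 0 <= g x)%E ->
  (\int[lam]_s (g (bW s) * ((bU s + bV s) ^+ k)%:E) =
   (((2 * m).-1 + k)`!%:R / (2 * m).-1`!%:R)%:E * \int[mu]_w ((hd w)%:E * g w))%E.
Proof.
move=> mg g0; pose F (z : R * R) := (g (z.1 / (z.1 + z.2))%R * (`|z.1 + z.2| ^+ k)%:E)%E.
have m1 := @measurable_fst _ _ mR mR; have m2 := @measurable_snd _ _ mR mR.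
have mD : measurable_fun setT (fun z : mR * mR => z.1 + z.2) by exact: measurable_funD.
have mF : measurable_fun setT (F : mR * mR -> _).
  apply: emeasurable_funM.
    apply: (measurableT_comp mg); apply: measurable_funM => //.
    exact: (measurableT_comp measurable_invr mD).
  by apply/measurable_EFinP/measurable_funX; exact: (measurableT_comp (@normr_measurable R setT) mD).
have F0 z : (0 <= F z)%E by rewrite mule_ge0// lee_fin exprn_ge0.
transitivity (\int[lam]_s F (bU s, bV s))%E.
  by apply: eq_integral => s _; rewrite /F /= ger0_norm ?addr_ge0 ?bU_ge0 ?bV_ge0.
rewrite (gamma_beta mF F0) -integral_gpdf.
have mh : measurable_fun setT (fun w : R => ((hd w)%:E * g w)%E).
  by apply: emeasurable_funM => //; apply/measurable_EFinP; exact: measurable_hd.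
have h0 w : (0 <= (hd w)%:E * g w)%E by rewrite mule_ge0// lee_fin hd_ge0.
have I0 : (0 <= \int[mu]_w ((hd w)%:E * g w))%E by apply: integral_ge0.
rewrite -(_ : (\int[mu]_s ((gpdf (2 * m).-1 s)%:E * (`|s| ^+ k)%:E) =
    \int[mu]_s ((gpdf (2 * m).-1 s)%:E * (s ^+ k)%:E)))%E; last first.
  apply: eq_integral => s _; rewrite /gpdf exp_pdfE; case: (lerP 0 s) => s0; last by rewrite mul0r !mul0e.
  by rewrite ger0_norm.
have mk : measurable_fun setT (fun s : R => ((gpdf (2 * m).-1 s)%:E * (`|s| ^+ k)%:E)%E).
  apply: emeasurable_funM; apply/measurable_EFinP; first exact: measurable_gpdf.
  by apply: measurable_funX; exact: normr_measurable.
have k0 s : (0 <= (gpdf (2 * m).-1 s)%:E * (`|s| ^+ k)%:E)%E.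
  by rewrite mule_ge0// lee_fin ?gpdf_ge0// exprn_ge0.
rewrite -(ge0_integralZr mu measurableT mk (fun s _ => k0 s) I0).
apply: eq_integral => r _; rewrite -muleA.
have [->|r0] := eqVneq r 0.
  have -> : gpdf (2 * m).-1 0 = 0.
    have -> : (2 * m).-1 = (2 * m).-2.+1 by lia.
    by rewrite /gpdf expr0n /= mul0r mulr0.
  by rewrite !mul0e.
congr (_ * _)%E; rewrite -ge0_integralZl//.
apply: eq_integral => w _; rewrite /F /= addrC subrK mulrAC mulfV// mul1r.
by rewrite muleCA [X in (_ * X)%E]muleC muleCA [X in (_ * X)%E]muleC.
Qed.

Lemma bU_bW s : bU s = bW s * (bU s + bV s).
Proof.
have [h|h] := eqVneq (bU s + bV s) 0; last by rewrite /bW divfK.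
rewrite h mulr0; apply/eqP; rewrite eq_le bU_ge0 andbT -h lerDl; exact: bV_ge0.
Qed.

Lemma bW01 s : 0 <= bW s <= 1.
Proof.
have [h|h] := eqVneq (bU s + bV s) 0; first by rewrite /bW h invr0 mulr0 lexx ler01.
have h' : 0 < bU s + bV s by rewrite lt_def h addr_ge0 ?bU_ge0 ?bV_ge0.
by rewrite /bW divr_ge0 ?bU_ge0 ?(ltW h')//= ler_pdivrMr// mul1r lerDl bV_ge0.
Qed.

Lemma integral_hd (g : R -> R) (v : R) : continuous g -> 0 <= v <= 1 -> (forall x, 0 <= x <= 1 -> 0 <= g x) ->
  (\int[mu]_w ((hd w)%:E * ((0 <= w <= v)%R%:R * g w)%:E) =
   (\int[mu]_(w in `[0, v]) (hden m w * g w))%:E)%E.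
Proof.
move=> cg /andP[v0 v1] g0.
have I : mu.-integrable `[0, v] (EFin \o (fun w => hden m w * g w)).
  by apply: continuous_integrable => x; apply: continuousM; [exact: continuous_hden|exact: cg].
rewrite /Rintegral fineK; last exact: integrable_fin_num.
rewrite [RHS]integral_mkcond; apply: eq_integral => w _; rewrite patchE /hd.
case: (boolP (w \in _)); rewrite ?notin_setE ?inE/= in_itv/=.
  by move=> /andP[w0 wv]; rewrite w0 wv (le_trans wv v1)/= mul1r EFinM.
by move/negP/negbTE => ->; rewrite mul0r mule0.
Qed.

Lemma mind (v : R) : measurable_fun setT (fun s => (bW s <= v)%R%:R : R).
Proof.
rewrite (_ : (fun s => _) = (fun s => if bW s <= v then 1 else 0)); last by apply/funext => s; case: ifP.
apply: measurable_fun_ifT => //; apply: measurable_fun_ler => //; exact: measurable_bW.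
Qed.

Lemma bW_mom (g : R -> R) (v : R) (k : nat) : continuous g -> 0 <= v <= 1 -> (forall x, 0 <= x <= 1 -> 0 <= g x) ->
  let f s := (bW s <= v)%R%:R * g (bW s) * (bU s + bV s) ^+ k in
  Int f /\ E f = ((2 * m).-1 + k)`!%:R / (2 * m).-1`!%:R * \int[mu]_(w in `[0, v]) (hden m w * g w).
Proof.
move=> cg v01 g0 f.
have mgW : measurable_fun setT (fun w : R => (0 <= w <= v)%R%:R * g w).
  rewrite (_ : (fun w => _) = (fun w => if 0 <= w <= v then g w else 0)); last first.
    by apply/funext => w; case: ifP; rewrite ?mul1r ?mul0r.
  apply: measurable_fun_ifT => //; last exact: measurable_continuous.
  by apply: measurable_and; apply: measurable_fun_ler.
have h : (\int[lam]_s (f s)%:E = (((2 * m).-1 + k)`!%:R / (2 * m).-1`!%:R * \int[mu]_(w in `[0, v]) (hden m w * g w))%:E)%E.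
  rewrite EFinM -integral_hd// -(bW_law (g := fun w => ((0 <= w <= v)%R%:R * g w)%:E)).
  - by apply: eq_integral => s _; rewrite /f EFinM; have /andP[-> _] := bW01 s.
  - exact/measurable_EFinP.
  - move=> w; rewrite lee_fin; case: (boolP (0 <= w <= v)) => [/andP[w0 wv]|_]; last by rewrite mul0r.
    by rewrite mul1r g0// w0/= (le_trans wv)//; case/andP: v01.
have mf : measurable_fun setT f.
  apply: measurable_funM; first apply: measurable_funM; first exact: mind.
    exact: (measurableT_comp (measurable_continuous cg) measurable_bW).
  by apply: measurable_funX; apply: measurable_funD; [exact: L4_bU.1|exact: L4_bV.1].
have f0 s : 0 <= f s.
  by rewrite /f mulr_ge0 ?exprn_ge0 ?addr_ge0 ?bU_ge0 ?bV_ge0// mulr_ge0// g0// bW01.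
have I : Int f by apply: Int_ge0 => //; rewrite h ltry.
split => //; apply: EFin_inj; rewrite -(E_EFin I); exact: h.
Qed.

Lemma E_ind (v : R) : 0 <= v <= 1 -> E (fun s => (bW s <= v)%R%:R) = Hm m v.
Proof.
move=> v01; have c1 : continuous (fun _ : R => 1 : R) by move=> x; exact: cst_continuous.
have [_] := bW_mom 0 c1 v01 (fun x _ => ler01); rewrite addn0 mulfV ?pnatr_eq0 -?lt0n ?fact_gt0// mul1r.
rewrite (_ : (fun s => _) = (fun s => (bW s <= v)%R%:R)); last by apply/funext => s; rewrite expr0 !mulr1.
move=> ->; rewrite (_ : (fun w => hden m w * 1) = hden m); last by apply/funext => w; rewrite mulr1.
have [v0 _] := andP v01.
by rewrite (integral_FTC2 (@dHm R m) (@continuous_hden R m) v0) Hm0 subr0.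
Qed.

Lemma Int_ind (v : R) : Int (fun s => (bW s <= v)%R%:R).
Proof. by apply: Int_01; [exact: mind|move=> s; case: (bW s <= v); rewrite /= ?lexx ?ler01]. Qed.

Definition bD (s : R) : R := bU s - bV s.

Lemma L4_bD : L4 bD.
Proof. by apply: L4D; [exact: L4_bU|exact: (L4N L4_bV)]. Qed.

Lemma E_bU : E bU = m%:R.
Proof. by rewrite -E_gsum; exact: (mpres_E (@mpres_th0 R) (L4_Int L4_gsum)). Qed.

Lemma E_bV : E bV = m%:R.
Proof. by rewrite -E_gsum; exact: (mpres_E (@mpres_th1 R) (L4_Int L4_gsum)). Qed.

Lemma E_bD : E bD = 0.
Proof. by rewrite (EB (L4_Int L4_bU) (L4_Int L4_bV)) E_bU E_bV subrr. Qed.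

Lemma E_bD2 : E (fun s => bD s * bD s) = (2 * m)%:R.
Proof.
have [I1 e1] := E_prod (L4_Int L4_gsum) (L4_Int L4_gsum).
have [I2 _] := gsum_moment 2.
have IU : Int (fun s => bU s ^+ 2) := mpres_Int (@mpres_th0 R) I2.
have IV : Int (fun s => bV s ^+ 2) := mpres_Int (@mpres_th1 R) I2.
transitivity (E (fun s => (bU s ^+ 2 + bV s ^+ 2) + (- 2) * (bU s * bV s))).
  by congr E; apply/funext => s; rewrite /bD; ring.
rewrite (ED (IntD IU IV) (IntZ (- 2) I1)) (EZ (- 2) I1) (ED IU IV).
have -> : E (fun s => bU s ^+ 2) = m%:R * (m%:R + 1) by rewrite -E_gsum2; exact: (mpres_E (@mpres_th0 R) I2).
have -> : E (fun s => bV s ^+ 2) = m%:R * (m%:R + 1) by rewrite -E_gsum2; exact: (mpres_E (@mpres_th1 R) I2).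
have -> : E (fun s => bU s * bV s) = E gsum * E gsum by exact: e1.
by rewrite E_gsum natrM; ring.
Qed.

(** U - V = (2W - 1) (U + V), where U + V has mean 2m and is independent of W; and 2m (2w - 1)
    [hden] is -2 times the derivative of [phi]. *)
Lemma E_ind_bD (v : R) : 0 <= v <= 1 -> E (fun s => (bW s <= v)%R%:R * bD s) = - 2 * phi m v.
Proof.
move=> v01; have c1 : continuous (fun _ : R => 1 : R) by move=> x; exact: cst_continuous.
have cid : continuous (fun x : R => x) by move=> x.
have [I1 e1] := bW_mom 1 c1 v01 (fun x _ => ler01).
have x0 (x : R) : 0 <= x <= 1 -> 0 <= x by case/andP.
have [I2 e2] := bW_mom 1 cid v01 x0.
transitivity (E (fun s => 2 * ((bW s <= v)%R%:R * bW s * (bU s + bV s) ^+ 1) +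
    - ((bW s <= v)%R%:R * 1 * (bU s + bV s) ^+ 1))).
  congr E; apply/funext => s; rewrite {1}/bD {1}(_ : bV s = (bU s + bV s) - bU s); last by rewrite addrC addKr.
  rewrite {1 3}(bU_bW s); ring.
rewrite ED; [|exact: IntZ|exact: IntN].
rewrite EZ// EN// e1 e2 addn1 factS natrM mulfK ?pnatr_eq0 -?lt0n ?fact_gt0//.
have -> : (2 * m).-1.+1 = (2 * m)%N by lia.
case/andP: (v01) => v0 v1.
have ci (g : R -> R) : continuous g -> continuous (fun w => hden m w * g w).
  by move=> cg x; apply: continuousM; [exact: continuous_hden|exact: cg].
have : \int[mu]_(w in `[0, v]) (m%:R * hden m w * (1 - 2 * w)) = phi m v - phi m 0.
  apply: integral_FTC2 => //; first exact: dphi.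
  move=> x; rewrite (_ : (fun w => _) = (fun w => hden m w * (m%:R * (1 - 2 * w)))); last by apply/funext => w; ring.
  apply: (ci (fun w : R => m%:R * (1 - 2 * w))) => y; apply: cvgM; first exact: cvg_cst.
  by apply: cvgB; [exact: cvg_cst|apply: cvgM; [exact: cvg_cst|exact: cvg_id]].
rewrite phi0// subr0 => <-.
have -> : \int[mu]_(w in `[0, v]) (m%:R * hden m w * (1 - 2 * w)) =
   m%:R * \int[mu]_(w in `[0, v]) (hden m w * 1) - 2 * m%:R * \int[mu]_(w in `[0, v]) (hden m w * w).
  rewrite -!RintegralZl//; [|exact: (continuous_integrable _ _ (ci _ cid))|exact: (continuous_integrable _ _ (ci _ c1))].
  rewrite -RintegralB//; first by apply: eq_Rintegral => w _; ring.
  - apply: (continuous_integrable (f := fun w => m%:R * (hden m w * 1))) => x.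
    by apply: cvgM; [exact: cvg_cst|exact: ci].
  - apply: (continuous_integrable (f := fun w => 2 * m%:R * (hden m w * w))) => x.
    by apply: cvgM; [exact: cvg_cst|exact: ci].
by rewrite natrM; ring.
Qed.

End GammaBeta.

(** * Oscillations of the empirical process *)

Section SumMoments.
Context {R : realType}.
Local Notation mR := (measurableTypeR R).
Local Notation lam := (@lam R).
Local Notation th0 := (@th0 R).
Local Notation th1 := (@th1 R).

Lemma L4_sumsd (f : nat -> R -> R) n : (forall k, L4 (f k)) -> L4 (fun w => \sum_(k < n) f k (sd k w)).
Proof. by move=> Lf; apply: L4_sum => k; exact: (L4_mpres (mpres_sd k) (Lf k)). Qed.

Lemma sumsdS (f : nat -> R -> R) n : (fun w : R => \sum_(k < n.+1) f k (sd k w)) =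
  (fun w => f 0%N (th0 w) + (fun w => \sum_(k < n) f k.+1 (sd k w)) (th1 w)).
Proof.
apply/funext => w; rewrite big_ord_recl; congr (_ + _).
by apply: eq_bigr => k _; rewrite -sdS.
Qed.

Lemma E_sumsd (f : nat -> R -> R) n : (forall k, L4 (f k)) -> (forall k, E (f k) = 0) ->
  E (fun w => \sum_(k < n) f k (sd k w)) = 0.
Proof.
move=> Lf Ef; rewrite E_sum; last by move=> k; exact: (L4_Int (L4_mpres (mpres_sd k) (Lf k))).
by apply: big1 => k _; rewrite -(Ef k); exact: (mpres_E (mpres_sd k) (L4_Int (Lf k))).
Qed.

Lemma E_sumsd2 n (f : nat -> R -> R) : (forall k, L4 (f k)) -> (forall k, E (f k) = 0) ->
  E (fun w => (\sum_(k < n) f k (sd k w)) * (\sum_(k < n) f k (sd k w))) = \sum_(k < n) E (fun s => f k s * f k s).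
Proof.
elim: n f => [|n IH] f Lf Ef.
  by rewrite big_ord0 -[RHS](E_cst (0 : R)); congr E; apply/funext => w; rewrite big_ord0 mul0r.
rewrite big_ord_recl -(IH (fun k => f k.+1))//.
have L1 := L4_sumsd n (fun k => Lf k.+1); have L0 := Lf 0%N.
rewrite -(cov_add L0 L0 L1 L1)//; last 2 first.
- exact: (E_sumsd n (fun k => Lf k.+1) (fun k => Ef k.+1)).
- exact: (E_sumsd n (fun k => Lf k.+1) (fun k => Ef k.+1)).
by congr E; apply/funext => w; rewrite -(congr1 (fun F => F w) (sumsdS f n)).
Qed.

(** In the expansion, the terms containing a first power of a centred independent factor vanish; the
    remaining cross terms give the coefficient 3 n^2. *)
Lemma E_sumsd4 n (f : R -> R) : L4 f -> E f = 0 ->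
  E (fun w => (\sum_(k < n) f (sd k w)) ^+ 4) <=
  n%:R * E (fun s => f s ^+ 4) + 3 * n%:R ^+ 2 * E (fun s => f s * f s) ^+ 2.
Proof.
move=> Lf Ef; elim: n => [|n IH].
  rewrite (_ : (fun w => _) = cst 0); last by apply/funext => w; rewrite big_ord0 expr0n.
  by rewrite E_cst mul0r expr0n /= mulr0 mul0r addr0.
pose S w := \sum_(k < n) f (sd k w).
have LS : L4 S by exact: (L4_sumsd n (fun _ : nat => Lf)).
have ES : E S = 0 by exact: (@E_sumsd (fun=> f)).
have ES2 : E (fun w => S w ^+ 2) = n%:R * E (fun s => f s * f s).
  transitivity (E (fun w => S w * S w)); first by congr E; apply/funext => w; rewrite expr2.
  by rewrite (@E_sumsd2 n (fun=> f))// sumr_const card_ord mulr_natl.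
have [f1 f2 f3] := Int_pow4 Lf.1 Lf.2; have [S1 S2 S3] := Int_pow4 LS.1 LS.2.
have [I31 e31] := E_prod f3 S1; have [I22 e22] := E_prod f2 S2; have [I13 e13] := E_prod f1 S3.
have I4 : Int (fun w => f (th0 w) ^+ 4) := mpres_Int (@mpres_th0 R) Lf.2.
have J4 : Int (fun w => S (th1 w) ^+ 4) := mpres_Int (@mpres_th1 R) LS.2.
have E4 : E (fun w => f (th0 w) ^+ 4) = E (fun s => f s ^+ 4) := mpres_E (@mpres_th0 R) Lf.2.
have F4 : E (fun w => S (th1 w) ^+ 4) = E (fun s => S s ^+ 4) := mpres_E (@mpres_th1 R) LS.2.
have -> : (fun w => (\sum_(k < n.+1) f (sd k w)) ^+ 4) =
  (fun w => (f (th0 w) ^+ 4 + S (th1 w) ^+ 4) + (4 * (f (th0 w) ^+ 3 * S (th1 w)) +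
     (6 * (f (th0 w) ^+ 2 * S (th1 w) ^+ 2) + 4 * (f (th0 w) * S (th1 w) ^+ 3)))).
  apply/funext => w; rewrite (congr1 (fun F => F w) (sumsdS (fun=> f) n)) -/(S _).
  by move: (f _) (S _) => a b; ring.
have K22 := IntZ 6 I22; have K13 := IntZ 4 I13; have K31 := IntZ 4 I31.
rewrite (ED (IntD I4 J4) (IntD K31 (IntD K22 K13))) (ED I4 J4) (ED K31 (IntD K22 K13)) (ED K22 K13).
rewrite (EZ 4 I31) (EZ 6 I22) (EZ 4 I13) e31 e22 e13 E4 F4 ES Ef ES2.
have e2 : E (fun s => f s ^+ 2) = E (fun s => f s * f s) by congr E; apply/funext => s; rewrite expr2.
rewrite e2 -[n.+1%:R]natr1; move: IH; rewrite -/S.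
move: (E (fun w => S w ^+ 4)) (E (fun s => f s ^+ 4)) (E (fun s => f s * f s)) => a b c h.
have := sqr_ge0 c; move: (n%:R) h => k h c2.
apply: (@le_trans _ _ (b + (k * b + 3 * k ^+ 2 * c ^+ 2) + (4 * (E (fun x => f x ^+ 3) * 0) + (6 * (c * (k * c)) + 4 * (0 * E (fun x => S x ^+ 3)))))).
  by rewrite lerD2r lerD2l.
rewrite -subr_ge0 (_ : _ - _ = 3 * c ^+ 2); last by ring.
by rewrite mulr_ge0.
Qed.

End SumMoments.

(** * Chaining along dyadic points *)

Section Chaining.
Context {R : realType}.

Lemma trunc_dyadic (x : R) l : 0 <= x -> let j := Num.trunc (2 ^+ l * x) in
  (Num.trunc (2 ^+ l.+1 * x) = 2 * j)%N \/ (Num.trunc (2 ^+ l.+1 * x) = (2 * j).+1)%N.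
Proof.
move=> x0 j; have h k : 0 <= 2 ^+ k * x by rewrite mulr_ge0// exprn_ge0.
have /andP[a1 a2] := truncn_itv (h l); have /andP[b1 b2] := truncn_itv (h l.+1).
rewrite -/j in a1 a2; move: b1 b2; rewrite exprS -mulrA; set i := Num.trunc _ => b1 b2.
have h1 : (i < 2 * j.+1)%N by rewrite -(ltr_nat R) natrM (le_lt_trans b1)// ltr_pM2l.
have h2 : (2 * j < i.+1)%N by rewrite -(ltr_nat R) natrM (le_lt_trans _ b2)// ler_pM2l.
by lia.
Qed.

Definition dyf l (x : R) : R := (Num.trunc (2 ^+ l * x))%:R / 2 ^+ l.

(** Increments are controlled on dyadic grids down to level [L] only. Inside the finest cells the
    one-sided bound takes over: a path that cannot drop fast is squeezed between the values at the
    ends of the cell. In 21, each endpoint costs 10, the geometric sum of ratio [rb], and the step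
    between neighbours at level [p] costs 1. *)
Lemma chaining (b : R -> R) (z c : R) (L p : nat) : 0 <= z -> 0 <= c -> (p <= L)%N ->
  (forall l j, (l <= L)%N -> (j < 2 ^ l)%N -> `|b (j.+1%:R / 2 ^+ l) - b (j%:R / 2 ^+ l)| <= z * rb ^+ l) ->
  (forall x y, 0 <= x -> x <= y -> y <= 1 -> - (c * (y - x)) <= b y - b x) ->
  forall x y, 0 <= x -> x <= y -> y <= 1 -> y - x <= (2 ^+ p)^-1 ->
  `|b x - b y| <= 21 * z * rb ^+ p + 2 * c / 2 ^+ L.
Proof.
have aux (i j : nat) : (i < j.+1)%N -> (j < i.+2)%N -> j = i \/ j = i.+1 by lia.
move=> z0 c0 pL inc mono.
have p2 l : 0 < 2 ^+ l :> R by rewrite exprn_gt0.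
have p2c l : (2 ^ l)%:R = 2 ^+ l :> R by rewrite natrX.
have /andP[rb0 rb1] := @rb01 R.
have zr l : 0 <= z * rb ^+ l by rewrite mulr_ge0// exprn_ge0.
have tr (x : R) l : 0 <= x -> (Num.trunc (2 ^+ l * x))%:R <= 2 ^+ l * x < (Num.trunc (2 ^+ l * x)).+1%:R.
  by move=> x0; apply: truncn_itv; rewrite mulr_ge0// ltW.
have trlt (x : R) l : 0 <= x -> x < 1 -> (Num.trunc (2 ^+ l * x) < 2 ^ l)%N.
  move=> x0 x1; have /andP[h _] := tr x l x0.
  by rewrite -(ltr_nat R) p2c (le_lt_trans h)// gtr_pMr.
have dyf1 l : dyf l 1 = 1.
  rewrite /dyf mulr1 -p2c natrK mulfV// p2c gt_eqF//.
have A (x : R) : 0 <= x -> x < 1 -> `|b x - b (dyf L x)| <= z * rb ^+ L + c / 2 ^+ L.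
  move=> x0 x1; have /andP[h1 h2] := tr x L x0; have jl := trlt x L x0 x1.
  have := inc L _ (leqnn L) jl; rewrite -/(dyf L x); set j := Num.trunc _ in h1 h2 jl *.
  set u := _ / _; set d := dyf L x; move=> hi.
  have d0 : 0 <= d by rewrite divr_ge0// ltW.
  have dx : d <= x by rewrite /d /dyf ler_pdivrMr// [x * _]mulrC.
  have xu : x <= u by rewrite /u ler_pdivlMr// mulrC ltW.
  have u1 : u <= 1 by rewrite /u ler_pdivrMr// mul1r -p2c ler_nat.
  have ud : u - d = (2 ^+ L)^-1 by rewrite /u /d /dyf -/j -natr1 mulrDl addrAC subrr add0r div1r.
  have m1 := mono d x d0 dx (ltW x1); have m2 := mono x u x0 xu u1.
  have k1 : c * (x - d) <= c / 2 ^+ L by apply: ler_wpM2l => //; rewrite -ud lerB.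
  have k2 : c * (u - x) <= c / 2 ^+ L by apply: ler_wpM2l => //; rewrite -ud lerB.
  move: hi; rewrite ler_norml => /andP[_ hi].
  have := zr L; rewrite ler_norml; lra.
have cL : 0 <= c / 2 ^+ L by rewrite divr_ge0// ltW.
(* Downward induction on the level. The factor 10 reproduces itself since 10 * (9 / 10) + 9 / 10 <=
   10. *)
have B' k : forall l (x : R), (l + k = L)%N -> 0 <= x -> x < 1 -> `|b x - b (dyf l x)| <= 10 * (z * rb ^+ l) + c / 2 ^+ L.
  elim: k => [|k IH] l x lk x0 x1.
    rewrite addn0 in lk; rewrite lk; have := A x x0 x1; have := zr L; lra.
  have := IH l.+1 x; rewrite addSnnS => /(_ lk x0 x1) h.
  have h2 : `|b (dyf l.+1 x) - b (dyf l x)| <= z * rb ^+ l.+1.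
    have [e|e] := @trunc_dyadic x l x0.
      rewrite [dyf l.+1 x]/dyf e /dyf natrM exprS -mulf_div mulfV// mul1r subrr normr0; exact: zr.
    have jl := trlt x l.+1 x0 x1; rewrite e in jl.
    have lL : (l.+1 <= L)%N by rewrite -lk addnS ltnS leq_addr.
    have := inc l.+1 _ lL (ltn_trans (ltnSn _) jl); rewrite [dyf l.+1 x]/dyf e.
    by rewrite [(2 * _)%N%:R]natrM exprS -[2 * _ / _]mulf_div mulfV// mul1r -exprS.
  have := zr l.
  have -> : `|b x - b (dyf l x)| = `|(b x - b (dyf l.+1 x)) + (b (dyf l.+1 x) - b (dyf l x))| by congr `|_|; ring.
  move=> zl; apply: (le_trans (ler_normD _ _)).
  have e : z * rb ^+ l.+1 = 9 / 10 * (z * rb ^+ l) by rewrite exprS /rb; ring.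
  by rewrite e in h h2; lra.
have B k l (x : R) : (l + k = L)%N -> 0 <= x -> x <= 1 -> `|b x - b (dyf l x)| <= 10 * (z * rb ^+ l) + c / 2 ^+ L.
  move=> lk x0; rewrite le_eqVlt => /predU1P[->|]; last exact: (B' k l x lk x0).
  by rewrite dyf1 subrr normr0 addr_ge0// mulr_ge0.
move=> x y x0 xy y1 yx.
have y0 := le_trans x0 xy; have x1 := le_trans xy y1.
have pk : (p + (L - p))%N = L by rewrite subnKC.
have h1 := B _ p x pk x0 x1; have h2 := B _ p y pk y0 y1.
have h3 : `|b (dyf p x) - b (dyf p y)| <= z * rb ^+ p.
  have /andP[a1 a2] := tr x p x0; have /andP[b1 b2] := tr y p y0.
  rewrite /dyf; set i := Num.trunc _ in a1 a2 *; set j := Num.trunc _ in b1 b2 *.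
  have xyp : 2 ^+ p * y <= 2 ^+ p * x + 1.
    by rewrite -lerBlDl -mulrBr mulrC -ler_pdivlMr// div1r.
  have ij : (i < j.+1)%N by rewrite -(ltr_nat R) (le_lt_trans _ b2)// (le_trans a1)// ler_pM2l.
  have ji : (j < i.+2)%N by rewrite -(ltr_nat R) (le_lt_trans b1)// (le_lt_trans xyp)// -[i.+2%:R]natr1 ltrD2r.
  case: (aux _ _ ij ji) => [->|e]; first by rewrite subrr normr0.
  have j2 : (j <= 2 ^ p)%N by rewrite -(ler_nat R) p2c (le_trans b1)// ger_pMr.
  by rewrite e distrC; apply: inc => //; rewrite -e.
have -> : b x - b y = (b x - b (dyf p x)) + ((b (dyf p x) - b (dyf p y)) - (b y - b (dyf p y))) by ring.
apply: (le_trans (ler_normD _ _)).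
have h4 := ler_normB (b (dyf p x) - b (dyf p y)) (b y - b (dyf p y)).
rewrite -mulrA -[2 * c / _]mulrA; lra.
Qed.

End Chaining.

(** * The empirical process of the ratios U / (U + V) *)

Section EmpiricalProcess.
Context {R : realType}.
Local Notation mR := (measurableTypeR R).
Local Notation lam := (@lam R).
Local Notation th0 := (@th0 R).
Local Notation th1 := (@th1 R).
Variable m : nat.
Hypothesis m_gt0 : (0 < m)%N.
Local Notation Hm := (@Hm R m).
Local Notation Kc := (@Kc R m).

Definition eb (v s : R) : R := (bW m s <= v)%R%:R - Hm v.
Definition bt (n : nat) (w v : R) : R := (Num.sqrt n%:R)^-1 * Sv n eb w v.

Lemma L4_bnd (f : R -> R) c : measurable_fun setT f -> (forall x, `|f x| <= c) -> L4 f.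
Proof.
move=> mf fc; split => //; apply: (@Int_bounded _ _ (c ^+ 4)); first exact: measurable_funX.
by move=> x; rewrite normrX; apply: lerXn2r => //; rewrite ?nnegrE// (le_trans _ (fc x)).
Qed.

Lemma measurable_eb v : measurable_fun setT (eb v).
Proof. by apply: measurable_funB => //; exact: mind. Qed.

Lemma L4_eb v : L4 (eb v).
Proof.
apply: (@L4_bnd _ (1 + `|Hm v|)); first exact: measurable_eb.
by move=> s; apply: (le_trans (ler_normB _ _)); rewrite lerD2r; case: (bW m s <= v); rewrite ?normr1 ?normr0.
Qed.

Lemma E_eb v : 0 <= v <= 1 -> E (eb v) = 0.
Proof.
move=> v01; rewrite (EB (@Int_ind R m m_gt0 v) (Int_cst (Hm v))) E_ind// -[E _]/(E (cst (Hm v))) E_cst subrr//.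
Qed.

Lemma E_ind_mul (a b : R) : 0 <= a <= 1 -> 0 <= b <= 1 ->
  E (fun s => (bW m s <= a)%R%:R * (bW m s <= b)%R%:R) = Num.min (Hm a) (Hm b).
Proof.
move=> a01 b01.
wlog ab : a b a01 b01 / a <= b => [h|].
  have [ab|/ltW ab] := leP a b; first exact: h.
  by rewrite minC -(h b a)//; congr E; apply/funext => s; rewrite mulrC.
have [_ /(_ (andP a01).1)] := (I, fun h => Hm_le m h ab (andP b01).2).
rewrite subr_ge0 => /andP[Hab _]; rewrite min_l// -(E_ind m_gt0 a01).
congr E; apply/funext => s; case: (boolP (bW m s <= a)) => h; last by rewrite mul0r.
by rewrite (le_trans h ab) mul1r.
Qed.

Lemma cov_eb (a b : R) : 0 <= a <= 1 -> 0 <= b <= 1 ->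
  E (fun s => eb a s * eb b s) = Num.min (Hm a) (Hm b) - Hm a * Hm b.
Proof.
move=> a01 b01.
have Ia := @Int_ind R m m_gt0 a; have Ib := @Int_ind R m m_gt0 b.
have La : L4 (fun s => (bW m s <= a)%R%:R : R).
  by apply: (@L4_bnd _ 1); [exact: mind|move=> s; case: (bW m s <= a); rewrite ?normr1 ?normr0].
have Lb : L4 (fun s => (bW m s <= b)%R%:R : R).
  by apply: (@L4_bnd _ 1); [exact: mind|move=> s; case: (bW m s <= b); rewrite ?normr1 ?normr0].
have Iab := L4_Int_mul La Lb.
transitivity (E (fun s => ((bW m s <= a)%R%:R * (bW m s <= b)%R%:R) + ((- Hm b) * (bW m s <= a)%R%:R + (- Hm a) * eb b s))).
  by congr E; apply/funext => s; rewrite /eb; ring.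
have Ie := L4_Int (L4_eb b).
rewrite (ED Iab (IntD (IntZ _ Ia) (IntZ _ Ie))) (ED (IntZ _ Ia) (IntZ _ Ie)) (EZ _ Ia) (EZ _ Ie).
by rewrite E_ind_mul// E_ind// E_eb//; ring.
Qed.

Let C0 : R := Kc + 3 * Kc ^+ 2.

(** The fourth moment of the summands contributes p / n with p at most Kc h, which is of order h^2
    only if 1 / n <= h. This is why the chain stops at level [trunc_log 2 n]. *)
Lemma incr4 n (a b h : R) : (0 < n)%N -> 0 <= a -> a <= b -> b <= 1 -> b - a <= h -> n%:R^-1 <= h ->
  Int (fun w => (bt n w b - bt n w a) ^+ 4) /\ E (fun w => (bt n w b - bt n w a) ^+ 4) <= C0 * h ^+ 2.
Proof.
move=> n0 a0 ab b1 bah nh.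
have a01 : 0 <= a <= 1 by rewrite a0 (le_trans ab).
have b01 : 0 <= b <= 1 by rewrite b1 (le_trans a0).
have n0' : 0 < n%:R :> R by rewrite ltr0n.
pose f s := eb b s - eb a s.
have Lf : L4 f by apply: L4D; [exact: L4_eb|exact: (L4N (L4_eb a))].
have Ef : E f = 0 by rewrite (EB (L4_Int (L4_eb b)) (L4_Int (L4_eb a))) !E_eb// subrr.
have /andP[p0 pK] := Hm_le m a0 ab b1; set p := Hm b - Hm a in p0 pK.
have Kc0 := @Kc_gt0 R m.
have ph : p <= Kc * h by apply: (le_trans pK); rewrite ler_pM2l.
have h0 : 0 <= h by apply: (le_trans _ bah); rewrite subr_ge0.
have p1 : p <= 1.
  have /andP[_ h1] := Hm01 m_gt0 b01; have /andP[h2 _] := Hm01 m_gt0 a01; rewrite /p; lra.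
have Ef2 : E (fun s => f s * f s) = p - p ^+ 2.
  have Lb := L4_eb b; have La := L4_eb a.
  have Ibb := L4_Int_mul Lb Lb; have Iaa := L4_Int_mul La La; have Iab := L4_Int_mul La Lb.
  transitivity (E (fun s => (eb b s * eb b s + eb a s * eb a s) + (-2) * (eb a s * eb b s))).
    by congr E; apply/funext => s; rewrite /f; ring.
  rewrite (ED (IntD Ibb Iaa) (IntZ _ Iab)) (ED Ibb Iaa) (EZ _ Iab) !cov_eb// !minxx min_l; first by rewrite /p; ring.
  by rewrite -subr_ge0.
have f1 s : `|f s| <= 1.
  rewrite /f /eb; have [h1|h1] := boolP (bW m s <= a).
    by rewrite (le_trans h1 ab) (_ : _ - _ = - p) ?normrN ?ger0_norm// /p; ring.
  case: (bW m s <= b) => /=.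
    by rewrite (_ : _ - _ = 1 - p); [rewrite ger0_norm; lra|rewrite /p; ring].
  by rewrite (_ : _ - _ = - p) ?normrN ?ger0_norm// /p; ring.
have Ef4 : E (fun s => f s ^+ 4) <= p.
  apply: (@le_trans _ _ (E (fun s => f s * f s))); last by rewrite Ef2 lerBlDr lerDl sqr_ge0.
  apply: E_le; [exact: Lf.2|exact: L4_Int_mul|move=> s].
  rewrite -expr2 (_ : f s ^+ 4 = f s ^+ 2 * f s ^+ 2); last by rewrite -exprD.
  by apply: ler_piMr; rewrite ?sqr_ge0// -real_normK ?num_real// exprn_ile1.
have bE w : bt n w b - bt n w a = (Num.sqrt n%:R)^-1 * \sum_(k < n) f (sd k w).
  rewrite /bt /Sv -mulrBr; congr (_ * _); rewrite -sumrB; exact: eq_bigr.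
have LS : L4 (fun w => \sum_(k < n) f (sd k w)) by exact: (L4_sumsd n (fun _ : nat => Lf)).
have -> : (fun w => (bt n w b - bt n w a) ^+ 4) = (fun w => (n%:R^-1) ^+ 2 * (\sum_(k < n) f (sd k w)) ^+ 4).
  apply/funext => w; rewrite bE exprMn; congr (_ * _).
  by rewrite (exprM _ 2 2 : _ ^+ 4 = _) [in _ ^+ 2 ^+ 2]exprVn sqr_sqrtr// ler0n.
split; first exact: (IntZ _ LS.2).
rewrite (EZ _ LS.2).
have h4 := E_sumsd4 n Lf Ef.
have Ef2' : E (fun s => f s * f s) <= p by rewrite Ef2 lerBlDr lerDl sqr_ge0.
have Ef20 : 0 <= E (fun s => f s * f s) by apply: E_ge0 => s; rewrite -expr2 sqr_ge0.
have nu : n%:R^-1 * n%:R = 1 :> R by rewrite mulVf// gt_eqF.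
have u0 : 0 <= n%:R^-1 :> R by rewrite invr_ge0 ltW.
move: h4 Ef4 Ef2' Ef20 nu u0 nh n0'; move: (n%:R) => k.
move: (E (fun w => _)) (E (fun s => f s ^+ 4)) (E (fun s => f s * f s)) (k^-1) => x y z u h4 hy hz z0 ku u0 uh k0.
apply: (@le_trans _ _ (u ^+ 2 * (k * y + 3 * k ^+ 2 * z ^+ 2))); first by rewrite ler_wpM2l// exprn_ge0.
have -> : u ^+ 2 * (k * y + 3 * k ^+ 2 * z ^+ 2) = (u * k) * (u * y) + 3 * (u * k) ^+ 2 * z ^+ 2 by ring.
have -> : C0 * h ^+ 2 = Kc * h ^+ 2 + 3 * Kc ^+ 2 * h ^+ 2 by rewrite /C0; ring.
rewrite ku mul1r expr1n mulr1; apply: lerD.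
  have -> : Kc * h ^+ 2 = h * (Kc * h) by ring.
  apply: (@le_trans _ _ (u * p)); first by rewrite ler_wpM2l.
  by apply: ler_pM.
have -> : 3 * Kc ^+ 2 * h ^+ 2 = 3 * (Kc * h) ^+ 2 by ring.
rewrite ler_wpM2l//; apply: lerXn2r; rewrite ?nnegrE//; first by rewrite mulr_ge0// ltW.
exact: le_trans ph.
Qed.

Definition dinc n l j (w : R) := bt n w (j.+1%:R / 2 ^+ l) - bt n w (j%:R / 2 ^+ l).
(* The fourth power of a random constant for the modulus of continuity: increments at scale [2 ^- l] are summed with a weight [(4 * cb) ^+ l] that fourth moments of order [4 ^- l] can afford. *)
Definition oz4 n (w : R) : R := \sum_(l < (trunc_log 2 n).+1) (4 * cb) ^+ l * \sum_(j < 2 ^ l) dinc n l j w ^+ 4.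
Definition oz n (w : R) : R := Num.sqrt (Num.sqrt (oz4 n w)).
Definition oC : R := C0 / (1 - 2 * cb).

(** Level l has 2^l increments of fourth moment C0 4^(-l); with the weight (4 cb)^l this is C0 (2
    cb)^l, a convergent series. *)
Lemma Int_oz4 n : (0 < n)%N -> Int (oz4 n) /\ E (oz4 n) <= oC.
Proof.
move=> n0; set L := trunc_log 2 n.
have /andP[nL _] := @trunc_log_bounds 2 n isT n0; rewrite -/L in nL.
have c0 := @cb_gt0 R; have /andP[c1 c2] := @cb_lt R.
have p2 l : 0 < 2 ^+ l :> R by rewrite exprn_gt0.
have I4 (l : 'I_L.+1) (j : 'I_(2 ^ l)) : Int (fun w => dinc n l j w ^+ 4) /\ E (fun w => dinc n l j w ^+ 4) <= C0 * (2 ^+ l)^-1 ^+ 2.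
  apply: incr4 => //.
  - by rewrite ler_pM2r ?invr_gt0// ler_nat.
  - by rewrite ler_pdivrMr// mul1r -natrX ler_nat.
  - by rewrite -natr1 mulrDl addrAC subrr add0r div1r.
  - by rewrite lef_pV2 ?posrE ?p2 ?ltr0n// -natrX ler_nat (leq_trans _ nL)// leq_exp2l// -ltnS ltn_ord.
have I4' (l : 'I_L.+1) : Int (fun w => (4 * cb) ^+ l * \sum_(j < 2 ^ l) dinc n l j w ^+ 4).
  by apply: IntZ; apply: Int_sum => j; exact: (I4 l j).1.
split; first exact: Int_sum.
rewrite /oz4 (E_sum _ I4') /oC.
apply: (@le_trans _ _ (\sum_(l < L.+1) C0 * (2 * cb) ^+ l)).
  apply: ler_sum => l _; rewrite EZ; last by apply: Int_sum => j; exact: (I4 l j).1.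
  rewrite E_sum; last by move=> j; exact: (I4 l j).1.
  apply: (@le_trans _ _ ((4 * cb) ^+ l * \sum_(j < 2 ^ l) C0 * (2 ^+ l)^-1 ^+ 2)).
    apply: ler_wpM2l; first by rewrite exprn_ge0// mulr_ge0// ltW.
    by apply: ler_sum => j _; exact: (I4 l j).2.
  rewrite sumr_const card_ord -[_ *+ (2 ^ l)]mulr_natl natrX.
  have -> : (4 * cb : R) ^+ l = 2 ^+ l * (2 * cb) ^+ l by rewrite -exprMn; congr (_ ^+ _); ring.
  move: ((2 * cb) ^+ l) (2 ^+ l) (p2 l) => x y y0.
  by rewrite le_eqVlt; apply/orP; left; apply/eqP; field; rewrite gt_eqF.
rewrite -mulr_sumr; apply: ler_wpM2l.
  by rewrite /C0; have := @Kc_gt0 R m; have := sqr_ge0 Kc; lra.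
by apply: geo_sum_le; rewrite c1.
Qed.

Lemma oz4_ge0 n w : 0 <= oz4 n w.
Proof.
apply: sumr_ge0 => l _; rewrite mulr_ge0//; first by rewrite exprn_ge0// mulr_ge0// ltW// cb_gt0.
by apply: sumr_ge0 => j _; rewrite (_ : _ ^+ 4 = (dinc n l j w ^+ 2) ^+ 2) ?sqr_ge0// -exprM.
Qed.

Lemma oz_ge0 n w : 0 <= oz n w. Proof. exact: sqrtr_ge0. Qed.

Lemma ozE n w : oz n w ^+ 4 = oz4 n w.
Proof. by rewrite /oz (_ : 4%N = (2 * 2)%N)// exprM !sqr_sqrtr ?sqrtr_ge0// oz4_ge0. Qed.

(** The indicators increase with the level, so only the centering [Hm], of slope at most [Kc], can
    make the process drop. *)
Lemma bt_mono n w (x y : R) : (0 < n)%N -> 0 <= x -> x <= y -> y <= 1 ->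
  - (Num.sqrt n%:R * Kc * (y - x)) <= bt n w y - bt n w x.
Proof.
move=> n0 x0 xy y1; have /andP[_ hK] := Hm_le m x0 xy y1.
have n0' : 0 < n%:R :> R by rewrite ltr0n.
have s0 : 0 < Num.sqrt n%:R :> R by rewrite sqrtr_gt0.
have nn : Num.sqrt n%:R = (Num.sqrt n%:R)^-1 * n%:R :> R.
  by rewrite -{3}(@sqr_sqrtr _ n%:R) ?ler0n// expr2 mulKf// gt_eqF.
move: (Kc) hK => K hK.
rewrite {1}nn -!mulrA -mulrN /bt -mulrBr ler_pM2l ?invr_gt0// /Sv -sumrB.
apply: (@le_trans _ _ (\sum_(k < n) - (K * (y - x)))); first by rewrite sumr_const card_ord mulNrn mulr_natl.
apply: ler_sum => k _; rewrite /eb.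
have : ((bW m (sd k w) <= x)%R%:R : R) <= (bW m (sd k w) <= y)%R%:R.
  rewrite ler_nat; case: (boolP (bW m (sd k w) <= x)) => // h; by rewrite (le_trans h).
lra.
Qed.

(** At the finest level, 2^(L+1) exceeds n, so the remainder 2 Kc sqrt n / 2^L of [chaining] is at
    most 4 Kc / sqrt n. *)
Lemma osc_bt n w p (x y : R) : (0 < n)%N -> (2 ^ p <= n)%N -> 0 <= x <= 1 -> 0 <= y <= 1 -> `|x - y| <= (2 ^+ p)^-1 ->
  `|bt n w x - bt n w y| <= 21 * oz n w * rb ^+ p + 4 * Kc / Num.sqrt n%:R.
Proof.
move=> n0 np; wlog xy : x y / x <= y => [h|].
  move=> x01 y01; have [xy|/ltW xy] := leP x y; first by apply: h.
  by rewrite distrC (distrC (bt n w x)); apply: h.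
move=> /andP[x0 x1] /andP[y0 y1]; rewrite distrC ger0_norm ?subr_ge0// => yx.
set L := trunc_log 2 n; have /andP[_ nL] := @trunc_log_bounds 2 n isT n0; rewrite -/L in nL.
have pL : (p <= L)%N by exact: trunc_log_max.
have n0' : 0 < n%:R :> R by rewrite ltr0n.
have s0 : 0 < Num.sqrt n%:R :> R by rewrite sqrtr_gt0.
have Kc0 := @Kc_gt0 R m; have c0 := @cb_gt0 R.
have inc l j : (l <= L)%N -> (j < 2 ^ l)%N -> `|bt n w (j.+1%:R / 2 ^+ l) - bt n w (j%:R / 2 ^+ l)| <= oz n w * rb ^+ l.
  move=> lL jl; have /andP[rb0 _] := @rb01 R; have z0 := oz_ge0 n w.
  rewrite -(@ler_pXn2r _ 4)// ?nnegrE// ?mulr_ge0// ?exprn_ge0// exprMn ozE -exprM mulnC exprM rb4 -/(dinc n l j w).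
  rewrite exprVn ler_pdivlMr ?exprn_gt0 ?mulr_gt0// mulrC.
  have -> : `|dinc n l j w| ^+ 4 = dinc n l j w ^+ 4.
    by rewrite (_ : 4%N = (2 * 2)%N)// !exprM real_normK// num_real.
  have ge4 k i : 0 <= dinc n k i w ^+ 4 by rewrite (_ : _ ^+ 4 = (dinc n k i w ^+ 2) ^+ 2) ?sqr_ge0// -exprM.
  have lL' : (l < L.+1)%N by [].
  rewrite /oz4 (bigD1 (Ordinal lL'))//= -/L.
  apply: (@le_trans _ _ ((4 * cb) ^+ l * \sum_(j < 2 ^ l) dinc n l j w ^+ 4)).
    rewrite ler_wpM2l ?exprn_ge0 ?mulr_ge0 ?(ltW c0)// (bigD1 (Ordinal jl))//= lerDl.
    by apply: sumr_ge0 => i _; exact: ge4.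
  rewrite lerDl; apply: sumr_ge0 => i _; rewrite mulr_ge0 ?exprn_ge0 ?mulr_ge0 ?(ltW c0)//.
  by apply: sumr_ge0 => k _; exact: ge4.
have cc : 0 <= Num.sqrt n%:R * Kc by rewrite mulr_ge0 ?sqrtr_ge0// ltW.
have := chaining (oz_ge0 n w) cc pL inc (fun x y => @bt_mono n w x y n0) x0 xy y1 yx.
move=> h; apply: (le_trans h); rewrite lerD2l.
have p2 : 0 < 2 ^+ L :> R by rewrite exprn_gt0.
rewrite ler_pdivrMr// mulrAC ler_pdivlMr//.
have -> : 2 * (Num.sqrt n%:R * Kc) * Num.sqrt n%:R = 2 * Kc * Num.sqrt n%:R ^+ 2 :> R by ring.
rewrite sqr_sqrtr ?ler0n//.
have -> : 4 * Kc * 2 ^+ L = 2 * Kc * 2 ^+ L.+1 by rewrite exprS; ring.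
rewrite ler_pM2l ?mulr_gt0// -natrX ler_nat; exact: ltnW.
Qed.

End EmpiricalProcess.

(** * Linearization of the ratio process *)

Section Approximation.
Context {R : realType}.
Local Notation mR := (measurableTypeR R).
Local Notation lam := (@lam R).
Local Notation th0 := (@th0 R).
Local Notation th1 := (@th1 R).

Lemma invsqrt_small (x : R) : 0 < x -> \forall n \near \oo, (0 < n)%N /\ (Num.sqrt n%:R)^-1 < x.
Proof.
move=> x0; have y0 : 0 < x ^- 2 by rewrite invr_gt0 exprn_gt0.
exists (Num.trunc (x ^- 2)).+1 => // n /= hn; have n0 : (0 < n)%N := leq_ltn_trans (leq0n _) hn.
split => //; have n0' : 0 < n%:R :> R by rewrite ltr0n.
have /andP[_ h] := truncn_itv (ltW y0).
have h2 : x ^- 2 < n%:R by apply: (lt_le_trans h); rewrite ler_nat.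
rewrite -[x]invrK ltf_pV2 ?posrE ?invr_gt0 ?sqrtr_gt0//.
rewrite -(@ltr_pXn2r _ 2)// ?nnegrE ?sqrtr_ge0 ?invr_ge0 ?(ltW x0)// sqr_sqrtr ?ltW//.
by rewrite exprVn.
Qed.

(** The smallness of t keeps 1 + tB above 1/2, so its inverse is at most 2; the constants 4 are 2
    times this bound. *)
Lemma rho_est (A B K t : R) : 0 <= K -> `|A| <= K + 1 -> `|B| <= K + 1 -> 0 < t -> 4 * (K + 1) * t <= 1 / 2 ->
  let r := (1 + t * A) / (1 + t * B) - 1 in
  [/\ 0 < 1 + t * A, 0 < 1 + t * B, `|r| <= 4 * (K + 1) * t & `|r / t - (A - B)| <= 4 * (K + 1) ^+ 2 * t].
Proof.
move=> K0 hA hB t0 tK r.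
have tC (C : R) : `|C| <= K + 1 -> `|t * C| <= 1 / 8.
  move=> hC; rewrite normrM gtr0_norm//.
  have := ler_wpM2l (ltW t0) hC; lra.
have tA := tC _ hA; have tB := tC _ hB.
have A0 : 0 < 1 + t * A by move: tA; rewrite ler_norml; lra.
have B0 : 1 / 2 < 1 + t * B by move: tB; rewrite ler_norml; lra.
have B1 : 0 < 1 + t * B by lra.
have B2 : (1 + t * B)^-1 <= 2 by rewrite -[2]invrK lef_pV2 ?posrE ?invr_gt0//; lra.
have B3 : 0 <= (1 + t * B)^-1 by rewrite invr_ge0 ltW.
have hAB : `|A - B| <= 2 * (K + 1) by apply: (le_trans (ler_normB _ _)); lra.
have e1 : r = t * ((A - B) * (1 + t * B)^-1) by rewrite /r; field; rewrite gt_eqF.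
have e2 : r / t - (A - B) = - (t * (((A - B) * B) * (1 + t * B)^-1)) by rewrite /r; field; rewrite !gt_eqF.
have K1 : 0 <= K + 1 by lra.
split => //.
- rewrite e1 normrM (gtr0_norm t0) mulrC ler_pM2r// normrM (ger0_norm B3).
  by have := ler_pM (normr_ge0 _) B3 hAB B2; lra.
- rewrite e2 normrN normrM (gtr0_norm t0) mulrC ler_pM2r// normrM (ger0_norm B3) normrM.
  have h1 := ler_pM (normr_ge0 _) (normr_ge0 _) hAB hB.
  have h2 := ler_pM (mulr_ge0 (normr_ge0 _) (normr_ge0 _)) B3 h1 B2.
  apply: (le_trans h2); rewrite le_eqVlt; apply/orP; left; apply/eqP; ring.
Qed.

(* The level at which [u / (u + v)] is to be compared when the totals [sx] and [sy] are in ratio [1 + r], see [ratio_le]. *)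
Definition tau (r x : R) : R := x * (1 + r) / (1 + x * r).

Lemma tau_est (r x : R) : `|r| <= 1 / 2 -> 0 <= x <= 1 ->
  [/\ 0 < 1 + x * r, 0 <= tau r x <= 1, `|tau r x - x| <= `|r| & `|tau r x - x - x * (1 - x) * r| <= r ^+ 2].
Proof.
move=> hr /andP[x0 x1].
have xr : `|x * r| <= `|r| by rewrite normrM ger0_norm// ler_piMl.
have D : 1 / 2 <= 1 + x * r by move: (le_trans xr hr); rewrite ler_norml; lra.
have D0 : 0 < 1 + x * r by lra.
have D2 : (1 + x * r)^-1 <= 2 by rewrite -[2]invrK lef_pV2 ?posrE ?invr_gt0//; lra.
have D3 : 0 <= (1 + x * r)^-1 by rewrite invr_ge0 ltW.
have y0 : 0 <= x * (1 - x) by rewrite mulr_ge0 ?subr_ge0.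
have y1 : x * (1 - x) <= 1 / 4.
  rewrite -subr_ge0; have -> : 1 / 4 - x * (1 - x) = (x - 1 / 2) ^+ 2 by field.
  exact: sqr_ge0.
have r1 : 0 <= 1 + r by move: hr; rewrite ler_norml; lra.
have e1 : tau r x - x = (x * (1 - x) * (1 + x * r)^-1) * r by rewrite /tau; field; rewrite gt_eqF.
have e2 : tau r x - x - x * (1 - x) * r = - ((x * (1 - x) * (1 + x * r)^-1) * (x * r ^+ 2)).
  by rewrite /tau; field; rewrite gt_eqF.
have z0 : 0 <= x * (1 - x) * (1 + x * r)^-1 by rewrite mulr_ge0.
have z1 : x * (1 - x) * (1 + x * r)^-1 <= 1 by have := ler_pM y0 D3 y1 D2; lra.
split => //.
- rewrite /tau divr_ge0 ?(ltW D0) ?mulr_ge0//= ler_pdivrMr//; lra.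
- by rewrite e1 normrM (ger0_norm z0) ler_piMl.
- have r2 := sqr_ge0 r; have xr2 : 0 <= x * r ^+ 2 by exact: mulr_ge0.
  rewrite e2 normrN normrM (ger0_norm z0) (ger0_norm xr2).
  apply: (@le_trans _ _ (x * r ^+ 2)); first exact: ler_piMl.
  exact: ler_piMl.
Qed.

Lemma ratio_le (a b sx sy u v x : R) : 0 < a -> 0 < b -> 0 < sx -> 0 < sy -> 0 <= u -> 0 <= v -> 0 <= x <= 1 ->
  let r := (b * sx) / (a * sy) - 1 in 0 < 1 + x * r ->
  ((a * (u / sx)) / (a * (u / sx) + b * (v / sy)) <= x) = (u / (u + v) <= tau r x).
Proof.
move=> a0 b0 x0 y0 u0 v0 /andP[hx0 hx1] r D0.
have r1 : 1 + r = (b * sx) / (a * sy) by rewrite /r addrC subrK.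
have rho0 : 0 < 1 + r by rewrite r1 divr_gt0// mulr_gt0.
(* When u = v = 0 both quotients are 0 / 0, which is 0 by convention. *)
have [uv|uv] := eqVneq (u + v) 0.
  have [-> ->] : u = 0 /\ v = 0 by split; lra.
  rewrite !mul0r !mulr0 mul0r hx0; suff -> : 0 <= tau r x by [].
  by apply: divr_ge0; [apply: mulr_ge0 => //; exact: ltW|exact: ltW].
have uv0 : 0 < u + v by rewrite lt_def uv addr_ge0.
set u' := a * (u / sx); set v' := b * (v / sy).
have u'0 : 0 <= u' := mulr_ge0 (ltW a0) (divr_ge0 u0 (ltW x0)).
have v'0 : 0 <= v' := mulr_ge0 (ltW b0) (divr_ge0 v0 (ltW y0)).
have uv'0 : 0 < u' + v'.
  have [ue|un0] := eqVneq u 0.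
    by rewrite ue add0r in uv0; rewrite ltr_wpDl// /v' mulr_gt0// divr_gt0.
  by rewrite ltr_pwDl// /u' mulr_gt0// divr_gt0// lt_def un0.
rewrite ler_pdivrMr// /tau ler_pdivrMr// mulrAC ler_pdivlMr//.
rewrite -[LHS]subr_ge0 -[RHS]subr_ge0.
have e : x * (1 + r) * (u + v) - u * (1 + x * r) = (sx / a) * (x * (u' + v') - u').
  rewrite /u' /v' (_ : r = (b * sx) / (a * sy) - 1)//; field; rewrite !gt_eqF//.
by rewrite e pmulr_rge0// divr_gt0.
Qed.

Variable m : nat.
Hypothesis m_gt0 : (0 < m)%N.
Local Notation Hm := (@Hm R m).
Local Notation Kc := (@Kc R m).
Local Notation bU := (@bU R m).
Local Notation bV := (@bV R m).
Local Notation bD := (@bD R m).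
Local Notation bt := (@bt R m).

Lemma Hm_est (om : R) : 0 < om -> exists2 d : R, 0 < d & forall x y : R, 0 <= x <= 1 -> 0 <= y <= 1 ->
  `|x - y| < d -> `|Hm y - Hm x - hden m x * (y - x)| <= om * `|y - x|.
Proof.
move=> om0; have [d d0 hd] := heine (@continuous_hden R m) om0.
exists d => // x y x01 y01 xy.
have key (a b : R) : a <= b -> exists2 c, a <= c <= b & Hm b - Hm a = hden m c * (b - a).
  rewrite le_eqVlt => /predU1P[->|ab]; first by exists b; rewrite ?lexx// !subrr mulr0.
  have cH : {within `[a, b], continuous Hm}.
    by apply: continuous_subspaceT => z; exact: (@continuous_Hm R m z).
  have [c cab e] := MVT ab (fun z _ => @dHm R m z) cH.
  by exists c => //; move: cab; rewrite in_itv/= => /andP[/ltW-> /ltW->].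
have : exists2 c, `|x - c| <= `|x - y| & Hm y - Hm x = hden m c * (y - x).
  have [xy'|/ltW xy'] := leP x y.
    have [c /andP[c1 c2] e] := key x y xy'; exists c => //.
    by rewrite distrC (distrC x) !ger0_norm ?subr_ge0// lerD2r.
  have [c /andP[c1 c2] e] := key y x xy'; exists c; last by rewrite -opprB e -mulrN opprB.
  by rewrite !ger0_norm ?subr_ge0// lerD2l lerN2.
case=> c cx ->; rewrite -mulrBl normrM ler_wpM2r//.
by rewrite distrC; apply/ltW/hd => //; exact: (le_lt_trans cx).
Qed.

Lemma hden_phi (v : R) : hden m v * (v * (1 - v)) = phi m v.
Proof. by rewrite /hden /phi -exprMn -mulrA -exprSr prednK. Qed.

Lemma phi_bnd (v : R) : 0 <= v <= 1 -> 0 <= phi m v <= Kc.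
Proof.
move=> v01; have /andP[h0 h1] := hden01 m v01; have /andP[v0 v1] := v01; rewrite -hden_phi.
have v2 : 0 <= v * (1 - v) by rewrite mulr_ge0 ?subr_ge0.
rewrite mulr_ge0//=; apply: (le_trans _ h1); rewrite ler_piMr//.
have := mulr_ile1 v0 (_ : 0 <= 1 - v) v1; apply; lra.
Qed.

Definition bA n (w : R) : R := (Num.sqrt n%:R)^-1 * \sum_(k < n) (bU (sd k w) - m%:R).
Definition bB n (w : R) : R := (Num.sqrt n%:R)^-1 * \sum_(k < n) (bV (sd k w) - m%:R).
(* The linearized summand, whose covariance is that of the limiting process. *)
Definition xiv (v s : R) : R := eb m v s + phi m v / m%:R * bD s.
Definition zt n (w v : R) : R := (Num.sqrt n%:R)^-1 * Sv n xiv w v.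

Lemma zt_bt n w v : zt n w v = bt n w v + phi m v / m%:R * (bA n w - bB n w).
Proof.
rewrite /zt /bt /Sv /bA /bB big_split /= mulrDr -mulr_sumr; congr (_ + _).
rewrite -mulrBr -sumrB mulrCA; congr (_ * (_ * _)); apply: eq_bigr => k _; rewrite /bD; ring.
Qed.

Definition tot (f : R -> R) n rx (w : R) : R := \sum_(k < n) f (sd k w) + rx.
(* The ratio process in terms of the block variables; [rx] and [ry] are the sums of the spacings outside of the chosen blocks. *)
Definition gp n (a b rx ry w v : R) : R := Num.sqrt n%:R * (n%:R^-1 * \sum_(k < n)
  (a * (bU (sd k w) / tot bU n rx w) / (a * (bU (sd k w) / tot bU n rx w) + b * (bV (sd k w) / tot bV n ry w)) <= v)%R%:R
  - Hm v).

Lemma gpE n (a b rx ry w v : R) : (0 < n)%N -> 0 < a -> 0 < b -> 0 < tot bU n rx w -> 0 < tot bV n ry w -> 0 <= v <= 1 ->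
  let r := (b * tot bU n rx w) / (a * tot bV n ry w) - 1 in 0 < 1 + v * r ->
  gp n a b rx ry w v = bt n w (tau r v) + Num.sqrt n%:R * (Hm (tau r v) - Hm v).
Proof.
move=> n0 a0 b0 sx sy v01 r D0; have n0' : 0 < n%:R :> R by rewrite ltr0n.
have s0 : 0 < Num.sqrt n%:R :> R by rewrite sqrtr_gt0.
rewrite /gp /bt /Sv /eb sumrB sumr_const card_ord -[Hm (tau r v) *+ n]mulr_natl.
under eq_bigr => k _ do rewrite (ratio_le a0 b0 sx sy (bU_ge0 m _) (bV_ge0 m _) v01 D0).
have e : Num.sqrt n%:R ^+ 2 = n%:R :> R by rewrite sqr_sqrtr// ltW.
rewrite -/r; move: (Num.sqrt n%:R) e s0 => q e q0; rewrite -e.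
by field; rewrite gt_eqF.
Qed.

Lemma totE (f : R -> R) n (rx w : R) : (0 < n)%N ->
  tot f n rx w = n%:R * m%:R + Num.sqrt n%:R * ((Num.sqrt n%:R)^-1 * \sum_(k < n) (f (sd k w) - m%:R)) + rx.
Proof.
move=> n0; have n0' : 0 < n%:R :> R by rewrite ltr0n.
rewrite mulrA mulfV ?mul1r ?gt_eqF ?sqrtr_gt0// sumrB sumr_const card_ord -[m%:R *+ n]mulr_natl /tot; ring.
Qed.

Let mm : 1 <= m%:R :> R. Proof. by rewrite ler1n. Qed.

(** The total is written relative to m (n + p), its approximate mean, with p discarded blocks. Since
    p is small against n, the factor [kp] = n / (n + p) by which the fluctuation is rescaled is
    close to 1. *)
Lemma tot_est n (f : R -> R) (K dl p rx w : R) : (0 < n)%N -> 0 <= K -> 0 < dl <= 1 -> 0 <= p <= dl * n%:R ->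
  let A := (Num.sqrt n%:R)^-1 * \sum_(k < n) (f (sd k w) - m%:R) in
  `|A| <= K -> `|rx - m%:R * p| <= dl * Num.sqrt n%:R ->
  exists a', [/\ tot f n rx w = m%:R * (n%:R + p) * (1 + (Num.sqrt n%:R)^-1 * a'), `|a'| <= K + 1 &
    `|a' - A / m%:R| <= dl * (K + 1)].
Proof.
move=> n0 K0 /andP[dl0 dl1] /andP[p0 pd] A hA hr.
have n0' : 0 < n%:R :> R by rewrite ltr0n.
rewrite (totE f rx w n0) -/A.
have s0 : 0 < Num.sqrt n%:R :> R by rewrite sqrtr_gt0.
have e : Num.sqrt n%:R ^+ 2 = n%:R :> R by rewrite sqr_sqrtr// ltW.
move: (A) hA => {}A hA.
move: (Num.sqrt n%:R) e s0 hr => q e q0 hr; rewrite -e in pd *.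
have a0 : 0 < q ^+ 2 + p by rewrite ltr_pwDl ?exprn_gt0.
have M0 : 0 < m%:R :> R by apply: lt_le_trans mm.
set y := (rx - m%:R * p) / q.
have hy : `|y| <= dl by rewrite normrM normfV (gtr0_norm q0) ler_pdivrMr.
set kp := q ^+ 2 / (q ^+ 2 + p).
have kp0 : 0 <= kp by rewrite divr_ge0 ?sqr_ge0 ?ltW.
have kp1 : kp <= 1 by rewrite ler_pdivrMr// mul1r lerDl.
have kpd : 1 - kp <= dl.
  have -> : 1 - kp = p / (q ^+ 2 + p) by rewrite /kp; field; rewrite gt_eqF.
  rewrite ler_pdivrMr//; apply: (le_trans pd); rewrite ler_pM2l// lerDl//.
exists (kp * (A + y) / m%:R).
have M1 : (0 : R) <= m%:R^-1 by rewrite invr_ge0 ltW.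
have M2 : m%:R^-1 <= (1 : R) by rewrite invf_le1.
split.
- by rewrite /kp /y; field; rewrite !gt_eqF.
- rewrite normrM (ger0_norm M1); apply: (@le_trans _ _ `|kp * (A + y)|); first by rewrite ler_piMr.
  rewrite normrM (ger0_norm kp0); apply: (@le_trans _ _ `|A + y|); first by rewrite ler_piMl.
  by apply: (le_trans (ler_normD _ _)); apply: lerD => //; exact: le_trans dl1.
- rewrite -mulrBl normrM (ger0_norm M1).
  apply: (@le_trans _ _ `|kp * (A + y) - A|); first by rewrite ler_piMr.
  have -> : kp * (A + y) - A = kp * y - (1 - kp) * A by ring.
  apply: (le_trans (ler_normB _ _)); rewrite (normrM kp y) (normrM (1 - kp) A) (ger0_norm kp0) (@ger0_norm _ (1 - kp)) ?subr_ge0//.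
  have h1 : kp * `|y| <= dl by apply: (le_trans _ hy); rewrite ler_piMl.
  have kp2 : 0 <= 1 - kp by rewrite subr_ge0.
  have h2 := ler_pM kp2 (normr_ge0 A) kpd hA.
  rewrite mulrDr mulr1 addrC; exact: lerD.
Qed.

Lemma ler_normB2 (x y c : R) : `|x| <= c -> `|y| <= c -> `|x - y| <= 2 * c.
Proof. by move=> hx hy; rewrite (le_trans (ler_normB _ _))// mulr_natl mulr2n lerD. Qed.

(** A deterministic statement: randomness enters only through the bounds on [bA], [bB], [oz] and on
    the discarded sums, and the conclusion is uniform in v. *)
Lemma gp_zt (eps K : R) : 0 < eps -> 1 <= K -> exists2 dl : R, 0 < dl & \forall n \near \oo,
  forall (p1 p2 rx ry w : R), 0 <= p1 <= dl * n%:R -> 0 <= p2 <= dl * n%:R ->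
  `|bA n w| <= K -> `|bB n w| <= K -> oz m n w <= K ->
  `|rx - m%:R * p1| <= dl * Num.sqrt n%:R -> `|ry - m%:R * p2| <= dl * Num.sqrt n%:R ->
  [/\ 0 < tot bU n rx w, 0 < tot bV n ry w & forall v, 0 <= v <= 1 ->
   `|gp n (n%:R + p1) (n%:R + p2) rx ry w v - zt n w v| <= eps].
Proof.
move=> e0 K1; have K0 : 0 <= K by lra.
have Kc0 := @Kc_gt0 R m; have KK : 0 < K + 1 by lra.
have M0 : 0 < m%:R :> R by apply: lt_le_trans mm.
have [p hp] := @rb_small R (21 * K) (eps / 6) (mulr_ge0 (ler0n _ 21) K0) (divr_gt0 e0 (ltr0n _ 6)).
have om0 : 0 < eps / 6 / (4 * (K + 1)) by rewrite !divr_gt0// mulr_gt0.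
have [d d0 hd] := Hm_est om0.
pose dl := Num.min 1 (eps / 6 / (2 * Kc * (K + 1))).
have dl0 : 0 < dl by rewrite lt_min ltr01 !divr_gt0// !mulr_gt0.
have dl1 : dl <= 1 by rewrite ge_min lexx.
have dl2 : Kc * (2 * dl * (K + 1)) <= eps / 6.
  have : dl <= eps / 6 / (2 * Kc * (K + 1)) by rewrite ge_min lexx orbT.
  by rewrite ler_pdivlMr ?mulr_gt0//; lra.
have two0 : 0 < (2 ^+ p)^-1 :> R by rewrite invr_gt0 exprn_gt0.
have sm (c x : R) : 0 < c -> 0 < x -> \forall n \near \oo, c * (Num.sqrt n%:R)^-1 < x.
  move=> c0 x0; near=> n; rewrite mulrC -ltr_pdivlMr//.
  by near: n; apply: filterS (invsqrt_small (divr_gt0 x0 c0)) => n [].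
have c4 : 0 < 4 * (K + 1) by rewrite mulr_gt0.
have e6 : 0 < eps / 6 by rewrite divr_gt0.
exists dl => //; near=> n => p1 p2 rx ry w h1 h2 hA hB hz hr1 hr2.
have n0 : (0 < n)%N by near: n; apply: filterS (invsqrt_small (@ltr01 R)) => n [].
have n0' : 0 < n%:R :> R by rewrite ltr0n.
have np : (2 ^ p <= n)%N by near: n; exists (2 ^ p)%N.
have s0 : 0 < Num.sqrt n%:R :> R by rewrite sqrtr_gt0.
have t0 : 0 < (Num.sqrt n%:R)^-1 :> R by rewrite invr_gt0.
have t1 : 4 * (K + 1) * (Num.sqrt n%:R)^-1 <= 1 / 2 by apply/ltW; near: n; apply: sm; lra.
have t2 : 4 * (K + 1) * (Num.sqrt n%:R)^-1 < d by near: n; apply: sm.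
have t3 : 4 * (K + 1) * (Num.sqrt n%:R)^-1 <= (2 ^+ p)^-1 by apply/ltW; near: n; apply: sm.
have t4 : 4 * Kc * (Num.sqrt n%:R)^-1 <= eps / 6 by apply/ltW; near: n; apply: sm => //; rewrite mulr_gt0.
have t5 : Kc * (16 * (K + 1) ^+ 2) * (Num.sqrt n%:R)^-1 <= eps / 6.
  by apply/ltW; near: n; apply: sm => //; rewrite !mulr_gt0// exprn_gt0.
have t6 : Kc * (4 * (K + 1) ^+ 2) * (Num.sqrt n%:R)^-1 <= eps / 6.
  by apply/ltW; near: n; apply: sm => //; rewrite !mulr_gt0// exprn_gt0.
pose t := (Num.sqrt n%:R)^-1 : R; rewrite -/t in t0 t1 t2 t3 t4 t5 t6.
have dl01 : 0 < dl <= 1 by rewrite dl0.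
have [a' [ea ha1 ha2]] := tot_est n0 K0 dl01 h1 hA hr1.
have [b' [eb hb1 hb2]] := tot_est n0 K0 dl01 h2 hB hr2.
have [A0 B0 hr hrt] := rho_est K0 ha1 hb1 t0 t1.
have pa : 0 < n%:R + p1 by case/andP: h1 => h _; rewrite ltr_pwDl.
have pb : 0 < n%:R + p2 by case/andP: h2 => h _; rewrite ltr_pwDl.
have sx0 : 0 < tot bU n rx w by rewrite ea !mulr_gt0.
have sy0 : 0 < tot bV n ry w by rewrite eb !mulr_gt0.
split => // v v01.
set r := _ - 1 in hr hrt.
(* The weights of the two samples cancel the approximate means of the totals, so that [r] retains
   the fluctuations only. *)
have er : ((n%:R + p2) * tot bU n rx w) / ((n%:R + p1) * tot bV n ry w) - 1 = r.
  by rewrite ea eb /r -/t; field; rewrite !gt_eqF.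
have [D0 ty td tq] := tau_est (le_trans hr t1) v01.
rewrite gpE// er// zt_bt.
have T1 : `|bt n w (tau r v) - bt n w v| <= 2 * (eps / 6).
  have := osc_bt m w n0 np ty v01 (le_trans (le_trans td hr) t3).
  have /andP[rb0 _] := @rb01 R.
  have h : 21 * oz m n w * rb ^+ p <= 21 * K * rb ^+ p.
    by rewrite ler_wpM2r ?exprn_ge0// ler_wpM2l.
  move=> h3; apply: (le_trans h3); rewrite (_ : 2 * (eps / 6) = eps / 6 + eps / 6); last by ring.
  by apply: lerD => //; exact: (le_trans h (ltW hp)).
have /andP[hd0 hd1] := hden01 m v01; have /andP[ph0 ph1] := phi_bnd v01.
have tvd : `|v - tau r v| < d by rewrite distrC (le_lt_trans td)// (le_lt_trans hr).
have T2 := hd v (tau r v) v01 ty tvd.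
have T2' : `|(Hm (tau r v) - Hm v - hden m v * (tau r v - v)) / t| <= eps / 6.
  rewrite normrM normfV (gtr0_norm t0) ler_pdivrMr//; apply: (le_trans T2).
  apply: (le_trans (ler_wpM2l (ltW om0) (le_trans td hr))).
  by rewrite mulrA divfK// gt_eqF.
have T3 : `|hden m v * (tau r v - v - v * (1 - v) * r) / t| <= eps / 6.
  rewrite normrM normfV (gtr0_norm t0) ler_pdivrMr// normrM (ger0_norm hd0).
  have r2 : r ^+ 2 <= (4 * (K + 1) * t) ^+ 2.
    by rewrite -real_normK ?num_real//; apply: lerXn2r; rewrite ?nnegrE// (le_trans _ hr).
  apply: (le_trans (ler_pM hd0 (normr_ge0 _) hd1 (le_trans tq r2))).
  have -> : Kc * (4 * (K + 1) * t) ^+ 2 = Kc * (16 * (K + 1) ^+ 2) * t * t by ring.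
  by rewrite ler_pM2r.
have T4 : `|phi m v * (r / t - (a' - b'))| <= eps / 6.
  rewrite normrM (ger0_norm ph0); apply: (le_trans (ler_pM ph0 (normr_ge0 _) ph1 hrt)).
  by rewrite mulrA.
have T5 : `|phi m v * ((a' - bA n w / m%:R) - (b' - bB n w / m%:R))| <= eps / 6.
  rewrite normrM (ger0_norm ph0); apply: (le_trans _ dl2).
  by apply: (ler_pM ph0 (normr_ge0 _) ph1); rewrite -mulrA; exact: (ler_normB2 ha2 hb2).
(* Five errors, in this order: the shift of the level inside the empirical process (counted twice),
   the curvature of [Hm], the nonlinearity of [tau], that of the ratio of the totals, and the
   discarded spacings. *)
have -> : bt n w (tau r v) + Num.sqrt n%:R * (Hm (tau r v) - Hm v) - (bt n w v + phi m v / m%:R * (bA n w - bB n w)) =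
  (bt n w (tau r v) - bt n w v) + ((Hm (tau r v) - Hm v - hden m v * (tau r v - v)) / t
   + (hden m v * (tau r v - v - v * (1 - v) * r) / t + (phi m v * (r / t - (a' - b'))
   + phi m v * ((a' - bA n w / m%:R) - (b' - bB n w / m%:R))))).
  rewrite -hden_phi /t invrK; move: (Num.sqrt n%:R) => q; field; exact: lt0r_neq0.
rewrite (_ : eps = 2 * (eps / 6) + (eps / 6 + (eps / 6 + (eps / 6 + eps / 6)))); last by field.
by do 4 (apply: (le_trans (ler_normD _ _)); apply: lerD => //).
Unshelve. all: by end_near.
Qed.

End Approximation.

(** * Events of large probability, and finite-dimensional limits *)

Section TargetEvents.
Context {R : realType}.
Local Notation mR := (measurableTypeR R).
Local Notation lam := (@lam R).
Local Notation th0 := (@th0 R).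
Local Notation th1 := (@th1 R).
Local Notation mu := (@lebesgue_measure R).

Lemma markov_E (F : R -> R) : Int F -> (forall w, 0 <= F w) ->
  measurable [set w | 1 <= F w] /\ (lam [set w | (1 <= F w)%R] <= (E F)%:E)%E.
Proof.
move=> I F0; have mF := Int_measurable I.
have mA : measurable [set w | 1 <= F w].
  rewrite (_ : [set w | _] = F @^-1` `[1, +oo[); first exact: (preimage_measurable mF).
  by apply/seteqP; split => w /=; rewrite in_itv/= andbT.
split => //; rewrite lamE// lee_fin; apply: E_le => //.
  apply: Int_01; last by move=> s; case: (s \in _); rewrite /= ?lexx ?ler01.
  by rewrite (_ : (fun s => _) = \1_[set w | 1 <= F w])//; exact: measurable_indic.
by move=> w; case: (boolP (w \in _)); rewrite ?inE/=.
Qed.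

Lemma expl_moment k : Int (fun s : R => expl s ^+ k) /\ E (fun s : R => expl s ^+ k) = k`!%:R.
Proof.
have h : (\int[lam]_w (expl w ^+ k)%:E = (k`!%:R)%:E)%E.
  have := @integral_gpdf R 0 k; rewrite add0n fact0 divr1 => <-.
  transitivity (\int[lam]_w (fun x => (`|x| ^+ k)%:E) (expl w))%E.
    by apply: eq_integral => w _; rewrite ger0_norm// expl_ge0.
  rewrite (expl_integral (f := fun x => (`|x| ^+ k)%:E)).
  - apply: eq_integral => s _; rewrite -!EFinM /gpdf exp_pdfE expr0 fact0 divr1 mulr1.
    by case: (lerP 0 s) => s0; rewrite ?mulr0 ?mul0r// ger0_norm// mulrC.
  - by apply/measurable_EFinP/measurable_funX; exact: normr_measurable.
  - by move=> x; rewrite lee_fin exprn_ge0.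
have mg : measurable_fun setT (fun s : R => expl s ^+ k) := measurable_funX k (@measurable_expl R).
have I : Int (fun s : R => expl s ^+ k).
  by apply: Int_ge0 => [//|s|]; [rewrite exprn_ge0// expl_ge0|rewrite h ltry].
split=> //; apply: EFin_inj; rewrite -(E_EFin I); exact: h.
Qed.

Lemma L4_expl : L4 (@expl R).
Proof. by split; [exact: measurable_expl|exact: (expl_moment 4).1]. Qed.

Lemma E_expl : E (@expl R) = 1.
Proof. by have := (expl_moment 1).2. Qed.

Lemma E_fcst (c : R) : E (fun=> c) = c. Proof. exact: E_cst. Qed.

Lemma var_expl : E (fun s : R => (expl s - 1) * (expl s - 1)) = 1.
Proof.
transitivity (E (fun s : R => expl s ^+ 2 + ((-2) * expl s + 1))); first by congr E; apply/funext => s; ring.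
have I1 := L4_Int L4_expl; have [I2 e2] := expl_moment 2.
rewrite (ED I2 (IntD (IntZ _ I1) (Int_cst 1))) (ED (IntZ _ I1) (Int_cst 1)) (EZ _ I1) e2 E_expl.
by rewrite E_fcst (_ : 2`! = 2)%N//; ring.
Qed.

Definition rest (L : nat) (c : nat -> bool) (s : R) : R := \sum_(l < L) (c l)%:R * expl (sd l s).

Lemma L4_rest L c : L4 (rest L c).
Proof. by apply: L4_sum => l; apply: L4Z; exact: (L4_mpres (mpres_sd l) L4_expl). Qed.

Lemma var_rest L (c : nat -> bool) (x : R) : let d := \sum_(l < L) (c l)%:R : R in
  E (fun s => (rest L c s - x) * (rest L c s - x)) = d + (d - x) ^+ 2.
Proof.
move=> d; pose f l s : R := (c l)%:R * (expl s - 1).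
have Lf l : L4 (f l) by apply: L4Z; apply: L4D; [exact: L4_expl|exact: L4_cst].
have Ef l : E (f l) = 0.
  rewrite (EZ _ (L4_Int (L4D L4_expl (L4_cst (- 1))))) (ED (L4_Int L4_expl) (Int_cst (- 1))) E_expl.
  by rewrite E_fcst subrr mulr0.
have rE s : rest L c s = \sum_(l < L) f l (sd l s) + d.
  by rewrite /rest /d -big_split; apply: eq_bigr => l _; rewrite /f /=; ring.
have LS := L4_sumsd L Lf; have ES := E_sumsd L Lf Ef; have ES2 := E_sumsd2 L Lf Ef.
transitivity (E (fun s => (\sum_(l < L) f l (sd l s)) * (\sum_(l < L) f l (sd l s)) +
    (2 * (d - x) * (\sum_(l < L) f l (sd l s)) + (d - x) ^+ 2))).
  by congr E; apply/funext => s; rewrite rE; ring.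
have IS := L4_Int LS; have IS2 := L4_Int_mul LS LS.
rewrite (ED IS2 (IntD (IntZ _ IS) (Int_cst _))) (ED (IntZ _ IS) (Int_cst _)) (EZ _ IS) ES ES2.
rewrite mulr0 add0r E_fcst; congr (_ + _).
apply: eq_bigr => l _; rewrite /f.
transitivity (E (fun s : R => (c l)%:R * ((expl s - 1) * (expl s - 1)))).
  by congr E; apply/funext => s; case: (c l); rewrite /= ?mul1r ?mul0r.
have Le : L4 (fun s : R => expl s - 1) := L4D L4_expl (L4_cst (- 1)).
by rewrite (EZ _ (L4_Int_mul Le Le)) var_expl mulr1.
Qed.

Variable m : nat.
Hypothesis m_gt0 : (0 < m)%N.
Local Notation Hm := (@Hm R m).
Local Notation Kc := (@Kc R m).
Local Notation bU := (@bU R m).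
Local Notation bV := (@bV R m).
Local Notation bD := (@bD R m).
Local Notation bt := (@bt R m).
Local Notation bA := (@bA R m).
Local Notation bB := (@bB R m).
Local Notation zt := (@zt R m).
Local Notation xiv := (@xiv R m).

Lemma var_gsum : E (fun s : R => (gsum m s - m%:R) * (gsum m s - m%:R)) = m%:R.
Proof.
transitivity (E (fun s : R => gsum m s ^+ 2 + ((-2) * m%:R * gsum m s + m%:R ^+ 2))).
  by congr E; apply/funext => s; ring.
have I1 := L4_Int (@L4_gsum R m m_gt0); have [I2 _] := @gsum_moment R m m_gt0 2.
rewrite (ED I2 (IntD (IntZ _ I1) (Int_cst _))) (ED (IntZ _ I1) (Int_cst _)) (EZ _ I1) E_gsum2// E_gsum//.
by rewrite (E_fcst (m%:R ^+ 2)); ring.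
Qed.

Lemma var_sumc n (p : R -> R) : (0 < n)%N -> mpres p -> let A w := (Num.sqrt n%:R)^-1 * \sum_(k < n) (gsum m (p (sd k w)) - m%:R) in
  L4 A /\ E (fun w => A w * A w) = m%:R.
Proof.
move=> n0 hp A; pose f s := gsum m s - m%:R : R.
have Lf : L4 f := L4D (@L4_gsum R m m_gt0) (L4_cst (- m%:R)).
have Ef : E f = 0.
  rewrite (ED (L4_Int (@L4_gsum R m m_gt0)) (Int_cst (- m%:R))) E_gsum// E_fcst subrr//.
have Lg : L4 (fun s => f (p s)) := L4_mpres hp Lf.
have Eg : E (fun s => f (p s)) = 0 by rewrite -Ef; exact: (mpres_E hp (L4_Int Lf)).
have LS := L4_sumsd n (fun _ : nat => Lg).
split; first exact: L4Z.
have n0' : 0 < n%:R :> R by rewrite ltr0n.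
transitivity (E (fun w => n%:R^-1 * ((\sum_(k < n) f (p (sd k w))) * (\sum_(k < n) f (p (sd k w)))))).
  congr E; apply/funext => w; rewrite /A -[n%:R in RHS]sqr_sqrtr ?(ltW n0')//.
  by rewrite expr2 invfM; rewrite mulrACA.
rewrite (EZ _ (L4_Int_mul LS LS)) (@E_sumsd2 _ n (fun=> (fun s => f (p s))))// sumr_const card_ord.
have -> : E (fun s => f (p s) * f (p s)) = m%:R.
  by rewrite -[RHS]var_gsum; exact: (mpres_E hp (L4_Int_mul Lf Lf)).
by rewrite -[m%:R *+ n]mulr_natl mulKf// gt_eqF.
Qed.

Lemma var_bA n : (0 < n)%N -> L4 (bA n) /\ E (fun w => bA n w * bA n w) = m%:R.
Proof. by move=> n0; exact: (var_sumc n0 (@mpres_th0 R)). Qed.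

Lemma var_bB n : (0 < n)%N -> L4 (bB n) /\ E (fun w => bB n w * bB n w) = m%:R.
Proof. by move=> n0; exact: (var_sumc n0 (@mpres_th1 R)). Qed.

Lemma add3_lt (a b c x : R) : 0 <= a -> 0 <= b -> 0 <= c -> a + (b + c) < x -> [/\ a < x, b < x & c < x].
Proof. by move=> a0 b0 c0 h; split; lra. Qed.

Lemma sqr_lt_norm (x K : R) : 0 < K -> x * x < K ^+ 2 -> `|x| <= K.
Proof.
move=> K0 h; apply/ltW; rewrite -(@ltr_pXn2r _ 2)// ?nnegrE// ?(ltW K0)//.
by rewrite real_normK ?num_real// expr2.
Qed.

Variables (L1 L2 : nat -> nat) (c1 c2 : nat -> nat -> bool) (p1 p2 : nat -> R).
Let rX N w := rest (L1 N) (c1 N) (th0 (sd N.+1 w)).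
Let rY N w := rest (L2 N) (c2 N) (th1 (sd N.+1 w)).
Let d1 N : R := \sum_(l < L1 N) (c1 N l)%:R.
Let d2 N : R := \sum_(l < L2 N) (c2 N l)%:R.
Hypothesis d1p : \forall N \near \oo, `|d1 N - m%:R * p1 N| <= m%:R.
Hypothesis d2p : \forall N \near \oo, `|d2 N - m%:R * p2 N| <= m%:R.
Hypothesis p1s : forall e, 0 < e -> \forall N \near \oo, 0 <= p1 N <= e * N.+1%:R.
Hypothesis p2s : forall e, 0 < e -> \forall N \near \oo, 0 <= p2 N <= e * N.+1%:R.

Lemma var_r L (c : nat -> bool) (x y : R) k (p : R -> R) : mpres p -> let d := \sum_(l < L) (c l)%:R : R in `|d - m%:R * x| <= m%:R -> m%:R * x <= y ->
  let r w := rest L c (p (sd k w)) - m%:R * x in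
  Int (fun w => r w * r w) /\ E (fun w => r w * r w) <= y + m%:R + m%:R ^+ 2.
Proof.
move=> hp d hd hx r; have hps := mpres_comp hp (mpres_sd k).
have Lr : L4 (fun s => rest L c s - m%:R * x) := L4D (L4_rest L c) (L4_cst _).
have Ir := L4_Int_mul Lr Lr; split; first exact: (mpres_Int hps Ir).
rewrite (mpres_E hps Ir) var_rest -/d; apply: lerD.
  by move: hd; rewrite ler_norml; lra.
by rewrite -real_normK ?num_real//; apply: lerXn2r; rewrite ?nnegrE.
Qed.

Lemma natr_big (x e : R) : 0 < e -> \forall N \near \oo, x <= e * N.+1%:R.
Proof.
move=> e0; exists (Num.trunc `|x / e|) => // N /= hN.
have /andP[_ h] := truncn_itv (normr_ge0 (x / e)).
rewrite mulrC -ler_pdivrMr//; apply: (le_trans (ler_norm _)); apply: (le_trans (ltW h)).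
by rewrite ler_nat ltnS.
Qed.

(** One Markov inequality for a weighted sum [F] of all the nonnegative quantities to be controlled.
    [K] is fixed before [dl], because [gp_zt] chooses [dl] from [K]. *)
Lemma good_event (eta : R) : 0 < eta -> exists2 K : R, 1 <= K & forall dl, 0 < dl -> \forall N \near \oo,
  exists Bad : set R, [/\ measurable Bad, (lam Bad <= eta%:E)%E & forall w, ~ Bad w ->
    [/\ `|bA N.+1 w| <= K, `|bB N.+1 w| <= K, oz m N.+1 w <= K,
     `|rX N w - m%:R * p1 N| <= dl * Num.sqrt N.+1%:R & `|rY N w - m%:R * p2 N| <= dl * Num.sqrt N.+1%:R] ].
Proof.
have aux (u k : R) : k + k ^+ 2 <= u -> 0 <= k * u -> 0 <= u ->
  k * u + k + k ^+ 2 + (k * u + k + k ^+ 2) <= 4 * (k + 1) * u by move=> *; lra.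
move=> e0; have oC0 : 0 <= oC m :> R.
  by have [_] := @Int_oz4 R m m_gt0 1 isT; apply: le_trans; apply: E_ge0 => w; exact: oz4_ge0.
pose M : R := 2 * m%:R + oC m.
have M0 : 0 <= M by rewrite addr_ge0// mulr_ge0.
(* Then K^2 >= K >= 2 M / eta, so the quantities of total mean at most M spend at most half of
   [eta]. *)
pose K : R := 1 + M * 2 / eta.
have K1 : 1 <= K by rewrite lerDl divr_ge0 ?mulr_ge0// ltW.
have K0 : 0 < K by apply: lt_le_trans K1.
have KM : K ^- 2 * M <= eta / 2.
  rewrite mulrC ler_pdivrMr ?exprn_gt0//; apply: (@le_trans _ _ (eta / 2 * K)).
    by rewrite /K mulrDr mulr1 (_ : eta / 2 * (M * 2 / eta) = M) ?lerDr ?divr_ge0 ?ltW//; field; rewrite gt_eqF.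
  by rewrite ler_pM2l ?divr_gt0// expr2 ler_peMr// ltW.
exists K => // dl dl0.
(* Chosen so that 4 (m + 1) e = eta dl^2 / 2, the half of [eta] left to the discarded sums. *)
pose e : R := eta * dl ^+ 2 / (8 * (m%:R + 1)).
have mm0 : 0 < m%:R + 1 :> R by rewrite ltr_wpDl.
have ee0 : 0 < e by rewrite divr_gt0// ?mulr_gt0// exprn_gt0.
near=> N.
have hd1 : `|d1 N - m%:R * p1 N| <= m%:R by near: N.
have hd2 : `|d2 N - m%:R * p2 N| <= m%:R by near: N.
have hp1 : 0 <= p1 N <= e * N.+1%:R by near: N; exact: p1s.
have hp2 : 0 <= p2 N <= e * N.+1%:R by near: N; exact: p2s.
have hm : m%:R + m%:R ^+ 2 <= e * N.+1%:R by near: N; exact: natr_big.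
have n0 : 0 < N.+1%:R :> R by rewrite ltr0n.
have hq1 : m%:R * p1 N <= m%:R * (e * N.+1%:R) by rewrite ler_wpM2l//; case/andP: hp1.
have hq2 : m%:R * p2 N <= m%:R * (e * N.+1%:R) by rewrite ler_wpM2l//; case/andP: hp2.
have [I1 E1] := var_r N.+1 (@mpres_th0 R) hd1 hq1.
have [I2 E2] := var_r N.+1 (@mpres_th1 R) hd2 hq2.
rewrite -/(rX N) in I1 E1; rewrite -/(rY N) in I2 E2.
have [LA EA] := @var_bA N.+1 isT; have [LB EB] := @var_bB N.+1 isT.
have IA := L4_Int_mul LA LA; have IB := L4_Int_mul LB LB.
have [IZ EZ4] := @Int_oz4 R m m_gt0 N.+1 isT.
pose c : R := (dl ^+ 2 * N.+1%:R)^-1.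
have c0 : 0 < c by rewrite invr_gt0 mulr_gt0// exprn_gt0.
have k0 : 0 < K ^- 2 by rewrite invr_gt0 exprn_gt0.
pose G1 w := bA N.+1 w * bA N.+1 w + (bB N.+1 w * bB N.+1 w + oz4 m N.+1 w).
pose rx w := rX N w - m%:R * p1 N; pose ry w := rY N w - m%:R * p2 N.
pose G2 w := rx w * rx w + ry w * ry w.
have IG1 : Int G1 by exact: (IntD IA (IntD IB IZ)).
have IG2 : Int G2 by exact: (IntD I1 I2).
pose F w := K ^- 2 * G1 w + c * G2 w.
have IF : Int F := IntD (IntZ _ IG1) (IntZ _ IG2).
have sq0 (x : R) : 0 <= x * x by rewrite -expr2 sqr_ge0.
have z0 (w : R) := oz4_ge0 m N.+1 w.
have F0 w : 0 <= F w.
  by rewrite addr_ge0// mulr_ge0 ?(ltW c0) ?(ltW k0)// ?addr_ge0// ?addr_ge0.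
have EF : E F <= eta.
  rewrite (ED (IntZ _ IG1) (IntZ _ IG2)) (EZ _ IG1) (EZ _ IG2) (ED IA (IntD IB IZ)) (ED IB IZ) (ED I1 I2) EA EB.
  rewrite (_ : eta = eta / 2 + eta / 2); last by field.
  apply: lerD.
    apply: (le_trans _ KM); by rewrite ler_pM2l// /M mulr_natl mulr2n addrA lerD2l; exact: EZ4.
  rewrite /c mulrC ler_pdivrMr ?mulr_gt0 ?exprn_gt0//.
  apply: (le_trans (lerD E1 E2)).
  have -> : eta / 2 * (dl ^+ 2 * N.+1%:R) = 4 * (m%:R + 1) * (e * N.+1%:R).
    by rewrite /e; field; rewrite gt_eqF.
  have en0 : 0 <= e * N.+1%:R by rewrite mulr_ge0// ltW.
  have men0 : 0 <= m%:R * (e * N.+1%:R) by rewrite mulr_ge0.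
  exact: aux.
have [mB lB] := markov_E IF F0.
exists [set w | 1 <= F w]; split => //; first by apply: (le_trans lB); rewrite lee_fin.
move=> w /= /negP; rewrite -ltNge => Fw.
have g1 : K ^- 2 * G1 w < 1.
  by apply: le_lt_trans Fw; rewrite lerDl mulr_ge0 ?(ltW c0)// addr_ge0.
have g2 : c * G2 w < 1.
  apply: le_lt_trans Fw; rewrite lerDr mulr_ge0 ?(ltW k0)// !addr_ge0//; exact: sq0.
rewrite mulrC ltr_pdivrMr ?exprn_gt0// mul1r in g1.
rewrite mulrC ltr_pdivrMr ?mulr_gt0 ?exprn_gt0// mul1r in g2.
have s0 : 0 < dl * Num.sqrt N.+1%:R by rewrite mulr_gt0// sqrtr_gt0.
have sE : (dl * Num.sqrt N.+1%:R) ^+ 2 = dl ^+ 2 * N.+1%:R by rewrite exprMn sqr_sqrtr// ltW.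
rewrite -sE in g2.
have a0 := sq0 (bA N.+1 w); have b0 := sq0 (bB N.+1 w); have x0 := sq0 (rx w); have y0 := sq0 (ry w).
have [ga gb gz] := add3_lt a0 b0 (z0 w) g1.
have [gx gy _] := add3_lt x0 y0 (lexx 0) (etrans (congr1 (fun z => _ + z < _) (addr0 _)) g2).
split.
- exact: (sqr_lt_norm K0 ga).
- exact: (sqr_lt_norm K0 gb).
- have zK : oz m N.+1 w ^+ 4 <= K ^+ 4.
    rewrite ozE; apply: (@le_trans _ _ (K ^+ 2)).
      exact: ltW.
    by apply: ler_weXn2l.
  by move: zK; rewrite ler_pXn2r// nnegrE ?oz_ge0// ltW.
- exact: (sqr_lt_norm s0 gx).
- exact: (sqr_lt_norm s0 gy).
Unshelve. all: by end_near.
Qed.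

Variable pth : nat -> R -> R -> R.
Hypothesis mpth : forall N v, measurable_fun setT (fun w => pth N w v).
Hypothesis pthE : forall N w v, (0 < N)%N -> 0 < tot bU N.+1 (rX N w) w -> 0 < tot bV N.+1 (rY N w) w -> 0 <= v <= 1 ->
  pth N w v = gp m N.+1 (N.+1%:R + p1 N) (N.+1%:R + p2 N) (rX N w) (rY N w) w v.

Lemma nearS (P : nat -> Prop) : (\forall n \near \oo, P n) -> \forall N \near \oo, P N.+1.
Proof. by case=> k _ h; exists k => // N kN; apply: h; exact: (leq_trans kN). Qed.

Lemma close_event (eta eps : R) : 0 < eta -> 0 < eps -> exists2 K : R, 1 <= K & \forall N \near \oo,
  exists Bad : set R, [/\ measurable Bad, (lam Bad <= eta%:E)%E & forall w, ~ Bad w ->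
    [/\ `|bA N.+1 w| <= K, `|bB N.+1 w| <= K, oz m N.+1 w <= K &
      forall v, 0 <= v <= 1 -> `|pth N w v - zt N.+1 w v| <= eps] ].
Proof.
move=> eta0 e0; have [K K1 hK] := good_event eta0; exists K => //.
have [dl dl0 hdl] := gp_zt m_gt0 e0 K1.
near=> N.
have [Bad [mB lB hB]] : exists Bad : set R, [/\ measurable Bad, (lam Bad <= eta%:E)%E & forall w, ~ Bad w ->
    [/\ `|bA N.+1 w| <= K, `|bB N.+1 w| <= K, oz m N.+1 w <= K,
     `|rX N w - m%:R * p1 N| <= dl * Num.sqrt N.+1%:R & `|rY N w - m%:R * p2 N| <= dl * Num.sqrt N.+1%:R] ].
  by near: N; exact: hK.
exists Bad; split => // w /hB[h1 h2 h3 h4 h5]; split => // v v01.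
have hp1 : 0 <= p1 N <= dl * N.+1%:R by near: N; exact: p1s.
have hp2 : 0 <= p2 N <= dl * N.+1%:R by near: N; exact: p2s.
have h : forall (p1 p2 rx ry w : R), 0 <= p1 <= dl * N.+1%:R -> 0 <= p2 <= dl * N.+1%:R ->
  `|bA N.+1 w| <= K -> `|bB N.+1 w| <= K -> oz m N.+1 w <= K ->
  `|rx - m%:R * p1| <= dl * Num.sqrt N.+1%:R -> `|ry - m%:R * p2| <= dl * Num.sqrt N.+1%:R ->
  [/\ 0 < tot bU N.+1 rx w, 0 < tot bV N.+1 ry w & forall v, 0 <= v <= 1 ->
   `|gp m N.+1 (N.+1%:R + p1) (N.+1%:R + p2) rx ry w v - zt N.+1 w v| <= eps].
  by near: N; exact: nearS hdl.
have [t1 t2 t3] := h _ _ _ _ _ hp1 hp2 h1 h2 h3 h4 h5.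
by rewrite pthE//; [exact: t3|near: N; exists 1%N].
Unshelve. all: by end_near.
Qed.

(** The process is close to [zt], whose empirical part oscillates little by [osc_bt] and whose other
    part is the continuous [phi] times a bounded factor. [d] is fixed before N. *)
Lemma osc_event (eta eps : R) : 0 < eta -> 0 < eps -> exists2 d : R, 0 < d & \forall N \near \oo,
  exists Bad : set R, [/\ measurable Bad, (lam Bad <= eta%:E)%E & forall w, ~ Bad w ->
    forall x y : R, 0 <= x <= 1 -> 0 <= y <= 1 -> `|x - y| <= d -> `|pth N w x - pth N w y| <= eps].
Proof.
have aux (a b c : R) : `|a / m%:R * c - b / m%:R * c| = `|a - b| / m%:R * `|c|.
  by rewrite -mulrBl -mulrBl !normrM (@ger0_norm _ m%:R^-1) ?invr_ge0.
move=> eta0 e0; have e8 : 0 < eps / 8 by rewrite divr_gt0.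
have [K K1 hK] := close_event eta0 e8.
have K0 : 0 < K by apply: lt_le_trans K1.
have Kc0 := @Kc_gt0 R m.
have M0 : 0 < m%:R :> R by rewrite ltr0n.
have [p hp] := @rb_small R (21 * K) (eps / 8) (mulr_ge0 (ler0n _ 21) (ltW K0)) e8.
have ph0 : 0 < eps / 8 / (2 * K) * m%:R by rewrite mulr_gt0// divr_gt0// mulr_gt0.
have [d d0 hd] := heine (@continuous_phi R m) ph0.
have two0 : 0 < (2 ^+ p)^-1 :> R by rewrite invr_gt0 exprn_gt0.
exists (Num.min (d / 2) (2 ^+ p)^-1); first by rewrite lt_min two0 divr_gt0.
near=> N.
have [Bad [mB lB hB]] : exists Bad : set R, [/\ measurable Bad, (lam Bad <= eta%:E)%E & forall w, ~ Bad w ->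
    [/\ `|bA N.+1 w| <= K, `|bB N.+1 w| <= K, oz m N.+1 w <= K &
      forall v, 0 <= v <= 1 -> `|pth N w v - zt N.+1 w v| <= eps / 8] ].
  by near: N; exact: hK.
exists Bad; split => // w /hB[h1 h2 h3 h4] x y x01 y01; rewrite le_min => /andP[xy1 xy2].
have np : (2 ^ p <= N.+1)%N by near: N; apply: (nearS (P := fun n => (2 ^ p <= n)%N)); exists (2 ^ p)%N.
have t4 : 4 * Kc / Num.sqrt N.+1%:R <= eps / 8.
  have : (0 < N.+1)%N /\ (Num.sqrt N.+1%:R)^-1 < eps / 8 / (4 * Kc).
    by near: N; apply: (nearS (P := fun n => (0 < n)%N /\ (Num.sqrt n%:R)^-1 < _)); apply: invsqrt_small; rewrite divr_gt0// mulr_gt0.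
  by move=> [_ /ltW h]; rewrite -ler_pdivlMl ?mulr_gt0// mulrC.
have hb := osc_bt m w (ltn0Sn N) np x01 y01 xy2.
have /andP[rb0 _] := @rb01 R.
have hb1 : 21 * oz m N.+1 w * rb ^+ p <= eps / 8.
  by apply: (le_trans _ (ltW hp)); rewrite ler_wpM2r ?exprn_ge0// ler_wpM2l.
have hz : `|phi m x / m%:R * (bA N.+1 w - bB N.+1 w) - phi m y / m%:R * (bA N.+1 w - bB N.+1 w)| <= eps / 8.
  rewrite aux.
  have xyd : `|x - y| < d by apply: (le_lt_trans xy1); rewrite ltr_pdivrMr// ltr_pMr// ltr1n.
  have hph := ltW (hd x y x01 xyd).
  have hAB : `|bA N.+1 w - bB N.+1 w| <= 2 * K.
    exact: ler_normB2.
  rewrite -ler_pdivrMr// in hph.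
  apply: (le_trans (ler_pM _ (normr_ge0 _) hph hAB)); first by rewrite mulr_ge0 ?invr_ge0.
  by rewrite divfK// gt_eqF// mulr_gt0.
have hx := h4 x x01; have hy := h4 y y01.
have -> : pth N w x - pth N w y = (pth N w x - zt N.+1 w x) - (pth N w y - zt N.+1 w y) +
   ((bt N.+1 w x - bt N.+1 w y) + (phi m x / m%:R * (bA N.+1 w - bB N.+1 w) - phi m y / m%:R * (bA N.+1 w - bB N.+1 w))).
  by rewrite !zt_bt; ring.
rewrite (_ : eps = (eps / 8 + eps / 8) + (((eps / 8 + eps / 8) + (eps / 8)) + 3 * (eps / 8))); last by field.
apply: (le_trans (ler_normD _ _)); apply: lerD; first by apply: (le_trans (ler_normB _ _)); exact: lerD.
apply: (@le_trans _ _ ((eps / 8 + eps / 8) + eps / 8)); last by rewrite lerDl mulr_ge0// ltW.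
apply: (le_trans (ler_normD _ _)); apply: lerD => //.
by apply: (le_trans hb); exact: lerD.
Unshelve. all: by end_near.
Qed.

Lemma L4_xiv v : L4 (xiv v).
Proof. by apply: L4D; [exact: L4_eb|apply: L4Z; exact: L4_bD]. Qed.

Lemma E_xiv v : 0 <= v <= 1 -> E (xiv v) = 0.
Proof.
move=> v01; have I := L4_Int (@L4_bD R m m_gt0).
by rewrite (ED (L4_Int (L4_eb m_gt0 v)) (IntZ _ I)) (EZ _ I) E_bD// E_eb// mulr0 addr0.
Qed.

Lemma E_eb_bD v : 0 <= v <= 1 -> E (fun s => eb m v s * bD s) = - 2 * phi m v.
Proof.
move=> v01; have LD := @L4_bD R m m_gt0; have I := L4_Int LD.
have Li : L4 (fun s : R => (bW m s <= v)%R%:R : R).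
  by apply: (@L4_bnd _ _ 1); [exact: mind|move=> s; case: (bW m s <= v); rewrite ?normr1 ?normr0].
transitivity (E (fun s => (bW m s <= v)%R%:R * bD s + (- Hm v) * bD s)).
  by congr E; apply/funext => s; rewrite /eb; ring.
by rewrite (ED (L4_Int_mul Li LD) (IntZ _ I)) (EZ _ I) E_bD// E_ind_bD// mulr0 addr0.
Qed.

(** The two cross terms give -4 / m and the variance of U - V gives 2 / m in front of phi(u) phi(v);
    the sum -2 / m is (2^2 - 4 (2m + 1)) / (2m)^2, whence the coefficient 2 of [Zp]. *)
Lemma cov_xiv u v : 0 <= u <= 1 -> 0 <= v <= 1 ->
  E (fun s => xiv u s * xiv v s) = E (fun w => Zp m 2 (Hm u) w * Zp m 2 (Hm v) w).
Proof.
move=> u01 v01.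
have LD := @L4_bD R m m_gt0; have Lu := L4_eb m_gt0 u; have Lv := L4_eb m_gt0 v.
have Iuv := L4_Int_mul Lu Lv; have Iu := L4_Int_mul Lu LD; have Iv := L4_Int_mul Lv LD; have ID := L4_Int_mul LD LD.
transitivity (E (fun s => eb m u s * eb m v s + (phi m v / m%:R * (eb m u s * bD s) +
   (phi m u / m%:R * (eb m v s * bD s) + phi m u / m%:R * (phi m v / m%:R) * (bD s * bD s))))).
  by congr E; apply/funext => s; rewrite /xiv; ring.
rewrite (ED Iuv (IntD (IntZ _ Iu) (IntD (IntZ _ Iv) (IntZ _ ID)))) (ED (IntZ _ Iu) (IntD (IntZ _ Iv) (IntZ _ ID))).
rewrite (ED (IntZ _ Iv) (IntZ _ ID)) (EZ _ Iu) (EZ _ Iv) (EZ _ ID) E_bD2// !E_eb_bD// cov_eb// cov_Zp//.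
have Hu := Hm01 m_gt0 u01; have Hv := Hm01 m_gt0 v01.
rewrite KB_in// -/(Hm u) -/(Hm v).
have e x : 0 <= x <= 1 -> cov1 m (Hm x) = phi m x / (2 * m)%:R.
  by move=> x01; have := cov1_Hc m_gt0 x; rewrite /Hc clip_id.
rewrite !e// !natrM natrD natrM; have := m_neq0 m_gt0 (R := R).
move: (Num.min (Hm u) (Hm v)) (phi m u) (phi m v) (Hm u) (Hm v) (m%:R) => a b c f g k k0; field; exact: k0.
Qed.

(** By stability the Gaussian side is constant in n, so it may be replaced by the n-fold sum that
    [lindeberg] compares with [zt]. Three errors: this comparison, the Lipschitz bound outside of
    [Bad], and 2c times the mass of [Bad]. *)
Lemma pth_fidi (I : finType) (v : I -> R) (f : (I -> R) -> R) : tst f -> (forall i, 0 <= v i <= 1) ->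
  E (fun w => f (fun i => pth N w (v i))) @[N --> \oo] --> E (fun w => f (fun i => Zp m 2 (Hm (v i)) w)).
Proof.
move=> tf v01; have [c hc] := tst_bound tf; have [c' c'0 hl] := tst_lip tf; have [_ cf] := tf.
pose xi i := xiv (v i); pose et i := Zp m 2 (Hm (v i)) : R -> R.
have m1 : mom4 xi by move=> i; exact: L4_xiv.
have m2 : mom4 et by move=> i; exact: L4_Zp.
have [C hC] := lindeberg tf m1 m2 (fun i => etrans (E_xiv (v01 i)) (esym (E_Zp m 2 (Hm (v i)))))
   (fun i j => cov_xiv (v01 i) (v01 j)).
have [mZ hZ] := wstab_Zp m (2 : R).
have eZ n : (0 < n)%N -> E (fun w => f (fun i => (Num.sqrt n%:R)^-1 * Sv n et w i)) = E (fun w => f (et ^~ w)).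
  move=> n0; pose g (y : R -> R) := f (fun i => y (Hm (v i))).
  have := hZ n n0 g c; apply => //.
  - by move=> d T x mx; apply: cf => i; exact: mx.
  - by move=> x; exact: hc.
  - move=> x_ x hx; exact: (tst_seqcont tf (x_ := fun n i => x_ n (Hm (v i))) (fun i => hx _)).
have c0 : 0 <= c := le_trans (normr_ge0 _) (hc (fun=> 0)).
apply/cvgrPdist_le => e e0.
have e3 : 0 < e / 3 by rewrite divr_gt0.
pose ep := e / 3 / (c' * #|I|%:R + 1).
have ci0 : 0 <= c' * #|I|%:R by rewrite mulr_ge0.
have ci1 : 0 < c' * #|I|%:R + 1 by rewrite ltr_wpDl.
have ep0 : 0 < ep by rewrite divr_gt0.
have ci2 : c' * (#|I|%:R * ep) <= e / 3.
  by rewrite mulrA /ep mulrCA ger_pMr// ler_pdivrMr// mul1r lerDl.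
pose et0 := e / 3 / (2 * c + 1).
have cc1 : 0 < 2 * c + 1 by rewrite ltr_wpDl// mulr_ge0.
have et00 : 0 < et0 by rewrite divr_gt0.
have cc2 : 2 * c * et0 <= e / 3.
  by rewrite /et0 mulrCA ger_pMr// ler_pdivrMr// mul1r lerDl.
have [K K1 hK] := close_event et00 ep0.
near=> N.
have [Bad [mB lB hB]] : exists Bad : set R, [/\ measurable Bad, (lam Bad <= et0%:E)%E & forall w, ~ Bad w ->
    [/\ `|bA N.+1 w| <= K, `|bB N.+1 w| <= K, oz m N.+1 w <= K &
      forall v, 0 <= v <= 1 -> `|pth N w v - zt N.+1 w v| <= ep] ].
  by near: N.
rewrite -(eZ N.+1)//.
have h1 := hC N.+1 isT; rewrite distrC in h1.
have h2 : C * (Num.sqrt N.+1%:R)^-1 <= e / 3.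
  apply: (@le_trans _ _ ((`|C| + 1) * (Num.sqrt N.+1%:R)^-1)).
    by rewrite ler_wpM2r ?invr_ge0 ?sqrtr_ge0// (le_trans (ler_norm C))// lerDl.
  rewrite mulrC -ler_pdivlMr ?ltr_wpDl//; apply/ltW.
  have : (0 < N.+1)%N /\ (Num.sqrt N.+1%:R)^-1 < e / 3 / (`|C| + 1).
    by near: N; apply: (nearS (P := fun n => (0 < n)%N /\ (Num.sqrt n%:R)^-1 < _)); apply: invsqrt_small; rewrite divr_gt0// ltr_wpDl.
  by case.
pose F1 w := f (fun i => pth N w (v i)); pose F2 w := f (fun i => zt N.+1 w (v i)).
have mF1 : measurable_fun setT F1 by apply: cf => i; exact: mpth.
have mF2 : measurable_fun setT F2.
  by apply: cf => i; apply: measurable_funM => //; apply: measurable_Sv => j; exact: (L4_xiv j).1.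
have I1 : Int F1 := Int_bounded mF1 (fun x => hc _).
have I2 : Int F2 := Int_bounded mF2 (fun x => hc _).
have mBi : measurable_fun setT (fun s : R => (s \in Bad)%:R : R).
  by rewrite (_ : (fun s => _) = \1_Bad)//; exact: measurable_indic.
have IB : Int (fun s : R => (s \in Bad)%:R).
  by apply: Int_01 => // s; case: (s \in Bad); rewrite /= ?lexx ?ler01.
have eB : E (fun s : R => (s \in Bad)%:R) <= et0 by rewrite -lee_fin -lamE.
have h3 : `|E F2 - E F1| <= e / 3 + e / 3.
  rewrite -(EB I2 I1); apply: (le_trans (E_abs (IntB I2 I1))).
  apply: (@le_trans _ _ (E (fun s => e / 3 + 2 * c * (s \in Bad)%:R))).
    apply: E_le; [exact: (Int_abs (IntB I2 I1))|exact: (IntD (Int_cst _) (IntZ _ IB))|move=> w].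
    case: (boolP (w \in Bad)) => wB.
      rewrite mulr1; apply: (le_trans (ler_normB _ _)).
      rewrite mulr_natl mulr2n; apply: (@le_trans _ _ (c + c)); last by rewrite lerDr ltW.
      by apply: lerD; exact: hc.
    rewrite mulr0 addr0; move: wB; rewrite notin_setE => /hB[_ _ _ hw].
    apply: (le_trans (hl _ _)); apply: (le_trans _ ci2); rewrite ler_wpM2l//.
    apply: (@le_trans _ _ (\sum_(i : I) ep)); last by rewrite sumr_const -[ep *+ _]mulr_natl.
    by apply: ler_sum => i _; rewrite distrC; exact: hw.
  rewrite (ED (Int_cst _) (IntZ _ IB)) (EZ _ IB) E_fcst lerD2l.
  by apply: (le_trans _ cc2); rewrite ler_wpM2l// mulr_ge0.
rewrite -/F1; set X := E (fun w => f _).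
have -> : X - E F1 = (X - E F2) + (E F2 - E F1) by ring.
rewrite (_ : e = e / 3 + (e / 3 + e / 3)); last by field.
apply: (le_trans (ler_normD _ _)); apply: lerD => //.
exact: (le_trans h1).
Unshelve. all: by end_near.
Qed.

End TargetEvents.

Lemma sum_range (V : nmodType) (m a : nat) (G : nat -> V) (r : nat) : (a + m <= r)%N ->
  \sum_(l < r | (a <= l < a + m)%N) G l = \sum_(o < m) G (a + o)%N.
Proof.
move=> ar; rewrite -(big_mkord (fun l => (a <= l < a + m)%N) G) big_mkcond.
rewrite (big_cat_nat (n := a)) /=; [|exact: leq0n|exact: (leq_trans (leq_addr _ _) ar)].
rewrite (big_cat_nat (m := a) (n := a + m)) /=; [|exact: leq_addr|exact: ar].
rewrite big_nat_cond big1 ?add0r; last by move=> l /andP[/andP[_ la] _]; rewrite leqNgt la.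
rewrite [X in _ + X]big_nat_cond [X in _ + X]big1 ?addr0; last first.
  by move=> l /andP[/andP[la _] _]; rewrite [(l < _)%N]ltnNge la andbF.
rewrite -{1}[a]add0n big_addn addKn big_mkord; apply: eq_bigr => o _.
by rewrite addnC leq_addr ltn_add2l ltn_ord.
Qed.

(** * From spacings to independent blocks *)

Section Blocks.
Variables (m N n : nat) (i : nat -> nat).
Hypothesis dis : disjoint_spacings m N n i.

Lemma spacing_le k : (k <= N)%N -> (i k + m <= n.+1)%N.
Proof.
case: dis => h hN; have [r] := ubnP (N - k); elim: r k => // r IH k rk.
rewrite leq_eqVlt => /predU1P[->//|kN].
have [h1 h2] := h k kN; apply: (leq_trans h2); apply: (leq_trans (leq_addr m _)).
by apply: IH => //; lia.
Qed.

Lemma spacing_lt k k' : (k < k')%N -> (k' <= N)%N -> (i k + m <= i k')%N.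
Proof.
case: dis => h _; elim: k' => // k' IH; rewrite ltnS leq_eqVlt => /predU1P[->|kk'] kN.
  by case: (h k').
have [_ h2] := h k' kN; have := IH kk' (ltnW kN); lia.
Qed.

(* Samples are listed in decreasing order, so that the gaps of the [k]-th spacing are numbered from [bst k]. *)
Definition bst k := (n.+1 - (i k + m))%N.
Definition inb k l := (bst k <= l < bst k + m)%N.

Lemma inb_uniq k k' l : (k <= N)%N -> (k' <= N)%N -> inb k l -> inb k' l -> k = k'.
Proof.
wlog kk' : k k' / (k <= k')%N => [h kN k'N h1 h2|kN k'N].
  by have [?|/ltnW ?] := leqP k k'; [exact: h|apply/esym; exact: h].
move: kk'; rewrite leq_eqVlt => /predU1P[//|kk'].
have := spacing_lt kk' k'N; have := spacing_le k'N; rewrite /inb /bst; lia.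
Qed.

(* Gap [l] is the [off l]-th exponential variable of block [blk l]; the gaps outside of all chosen spacings form block [N + 1]. *)
Definition blk l : nat := if [pick k : 'I_N.+1 | inb k l] is Some k then k else N.+1.
Definition off l : nat := if [pick k : 'I_N.+1 | inb k l] is Some k then (l - bst k)%N else l.

Lemma blkP l : (exists k, [/\ (k <= N)%N, inb k l, blk l = k & off l = (l - bst k)%N]) \/
  (blk l = N.+1 /\ off l = l).
Proof.
rewrite /blk /off; case: pickP => [k hk|_]; last by right.
by left; exists k; split => //; rewrite -ltnS ltn_ord.
Qed.

Lemma blk_inb k l : (k <= N)%N -> (blk l == k) = inb k l.
Proof.
move=> kN; have [[k' [k'N h -> _]]|[e _]] := blkP l.
  apply/eqP/idP => [<-//|h']; exact: inb_uniq h h'.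
rewrite e gtn_eqF//; apply/esym/negbTE/negP => h.
move: e; rewrite /blk; case: pickP => [k' h' e|/(_ (Ordinal (kN : (k < N.+1)%N)))]; last by rewrite /= h.
by have := ltn_ord k'; rewrite e ltnn.
Qed.

(** Makes the pair (block, offset) a relabelling of the gaps, so that distinct gaps read distinct
    seeds. *)
Lemma off_inj l l' : blk l = blk l' -> off l = off l' -> l = l'.
Proof.
have [[k [kN h1 -> ->]]|[-> ->]] := blkP l; have [[k' [kN' h1' -> ->]]|[-> ->]] := blkP l'; last by [].
- by move=> e; subst k'; move: h1 h1'; rewrite /inb; lia.
- by move=> e; move: kN; rewrite e ltnn.
- by move=> e; move: kN'; rewrite -e ltnn.
Qed.

Lemma blk_lt l : (blk l < N.+2)%N.
Proof. by have [[k [kN _ -> _]]|[-> _]] := blkP l => //; rewrite !ltnS ltnW. Qed.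

Lemma off_lt l : (off l <= l)%N.
Proof. by have [[k [_ _ _ ->]]|[_ ->]] := blkP l => //; exact: leq_subr. Qed.

Lemma block_sum (V : nmodType) (F : nat -> nat -> V) k : (k <= N)%N ->
  \sum_(l < n.+1 | (bst k <= l < bst k + m)%N) F (blk l) (off l) = \sum_(o < m) F k o.
Proof.
move=> kN; have hk := spacing_le kN.
rewrite (sum_range (fun l => F (blk l) (off l))); last by rewrite /bst; lia.
apply: eq_bigr => o _; have h : inb k (bst k + o) by rewrite /inb leq_addr ltn_add2l ltn_ord.
have [[k' [k'N h' -> ->]]|[e _]] := blkP (bst k + o).
  by rewrite (inb_uniq k'N kN h' h) addKn.
by move: h; rewrite -(blk_inb _ kN) e => /eqP e'; move: kN; rewrite -e' ltnn.
Qed.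

Lemma total_sum (V : nmodType) (F : nat -> nat -> V) :
  \sum_(l < n.+1) F (blk l) (off l) = \sum_(k < N.+1) \sum_(o < m) F k o + \sum_(l < n.+1 | blk l == N.+1) F N.+1 l.
Proof.
rewrite (partition_big (fun l : 'I_n.+1 => Ordinal (blk_lt l)) xpredT)//= big_ord_recr /=; congr (_ + _).
  apply: eq_bigr => k _; have kN : (k <= N)%N by rewrite -ltnS ltn_ord.
  rewrite -block_sum//; apply: eq_bigl => l; rewrite -val_eqE /=; exact: blk_inb.
apply: eq_big => [l|l]; first by rewrite -val_eqE.
by rewrite -val_eqE /= => /eqP e; have [[k [kN _ e' _]]|[-> ->]] := blkP l => //; move: kN; rewrite -e' e ltnn.
Qed.

End Blocks.

(** * The law of the ratio process in terms of block seeds *)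

Section Transfer.
Context {R : realType}.
Local Notation mR := (measurableTypeR R).
Local Notation lam := (@lam R).
Local Notation th0 := (@th0 R).
Local Notation th1 := (@th1 R).

Lemma mlist_comp d1 d2 (T1 : measurableType d1) (T2 : measurableType d2) (g : T2 -> T1) (l : seq (T1 -> R)) :
  measurable_fun setT g -> mlist l -> mlist [seq (fun t => f (g t)) | f <- l].
Proof.
move=> mg ml j; have [jl|jl] := ltnP j (size l).
  by rewrite (nth_map (fun=> 0))//; exact: (measurableT_comp (ml j) mg).
by rewrite nth_default ?size_map//; exact: measurable_cst.
Qed.

Definition smeas2 (F : seq R -> seq R -> \bar R) :=
  forall d (T : measurableType d) (l1 l2 : seq (T -> R)), mlist l1 -> mlist l2 ->
  measurable_fun setT (fun t => F [seq f t | f <- l1] [seq f t | f <- l2]).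

Definition lmeas (D : R -> seq R) := forall d1 (S : measurableType d1) (K : S -> seq R -> \bar R)
    d2 (T : measurableType d2) (g : T -> S) (w : T -> R),
  pmeas K -> measurable_fun setT g -> measurable_fun setT w -> measurable_fun setT (fun t => K (g t) (D (w t))).

Definition nl (n : nat) (w : R) : seq R := [seq x * (head 0 (sl n.+1 w))^-1 | x <- behead (sl n.+1 w)].

Lemma lmeas_dl n : lmeas (dl n).
Proof. by move=> d1 S K d2 T g w mK mg mw; exact: measurable_dl. Qed.

Lemma lmeas_nl n : lmeas (nl n).
Proof.
move=> d1 S K d2 T g w mK mg mw.
apply: (@measurable_sl _ _ _ n.+1 _ S (fun s l => K s [seq x * (head 0 l)^-1 | x <- behead l]) _ T g w) => //.
move=> d' T' g' [|f l] mg' ml /=.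
  by apply: (mK _ T' g' [::]) => // j; rewrite nth_nil; exact: measurable_cst.
have [mf ml'] := mlist_behead ml.
have := mK _ T' g' _ mg' (mlist_div (measurableT_comp measurable_invr mf) ml').
by under eq_fun do rewrite -map_comp; under [in X in _ -> X]eq_fun do rewrite -map_comp.
Qed.

Lemma smeas2_measurable F D1 D2 : smeas2 F -> lmeas D1 -> lmeas D2 ->
  measurable_fun setT (fun z : mR * mR => F (D1 z.1) (D2 z.2)).
Proof.
move=> mF m1 m2; apply: (m2 _ mR (fun x l => F (D1 x) l) _ (mR * mR)%type (fun z => z.1) (fun z => z.2)).
- move=> d' T g l mg ml; apply: (m1 _ T (fun t l1 => F l1 [seq f t | f <- l]) _ T id g) => //.
  move=> d2 T2 g2 l1 mg2 ml1.
  have := mF _ T2 l1 [seq (fun t => f (g2 t)) | f <- l] ml1 (mlist_comp mg2 ml).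
  by under [in X in X -> _]eq_fun do rewrite -map_comp.
- exact: measurable_fst.
- exact: measurable_snd.
Qed.

Lemma smeas2_smeas F D x : smeas2 F -> lmeas D -> smeas (F (D x)).
Proof.
move=> mF mD d T l ml; apply: (mD _ T (fun t l1 => F l1 [seq f t | f <- l]) _ T id (fun=> x)) => //.
move=> d2 T2 g2 l1 mg2 ml1.
have := mF _ T2 l1 [seq (fun t => f (g2 t)) | f <- l] ml1 (mlist_comp mg2 ml).
by under [in X in X -> _]eq_fun do rewrite -map_comp.
Qed.

(** [order_law] is applied to one sample while the other is frozen, the order of integration being
    swapped in between. *)
Lemma order_law2 n1 n2 F : smeas2 F -> (forall l1 l2, 0 <= F l1 l2)%E ->
  (\int[lam]_w F (dl n1 (th0 w)) (dl n2 (th1 w)) = \int[lam]_w F (nl n1 (th0 w)) (nl n2 (th1 w)))%E.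
Proof.
move=> mF F0.
have mF' : smeas2 (fun l1 l2 => F l2 l1) by move=> d T l1 l2 m1 m2; exact: mF.
have A := smeas2_measurable mF (@lmeas_dl n1) (@lmeas_dl n2).
have B := smeas2_measurable mF (@lmeas_dl n1) (@lmeas_nl n2).
have C := smeas2_measurable mF (@lmeas_nl n1) (@lmeas_nl n2).
rewrite (ge0_split A (fun z => F0 _ _)).
under eq_integral => x _ do rewrite /= (order_law n2 (smeas2_smeas x mF (@lmeas_dl n1)) (fun l => F0 _ _)).
rewrite -(ge0_split B (fun z => F0 _ _)) (ge0_split_swap B (fun z => F0 _ _)).
under eq_integral => y _ do rewrite /= (order_law n1 (smeas2_smeas y mF' (@lmeas_nl n2)) (fun l => F0 _ _)).
by rewrite -(ge0_split_swap C (fun z => F0 _ _)).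
Qed.

Definition ls (e : nat -> R) (n : nat) : seq R :=
  [seq (\sum_(j.+1 <= k < n.+1) e k) * (\sum_(0 <= k < n.+1) e k)^-1 | j <- iota 0 n].

Lemma nl_ls n w : nl n w = ls (fun k => expl (sd k w)) n.
Proof.
have s1 : size (behead (sl n.+1 w)) = n by rewrite size_behead size_sl.
apply: (@eq_from_nth _ 0); first by rewrite /nl /ls !size_map size_iota s1.
rewrite size_map s1 => j jn; rewrite (nth_map 0) ?s1// (nth_map 0%N) ?size_iota// nth_iota// add0n.
by rewrite nth_behead -nth0 !nth_sl.
Qed.

(** [order_stat] for a sample given in decreasing order, with the same values at the two ends. *)
Definition os (l : seq R) (k : nat) : R := nth 1 (0 :: rev l) k.

Lemma os_ls (e : nat -> R) n k : \sum_(0 <= k < n.+1) e k != 0 -> (k <= n.+1)%N ->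
  os (ls e n) k = (\sum_(n.+1 - k <= j < n.+1) e j) / \sum_(0 <= k < n.+1) e k.
Proof.
move=> S0; case: k => [_|k]; first by rewrite subn0 big_geq// mul0r.
rewrite ltnS leq_eqVlt => /predU1P[->|kn].
  by rewrite subnn mulfV// /os /= nth_default// size_rev size_map size_iota.
rewrite /os /= nth_rev ?size_map ?size_iota// (nth_map 0%N) ?size_iota; last by lia.
by rewrite nth_iota ?add0n; [rewrite (_ : (n - k.+1).+1 = (n.+1 - k.+1)%N)//; lia|lia].
Qed.

Lemma os_spacing (e : nat -> R) n m a : \sum_(0 <= k < n.+1) e k != 0 -> (a + m <= n.+1)%N ->
  os (ls e n) (a + m) - os (ls e n) a =
  (\sum_(l < n.+1 | (n.+1 - (a + m) <= l < n.+1 - (a + m) + m)%N) e l) / \sum_(0 <= k < n.+1) e k.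
Proof.
move=> S0 am; rewrite !os_ls//; last exact: (leq_trans (leq_addr _ _) am).
rewrite -mulrBl; congr (_ / _); rewrite (sum_range e); last by lia.
rewrite (big_cat_nat (n := n.+1 - a)) /=; [|by lia|by lia].
rewrite addrK -{1}[(n.+1 - (a + m))%N]add0n big_addn (_ : (n.+1 - a - (n.+1 - (a + m)) = m)%N); last by lia.
by rewrite big_mkord; apply: eq_bigr => o _; rewrite addnC.
Qed.

Lemma ls_ext (e e' : nat -> R) n : (forall k, (k < n.+1)%N -> e k = e' k) -> ls e n = ls e' n.
Proof.
move=> h; have hs j : \sum_(j <= k < n.+1) e k = \sum_(j <= k < n.+1) e' k.
  by rewrite !big_nat; apply: eq_bigr => k /andP[_ kn]; exact: h.
by apply: eq_map => j; rewrite !hs.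
Qed.

Lemma ls_map d (T : measurableType d) (e : nat -> T -> R) n : (forall k, measurable_fun setT (e k)) ->
  exists2 l : seq (T -> R), mlist l & forall t, ls (e ^~ t) n = [seq f t | f <- l].
Proof.
move=> me; pose g j t := (\sum_(j.+1 <= k < n.+1) e k t) * (\sum_(0 <= k < n.+1) e k t)^-1.
exists [seq g j | j <- iota 0 n]; last by move=> t; rewrite -map_comp.
have ms j : measurable_fun setT (fun t => \sum_(j <= k < n.+1) e k t).
  by apply: measurable_sum.
move=> j; have [jn|jn] := ltnP j n; last by rewrite nth_default ?size_map ?size_iota//; exact: measurable_cst.
rewrite (nth_map 0%N) ?size_iota// nth_iota// add0n.
by apply: measurable_funM => //; exact: (measurableT_comp measurable_invr (ms 0%N)).
Qed.

Lemma measurable_os d (T : measurableType d) (l : seq (T -> R)) k : mlist l ->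
  measurable_fun setT (fun t => os [seq f t | f <- l] k).
Proof.
move=> ml; rewrite /os; case: k => [|k] /=; first exact: measurable_cst.
under eq_fun do rewrite -map_rev.
have [kl|kl] := ltnP k (size (rev l)).
  under eq_fun do rewrite (nth_map (fun=> 0))//; rewrite nth_rev -?(size_rev l)//; exact: ml.
by under eq_fun do rewrite nth_default ?size_map//; exact: measurable_cst.
Qed.

Variable m : nat.

Definition gpath (N n1 n2 : nat) (i j : nat -> nat) (l1 l2 : seq R) (v : R) : R :=
  let r k := let sx := (last_spacing m n1).+1%:R * (os l1 (i k + m) - os l1 (i k)) in
    let sy := (last_spacing m n2).+1%:R * (os l2 (j k + m) - os l2 (j k)) in sx / (sx + sy) in
  Num.sqrt N.+1%:R * (N.+1%:R^-1 * \sum_(k < N.+1) (r k <= v)%R%:R - beta_cdf m v).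

Lemma ratio_process_gpath N n1 n2 i j x y v :
  ratio_process m N n1 n2 i j (fun k => sd k x) (fun k => sd k y) v = gpath N n1 n2 i j (dl n1 x) (dl n2 y) v :> R.
Proof. by rewrite /gpath !dlE /os !revK. Qed.

Lemma measurable_gpath N n1 n2 i j d (T : measurableType d) (l1 l2 : seq (T -> R)) v : mlist l1 -> mlist l2 ->
  measurable_fun setT (fun t => gpath N n1 n2 i j [seq f t | f <- l1] [seq f t | f <- l2] v).
Proof.
move=> m1 m2; apply: measurable_funM => //; apply: measurable_funB => //; apply: measurable_funM => //.
apply: measurable_sum => k /=.
pose sx t : R := (last_spacing m n1).+1%:R * (os [seq f t | f <- l1] (i k + m) - os [seq f t | f <- l1] (i k)).
pose sy t : R := (last_spacing m n2).+1%:R * (os [seq f t | f <- l2] (j k + m) - os [seq f t | f <- l2] (j k)).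
have ms (l : seq (T -> R)) (c : R) a b : mlist l ->
    measurable_fun setT (fun t => c * (os [seq f t | f <- l] a - os [seq f t | f <- l] b)).
  by move=> ml; apply: measurable_funM => //; apply: measurable_funB; exact: measurable_os.
have mx : measurable_fun setT sx by exact: ms.
have my : measurable_fun setT sy by exact: ms.
rewrite (_ : (fun t => _) = (fun t => if sx t / (sx t + sy t) <= v then 1 else 0)); last first.
  by apply/funext => t; rewrite -/(sx t) -/(sy t); case: (_ <= v).
apply: measurable_fun_ifT => //; apply: measurable_fun_ler => //; apply: measurable_funM => //.
by apply: (measurableT_comp measurable_invr); exact: measurable_funD.
Qed.

Section Sizes.
Variables (N n1 n2 : nat) (i j : nat -> nat).

(** The gap reads a seed from the first half of the seed of its block, and [e2] reads from the
    second half: the sums over one block are then [bU] and [bV] of that block seed. *)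
Definition e1 (w : R) (l : nat) : R := expl (sd (off m N n1 i l) (th0 (sd (blk m N n1 i l) w))).
Definition e2 (w : R) (l : nat) : R := expl (sd (off m N n2 j l) (th1 (sd (blk m N n2 j l) w))).
(* The ratio process computed from the seeds [sd k], one for each block, instead of the sample; it has the same law ([path_law]). *)
Definition tpath (w : R) : R -> R := gpath N n1 n2 i j (ls (e1 w) n1) (ls (e2 w) n2).

Lemma measurable_e1 l : measurable_fun setT (fun w => e1 w l).
Proof.
apply: (measurableT_comp (@measurable_expl R)); apply: (measurableT_comp (measurable_sd _)).
exact: (measurableT_comp (@mth0 R) (measurable_sd _)).
Qed.

Lemma measurable_e2 l : measurable_fun setT (fun w => e2 w l).
Proof.
apply: (measurableT_comp (@measurable_expl R)); apply: (measurableT_comp (measurable_sd _)).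
exact: (measurableT_comp (@mth1 R) (measurable_sd _)).
Qed.

Lemma measurable_tpath v : measurable_fun setT (fun w => tpath w v).
Proof.
have [l1 ml1 h1] := @ls_map _ mR (fun k w => e1 w k) n1 measurable_e1.
have [l2 ml2 h2] := @ls_map _ mR (fun k w => e2 w k) n2 measurable_e2.
rewrite /tpath; under eq_fun do rewrite (h1 _ : ls (e1 _) n1 = _) (h2 _ : ls (e2 _) n2 = _).
exact: measurable_gpath.
Qed.

(** Once the samples are replaced by normalised exponentials, both sides are the same functional of
    an array of independent uniform seeds, up to the injective relabelling [sg]. *)
Lemma path_law (Phi : (R -> R) -> \bar R) : cmeas Phi -> (forall y, 0 <= Phi y)%E ->
  (\int[lam]_w Phi (ratio_process m N n1 n2 i j (fun k => sd k (th0 w)) (fun k => sd k (th1 w))) =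
   \int[lam]_w Phi (tpath w))%E.
Proof.
move=> mP P0; pose F l1 l2 := Phi (gpath N n1 n2 i j l1 l2).
have mF : smeas2 F by move=> d T l1 l2 m1 m2; apply: mP => v; exact: measurable_gpath.
transitivity (\int[lam]_w F (dl n1 (th0 w)) (dl n2 (th1 w)))%E.
  by apply: eq_integral => w _; congr Phi; apply/funext => v; exact: ratio_process_gpath.
rewrite (order_law2 n1 n2 mF (fun _ _ => P0 _)); pose J := ('I_n1.+1 * unit + 'I_n2.+1 * unit)%type : finType.
pose G (z : J -> R) := F (ls (fun k => expl (z (inl (inord k, tt)))) n1) (ls (fun k => expl (z (inr (inord k, tt)))) n2).
have mG : cmeas G.
  move=> d T x mx.
  have mx1 k : measurable_fun setT (fun t => expl (x (inl (inord k, tt)) t)) := measurableT_comp (@measurable_expl R) (mx _).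
  have mx2 k : measurable_fun setT (fun t => expl (x (inr (inord k, tt)) t)) := measurableT_comp (@measurable_expl R) (mx _).
  have [l1 ml1 h1] := ls_map n1 mx1; have [l2 ml2 h2] := ls_map n2 mx2.
  by rewrite /G; under eq_fun do rewrite h1 h2; exact: mF.
have U0 := iidu_pair (iidu_sd n1.+1 (@iidu_id R)) (iidu_sd n2.+1 (@iidu_id R)).
(* A common bound for the offsets of both samples, as [off l <= l]. The block index below ranges
   over the chosen blocks and one more for the discarded gaps. *)
pose M := (n1 + n2).+1.
have U1 := iidu_sd N.+2 (iidu_pair (iidu_sd M (@iidu_id R)) (iidu_sd M (@iidu_id R))).
pose sg (p : J) : ('I_N.+2 * ('I_M * unit + 'I_M * unit))%type := match p with
  | inl q => (inord (blk m N n1 i q.1), inl (inord (off m N n1 i q.1), tt))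
  | inr q => (inord (blk m N n2 j q.1), inr (inord (off m N n2 j q.1), tt)) end.
have oM1 (q : 'I_n1.+1) : (off m N n1 i q < M)%N.
  by apply: (leq_ltn_trans (off_lt _ _ _ _ _)); rewrite /M; have := ltn_ord q; lia.
have oM2 (q : 'I_n2.+1) : (off m N n2 j q < M)%N.
  by apply: (leq_ltn_trans (off_lt _ _ _ _ _)); rewrite /M; have := ltn_ord q; lia.
have inj : injective sg.
  move=> [[q []]|[q []]] [[q' []]|[q' []]] //= [].
    move=> /(congr1 (@nat_of_ord _)) + /(congr1 (@nat_of_ord _)); rewrite !inordK ?blk_lt// => e e'.
    by congr (inl (_, _)); apply: val_inj; exact: (off_inj e e').
  move=> /(congr1 (@nat_of_ord _)) + /(congr1 (@nat_of_ord _)); rewrite !inordK ?blk_lt// => e e'.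
  by congr (inr (_, _)); apply: val_inj; exact: (off_inj e e').
have := iidu_eq U0 (iidu_comp inj U1) mG (fun z => P0 _).
move=> h; transitivity (\int[lam]_w G ((fun k : J => match k with
   | inl i0 => fun w => sd i0.1 (th0 w) | inr j0 => fun w => sd j0.1 (th1 w) end) ^~ w))%E.
  apply: eq_integral => w _.
  have -> : nl n1 (th0 w) = ls (fun k => expl (sd (inord k : 'I_n1.+1) (th0 w))) n1.
    by rewrite nl_ls; apply: ls_ext => k kn; rewrite inordK.
  have -> : nl n2 (th1 w) = ls (fun k => expl (sd (inord k : 'I_n2.+1) (th1 w))) n2.
    by rewrite nl_ls; apply: ls_ext => k kn; rewrite inordK.
  by [].
rewrite [LHS]h; apply: eq_integral => w _; rewrite /tpath.
have -> : ls (e1 w) n1 = ls (fun k => expl (sd (inord (off m N n1 i (inord k : 'I_n1.+1)) : 'I_M)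
   (th0 (sd (inord (blk m N n1 i (inord k : 'I_n1.+1)) : 'I_N.+2) w)))) n1.
  apply: ls_ext => k kn; have := oM1 (Ordinal kn) => /= ok.
  by rewrite /e1 (inordK kn) !inordK ?blk_lt.
have -> : ls (e2 w) n2 = ls (fun k => expl (sd (inord (off m N n2 j (inord k : 'I_n2.+1)) : 'I_M)
   (th1 (sd (inord (blk m N n2 j (inord k : 'I_n2.+1)) : 'I_N.+2) w)))) n2.
  apply: ls_ext => k kn; have := oM2 (Ordinal kn) => /= ok.
  by rewrite /e2 (inordK kn) !inordK ?blk_lt.
by [].
Qed.

Hypothesis m_gt0 : (0 < m)%N.
Hypothesis dis_i : disjoint_spacings m N n1 i.
Hypothesis dis_j : disjoint_spacings m N n2 j.
Hypothesis le1 : (N <= last_spacing m n1)%N.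
Hypothesis le2 : (N <= last_spacing m n2)%N.

Lemma tpathE w v : let rx := rest n1.+1 (fun l => blk m N n1 i l == N.+1) (th0 (sd N.+1 w)) in
  let ry := rest n2.+1 (fun l => blk m N n2 j l == N.+1) (th1 (sd N.+1 w)) in
  0 < tot (bU m) N.+1 rx w -> 0 < tot (bV m) N.+1 ry w -> 0 <= v <= 1 ->
  tpath w v = gp m N.+1 (N.+1%:R + (last_spacing m n1 - N)%N%:R) (N.+1%:R + (last_spacing m n2 - N)%N%:R) rx ry w v.
Proof.
move=> rx ry.
have t1 : \sum_(0 <= l < n1.+1) e1 w l = tot (bU m) N.+1 rx w.
  rewrite big_mkord (total_sum dis_i (fun k o => expl (sd o (th0 (sd k w))))); congr (_ + _).
  by rewrite big_mkcond; apply: eq_bigr => l _; case: ifP; rewrite ?mul1r ?mul0r.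
have t2 : \sum_(0 <= l < n2.+1) e2 w l = tot (bV m) N.+1 ry w.
  rewrite big_mkord (total_sum dis_j (fun k o => expl (sd o (th1 (sd k w))))); congr (_ + _).
  by rewrite big_mkcond; apply: eq_bigr => l _; case: ifP; rewrite ?mul1r ?mul0r.
move=> sx sy v01; rewrite /tpath /gpath /gp beta_cdfE; last by case/andP: v01.
rewrite -!natrD !addSn !subnKC//; congr (_ * (_ * _ - _)); apply: eq_bigr => k _.
have kN : (k <= N)%N by rewrite -ltnS ltn_ord.
rewrite !os_spacing ?t1 ?t2 ?gt_eqF//; last 2 first.
- exact: (spacing_le dis_j).
- exact: (spacing_le dis_i).
rewrite -/(bst m n1 i k) -/(bst m n2 j k).
rewrite (block_sum dis_i (fun k o => expl (sd o (th0 (sd k w)))) kN).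
by rewrite (block_sum dis_j (fun k o => expl (sd o (th1 (sd k w)))) kN).
Qed.

End Sizes.

(** The difference is exactly the remainder of n + 1 modulo m. The condition 1 <= N excludes a
    quotient 0, where the truncated predecessor in [last_spacing] would spoil the count. *)
Lemma rest_count N n i : (0 < m)%N -> disjoint_spacings m N n i -> (N <= last_spacing m n)%N -> (1 <= N)%N ->
  `|\sum_(l < n.+1) (blk m N n i l == N.+1)%:R - m%:R * (last_spacing m n - N)%N%:R| <= m%:R :> R.
Proof.
move=> m0 dis le1 N1; have h := total_sum dis (fun _ _ => 1 : R).
have hc : \sum_(l < n.+1 | blk m N n i l == N.+1) 1 = \sum_(l < n.+1) (blk m N n i l == N.+1)%:R :> R.
  by rewrite big_mkcond; apply: eq_bigr => l _; case: ifP.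
rewrite hc !sumr_const !card_ord in h; move: h; set c := \sum_(l < _) _ => h.
have := divn_eq n.+1 m; have := ltn_mod n.+1 m; rewrite m0; move: le1; rewrite /last_spacing.
case: (n.+1 %/ m)%N => [|q] /=; first by rewrite leqn0 => /eqP e; rewrite e in N1.
set r := (n.+1 %% m)%N => Nq rm e.
have {}h : c = n.+1%:R - N.+1%:R * m%:R by rewrite h -mulr_natl -[m%:R *+ _]mulr_natl; ring.
have -> : c - m%:R * (q - N)%:R = r%:R by rewrite h e natrD natrM natrB// -!natr1; ring.
by rewrite ger0_norm// ler_nat ltnW.
Qed.

End Transfer.

(** * Coupling *)

Section Coupling.
Context {R : realType}.
Local Notation mR := (measurableTypeR R).
Local Notation lam := (@lam R).
Local Notation th0 := (@th0 R).
Local Notation th1 := (@th1 R).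

(* Conditional quantile transform. *)
Lemma kernel_coupling (k : R -> R -> R) : measurable_fun setT (fun z : mR * mR => k z.1 z.2) ->
  (forall x y, 0 <= k x y) -> (forall x, \int[lam]_y (k x y)%:E = 1)%E -> (forall y, \int[lam]_x (k x y)%:E = 1)%E ->
  exists2 psi : R -> R, mpres psi & forall F : mR * mR -> \bar R, measurable_fun setT F -> (forall z, 0 <= F z)%E ->
   (\int[lam]_w F (th0 w, psi w) = \int[lam]_w (F (th0 w, th1 w) * (k (th0 w) (th1 w))%:E))%E.
Proof.
move=> mk k0 k1 k2; have m1 := @measurable_fst _ _ mR mR; have m2 := @measurable_snd _ _ mR mR.
have mkx x : measurable_fun setT (k x : mR -> mR) := measurable_fun_pair2 x mk.
pose nu x := @densP _ mR R lam (k x) (mkx x) (k0 x) (k1 x).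
have mnu a : measurable_fun setT (fun x : mR => nu x `]-oo, a]%classic).
  rewrite (_ : (fun x => _) = (fun x => \int[lam]_y (if (y <= a)%R then (k x y)%:E else 0)))%E.
    have mF : measurable_fun setT (fun z : mR * mR => if z.2 <= a then (k z.1 z.2)%:E else 0%E).
      by apply: measurable_fun_ifT => //; [exact: measurable_fun_ler|exact/measurable_EFinP].
    have F0 (z : mR * mR) : (0 <= if (z.2 <= a)%R then (k z.1 z.2)%:E else 0)%E.
      by case: (z.2 <= a) => //; rewrite lee_fin.
    exact: (@measurable_fun_fubini_tonelli_F _ _ mR mR R lam _ mF F0).
  apply/funext => x; rewrite densPE integral_mkcond; apply: eq_integral => y _; rewrite patchE.
  by case: (boolP (y \in _)); rewrite ?notin_setE ?inE/= in_itv/=; [move=> ->|move/negP/negbTE => ->].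
pose q := quant nu.
have mq : measurable_fun setT (fun z : mR * mR => q z.1 z.2) := measurable_quant mnu.
pose psi w := q (th0 w) (th1 w).
have FE (F : mR * mR -> \bar R) : measurable_fun setT F -> (forall z, 0 <= F z)%E ->
   (\int[lam]_w F (th0 w, psi w) = \int[lam]_w (F (th0 w, th1 w) * (k (th0 w) (th1 w))%:E))%E.
  move=> mF F0.
  have mG : measurable_fun setT (fun z : mR * mR => F (z.1, q z.1 z.2)).
    by apply: (measurableT_comp mF); apply/measurable_fun_pairP; split; [exact: m1|exact: mq].
  have mH : measurable_fun setT (fun z : mR * mR => F z * (k z.1 z.2)%:E)%E.
    by apply: emeasurable_funM => //; exact/measurable_EFinP.
  have H0 (z : mR * mR) : (0 <= F z * (k z.1 z.2)%:E)%E by rewrite mule_ge0// lee_fin.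
  transitivity (\int[lam]_w (fun z : mR * mR => F (z.1, q z.1 z.2)) (th0 w, th1 w))%E; first by [].
  rewrite (ge0_split mG (fun z => F0 _)).
  transitivity (\int[lam]_w (fun z : mR * mR => F z * (k z.1 z.2)%:E) (th0 w, th1 w))%E; last by [].
  rewrite (ge0_split mH H0); apply: eq_integral => x _.
  have mFx : measurable_fun setT (fun y : mR => F (x, y)) := measurable_fun_pair2 x mF.
  have F0x (y : R) : (0 <= F (x, y))%E by exact: F0.
  have h1 := quant_integral mnu x mFx F0x.
  have h2 := @ge0_integral_densP _ mR R lam (k x) (mkx x) (k0 x) (k1 x) _ mFx F0x.
  exact: (etrans h1 h2).
exists psi; last exact: FE.
have mpsi : measurable_fun setT psi.
  have mt : measurable_fun setT (fun w : mR => (th0 w, th1 w)) by apply/measurable_fun_pairP; split; [exact: mth0|exact: mth1].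
  exact: (measurableT_comp mq mt).
(* That the kernel integrates to 1 in its first variable is what gives [psi] the uniform law. *)
split => // A mA.
have mI : measurable_fun setT (fun z : mR * mR => (\1_A z.2)%:E : \bar R).
  by apply/measurable_EFinP; apply: (measurableT_comp (measurable_indic mA) m2).
have I0 (z : mR * mR) : (0 <= (\1_A z.2)%:E :> \bar R)%E by rewrite lee_fin.
have := FE _ mI I0; rewrite /=.
rewrite -[X in X = _ -> _]/(\int[lam]_w (\1_(psi @^-1` A) w)%:E)%E.
have mpA : measurable (psi @^-1` A) := preimage_measurable mpsi mA.
rewrite (integral_indic lam measurableT mpA) setIT => ->.
have mH : measurable_fun setT (fun z : mR * mR => (\1_A z.2)%:E * (k z.1 z.2)%:E)%E.
  by apply: emeasurable_funM => //; exact/measurable_EFinP.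
have H0 (z : mR * mR) : (0 <= (\1_A z.2)%:E * (k z.1 z.2)%:E :> \bar R)%E by rewrite mule_ge0 ?lee_fin.
transitivity (\int[lam]_w (fun z : mR * mR => (\1_A z.2)%:E * (k z.1 z.2)%:E) (th0 w, th1 w))%E; first by [].
rewrite (ge0_split_swap mH H0).
transitivity (\int[lam]_y (\1_A y)%:E)%E; last by rewrite (integral_indic lam measurableT mA) setIT.
apply: eq_integral => y _ /=; rewrite -[RHS]mule1 -(k2 y) -ge0_integralZl//.
- by apply/measurable_EFinP; exact: (measurable_fun_pair1 y mk).
- by move=> x _; rewrite lee_fin.
Qed.

(** If the mean were 0, so would be that of min(1, n f), which converges to 1. *)
Lemma E_gt0 (f : R -> R) c : measurable_fun setT f -> (forall x, 0 < f x <= c) -> 0 < E f.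
Proof.
move=> mf f0; have I : Int f by apply: (Int_bnd (a := 0) (b := c)) => // x; case/andP: (f0 x) => /ltW -> ->.
rewrite lt_def E_ge0 ?andbT; last by move=> x; case/andP: (f0 x) => /ltW.
apply/negP => /eqP Ef0.
pose g n x := Num.min 1 (n%:R * f x).
have mg n : measurable_fun setT (g n) by apply: measurable_minr => //; exact: measurable_funM.
have g1 n x : 0 <= g n x <= 1.
  by rewrite /g le_min ler01 mulr_ge0//= ?ge_min ?lexx//; case/andP: (f0 x) => /ltW.
have Eg n : E (g n) = 0.
  apply/eqP; rewrite eq_le E_ge0 ?andbT; last by move=> x; case/andP: (g1 n x).
  rewrite -(mulr0 n%:R) -Ef0 -(EZ _ I); apply: E_le; [exact: Int_01|exact: IntZ|move=> x].
  by rewrite /g ge_min lexx orbT.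
have : E (g n) @[n --> \oo] --> E (cst (1 : R)).
  apply: (E_dct (g := cst 1)) => // [x|n x|]; last exact: Int_cst.
    apply: cvg_near_cst; have /andP[fx _] := f0 x.
    have fi : 0 < (f x)^-1 by rewrite invr_gt0.
    exists (Num.trunc (f x)^-1).+1 => // n /= hn; have /andP[_ h] := truncn_itv (ltW fi).
    by rewrite /g min_l// -ler_pdivrMr// div1r; apply: (le_trans (ltW h)); rewrite ler_nat.
  by case/andP: (g1 n x) => h0 h1; rewrite ger0_norm.
under eq_fun do rewrite Eg; rewrite E_cst => h.
have e1 : (1 : R) = 0 by apply: (cvg_unique (@norm_hausdorff _ R^o) h); exact: cvg_cst.
by move/eqP: e1; rewrite oner_eq0.
Qed.

Lemma sigm_lt (x y : R) : x < y -> sigm x < sigm y.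
Proof.
move=> xy; have e0 (z : R) : 0 < 1 + expR (- z) by rewrite ltr_wpDl ?expR_gt0.
by rewrite /sigm ltf_pV2 ?posrE// ltrD2l ltr_expR ltrN2.
Qed.

Lemma sigm_far (th h x : R) : 0 < th -> 0 < h -> x <= - h -> sigm ((th * h)^-1 * x) <= th.
Proof.
move=> t0 h0 xh; have th0 : 0 < th * h by rewrite mulr_gt0.
have x1 : (th * h)^-1 * x <= - th^-1.
  by rewrite mulrC ler_pdivrMr// mulNr mulKf// gt_eqF.
have ti : 0 < th^-1 by rewrite invr_gt0.
have x0 : (th * h)^-1 * x <= 0 by apply: (le_trans x1); rewrite oppr_le0 ltW.
apply: (le_trans (sigm_le0 x0)); rewrite -[leRHS]invrK lef_pV2 ?posrE//; first by lra.
by rewrite ltr_wpDr// oppr_ge0.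
Qed.

(* A smooth partition of unity into cells of small diameter, so that the masses of the cells are expectations of test functions. *)
Lemma soft_cells (I : finType) (Z : I -> R -> R) (eps eta : R) : (forall i, L4 (Z i)) -> 0 < eps -> 0 < eta ->
  exists C : finType, exists p : C -> (I -> R) -> R, exists a : C -> I -> R, exists ext : pred C,
  exists2 th : R, 0 <= th /\ #|C|%:R * th <= eta & exists2 B : set R, measurable B /\ (lam B <= eta%:E)%E &
  [/\ forall c, tst (p c), forall c x, 0 < p c x, forall x, \sum_c p c x = 1,
    forall c x, ~~ ext c -> (exists i, eps < `|x i - a c i|) -> p c x <= th &
    forall c z, ~ B z -> ext c \/ (exists i, eps < `|Z i z - a c i|) -> p c (Z ^~ z) <= th].
Proof.
move=> LZ e0 n0.
have IZ : Int (fun z => \sum_i Z i z * Z i z) by apply: Int_sum => i; exact: L4_Int_mul.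
set M := E (fun z => \sum_i Z i z * Z i z).
have M0 : 0 <= M by apply: E_ge0 => z; apply: sumr_ge0 => i _; rewrite -expr2 sqr_ge0.
pose K : R := 1 + M / eta.
have K1 : 1 <= K by rewrite lerDl divr_ge0// ltW.
have K0 : 0 < K by apply: lt_le_trans K1.
have KM : K ^- 2 * M <= eta.
  rewrite mulrC ler_pdivrMr ?exprn_gt0//; apply: (@le_trans _ _ (eta * K)).
    by rewrite /K mulrDr mulr1 mulrCA mulfV ?gt_eqF// mulr1 lerDr ltW.
  by rewrite ler_pM2l// expr2 ler_peMr// ltW.
have k0 : 0 < K ^- 2 by rewrite invr_gt0 exprn_gt0.
have F0 z : 0 <= K ^- 2 * \sum_i Z i z * Z i z.
  by rewrite mulr_ge0 ?(ltW k0)//; apply: sumr_ge0 => i _; rewrite -expr2 sqr_ge0.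
have [mB lB] := markov_E (IntZ (K ^- 2) IZ) F0; rewrite (EZ _ IZ) in lB.
pose B := [set z | 1 <= K ^- 2 * \sum_i Z i z * Z i z].
have hB z : ~ B z -> forall i, `|Z i z| <= K.
  move=> /= /negP; rewrite -ltNge mulrC ltr_pdivrMr ?exprn_gt0// mul1r => h i.
  apply: sqr_lt_norm => //; apply: le_lt_trans h; rewrite (bigD1 i)//= lerDl.
  by apply: sumr_ge0 => l _; rewrite -expr2 sqr_ge0.
pose h := eps / 2; have h0 : 0 < h by rewrite divr_gt0.
(* Enough grid points of step h to cover [-K, K] with a margin h at both ends. *)
have [J hJ] : exists J : nat, 2 * (K + h) <= J%:R * h.
  exists (Num.trunc (2 * (K + h) / h)).+1; have /andP[_ /ltW] := @truncn_itv R (2 * (K + h) / h) (divr_ge0 (mulr_ge0 (ler0n _ 2) (addr_ge0 (ltW K0) (ltW h0))) (ltW h0)).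
  by rewrite ler_pdivrMr.
pose C : finType := {ffun I -> 'I_J.+2}.
have C0 : 0 < #|C|%:R :> R.
  by rewrite ltr0n; apply/card_gt0P; exists [ffun=> ord0].
pose th := eta / #|C|%:R; have t0 : 0 < th by rewrite divr_gt0.
pose b (j : nat) := - (K + h) + j%:R * h.
pose s (j : nat) (x : R) := sigm ((th * h)^-1 * (x - b j)).
(* Decreasing in j from 1 to 0, each a smoothed indicator of a ray; the differences [q] are
   positive, sum to 1 and concentrate on an interval of the grid. *)
pose S (j : nat) (x : R) := if j is j'.+1 then (if (j' <= J)%N then s j' x else 0) else 1.
pose q (j : nat) (x : R) := S j x - S j.+1 x.
have s01 j x : 0 < s j x < 1 by exact: sigm01.
have thh : 0 < (th * h)^-1 by rewrite invr_gt0 mulr_gt0.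
have q0 j x : (j < J.+2)%N -> 0 < q j x.
  rewrite /q /S; case: j => [_|j]; first by rewrite leq0n subr_gt0; case/andP: (s01 0%N x).
  rewrite !ltnS => jJ; rewrite jJ; case: (ltnP j J) => jJ'; last by rewrite subr0; case/andP: (s01 j x).
  rewrite subr_gt0; apply: sigm_lt; rewrite ltr_pM2l// ltrD2l ltrN2 ltrD2l ltr_pM2r// ltr_nat//.
have S01 j x : 0 <= S j x <= 1.
  rewrite /S; case: j => [|j]; first by rewrite ler01 lexx.
  by case: ifP => _; [case/andP: (s01 j x) => /ltW -> /ltW ->|rewrite lexx ler01].
have q1 j x : q j x <= 1.
  by rewrite /q; have /andP[_ h1] := S01 j x; have /andP[h2 _] := S01 j.+1 x; lra.
have sum_q x : \sum_(j < J.+2) q j x = 1.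
  rewrite /q -(big_mkord xpredT (fun j => S j x - S j.+1 x)).
  under eq_bigr do rewrite -opprB.
  by rewrite sumrN telescope_sumr// /S ltnn opprB subr0.
have s_lo j x : b j + h <= x -> 1 - s j x <= th.
  move=> hx; rewrite /s -sigm_opp -mulrN; apply: sigm_far => //; lra.
have s_hi j x : x <= b j - h -> s j x <= th.
  move=> hx; apply: sigm_far => //; lra.
have q_far j x : (0 < j <= J)%N -> eps < `|x - b j| -> q j x <= th.
  case: j => // j; rewrite !ltnS => /= jJ hx; rewrite /q /S (ltnW jJ) jJ.
  have /andP[a1 _] := s01 j.+1 x; have /andP[_ a2] := s01 j x.
  have bj : b j.+1 = b j + h by rewrite /b -natr1; ring.
  have eh : eps = h + h by rewrite /h; field.
  have [hx'|hx'] := leP (b j.+1) x.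
    rewrite ger0_norm ?subr_ge0// in hx.
    have : 1 - s j.+1 x <= th by apply: s_lo; lra.
    lra.
  rewrite ltr0_norm ?subr_lt0// in hx.
  have : s j x <= th by apply: s_hi; lra.
  lra.
(* The two extreme cells are unbounded, so their centres mean nothing; what is used instead is that
   they are nearly empty for |x| <= K. *)
have q_ext j x : (j == 0)%N || (j == J.+1) -> `|x| <= K -> q j x <= th.
  rewrite ler_norml => /orP[/eqP->|/eqP->] /andP[x1 x2]; rewrite /q /S.
    rewrite leq0n; apply: s_lo; rewrite /b mul0r; lra.
  rewrite leqnn ltnn subr0; apply: s_hi; rewrite /b; lra.
pose p (c : C) (x : I -> R) := \prod_i q (c i) (x i).
have p_le c x i : p c x <= q (c i) (x i).
  rewrite /p (bigD1 i)//= ler_piMr; [by []|exact: (ltW (q0 _ _ (ltn_ord _)))|].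
  suff /andP[] : 0 <= \prod_(l | l != i) q (c l) (x l) <= 1 by [].
  elim/big_rec: _ => [|l y _ /andP[y0 y1]]; first by rewrite ler01 lexx.
  have ql := ltW (q0 _ (x l) (ltn_ord (c l))).
  by rewrite mulr_ge0//= mulr_ile1.
exists C, p, (fun (c : C) i => b (c i)), (fun c : C => [exists i, (c i == 0 :> nat)%N || (c i == J.+1 :> nat)]).
exists th; first by rewrite (ltW t0) /th mulrC divfK ?gt_eqF.
exists B; first by split => //; apply: (le_trans lB); rewrite lee_fin.
have far (c : C) x i : ~~ ((c i == 0 :> nat)%N || (c i == J.+1 :> nat)) -> eps < `|x i - b (c i)| -> p c x <= th.
  rewrite negb_or => /andP[c0 cJ] hx; apply: (le_trans (p_le c x i)); apply: q_far => //.
  by rewrite lt0n c0 /= -ltnS ltn_neqAle cJ -ltnS ltn_ord.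
split.
- move=> c; apply: tst_prod => i.
  have tS j : tst (fun x : I -> R => S j (x i)).
    rewrite /S; case: j => [|j]; first exact: tst_cst.
    case: (j <= J)%N; last exact: tst_cst.
    have := @tst_sigm R I i (th * h)^-1 (- ((th * h)^-1 * b j)).
    by rewrite (_ : (fun x : I -> R => _) = (fun x => s j (x i)))//; apply/funext => x; rewrite /s mulrBr.
  have := tst_lin (-1) (tS (c i)) (tS (c i).+1).
  by rewrite (_ : (fun x : I -> R => _) = (fun x => q (c i) (x i)))//; apply/funext => x; rewrite /q mulN1r.
- by move=> c x; apply: prodr_gt0 => i _; exact: q0.
- move=> x; rewrite /p -(bigA_distr_bigA (fun i (j : 'I_J.+2) => q j (x i))).
  by apply: big1 => i _; exact: sum_q.
- move=> c x /existsPn hc [i hi]; exact: (far c x i).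
- move=> c z /hB hz hc; have [/existsP[i hi]|/existsPn hn] := boolP [exists i, (c i == 0 :> nat)%N || (c i == J.+1 :> nat)].
    by apply: (le_trans (p_le c _ i)); exact: q_ext.
  by case: hc => [/existsP[i hi]|[i hi]]; [have := hn i; rewrite hi|exact: (far c _ i)].
Qed.

(* [Z] is drawn from its law reweighted by a mixture over the cells: this density is close to 1 since the masses of the cells converge. *)
Lemma couple (I : finType) (X : nat -> I -> R -> R) (Z : I -> R -> R) (eps eta : R) :
  (forall N i, measurable_fun setT (X N i)) -> (forall i, L4 (Z i)) ->
  (forall f, tst f -> E (fun w => f (X N ^~ w)) @[N --> \oo] --> E (fun w => f (Z ^~ w))) ->
  0 < eps -> 0 < eta -> \forall N \near \oo, exists2 psi : R -> R, mpres psi & exists Bad : set R,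
   [/\ measurable Bad, (lam Bad <= eta%:E)%E & forall w, ~ Bad w -> forall i, `|X N i (th0 w) - Z i (psi w)| <= eps].
Proof.
move=> mX LZ cX eps0 eta0.
have m1 := @measurable_fst _ _ mR mR; have m2 := @measurable_snd _ _ mR mR.
pose e4 := Num.min (eta / 4) (1 / 2); have e40 : 0 < e4 by rewrite lt_min !divr_gt0.
have e4h : e4 <= 1 / 2 by rewrite ge_min lexx orbT.
have e4e : e4 <= eta / 4 by rewrite ge_min lexx.
move: e4 e40 e4h e4e => e4 e40 e4h e4e.
have eps2 : 0 < eps / 2 by rewrite divr_gt0.
have [C [p [ctr [ext [th [th0' t1] [B [mB lB] [tp p0 p1 pX pZ]]]]]]] := soft_cells LZ eps2 e40.
(* The part of the mass to be coupled cell by cell; a value below 1 leaves room for the error on the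
   masses of the cells. *)
pose t := 1 - e4; have t01 : 0 < t <= 1 by rewrite /t; lra.
have [tp0 tp1] := andP t01.
pose be c z := p c (Z ^~ z).
have ple c x : p c x <= 1.
  by rewrite -(p1 x) (bigD1 c)//= lerDl; apply: sumr_ge0 => d _; rewrite ltW.
have mbe c : measurable_fun setT (be c) by apply: (tp c).2 => i; exact: (LZ i).1.
have be01 c z : 0 <= be c z <= 1 by rewrite ltW ?p0//=; exact: ple.
have Ibe c : Int (be c) by exact: Int_01.
pose q c := E (be c).
have q0 c : 0 < q c by apply: (@E_gt0 _ 1) => // z; rewrite p0; exact: ple.
near=> N.
pose al c x := p c (X N ^~ x).
have mal c : measurable_fun setT (al c) by apply: (tp c).2 => i; exact: mX.
have al01 c z : 0 <= al c z <= 1 by rewrite ltW ?p0//=; exact: ple.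
have Ial c : Int (al c) by exact: Int_01.
pose a c := E (al c).
(* Each limit mass [q c] is positive, so t q c < q c, and finitely many cells allow a common N. *)
have ta c : t * a c <= q c.
  have : forall c, t * E (fun w => p c (X N ^~ w)) < q c.
    near: N; apply: filter_forall => d.
    have h : t * E (fun w => p d (X N ^~ w)) @[N --> \oo] --> t * q d by apply: cvgMr; exact: cX.
    have hq : t * q d < q d by rewrite gtr_pMl// /t; lra.
    exact: (cvgr_lt _ h _ hq).
  by move=> /(_ c)/ltW.
pose r c := t / q c; have r0 c : 0 <= r c by rewrite divr_ge0 ?(ltW tp0) ?(ltW (q0 c)).
have ra c : r c * a c <= 1 by rewrite mulrAC ler_pdivrMr// mul1r.
have rq c : r c * q c = t by rewrite divfK// gt_eqF.
clearbody r.
have a0 c : 0 <= a c by apply: E_ge0 => z; case/andP: (al01 c z).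
have be_1 z : \sum_c be c z = 1 by exact: p1.
have al_1 x : \sum_c al c x = 1 by exact: p1.
have sa : \sum_c a c = 1.
  by rewrite -(E_sum _ Ial) -[RHS](E_cst (1 : R)); congr E; apply/funext => x; exact: al_1.
(* The sum pairs x and z in the same cell; the bracket adds the missing mass as a function of z
   alone. It is nonnegative by [ra], and both marginals become uniform. *)
pose k x z := \sum_c (r c * al c x) * be c z + (1 - \sum_c (r c * a c) * be c z).
have sle z : \sum_c (r c * a c) * be c z <= 1.
  rewrite -(be_1 z); apply: ler_sum => c _; rewrite ler_piMl//; by case/andP: (be01 c z).
have mk : measurable_fun setT (fun z : mR * mR => k z.1 z.2).
  have mb c : measurable_fun setT (fun z : mR * mR => be c z.2) := measurableT_comp (mbe c) m2.
  have ma c : measurable_fun setT (fun z : mR * mR => al c z.1) := measurableT_comp (mal c) m1.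
  apply: measurable_funD.
    apply: measurable_sum => c; apply: measurable_funM; last exact: mb.
    by apply: measurable_funM; [exact: measurable_cst|exact: ma].
  apply: measurable_funB; first exact: measurable_cst.
  by apply: measurable_sum => c; apply: measurable_funM; [exact: measurable_cst|exact: mb].
have k0 x z : 0 <= k x z.
  rewrite addr_ge0 ?subr_ge0//; apply: sumr_ge0 => c _.
  have /andP[h1 _] := al01 c x; have /andP[h2 _] := be01 c z.
  exact: (mulr_ge0 (mulr_ge0 (r0 c) h1) h2).
have Isb (c_ : C -> R) : Int (fun z => \sum_c c_ c * be c z) by apply: Int_sum => c; exact: IntZ.
have Esb (c_ : C -> R) : E (fun z => \sum_c c_ c * be c z) = \sum_c c_ c * q c.
  by rewrite E_sum; [apply: eq_bigr => c _; rewrite EZ|move=> c; exact: IntZ].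
have k1 x : (\int[lam]_y (k x y)%:E = 1)%E.
  have J := IntD (Isb (fun c => r c * al c x)) (IntB (Int_cst 1) (Isb (fun c => r c * a c))).
  rewrite (E_EFin J) (ED (Isb _) (IntB (Int_cst 1) (Isb _))) (EB (Int_cst 1) (Isb _)) !Esb E_fcst.
  under eq_bigr do rewrite mulrAC rq; under [X in _ - X]eq_bigr do rewrite mulrAC rq.
  by rewrite -!mulr_sumr al_1 sa; congr (_%:E); ring.
have k2 y : (\int[lam]_x (k x y)%:E = 1)%E.
  have Is : Int (fun x => \sum_c (r c * al c x) * be c y).
    by apply: Int_sum => c; under eq_fun do rewrite mulrAC; exact: IntZ.
  have J := IntD Is (Int_cst (1 - \sum_c (r c * a c) * be c y)).
  rewrite (E_EFin J) (ED Is (Int_cst _)) E_fcst E_sum; last by move=> c; under eq_fun do rewrite mulrAC; exact: IntZ.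
  rewrite (eq_bigr (fun c => (r c * a c) * be c y)); first by rewrite addrCA subrr addr0.
  move=> c _; rewrite mulrAC -(EZ _ (Ial c)); congr E; apply/funext => x; exact: mulrAC.
have [psi mpsi hpsi] := kernel_coupling mk k0 k1 k2; exists psi => //.
pose D : set (mR * mR) := \bigcup_i [set z | eps < `|X N i z.1 - Z i z.2|].
have mD : measurable D.
  apply: fin_bigcup_measurable => [|i _]; first exact: finite_finset.
  have mf : measurable_fun setT (fun z : mR * mR => `|X N i z.1 - Z i z.2|).
    apply: (measurableT_comp (@normr_measurable R setT)); apply: measurable_funB.
      exact: (measurableT_comp (mX N i) m1).
    exact: (measurableT_comp (LZ i).1 m2).
  rewrite (_ : [set z | _] = (fun z : mR * mR => `|X N i z.1 - Z i z.2|) @^-1` `]eps, +oo[).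
    exact: (preimage_measurable mf).
  by apply/seteqP; split => z /=; rewrite in_itv/= andbT.
pose Bad : set R := [set w | D (th0 w, psi w)].
have mt : measurable_fun setT (fun w : mR => (th0 w, psi w)).
  by apply/measurable_fun_pairP; split; [exact: mth0|exact: mpsi.1].
have mBad : measurable Bad := preimage_measurable mt mD.
exists Bad; split => //; last first.
  by move=> w hw i; rewrite leNgt; apply/negP => h; apply: hw; exists i.
pose F (z : mR * mR) : \bar R := (\1_D z)%:E.
have mF : measurable_fun setT F by apply/measurable_EFinP; exact: measurable_indic.
have F0 z : (0 <= F z)%E by rewrite lee_fin.
have -> : lam Bad = (\int[lam]_w F (th0 w, psi w))%E by rewrite (integral_indic lam measurableT mBad) setIT.
rewrite (hpsi F mF F0).
pose g c z := \1_B z * be c z : R.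
have mg c : measurable_fun setT (g c) by apply: measurable_funM => //; exact: measurable_indic.
have B01 z : 0 <= (\1_B z : R) <= 1 by rewrite indicE; case: (z \in B); rewrite /= ?lexx ?ler01.
have g01 c z : 0 <= g c z <= 1.
  have /andP[h1 h2] := B01 z; have /andP[h3 h4] := be01 c z.
  by rewrite /g mulr_ge0//= mulr_ile1.
have Ig c : Int (g c) by exact: Int_01.
(* Dominates the density on [D]. In a common cell a distance above [eps] forces z far from the
   centre, z in the exceptional set, or x far: one term for each, and the rest is the uncoupled
   mass. The total is at most 4 e4. *)
pose G w := \sum_c (r c * th * al c (th0 w) + (r c * (al c (th0 w) * g c (th1 w)) + (r c * th - r c * a c) * be c (th1 w))) + 1.
have Ia c : Int (fun w => al c (th0 w)) := mpres_Int (@mpres_th0 R) (Ial c).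
have Ib c : Int (fun w => be c (th1 w)) := mpres_Int (@mpres_th1 R) (Ibe c).
have Iag c : Int (fun w => al c (th0 w) * g c (th1 w)) := (E_prod (Ial c) (Ig c)).1.
have I3 c := IntD (IntZ (r c) (Iag c)) (IntZ (r c * th - r c * a c) (Ib c)).
have I4 c := IntD (IntZ (r c * th) (Ia c)) (I3 c).
have IG : Int G by apply: IntD; [exact: Int_sum|exact: Int_cst].
have G0 w : (F (th0 w, th1 w) * (k (th0 w) (th1 w))%:E <= (G w)%:E)%E.
  rewrite /F -EFinM lee_fin; set x := th0 w; set z := th1 w.
  have GE : G w = \sum_c (r c * th * al c x + (r c * (al c x * g c z) + r c * th * be c z)) + (1 - \sum_c (r c * a c) * be c z).
    rewrite /G addrCA -sumrB addrC; congr (_ + _); apply: eq_bigr => c _; rewrite -/x -/z; ring.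
  have terms c : 0 <= r c * th * al c x /\ 0 <= r c * (al c x * g c z) /\ 0 <= r c * th * be c z.
    have /andP[h1 _] := al01 c x; have /andP[h2 _] := be01 c z; have /andP[h3 _] := g01 c z.
    have rt := mulr_ge0 (r0 c) th0'.
    by split; [exact: mulr_ge0|split; [exact: (mulr_ge0 (r0 c) (mulr_ge0 h1 h3))|exact: mulr_ge0]].
  rewrite GE indicE; case: (boolP ((x, z) \in D)) => hD; last first.
    rewrite mul0r addr_ge0 ?subr_ge0//; apply: sumr_ge0 => c _.
    by have [h1 [h2 h3]] := terms c; rewrite !addr_ge0.
  rewrite mul1r /k lerD2r; apply: ler_sum => c _.
  have [h1 [h2 h3]] := terms c; have /andP[h4 _] := al01 c x; have /andP[h5 _] := be01 c z.
  have [i _ hi] : D (x, z) by rewrite inE in hD.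
  have key : (ext c \/ exists i, eps / 2 < `|Z i z - ctr c i|) \/ (~~ ext c /\ exists i, eps / 2 < `|X N i x - ctr c i|).
    have [ec|ec] := boolP (ext c); first by left; left.
    have [hz|hz] := ltP (eps / 2) `|Z i z - ctr c i|; first by left; right; exists i.
    right; split => //; exists i; rewrite ltNge; apply/negP => hx.
    have : `|X N i x - Z i z| <= eps.
      rewrite (_ : _ - _ = (X N i x - ctr c i) - (Z i z - ctr c i)); last by ring.
      by apply: (le_trans (ler_normB _ _)); rewrite (_ : eps = eps / 2 + eps / 2); [exact: lerD|field].
    by rewrite leNgt hi.
  case: key => [hz|[ec hx]].
    have [zB|zB] := boolP (z \in B).
      rewrite -mulrA (_ : al c x * be c z = al c x * g c z); first by rewrite addrCA lerDl addr_ge0.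
      by rewrite /g indicE zB mul1r.
    have bt : be c z <= th by apply: pZ => //; rewrite notin_setE in zB.
    apply: (@le_trans _ _ (r c * th * al c x)); last by rewrite lerDl addr_ge0.
    by rewrite -!mulrA ler_wpM2l// mulrC ler_wpM2r.
  have at' : al c x <= th by exact: pX.
  apply: (@le_trans _ _ (r c * th * be c z)); last by rewrite addrA lerDr addr_ge0.
  by rewrite -!mulrA ler_wpM2l// ler_wpM2r.
have mk' : measurable_fun setT (fun w : mR => (F (th0 w, th1 w) * (k (th0 w) (th1 w))%:E)%E).
  have mtt : measurable_fun setT (fun w : mR => (th0 w, th1 w)) by apply/measurable_fun_pairP; split; [exact: mth0|exact: mth1].
  apply: emeasurable_funM; first exact: (measurableT_comp mF mtt).
  by apply/measurable_EFinP; exact: (measurableT_comp mk mtt).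
apply: (@le_trans _ _ (\int[lam]_w (G w)%:E)%E).
  apply: ge0_le_integral => //.
  - by move=> w _; rewrite mule_ge0// lee_fin.
  - by apply/measurable_EFinP; exact: Int_measurable.
rewrite (E_EFin IG) lee_fin (ED (Int_sum _ I4) (Int_cst 1)) E_fcst (E_sum _ I4).
apply: (@le_trans _ _ (\sum_c (th + (E (g c) + (th - t * a c))) + 1)).
  rewrite lerD2r; apply: ler_sum => c _.
  rewrite (ED (IntZ _ (Ia c)) (I3 c)) (ED (IntZ _ (Iag c)) (IntZ _ (Ib c))) (EZ _ (Ia c)) (EZ _ (Iag c)) (EZ _ (Ib c)).
  rewrite (E_prod (Ial c) (Ig c)).2.
  have -> : E (fun w => al c (th0 w)) = a c := mpres_E (@mpres_th0 R) (Ial c).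
  have -> : E (fun w => be c (th1 w)) = q c := mpres_E (@mpres_th1 R) (Ibe c).
  rewrite -/(a c); apply: lerD; first by rewrite mulrAC ler_piMl.
  apply: lerD; first by rewrite mulrA ler_piMl// E_ge0// => z; case/andP: (g01 c z).
  have -> : (r c * th - r c * a c) * q c = r c * q c * th - r c * q c * a c by ring.
  by rewrite rq lerD2r ler_piMl.
rewrite !big_split /= sumr_const sumrN -mulr_sumr sa -(E_sum _ Ig).
have -> : E (fun z => \sum_c g c z) = E (fun z => (z \in B)%:R).
  by congr E; apply/funext => z; rewrite -mulr_sumr be_1 mulr1 indicE.
have lB' : E (fun z => (z \in B)%:R) <= e4 by rewrite -lee_fin -lamE.
rewrite -[th *+ _]mulr_natl /t; lra.
Unshelve. all: by end_near.
Qed.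

End Coupling.

(** * Suprema over rational points, and diagonal extraction *)

Section SupNorm.
Context {R : realType}.
Local Notation mR := (measurableTypeR R).
Local Notation lam := (@lam R).
Local Notation th0 := (@th0 R).
Local Notation th1 := (@th1 R).

(** The regularity of empirical distribution functions. It reduces suprema over [0, 1] to rational
    points, the endpoint 1 being itself rational. *)
Definition rcont (g : R -> R) := forall v, 0 <= v -> g x @[x --> v^'+] --> g v.

Lemma rcont_continuous (g : R -> R) : continuous g -> rcont g.
Proof. by move=> cg v _; apply: cvg_at_right_filter; exact: cg. Qed.

Lemma rcont_step (r : R) : rcont (fun x => (r <= x)%R%:R).
Proof.
move=> v _; apply: cvg_near_cst; case: (leP r v) => rv.
  by near=> x; rewrite (le_trans rv)//; near: x; exact: nbhs_right_ge.
near=> x; rewrite leNgt (_ : x < r)//; near: x; exact: nbhs_right_lt.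
Unshelve. all: by end_near.
Qed.

Lemma right_interval (P : R -> Prop) (v : R) : (\forall x \near v^'+, P x) ->
  exists2 d, 0 < d & forall x, v < x < v + d -> P x.
Proof.
case=> d d0 h; exists d => // x /andP[vx xd]; apply: h => //=.
by rewrite ltr0_norm ?subr_lt0// opprB ltrBlDl.
Qed.

Lemma rcont_rat (g : R -> R) (e : R) : rcont g -> (exists2 v, 0 <= v <= 1 & e < `|g v|) ->
  exists2 q : rat, 0 <= (ratr q : R) <= 1 & e < `|g (ratr q)|.
Proof.
move=> rg [v /andP[v0 v1] gv]; move: v1; rewrite le_eqVlt => /predU1P[v1|v1].
  by exists 1%Q; rewrite rmorph1 ?ler01 ?lexx// -v1.
have h : `|g x| @[x --> v^'+] --> `|g v| by apply: cvg_norm; exact: rg.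
have n1 : \forall x \near v^'+, e < `|g x| /\ x < 1.
  by near=> x; split; near: x; [exact: (cvgr_gt _ h _ gv)|exact: nbhs_right_lt].
have [d d0 hd] := right_interval n1.
have vd : v < v + d by rewrite ltrDl.
have [q] := rat_in_itvoo vd; rewrite in_itv/= => hq; have [h1 h2] := hd _ hq; exists q => //.
by rewrite (ltW h2) andbT (le_trans v0)// ltW//; case/andP: hq.
Unshelve. all: by end_near.
Qed.

Lemma sup01_ext (f g : R -> R) : (forall v, 0 <= v <= 1 -> f v = g v) -> sup01 f = sup01 g.
Proof.
move=> h; congr ereal_sup; apply/seteqP; split => _ [v + <-]; rewrite /= in_itv/= => v01;
  by exists v; rewrite /= ?in_itv//= h.
Qed.

Lemma sup01_gt (f : R -> R) (e : R) : rcont f -> (e%:E < sup01 f)%E <->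
  exists2 q : rat, 0 <= (ratr q : R) <= 1 & e < `|f (ratr q)|.
Proof.
move=> rf; split=> [/ereal_sup_gt[_ [v + <-]]|[q q01 hq]].
  by rewrite /= in_itv/= lte_fin => v01 h; apply: rcont_rat => //; exists v.
apply: (@lt_le_trans _ _ `|f (ratr q)|%:E); first by rewrite lte_fin.
by apply: ereal_sup_ubound; exists (ratr q) => //=; rewrite in_itv.
Qed.

Lemma sup01_ge0 (f : R -> R) : (0 <= sup01 f)%E.
Proof.
apply: (@le_trans _ _ `|f 0|%:E); first by rewrite lee_fin.
by apply: ereal_sup_ubound; exists 0 => //=; rewrite in_itv/= lexx ler01.
Qed.

Lemma measurable_rat_gt d (T : measurableType d) (f : R -> T -> R) (P : rat -> bool) (e : R) :
  (forall v, measurable_fun setT (f v)) -> measurable [set t | exists2 q : rat, P q & e < `|f (ratr q) t|].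
Proof.
move=> mf; rewrite (_ : [set t | _] = \bigcup_(q : rat) (if P q then [set t | e < `|f (ratr q) t|] else set0)).
  apply: bigcupT_measurable_rat => q; case: (P q) => //.
  have mn : measurable_fun setT (fun t => `|f (ratr q) t|) := measurableT_comp (@normr_measurable R setT) (mf _).
  rewrite (_ : [set t | _] = (fun t => `|f (ratr q) t|) @^-1` `]e, +oo[); first exact: (preimage_measurable mn).
  by apply/seteqP; split => t /=; rewrite in_itv/= andbT.
by apply/seteqP; split => t /=; [case=> q Pq h; exists q => //; rewrite Pq|case=> q _; case: ifP => // Pq h; exists q].
Qed.

Lemma measurable_sup01 d (T : measurableType d) (f : R -> T -> R) : (forall v, measurable_fun setT (f v)) ->
  (forall t, rcont (f ^~ t)) -> measurable_fun setT (fun t => sup01 (f ^~ t)).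
Proof.
move=> mf rf; apply: (measurability _ (ErealGenOInfty.measurableE R)) => //.
move=> /= _ [_ [x ->] <-]; rewrite setTI.
rewrite (_ : _ @^-1` _ = [set t | exists2 q : rat, 0 <= (ratr q : R) <= 1 & x < `|f (ratr q) t|]).
  exact: measurable_rat_gt.
apply/seteqP; split => t /=; first by rewrite in_itv/= andbT => h; exact/(sup01_gt _ (rf t)).
by move=> h; rewrite in_itv/= andbT; apply/(sup01_gt _ (rf t)).
Qed.

(* Restricted to rational points in order to define a measurable event. *)
Definition rosc (d e : R) (y : R -> R) := exists z : rat * rat,
  [/\ 0 <= (ratr z.1 : R) <= 1, 0 <= (ratr z.2 : R) <= 1, `|(ratr z.1 : R) - ratr z.2| <= d & e < `|y (ratr z.1) - y (ratr z.2)|].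

Lemma measurable_rosc d e dd (T : measurableType dd) (f : R -> T -> R) : (forall v, measurable_fun setT (f v)) ->
  measurable [set t | rosc d e (f ^~ t)].
Proof.
move=> mf; pose P (q r : rat) := [&& 0 <= (ratr q : R) <= 1, 0 <= (ratr r : R) <= 1 & `|ratr q - ratr r| <= d].
rewrite (_ : [set t | _] = \bigcup_(r : rat) [set t | exists2 q : rat, P q r & e < `|f (ratr q) t - f (ratr r) t|]).
  apply: bigcupT_measurable_rat => r.
  by apply: (@measurable_rat_gt _ T (fun v t => f v t - f (ratr r) t)) => v; exact: measurable_funB.
apply/seteqP; split => t /=.
  by move=> [[q r] /= [h1 h2 h3 h4]]; exists r => //; exists q => //; exact/and3P.
by move=> [r _ [q /and3P[h1 h2 h3] h4]]; exists (q, r).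
Qed.

Lemma cvge0_le (u : nat -> \bar R) : (forall n, 0 <= u n)%E ->
  (forall e, 0 < e -> \forall n \near \oo, (u n <= e%:E)%E) -> u @ \oo --> 0%E.
Proof.
move=> u0 h; apply/fine_cvgP; have fu e n : (u n <= e%:E)%E -> u n \is a fin_num.
  by move=> ue; rewrite ge0_fin_numE// (le_lt_trans ue)// ltry.
split; first by near=> n; apply: (fu 1); near: n; exact: h.
apply/cvgrPdist_le => e e0; near=> n.
have ue : (u n <= e%:E)%E by near: n; exact: h.
by rewrite sub0r normrN /= ger0_norm ?fine_ge0// -lee_fin fineK// (fu e).
Unshelve. all: by end_near.
Qed.

(** At each N, among the levels below N that can be attained, the highest is realised; any fixed
    level is eventually attainable. *)
Lemma diagonal (T : Type) (P : nat -> nat -> T -> Prop) (t0 : T) :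
  (forall k, \forall N \near \oo, exists t, P N k t) ->
  exists f : nat -> T, forall k, \forall N \near \oo, exists2 k', (k <= k')%N & P N k' (f N).
Proof.
move=> h; have key N n : exists t, forall k, (k < n)%N -> (exists t', P N k t') -> exists2 k', (k <= k')%N & P N k' t.
  elim: n => [|n [t IH]]; first by exists t0.
  have [[t' ht']|no] := pselect (exists t', P N n t').
    by exists t' => k; rewrite ltnS => kn _; exists n.
  by exists t => k; rewrite ltnS leq_eqVlt => /predU1P[->//|kn]; exact: IH.
exists (fun N => sval (cid (key N N))) => k; near=> N.
apply: (svalP (cid (key N N))); first by near: N; exists k.+1.
by near: N; exact: h.
Unshelve. all: by end_near.
Qed.

Lemma lam_setU_le (A B : set R) (a b : R) : measurable A -> measurable B -> (lam A <= a%:E)%E -> (lam B <= b%:E)%E ->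
  (lam (A `|` B) <= (a + b)%:E)%E.
Proof.
move=> mA mB hA hB; apply: (le_trans (measureU2 lam mA mB)).
by rewrite EFinD; exact: leeD.
Qed.

End SupNorm.

(** * The paths of the data and of the limit *)

Section Assembly.
Context {R : realType}.
Local Notation mR := (measurableTypeR R).
Local Notation lam := (@lam R).
Local Notation th0 := (@th0 R).
Local Notation th1 := (@th1 R).

Lemma rcontB (f g : R -> R) : rcont f -> rcont g -> rcont (fun v => f v - g v).
Proof. by move=> rf rg v v0; apply: cvgB; [exact: rf|exact: rg]. Qed.

Lemma rcontZ (c : R) (f : R -> R) : rcont f -> rcont (fun v => c * f v).
Proof. by move=> rf v v0; apply: cvgM; [exact: cvg_cst|exact: rf]. Qed.

Lemma rcont_sum (n : nat) (f : nat -> R -> R) : (forall k, rcont (f k)) -> rcont (fun v => \sum_(k < n) f k v).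
Proof.
move=> rf; elim: n => [|n IH].
  by under eq_fun do rewrite big_ord0; move=> v _; exact: cvg_cst.
by under eq_fun do rewrite big_ord_recr/=; move=> v v0; apply: cvgD; [exact: IH|exact: rf].
Qed.

Lemma rcont_ext (f g : R -> R) : (forall v, 0 <= v -> f v = g v) -> rcont f -> rcont g.
Proof.
move=> h rf v v0; rewrite -(h v v0); apply: cvg_trans (rf v v0); apply: near_eq_cvg; near=> x.
by apply: h; rewrite (le_trans v0)//; near: x; exact: nbhs_right_ge.
Unshelve. all: by end_near.
Qed.

Variable m : nat.
Hypothesis m_gt0 : (0 < m)%N.

Lemma rcont_ratio_process N n1 n2 i j (x y : nat -> R) : rcont (ratio_process m N n1 n2 i j x y).
Proof.
apply: rcontZ; apply: rcontB; first by apply/rcontZ/(@rcont_sum _ (fun k v => (spacing_ratio m n1 n2 i j x y k <= v)%R%:R)) => k; exact: rcont_step.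
apply: (@rcont_ext (Hm m)); first by move=> v v0; rewrite beta_cdfE.
by apply: rcont_continuous; exact: continuous_Hm.
Qed.

Lemma continuous_ZqHm (al x y : R) : continuous (fun v => Zq m al x y (Hm m v)).
Proof. by move=> v; apply: (@continuous_comp _ _ _ (Hm m) (Zq m al x y)); [exact: continuous_Hm|exact: continuous_Zq]. Qed.

Lemma measurable_in (A : set R) : measurable A -> measurable_fun setT (fun s : R => ((s \in A)%:R : R)).
Proof. by move=> mA; rewrite (_ : (fun s => _) = \1_A)//; exact: measurable_indic. Qed.

(** For each seed the path is uniformly continuous, so the indicator of a large oscillation at scale
    1 / (n + 1) vanishes for large n; dominated convergence does the rest. *)
Lemma limit_osc (al eta eps : R) : 0 < eta -> 0 < eps -> exists2 d : R, 0 < d &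
  (lam [set z | rosc d eps (fun v => Zp m al (Hm m v) z)] <= eta%:E)%E.
Proof.
move=> eta0 eps0; pose S n := [set z | rosc (n.+1%:R^-1) eps (fun v => Zp m al (Hm m v) z)].
have mS n : measurable (S n) by apply: measurable_rosc => v; case: (L4_Zp m al (Hm m v)).
have h : E (fun z => (z \in S n)%:R) @[n --> \oo] --> E (fun=> 0 : R).
  apply: (@E_dct _ _ _ (fun=> 1)) => [n|z|n z|]; [exact: measurable_in| | |exact: Int_cst].
    apply: cvg_near_cst; have [d d0 hd] := heine (@continuous_ZqHm al (gz (th0 z)) (th1 z)) eps0.
    near=> n; rewrite (_ : z \in S n = false)//; apply/negbTE; apply/negP; rewrite inE => -[[q r] /= [q01 r01 qr]].
    have qrd : `|(ratr q : R) - ratr r| < d.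
      apply: (le_lt_trans qr); near: n; exact: (near_infty_natSinv_lt (PosNum d0)).
    by apply/negP; rewrite -leNgt ltW//; exact: hd.
  by case: (_ \in _); rewrite /= ?normr0 ?normr1 ?ler01.
rewrite (E_fcst 0) in h.
have [n _ hn] := cvgr_lt _ h _ eta0.
exists n.+1%:R^-1; first by rewrite invr_gt0 ltr0n.
by rewrite (lamE (mS n)) lee_fin ltW//; exact: (hn n (leqnn n)).
Unshelve. all: by end_near.
Qed.

Section Paths.
Variables (N n1 n2 : nat) (i j : nat -> nat).

(** The two samples are read from the halves of a data seed [D], which will be [th0 w] on the final
    space. *)
Definition dpath (D : R) : R -> R := ratio_process m N n1 n2 i j (fun k => sd k (th0 D)) (fun k => sd k (th1 D)).

Lemma measurable_dpath v : measurable_fun setT (fun D => dpath D v).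
Proof.
pose F l1 l2 := (gpath m N n1 n2 i j l1 l2 v)%:E.
have mF : smeas2 F by move=> d T l1 l2 m1 m2; apply/measurable_EFinP; exact: measurable_gpath.
have h := smeas2_measurable mF (@lmeas_dl R n1) (@lmeas_dl R n2).
have mp : measurable_fun setT (fun w : mR => (th0 w, th1 w) : mR * mR).
  by apply/measurable_fun_pairP; split; [exact: mth0|exact: mth1].
have /measurable_EFinP := measurableT_comp h mp.
by congr measurable_fun; apply/funext => w; rewrite /dpath ratio_process_gpath.
Qed.

Lemma dpath_rosc d e : (lam [set D | rosc d e (dpath D)] = lam [set w | rosc d e (tpath m N n1 n2 i j w)])%E.
Proof.
pose Phi (y : R -> R) : \bar R := ((y \in [set y | rosc d e y])%:R)%:E.
have mP : cmeas Phi.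
  move=> d' T x mx; have mA := measurable_rosc d e mx.
  by apply/measurable_EFinP; rewrite (_ : (fun t => _) = \1_[set t | rosc d e (x ^~ t)])//; exact: measurable_indic.
have h := @path_law R m N n1 n2 i j Phi mP (fun y => ltac:(by rewrite lee_fin; case: (_ \in _))).
have m1 := measurable_rosc d e measurable_dpath.
have m2 := measurable_rosc d e (measurable_tpath m N n1 n2 i j).
have e1 := integral_indic lam measurableT m1; have e2 := integral_indic lam measurableT m2.
by rewrite !setIT in e1 e2; rewrite -e1 -e2.
Qed.

Lemma dpath_fidi (I : finType) (v : I -> R) (f : (I -> R) -> R) : tst f ->
  E (fun D => f (fun l => dpath D (v l))) = E (fun w => f (fun l => tpath m N n1 n2 i j w (v l))).
Proof.
move=> tf; have [c hc] := tst_bound tf; have [_ cf] := tf.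
pose Phi (y : R -> R) : \bar R := (f (fun l => y (v l)) + c)%:E.
have fc y : 0 <= f y + c by have := hc y; rewrite ler_norml => /andP[]; lra.
have mP : cmeas Phi.
  move=> d' T x mx; apply/measurable_EFinP; apply: measurable_funD => //.
  exact: (cf _ _ (fun l t => x (v l) t) (fun l => mx _)).
have h := @path_law R m N n1 n2 i j Phi mP (fun y => ltac:(by rewrite lee_fin fc)).
have ID (g : R -> R -> R) : (forall s, measurable_fun setT (fun w => g w s)) -> Int (fun w => f (fun l => g w (v l))).
  move=> mg; apply: (@Int_bounded _ _ c) => [|w]; [exact: (cf _ _ (fun l w => g w (v l)) (fun l => mg _))|exact: hc].
have I1 := ID _ measurable_dpath; have I2 := ID _ (measurable_tpath m N n1 n2 i j).
have key (g : R -> R -> R) : Int (fun w => f (fun l => g w (v l))) ->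
    (\int[lam]_w Phi (g w) = (E (fun w => f (fun l => g w (v l))) + c)%:E)%E.
  by move=> Ig; rewrite /Phi (E_EFin (IntD Ig (Int_cst c))) (ED Ig (Int_cst c)) E_fcst.
by move: h; rewrite (key dpath I1) (key (tpath m N n1 n2 i j) I2) => -[] /addIr.
Qed.

End Paths.
End Assembly.

(** * Uniform coupling of the paths *)

Section PathCoupling.
Context {R : realType}.
Local Notation mR := (measurableTypeR R).
Local Notation lam := (@lam R).
Local Notation th0 := (@th0 R).
Local Notation th1 := (@th1 R).

Lemma grid_near (K : nat) (x : R) : 0 <= x <= 1 -> exists l : 'I_K.+2, `|x - l%:R / K.+1%:R| <= K.+1%:R^-1.
Proof.
move=> /andP[x0 x1]; have K0 : 0 < K.+1%:R :> R by rewrite ltr0n.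
have /andP[h1 h2] : ((Num.truncn (x * K.+1%:R))%:R <= x * K.+1%:R < (Num.truncn (x * K.+1%:R)).+1%:R).
  by apply: truncn_itv; rewrite mulr_ge0// ltW.
have lK : (Num.truncn (x * K.+1%:R) < K.+2)%N.
  by rewrite ltnS -(ler_nat R) (le_trans h1)// ler_piMl// ltW.
exists (Ordinal lK) => /=; rewrite ger0_norm ?subr_ge0 ?ler_pdivrMr//.
by rewrite lerBlDr -[X in X + _]mul1r -mulrDl ler_pdivlMr// nat1r ltW.
Qed.

Variables (m : nat) (n1 n2 : nat -> nat) (i j : nat -> nat -> nat).
Hypothesis m_gt0 : (0 < m)%N.
Hypothesis leN1 : forall N, (1 <= N)%N -> (N <= last_spacing m (n1 N))%N.
Hypothesis leN2 : forall N, (1 <= N)%N -> (N <= last_spacing m (n2 N))%N.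
Hypothesis disj_i : forall N, (1 <= N)%N -> disjoint_spacings m N (n1 N) (i N).
Hypothesis disj_j : forall N, (1 <= N)%N -> disjoint_spacings m N (n2 N) (j N).
Hypothesis cvgP : (last_spacing m (n1 N) - N)%N%:R / N.+1%:R @[N --> \oo] --> (0 : R).
Hypothesis cvgQ : (last_spacing m (n2 N) - N)%N%:R / N.+1%:R @[N --> \oo] --> (0 : R).

Local Notation gm N := (dpath m N (n1 N) (n2 N) (i N) (j N)).

Let pth N w v : R := tpath m N (n1 N) (n2 N) (i N) (j N) w v.
Let L1 N := (n1 N).+1.
Let L2 N := (n2 N).+1.
Let c1 N l := blk m N (n1 N) (i N) l == N.+1.
Let c2 N l := blk m N (n2 N) (j N) l == N.+1.
Let p1 N : R := (last_spacing m (n1 N) - N)%N%:R.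
Let p2 N : R := (last_spacing m (n2 N) - N)%N%:R.

Let ps (a : nat -> nat) : (a N)%:R / N.+1%:R @[N --> \oo] --> (0 : R) ->
  forall e : R, 0 < e -> \forall N \near \oo, 0 <= ((a N)%:R : R) <= e * N.+1%:R.
Proof.
move=> h e e0; near=> N; rewrite ler0n /= -ler_pdivrMr ?ltr0n// ltW//.
by near: N; exact: (cvgr_lt _ h _ e0).
Unshelve. all: by end_near.
Qed.

Let d1p : \forall N \near \oo, `|\sum_(l < L1 N) (c1 N l)%:R - m%:R * p1 N| <= m%:R.
Proof. by exists 1%N => // N /= N1; apply: rest_count => //; [exact: disj_i|exact: leN1]. Qed.

Let d2p : \forall N \near \oo, `|\sum_(l < L2 N) (c2 N l)%:R - m%:R * p2 N| <= m%:R.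
Proof. by exists 1%N => // N /= N1; apply: rest_count => //; [exact: disj_j|exact: leN2]. Qed.

Let pthE N w v : (0 < N)%N -> 0 < tot (bU m) N.+1 (rest (L1 N) (c1 N) (th0 (sd N.+1 w))) w ->
  0 < tot (bV m) N.+1 (rest (L2 N) (c2 N) (th1 (sd N.+1 w))) w -> 0 <= v <= 1 ->
  pth N w v = gp m N.+1 (N.+1%:R + p1 N) (N.+1%:R + p2 N)
    (rest (L1 N) (c1 N) (th0 (sd N.+1 w))) (rest (L2 N) (c2 N) (th1 (sd N.+1 w))) w v.
Proof. by move=> N0 t1 t2 v01; apply: tpathE => //; [exact: disj_i|exact: disj_j|exact: leN1|exact: leN2]. Qed.

Lemma gm_osc (eta eps : R) : 0 < eta -> 0 < eps -> exists2 d : R, 0 < d &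
  \forall N \near \oo, (lam [set D | rosc d eps (gm N D)] <= eta%:E)%E.
Proof.
move=> eta0 eps0; have [d d0 h] := osc_event m_gt0 d1p d2p (ps cvgP) (ps cvgQ) pthE eta0 eps0.
exists d => //; apply: filterS h; move=> N [Bad [mB lB hB]]; rewrite dpath_rosc; apply: (le_trans _ lB); apply: le_measure; rewrite ?inE//.
  by apply: measurable_rosc => v; exact: measurable_tpath.
move=> w [[q r] /= [q01 r01 qr]]; apply: contraPP => /hB hw; apply/negP; rewrite -leNgt; exact: hw.
Qed.

Lemma gm_fidi (I : finType) (v : I -> R) (f : (I -> R) -> R) : tst f -> (forall l, 0 <= v l <= 1) ->
  E (fun D => f (fun l => gm N D (v l))) @[N --> \oo] --> E (fun w => f (fun l => Zp m 2 (Hm m (v l)) w)).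
Proof.
move=> tf v01; have h := pth_fidi m_gt0 d1p d2p (ps cvgP) (ps cvgQ)
  (fun N v => measurable_tpath m N (n1 N) (n2 N) (i N) (j N) v) pthE tf v01.
by under eq_fun do rewrite dpath_fidi//.
Qed.

(** Stated at rational levels, where the oscillation events are defined; right continuity extends it
    to the supremum. *)
Definition close_paths (e : R) N (psi : R -> R) := exists Bad : set R,
  [/\ measurable Bad, (lam Bad <= e%:E)%E & forall w, ~ Bad w -> forall q : rat, 0 <= (ratr q : R) <= 1 ->
    `|gm N (th0 w) (ratr q) - Zp m 2 (Hm m (ratr q)) (psi w)| <= e].

(** The vectors of values on a fine grid are coupled, and the small oscillations of both processes
    fill the gaps. The grid is chosen before N, as both oscillation bounds allow. *)
Lemma path_couple (e : R) : 0 < e -> \forall N \near \oo, exists2 psi, mpres psi & close_paths e N psi.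
Proof.
move=> e0; have e3 : 0 < e / 3 by rewrite divr_gt0.
have [dg dg0 hg] := gm_osc e3 e3.
have [dz dz0 hz] := limit_osc m_gt0 2 e3 e3.
have d0 : 0 < Num.min dg dz by rewrite lt_min dg0.
have [K _ hK] := near_infty_natSinv_lt (PosNum d0).
have {hK} : K.+1%:R^-1 < Num.min dg dz by exact: (hK K (leqnn K)).
rewrite lt_min => /andP[/ltW Kg /ltW Kz].
(* Grid points are images of rationals because [rosc] compares rational points only. *)
pose v (l : 'I_K.+2) : R := ratr (l%:R / K.+1%:R : rat).
have vE l : v l = l%:R / K.+1%:R by rewrite /v fmorph_div/= !ratr_nat.
have v01 l : 0 <= v l <= 1.
  by rewrite vE divr_ge0 ?ler0n//= ler_pdivrMr ?ltr0n// mul1r ler_nat -ltnS.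
have cp := couple (X := fun N l D => gm N D (v l)) (Z := fun l => Zp m 2 (Hm m (v l)))
  (fun N l => measurable_dpath m N (n1 N) (n2 N) (i N) (j N) (v l)) (fun l => L4_Zp m 2 (Hm m (v l)))
  (fun f tf => gm_fidi tf v01) e3 e3.
near=> N.
have [psi mpsi [B [mB lB hB]]] : exists2 psi : R -> R, mpres psi & exists B, [/\ measurable B, (lam B <= (e / 3)%:E)%E &
   forall w, ~ B w -> forall l, `|gm N (th0 w) (v l) - Zp m 2 (Hm m (v l)) (psi w)| <= e / 3] by near: N; exact: cp.
have lg : (lam [set D | rosc dg (e / 3) (gm N D)] <= (e / 3)%:E)%E by near: N; exact: hg.
exists psi => //.
have mG : measurable [set D | rosc dg (e / 3) (gm N D)] by apply: measurable_rosc => x; exact: measurable_dpath.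
have mZ : measurable [set z | rosc dz (e / 3) (fun x => Zp m 2 (Hm m x) z)].
  by apply: measurable_rosc => x; case: (L4_Zp m 2 (Hm m x)).
have [mp0 lp0] := @mpres_th0 R; have [mpp lpp] := mpsi.
exists (B `|` (th0 @^-1` [set D | rosc dg (e / 3) (gm N D)] `|`
   psi @^-1` [set z | rosc dz (e / 3) (fun x => Zp m 2 (Hm m x) z)])); split.
- by apply: measurableU => //; apply: measurableU; exact: preimage_measurable.
- rewrite [X in (_ <= X%:E)%E](_ : e = e / 3 + (e / 3 + e / 3)); last by field.
  apply: lam_setU_le => //; first by apply: measurableU; exact: preimage_measurable.
  by apply: lam_setU_le; [exact: preimage_measurable|exact: preimage_measurable|rewrite lp0|rewrite lpp].
move=> w hw q q01; have nB : ~ B w by move=> b; apply: hw; left.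
have nG : ~ rosc dg (e / 3) (gm N (th0 w)) by move=> b; apply: hw; right; left.
have nZ : ~ rosc dz (e / 3) (fun x => Zp m 2 (Hm m x) (psi w)) by move=> b; apply: hw; right; right.
have [l hl] := grid_near K q01; rewrite -vE in hl.
have b1 : `|gm N (th0 w) (ratr q) - gm N (th0 w) (v l)| <= e / 3.
  rewrite leNgt; apply/negP => hh; apply: nG; exists (q, l%:R / K.+1%:R); split => //; [exact: v01|exact: (le_trans hl)].
have b3 : `|Zp m 2 (Hm m (ratr q)) (psi w) - Zp m 2 (Hm m (v l)) (psi w)| <= e / 3.
  rewrite leNgt; apply/negP => hh; apply: nZ; exists (q, l%:R / K.+1%:R); split => //; [exact: v01|exact: (le_trans hl)].
have b2 := hB w nB l.
rewrite (_ : _ - _ = (gm N (th0 w) (ratr q) - gm N (th0 w) (v l)) + (gm N (th0 w) (v l) - Zp m 2 (Hm m (v l)) (psi w)) -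
  (Zp m 2 (Hm m (ratr q)) (psi w) - Zp m 2 (Hm m (v l)) (psi w))); last by ring.
rewrite [e](_ : _ = e / 3 + e / 3 + e / 3); last by field.
by apply: (le_trans (ler_normB _ _)); apply: lerD b3; apply: (le_trans (ler_normD _ _)); exact: lerD.
Unshelve. all: by end_near.
Qed.

Lemma coupling : exists psi : nat -> R -> R, (forall N, mpres (psi N)) /\
  forall e, 0 < e -> \forall N \near \oo, close_paths e N (psi N).
Proof.
pose P N k (s : {psi : R -> R | mpres psi}) := close_paths k.+1%:R^-1 N (sval s).
have h k : \forall N \near \oo, exists t, P N k t.
  have k0 : 0 < k.+1%:R^-1 :> R by rewrite invr_gt0 ltr0n.
  by apply: filterS (path_couple k0) => N [psi mp cp]; exists (exist _ psi mp).
have [f hf] := diagonal (exist _ id (@mpres_id R)) h.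
exists (fun N => sval (f N)); split=> [N|e e0]; first exact: (svalP (f N)).
have [k _ hk] := near_infty_natSinv_lt (PosNum e0).
apply: filterS (hf k) => N [k' kk' [Bad [mB lB hB]]].
have ke : k'.+1%:R^-1 <= e by apply: ltW; exact: (hk k').
exists Bad; split => //; first by apply: (le_trans lB); rewrite lee_fin.
by move=> w hw q q01; apply: (le_trans (hB w hw q q01)).
Qed.

(** The hypothesis says that the correction [a] turns the bridge of coefficient [al] into [Zp m 2],
    the process to which the data are coupled; the same [psi] therefore serves both signs. *)
Lemma corrected_cvg0 (a al : R) (psi : nat -> R -> R) : al * (1 - a / (4 * (2 * m + 1))%:R) = 2 ->
  (forall N, mpres (psi N)) -> (forall e, 0 < e -> \forall N \near \oo, close_paths e N (psi N)) ->
  cvg0_in_probability lam (fun N w => sup01 (fun v => gm N (th0 w) v -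
    corrected_path m a (fun t => Zp m al t (psi N w)) v)).
Proof.
move=> ha mp hp; pose F N v w : R := gm N (th0 w) v - Zp m 2 (Hm m v) (psi N w).
have eF N w : sup01 (fun v => gm N (th0 w) v - corrected_path m a (fun t => Zp m al t (psi N w)) v) = sup01 (F N ^~ w).
  apply: sup01_ext => v v01; rewrite /F; congr (_ - _).
  by rewrite [LHS](corrected_Zq m_gt0)// ha beta_cdfE//; case/andP: v01.
have rF N w : rcont (F N ^~ w).
  apply: rcontB; first exact: rcont_ratio_process.
  by apply: rcont_continuous; exact: continuous_ZqHm.
have mF N v : measurable_fun setT (F N v).
  apply: measurable_funB; first exact: (measurableT_comp (measurable_dpath _ _ _ _ _ _ _) (@mth0 R)).
  by have [mz _] := L4_Zp m 2 (Hm m v); exact: (measurableT_comp mz (mp N).1).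
have mS N : measurable_fun setT (fun w => sup01 (F N ^~ w)) by exact: measurable_sup01.
split; first by near=> N; under eq_fun do rewrite eF; exact: mS.
move=> e e0; apply: cvge0_le => [N|e' e'0]; first exact: measure_ge0.
have me0 : 0 < Num.min e e' by rewrite lt_min e0.
apply: filterS (hp _ me0) => N [Bad [mB lB hB]].
apply: (@le_trans _ _ (lam Bad)); last by apply: (le_trans lB); rewrite lee_fin ge_min lexx orbT.
rewrite (_ : [set w | _] = [set w | exists2 q : rat, 0 <= (ratr q : R) <= 1 & e < `|F N (ratr q) w|]); last first.
  apply/seteqP; split => w /=; rewrite eF gee0_abs ?sup01_ge0//; exact: (sup01_gt _ (rF N w)).1 || exact: (sup01_gt _ (rF N w)).2.
have mT : measurable [set w | exists2 q : rat, 0 <= (ratr q : R) <= 1 & e < `|F N (ratr q) w|].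
  exact: (@measurable_rat_gt _ _ mR (F N) (fun q => 0 <= (ratr q : R) <= 1) e (mF N)).
apply: le_measure; [exact/mem_set|exact/mem_set|].
move=> w /= [q q01]; apply: contraPP => /hB hw; apply/negP; rewrite -leNgt; apply: (le_trans (hw q q01)).
by rewrite ge_min lexx.
Unshelve. all: by end_near.
Qed.

End PathCoupling.

(** * The two samples as sequences of seeds *)

Section UniformSequences.
Context {R : realType}.
Local Notation mR := (measurableTypeR R).
Local Notation lam := (@lam R).
Local Notation th0 := (@th0 R).
Local Notation th1 := (@th1 R).

Lemma prod_uniq (n : nat) (J : seq nat) (a : nat -> R) : uniq J -> (forall k, k \in J -> (k < n)%N) ->
  \prod_(k < n) (if nat_of_ord k \in J then a k else 1) = \prod_(k <- J) a k.
Proof.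
move=> uJ Jn; rewrite -big_mkcond -(big_mkord (fun k => k \in J) a) -big_filter; apply: perm_big.
apply: uniq_perm => //; first by rewrite filter_uniq// iota_uniq.
move=> k; rewrite mem_filter mem_index_iota; apply/andP/idP => [[]//|kJ]; split => //; exact: Jn.
Qed.

Section Sequence.
Variable p : R -> R.
Hypothesis mp : mpres p.

Let mX k : measurable_fun setT (fun w : mR => sd k (p w)).
Proof. exact: (mpres_comp (mpres_sd k) mp).1. Qed.

Definition useq (k : nat) : {RV lam >-> R} := @mkmfun _ _ mR R _ (mX k).

Lemma uniform01_useq k : uniform01 (useq k).
Proof. by move=> A mA; exact: (mpres_comp (mpres_sd k) mp).2. Qed.

Lemma independent_useq : mutually_independent useq.
Proof.
move=> J A uJ mA; pose n := (\max_(k <- J) k).+1.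
have Jn k : k \in J -> (k < n)%N by move=> kJ; rewrite ltnS; exact: leq_bigmax_seq.
pose g k s : R := if k \in J then (s \in A k)%:R else 1.
have g01 k s : 0 <= g k s <= 1 by rewrite /g; case: ifP => _; [case: (_ \in _)|]; rewrite /= ?lexx ?ler01.
have mg k : measurable_fun setT (g k) by rewrite /g; case: (k \in J); [exact: measurable_in|exact: measurable_cst].
have mB : measurable (\bigcap_(k in [set` J]) (useq k @^-1` A k)).
  by apply: bigcap_measurableType => k _; exact: (preimage_measurable (mX k)).
pose G w : R := \prod_(k < n) g k (sd k w).
have mG : measurable_fun setT G by apply: measurable_prod => k _; exact: (measurableT_comp (mg _) (mpres_sd _).1).
have G01 w : 0 <= G w <= 1 by exact: prod_01.
have IG := Int_01 mG G01.
have eG : (fun w => (w \in \bigcap_(k in [set` J]) (useq k @^-1` A k))%:R) = G \o p.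
  apply/funext => w /=; rewrite /G; case: (boolP (w \in _)) => [|nw].
    rewrite inE => hw; rewrite big1//= => k _; rewrite /g; case: ifP => // kJ.
    by rewrite (_ : _ \in _)//; apply/mem_set; exact: (hw k kJ).
  have [k kJ hk] : exists2 k, k \in J & sd k (p w) \notin A k.
    move: nw; apply: contraNP => h; apply/mem_set => k /= kJ; apply/set_mem; apply: contraPP h => hk; apply.
    by exists k => //; apply/negP.
  by rewrite (bigD1 (Ordinal (Jn k kJ)))//= /g kJ (negbTE hk) mul0r.
rewrite (lamE mB) eG (mpres_E mp IG) (E_prod_sd n mg g01).
rewrite (_ : \prod_(k < n) E (g k) = \prod_(k <- J) E (fun s => (s \in A k)%:R)); last first.
  rewrite -(prod_uniq (fun k => E (fun s => (s \in A k)%:R)) uJ Jn); apply: eq_bigr => k _.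
  by rewrite /g; case: ifP => // _; exact: E_fcst.
elim: J {uJ n Jn g g01 mg mB G mG G01 IG eG} => [|k J IH]; first by rewrite !big_nil.
by rewrite !big_cons EFinM IH -(lamE (mA k)) -((mpres_comp (mpres_sd k) mp).2 _ (mA k)).
Qed.

Lemma iid_useq : iid_uniform01 useq.
Proof. by split; [exact: independent_useq|exact: uniform01_useq]. Qed.

End Sequence.

Lemma independent_useq_split (p : R -> R) (mp : mpres p) :
  independent_sequences (useq (mpres_comp (@mpres_th0 R) mp)) (useq (mpres_comp (@mpres_th1 R) mp)).
Proof.
move=> A B cA cB; pose A' := [set s | A (fun k => sd k s)]; pose B' := [set s | B (fun k => sd k s)].
have mA : measurable A' by apply: (@cylinder_measurable _ _ mR _ setT (fun k s => sd k s)) => // k _; exact: measurable_sd.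
have mB : measurable B' by apply: (@cylinder_measurable _ _ mR _ setT (fun k s => sd k s)) => // k _; exact: measurable_sd.
have mI : measurable (th0 @^-1` A' `&` th1 @^-1` B').
  by apply: measurableI; apply: preimage_measurable => //; [exact: mth0|exact: mth1].
transitivity (lam (p @^-1` (th0 @^-1` A' `&` th1 @^-1` B'))); first by [].
rewrite (mp.2 _ mI) (split_rect mA mB).
rewrite -[X in (X * _)%E]((mpres_comp (@mpres_th0 R) mp).2 _ mA).
by rewrite -[X in (_ * X)%E]((mpres_comp (@mpres_th1 R) mp).2 _ mB).
Qed.

End UniformSequences.

Theorem mainTheorem1 (R : realType) (m : nat) (n1 n2 : nat -> nat)
    (i j : nat -> nat -> nat)
    (m_ge1 : (1 <= m)%N)
    (leN1 : forall N, (1 <= N)%N -> (N <= last_spacing m (n1 N))%N)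
    (leN2 : forall N, (1 <= N)%N -> (N <= last_spacing m (n2 N))%N)
    (disj_i : forall N, (1 <= N)%N -> disjoint_spacings m N (n1 N) (i N))
    (disj_j : forall N, (1 <= N)%N -> disjoint_spacings m N (n2 N) (j N))
    (cvgP : (last_spacing m (n1 N) - N)%N%:R / N.+1%:R @[N --> \oo] --> (0 : R))
    (cvgQ : (last_spacing m (n2 N) - N)%N%:R / N.+1%:R @[N --> \oo] --> (0 : R)) :
  exists (d : measure_display) (T : measurableType d) (P : probability T R)
      (X Y : nat -> {RV P >-> R}) (Bp Bm : nat -> R -> T -> R),
    let gamma (N : nat) (w : T) : R -> R :=
      ratio_process m N (n1 N) (n2 N) (i N) (j N)
        (fun k => X k w) (fun k => Y k w) in
    [/\ iid_uniform01 X, iid_uniform01 Y & independent_sequences X Y] /\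
    (forall N, (1 <= N)%N -> brownian_bridge P (Bp N)) /\
    (forall N, (1 <= N)%N -> brownian_bridge P (Bm N)) /\
    (forall N, (1 <= N)%N ->
      same_law P `[0, 1]
        (fun v w => Bp N (beta_cdf m v) w)
        (fun v w => corrected_path m (8 * (2 * m + 1)%N%:R)
                      (fun t => Bp N t w) v)) /\
    (forall N, (1 <= N)%N ->
      same_law P `[0, 1]
        (fun v w => Bm N (beta_cdf m v) w)
        (fun v w => corrected_path m (8 * (2 * m + 1)%N%:R)
                      (fun t => Bm N t w) v)) /\
    cvg0_in_probability P (fun N w => sup01 (fun v => gamma N w v -
      corrected_path m
        (4 * (2 * m + 1)%N%:R * (1 + (Num.sqrt (2 * m + 1)%N%:R)^-1))
        (fun t => Bp N t w) v)) /\
    cvg0_in_probability P (fun N w => sup01 (fun v => gamma N w v -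
      corrected_path m
        (4 * (2 * m + 1)%N%:R * (1 - (Num.sqrt (2 * m + 1)%N%:R)^-1))
        (fun t => Bm N t w) v)).
Proof.
have [psi [mp hp]] := coupling m_ge1 leN1 leN2 disj_i disj_j cvgP cvgQ.
pose q : R := (2 * m + 1)%N%:R; pose s := Num.sqrt q.
have q0 : 0 < q by rewrite ltr0n addn1.
have s0 : 0 < s by rewrite sqrtr_gt0.
have s2 : s ^+ 2 = q by rewrite sqr_sqrtr// ltW.
have q4E : (4 * (2 * m + 1))%N%:R = 4 * q :> R by rewrite natrM.
have al2 (e : R) : e ^+ 2 = 4 -> (e * s) ^+ 2 = (4 * (2 * m + 1))%N%:R by move=> he; rewrite exprMn he s2 q4E.
(* The correction leaves the factor -a / s, and e s times it is -(e a). The plus sign thus requires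
   the coefficient -2 s, and the minus sign requires 2 s. *)
have alq (a e : R) : e * a = -2 -> e * s * (1 - 4 * q * (1 + a * s^-1) / (4 * (2 * m + 1))%N%:R) = 2.
  by move=> hea; rewrite q4E (_ : _ * _ = - (e * a)); [rewrite hea opprK|field; rewrite !gt_eqF].
have sq2n : (-2 : R) ^+ 2 = 4 by rewrite sqrrN -natrX.
have sq2p : (2 : R) ^+ 2 = 4 by rewrite -natrX.
(* The samples use only [th0 w]; the second half of the seed remains as the additional randomness
   from which [psi N] is built. *)
exists _, (measurableTypeR R), (@lam R), (useq (mpres_comp (@mpres_th0 R) (@mpres_th0 R))),
  (useq (mpres_comp (@mpres_th1 R) (@mpres_th0 R))), (fun N t w => Zp m (-2 * s) t (psi N w)),
  (fun N t w => Zp m (2 * s) t (psi N w)).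
split; first by split; [exact: iid_useq|exact: iid_useq|exact: independent_useq_split].
split; first by move=> N _; apply: bridge_Zp => //; exact: al2.
split; first by move=> N _; apply: bridge_Zp => //; exact: al2.
split; first by move=> N _; exact: same_law_Zp.
split; first by move=> N _; exact: same_law_Zp.
split.
  have a1 := alq 1 (-2) (mulr1 _); rewrite mul1r in a1.
  exact: (corrected_cvg0 m_ge1 a1 mp hp).
have a2 := alq (-1) 2 (mulrN1 _); rewrite mulN1r in a2.
exact: (corrected_cvg0 m_ge1 a2 mp hp).
Qed.
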